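(* Let $P$ be a polygon in the plane containing the origin, given by its $k$ vertices, each having $b$-bit rational coordinates, and let $D$ be the diameter of $P$. Then the number of primitive lattice points inside $P$ can be computed (exactly) in time $D^{6/7} \cdot k \cdot b^{O(1)}$.
   Context: A primitive lattice point is a point $(x,y) \in \mathbb{Z}^2$ with $\gcd(x,y)=1$. The diameter of $P$ is the maximum Euclidean distance between two points of $P$.
   Formalization: The factor D^{6/7} is read as max(1,D)^{6/7}, since for polygons of exponentially small diameter (possible with b-bit rational vertices) the literal bound D^{6/7}·k·b^{O(1)} falls below a single time step and no algorithm could meet it. *)

(* Defs.v *)
From HB Require Import structures.
From mathcomp Require Import all_boot all_order all_algebra.
From mathcomp Require Import all_classical all_reals all_analysis.

Set Implicit Arguments.
Unset Strict Implicit.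
Unset Printing Implicit Defensive.

Import Order.TTheory GRing.Theory Num.Theory.
Import numFieldNormedType.Exports.

Local Open Scope classical_set_scope.
Local Open Scope ring_scope.

(** * Random access machine with logarithmic cost *)

(* Registers are indexed by [nat] and hold unbounded integers. Time is charged
   by the logarithmic cost criterion (every instruction pays for the bit length
   of each constant, register index and register content it handles), so that
   the size of the numbers is accounted for and no word size has to be fixed. *)
Definition memory := nat -> int.

(* [OpDiv] is Euclidean division, with [x / 0 = 0]. *)
Inductive binop := OpAdd | OpSub | OpMul | OpDiv.

Definition eval_binop (o : binop) (x y : int) : int :=
  match o with
  | OpAdd => x + y
  | OpSub => x - y
  | OpMul => x * y
  | OpDiv => (x %/ y)%Z
  end.

(* [Read] and [Write] are the two forms of indirect addressing: writing [r i]
   for the content of register [i],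
     [Const i z] : r i := z             [Read i j]  : r i := r (r j)
     [Op o i j l] : r i := r j o r l    [Write i j] : r (r i) := r j
   [If] and [While] test whether [r i > 0]. *)
Inductive program :=
| Skip
| Const of nat & int
| Op of binop & nat & nat & nat
| Read of nat & nat
| Write of nat & nat
| Seq of program & program
| If of nat & program & program
| While of nat & program.

(* Bit length of [`|z|], with [bitlen 0 = 1]. *)
Definition bitlen (z : int) : nat := (trunc_log 2 `|z|%N).+1.

Definition update (m : memory) (i : nat) (z : int) : memory :=
  [eta m with i |-> z].

(* [exec p m m' t]: started on memory [m], the program [p] halts with memory
   [m'] after time [t]. A program that addresses a negative register is stuck. *)
Inductive exec : program -> memory -> memory -> nat -> Prop :=
| exec_Skip (m : memory) : exec Skip m m 1%N
| exec_Const (m : memory) (i : nat) (z : int) :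
    exec (Const i z) m (update m i z) (1 + bitlen i + bitlen z)%N
| exec_Op (m : memory) (o : binop) (i j l : nat) :
    exec (Op o i j l) m (update m i (eval_binop o (m j) (m l)))
      (1 + bitlen i + bitlen j + bitlen l + bitlen (m j) + bitlen (m l))%N
| exec_Read (m : memory) (i j a : nat) : m j = Posz a ->
    exec (Read i j) m (update m i (m a))
      (1 + bitlen i + bitlen j + bitlen a + bitlen (m a))%N
| exec_Write (m : memory) (i j a : nat) : m i = Posz a ->
    exec (Write i j) m (update m a (m j))
      (1 + bitlen i + bitlen j + bitlen a + bitlen (m j))%N
| exec_Seq (p q : program) (m1 m2 m3 : memory) (t u : nat) :
    exec p m1 m2 t -> exec q m2 m3 u ->
    exec (Seq p q) m1 m3 (t + u)%N
| exec_IfT (i : nat) (p q : program) (m m' : memory) (t : nat) :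
    0 < m i -> exec p m m' t ->
    exec (If i p q) m m' (1 + bitlen i + bitlen (m i) + t)%N
| exec_IfF (i : nat) (p q : program) (m m' : memory) (t : nat) :
    m i <= 0 -> exec q m m' t ->
    exec (If i p q) m m' (1 + bitlen i + bitlen (m i) + t)%N
| exec_WhileF (i : nat) (p : program) (m : memory) :
    m i <= 0 ->
    exec (While i p) m m (1 + bitlen i + bitlen (m i))%N
| exec_WhileT (i : nat) (p : program) (m1 m2 m3 : memory) (t u : nat) :
    0 < m1 i -> exec p m1 m2 t -> exec (While i p) m2 m3 u ->
    exec (While i p) m1 m3 (1 + bitlen i + bitlen (m1 i) + t + u)%N.

(* The input occupies the first registers, all others are 0; the output is
   read off register 0. *)
Definition computes_in_time (p : program) (input : seq int) (output : int)
    (t : nat) : Prop :=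
  exists2 m' : memory, exec p (fun i => nth 0 input i) m' t & m' 0%N = output.

(** * Rational polygons *)

(* Vertices are listed in their cyclic order along the boundary; the edge
   number [i] joins vertex [i] to vertex [ordS i], [ordS] being the cyclic
   successor on ['I_k]. *)
Definition vertices (k : nat) := k.-tuple (rat * rat).

Definition is_bit_rat (b : nat) (q : rat) : bool :=
  (`|numq q| < 2 ^+ b) && (denq q < 2 ^+ b).

Definition is_bit_vertices (b k : nat) (v : vertices k) : bool :=
  all (fun q : rat * rat => is_bit_rat b q.1 && is_bit_rat b q.2) v.

Definition polygon_input (k : nat) (v : vertices k) : seq int :=
  Posz k :: flatten [seq [:: numq q.1; denq q.1; numq q.2; denq q.2]
                    | q : rat * rat <- v].

Section Plane.
Variable R : realType.
Implicit Types (p q : R * R) (A : set (R * R)).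

Definition rat_point (q : rat * rat) : R * R := (ratr q.1, ratr q.2).

Definition int_point (z : int * int) : R * R := (z.1%:~R, z.2%:~R).

Definition edist p q : R :=
  Num.sqrt ((p.1 - q.1) ^+ 2 + (p.2 - q.2) ^+ 2).

(* [D] is the maximum (not just the supremum) of the distances. *)
Definition is_diameter A (D : R) : Prop :=
  (exists p q, [/\ A p, A q & edist p q = D]) /\
  (forall p q, A p -> A q -> edist p q <= D).

Definition primitive_points A : set (int * int) :=
  [set z | gcdz z.1 z.2 = 1 /\ A (int_point z)].

Section Polygon.
Variables (k : nat) (v : vertices k).

Definition edge_point (i : 'I_k) (s : R) : R * R :=
  (1 - s) *: rat_point (tnth v i) + s *: rat_point (tnth v (ordS i)).

Definition polygon_boundary : set (R * R) :=
  [set p | exists (i : 'I_k) (s : R), 0 <= s <= 1 /\ p = edge_point i s].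

(* The closed polygonal line does not meet itself: travelling once along it,
   half-open edge after half-open edge, no point is visited twice. *)
Definition simple_polygon : Prop :=
  forall (i j : 'I_k) (s t : R), 0 <= s < 1 -> 0 <= t < 1 ->
    edge_point i s = edge_point j t -> i = j /\ s = t.

(* The closed region enclosed by the boundary: the boundary itself together
   with the bounded connected components of its complement. *)
Definition polygon_region : set (R * R) :=
  polygon_boundary `|`
  [set p | ~ polygon_boundary p /\
           bounded_set (connected_component (~` polygon_boundary) p)].

End Polygon.
End Plane.

Arguments polygon_boundary R {k} v.
Arguments simple_polygon R {k} v.
Arguments polygon_region R {k} v.

(* Main.v *)
(* Write f for the indicator function of the region P on Z^2, mu for the Moebius
   function and M for its summatory (Mertens) function. The number of primitive
   points of P is the sum of mu(d) f(d z) over all d >= 1 and z <> 0. Let u be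
   about D^(1/7). For d <= u^6 the sum over z counts lattice points in a dilated
   polygon, which floor sums do in polynomial time. For d > u^6 only z in
   [-u, u]^2 matter, and for fixed z every edge confines d to an interval, so
   that the sum over d is a difference of two values of M. A sieve yields M up
   to u^6; at a larger x <= D the identity sum_(d <= n) M(n / d) = 1, applied to
   the quotients n = x / j > u^6 in increasing order, yields M(x) in time about
   u^4. This adds up to k u^6 operations on numbers of O(b) bits.

   Since P need not be convex, f is written as a sum of weights, one for each
   edge (a signed half-infinite strip below the edge) and one for each vertex (a
   correction on the boundary that depends on the two adjacent edges only). That
   these weights add up to f for one of the two orientations, and to a
   nonpositive function for the other one, is a version of the Jordan curve
   theorem for polygons: the winding number is locally constant off the boundary
   and jumps by one across each edge, and every component of the complement
   touches the whole boundary, so that there are only two of them. The program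
   tries both orientations and recognizes the right one by the weight of the
   origin. *)

Require Import Defs.
From HB Require Import structures.
From mathcomp Require Import all_boot all_order all_algebra finmap.
From mathcomp Require Import all_classical all_reals all_analysis.
From mathcomp Require Import ring lra zify.

Set Implicit Arguments.
Unset Strict Implicit.
Unset Printing Implicit Defensive.

Import Order.TTheory GRing.Theory Num.Theory.
Import numFieldNormedType.Exports.

Local Open Scope ring_scope.

(** * Local weights of a polygon *)

(** The exponent balances two costs. With a table up to Y, a value of M near D takes about D /
    Y^(1/2) operations, and for each edge the tail d > Y asks for such values at about (D / Y)^2
    points; the sieve takes Y. Equating Y with D^3 / Y^(5/2) gives Y = D^(6/7).

    The diameter is not part of the input. The program uses an integer bound on the coordinates
    instead, which is at most the diameter plus 1 because the origin lies in P.

    A common denominator of all vertices would have about k b bits. Each corner (a vertex with its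
    two neighbours) is therefore scaled by its own denominator of 6 b bits: the weights involve
    three consecutive vertices and are invariant under scaling, so each can be evaluated in its own
    integral coordinates.

    On the boundary one rule produces all corrections: a boundary point is pushed infinitesimally in
    the direction (epsilon, 1), which leads off the curve, and 1 is added if it is pushed to the
    right of the curve. This makes the region closed for the counterclockwise orientation. *)

Definition ind (b : bool) : int := (b : nat)%:Z.

Lemma indE : (ind true = 1) * (ind false = 0).
Proof. by []. Qed.

Definition cross (R : realDomainType) (u v : R * R) : R := u.1 * v.2 - u.2 * v.1.

Section Weights.
Variable T : realDomainType.
Implicit Types (a b o p u v : T * T).

(* [u] points to the left of the direction (epsilon, 1), [epsilon] infinitesimal. *)
Definition lexleft u := (u.1 < 0) || (u.1 == 0) && (0 < u.2).

(** For the counterclockwise orientation, an edge running left bounds the region from above and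
    counts the points below or on it; an edge running right subtracts the points strictly below it.
    Since the columns are half-open on the right, they miss a vertical edge running upwards, which
    therefore adds its own points; an edge running downwards is covered by the columns to its
    right. *)
Definition edge_weight a b p : int :=
  if a.1 < b.1 then - ind [&& a.1 <= p.1, p.1 < b.1 & cross (b - a) (p - a) < 0]
  else if b.1 < a.1 then ind [&& b.1 <= p.1, p.1 < a.1 & 0 <= cross (b - a) (p - a)]
  else ind [&& p.1 == a.1, a.2 < p.2 & p.2 <= b.2].

(* The direction (epsilon, 1) lies in [sector v u]. *)
Definition lex_sector v u :=
  if 0 < cross v u then ~~ lexleft v && lexleft u else ~~ lexleft v || lexleft u.

(** Here [a] is the vertex between [o] and [b]. The edge from [o] to [a] contains its end point and
    has already added 1 there if [a - o] is [lexleft]; this is replaced by 1 exactly when the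
    direction (epsilon, 1) enters the sector to the right of the curve. *)
Definition vertex_weight o a b : int :=
  ind (lex_sector (o - a) (b - a)) - ind (~~ lexleft (o - a)).

Definition local_weight o a b p : int :=
  edge_weight a b p + vertex_weight o a b * ind (p == a).

End Weights.

(** * The Moebius and Mertens functions *)

Fixpoint mu_rec (fuel n : nat) : int :=
  if fuel is f.+1 then
    ind (n == 1) - \sum_(1 <= d < n) ind (d %| n)%N * mu_rec f d
  else 0.

(* The recursion is the one which the sieve implements. *)
Definition mu (n : nat) : int := mu_rec n n.

Definition mertens (n : nat) : int := \sum_(1 <= d < n.+1) mu d.

Lemma mu_rec_stable f g n : (n <= f)%N -> (n <= g)%N -> mu_rec f n = mu_rec g n.
Proof.
have z h : mu_rec h 0 = 0 by case: h => //= h; rewrite big_geq.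
elim: f g n => [|f IH] [|g] [|n] nf ng; rewrite ?z //.
rewrite /=; congr (_ - _); apply: eq_big_nat => d /andP[d1 dn].
by rewrite (IH g d) //; lia.
Qed.

Lemma muE n : (0 < n)%N -> mu n = ind (n == 1) - \sum_(1 <= d < n) ind (d %| n)%N * mu d.
Proof.
case: n => // n _; rewrite {1}/mu /=; congr (_ - _).
by apply: eq_big_nat => d /andP[_ dn]; rewrite (@mu_rec_stable n d) //; lia.
Qed.

Lemma sum_mu n : (0 < n)%N -> \sum_(1 <= d < n.+1) ind (d %| n)%N * mu d = ind (n == 1).
Proof.
by move=> n0; rewrite big_nat_recr //= dvdnn mul1r [mu n]muE // addrC subrK.
Qed.

Lemma sum_ind_le n m : (m <= n)%N -> \sum_(1 <= d < n.+1) ind (d <= m)%N = Posz m.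
Proof.
move=> mn; rewrite (big_cat_nat (n := m.+1)) //=.
rewrite (eq_big_nat _ _ (F2 := fun=> 1)); last by move=> d /andP[_ h]; rewrite ltnS in h; rewrite h.
rewrite [X in _ + X]big1_seq ?addr0.
  by rewrite big_const_nat subn1 /= iter_addr_0 natz.
by move=> d; rewrite mem_index_iota => /andP[_ /andP[h _]]; rewrite leqNgt h.
Qed.

Lemma ind_dvd n e : (0 < e)%N -> Posz (n.+1 %/ e) = Posz (n %/ e) + ind (e %| n.+1)%N.
Proof.
move=> e0; rewrite -PoszD; congr Posz.
have [h|h] := boolP (e %| n.+1)%N.
  case/dvdnP: h => q h; have q0 : (0 < q)%N by case: q h.
  rewrite h mulnK //= -(prednK q0) addn1; congr _.+1.
  have -> : n = (q.-1 * e + e.-1)%N by case: q q0 h => // q _; rewrite mulSn /=; lia.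
  by rewrite divnMDl // divn_small ?addn0 ?prednK.
rewrite addn0; have := divn_eq n.+1 e; have := ltn_pmod n.+1 e0.
move: h; rewrite /dvdn; move: (n.+1 %/ e)%N (n.+1 %% e)%N => q r r0 re h.
have -> : n = (q * e + r.-1)%N by lia.
by rewrite divnMDl // [(r.-1 %/ e)%N]divn_small ?addn0 //; lia.
Qed.

(** When n grows by one, the quotient by e grows by one exactly for the divisors e of the new n, and
    by [sum_mu] their values of mu add up to 0. *)
Lemma sum_mu_div n : (0 < n)%N -> \sum_(1 <= e < n.+1) mu e * Posz (n %/ e) = 1.
Proof.
case: n => // n _; elim: n => [|n IH].
  by rewrite big_nat1 divn1 mulr1 muE // big_geq // subr0.
rewrite big_nat_recr //= divnn mulr1.
rewrite (eq_big_nat _ _ (F2 := fun e => mu e * Posz (n.+1 %/ e) + ind (e %| n.+2)%N * mu e)).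
  rewrite big_split /= IH -addrA.
  have := sum_mu (isT : (0 < n.+2)%N); rewrite big_nat_recr //= dvdnn mul1r => ->.
  by rewrite addr0.
by move=> e /andP[e0 _]; rewrite ind_dvd // mulrDr [ind _ * _]mulrC.
Qed.

Lemma sum_mertens_div n : (0 < n)%N -> \sum_(1 <= d < n.+1) mertens (n %/ d) = 1.
Proof.
move=> n0; rewrite -(sum_mu_div n0).
rewrite (eq_big_nat _ _ (F2 := fun d => \sum_(1 <= e < n.+1) mu e * ind (e <= n %/ d)%N)).
  rewrite exchange_big_nat /=; apply: eq_big_nat => e /andP[e0 en].
  rewrite -mulr_sumr; congr (_ * _).
  rewrite -(@sum_ind_le n) ?leq_div //; apply: eq_big_nat => d /andP[d0 dn].
  by rewrite !leq_divRL // mulnC.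
move=> d /andP[d0 dn]; rewrite /mertens.
rewrite [RHS](big_cat_nat (n := (n %/ d).+1)) //=; last by rewrite ltnS leq_div.
rewrite [X in _ = _ + X]big1_seq ?addr0.
  by apply: eq_big_nat => e /andP[_ h]; rewrite ltnS in h; rewrite h mulr1.
by move=> e; rewrite mem_index_iota => /andP[_ /andP[h _]]; rewrite leqNgt h mulr0.
Qed.

Lemma sum_quotient n q : (0 < q)%N -> 
  \sum_(1 <= d < n.+1) ind (n %/ d == q)%N = Posz (n %/ q) - Posz (n %/ q.+1).
Proof.
move=> q0; rewrite -(@sum_ind_le n (n %/ q)) ?leq_div // -(@sum_ind_le n (n %/ q.+1)) ?leq_div //.
rewrite -sumrB; apply: eq_big_nat => d /andP[d0 dn].
rewrite !leq_divRL // ![(d * _)%N]mulnC -!leq_divRL //.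
by move: (n %/ d)%N => x; have [h|h|h] := ltngtP x q.
Qed.

(** The term d = 1 of [sum_mertens_div] is isolated. The condition d > n / (K + 1) is equivalent to
    n / d <= K, so the terms beyond this point can be collected by the value q of the quotient. *)
Theorem mertens_rec n K : (K < n)%N ->
  mertens n = 1 - \sum_(1 <= q < K.+1) mertens q * (Posz (n %/ q) - Posz (n %/ q.+1))
    - \sum_(2 <= d < (n %/ K.+1).+1) mertens (n %/ d).
Proof.
move=> Kn; have n0 : (0 < n)%N by lia.
have E0 : (0 < n %/ K.+1)%N by rewrite divn_gt0.
have := sum_mertens_div n0.
rewrite (big_cat_nat (n := (n %/ K.+1).+1)) //=; last by rewrite ltnS leq_div.
rewrite big_ltn //= divn1.
have -> : \sum_((n %/ K.+1).+1 <= d < n.+1) mertens (n %/ d) =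
    \sum_(1 <= q < K.+1) mertens q * (Posz (n %/ q) - Posz (n %/ q.+1)).
  rewrite [RHS](eq_big_nat _ _ (F2 := fun q => \sum_(1 <= d < n.+1) mertens q * ind (n %/ d == q)%N)).
    rewrite [RHS]exchange_big_nat /=.
    rewrite [RHS](big_cat_nat (n := (n %/ K.+1).+1)) //=; last by rewrite ltnS leq_div.
    rewrite [X in _ = X + _]big1_seq ?add0r.
      apply: eq_big_nat => d /andP[d1 d2].
      have q0 : (0 < n %/ d)%N by rewrite divn_gt0; lia.
      have qK : (n %/ d < K.+1)%N.
        by rewrite ltn_divLR; [rewrite mulnC -ltn_divLR|lia].
      rewrite (bigD1_seq (n %/ d)%N) ?iota_uniq ?mem_index_iota ?q0 //= eqxx mulr1.
      by rewrite big1 ?addr0 // => q /negbTE h; rewrite eq_sym h mulr0.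
    move=> d; rewrite mem_index_iota => /andP[_ /andP[d1 d2]].
    rewrite big1_seq // => q; rewrite mem_index_iota => /andP[_ /andP[q1 q2]].
    case: eqP => [h|_]; last by rewrite mulr0.
    by move: d2; rewrite ltnS leq_divRL // mulnC -leq_divRL // h; lia.
  by move=> q /andP[q0 _]; rewrite -mulr_sumr sum_quotient.
by move=> <-; ring.
Qed.

(** An integral form of the bound 1 - 1/m for the sum of 1/e^2 over 2 <= e <= m, which comes from
    1/e^2 <= 1/(e-1) - 1/e. *)
Lemma sum_quotient_sq n m : (0 < m)%N ->
  (\sum_(2 <= e < m.+1) (n %/ e) ^ 2 * m <= n ^ 2 * m.-1)%N.
Proof.
case: m => // m _; elim: m => [|m IH]; first by rewrite big_geq.
rewrite -big_distrl big_nat_recr //= mulnDl.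
rewrite -big_distrl /= in IH; move: IH; set S := (\sum_(2 <= e < m.+2) _)%N.
have h : (n %/ m.+2 * m.+2 <= n)%N by exact: leq_divM.
move: (n %/ m.+2)%N h => q h IH.
have h2 : ((q * m.+2) ^ 2 <= n ^ 2)%N by rewrite leq_exp2r.
have h3 : ((S * m.+2 + q ^ 2 * m.+2) * m.+1 <= n ^ 2 * m.+1 * m.+1)%N.
  rewrite expnMn in h2; move: h2 IH; rewrite -!mulnn; move: (n * n)%N (q * q)%N => N Q h2 IH.
  have : (S * m.+1 * m.+2 <= N * m * m.+2)%N by rewrite leq_mul.
  have : (Q * m.+2 * m.+1 <= Q * (m.+2 * m.+2))%N by rewrite -mulnA leq_mul // leq_mul.
  by nia.
by rewrite leq_mul2r in h3.
Qed.

(** A proper divisor is n / e with e >= 2, and the sum of 1/e^2 over e >= 2 stays below 1. *)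
Lemma sum_divisors_sq n : (0 < n)%N -> (\sum_(1 <= d < n) (d %| n) * d ^ 2 < n ^ 2)%N.
Proof.
move=> n0.
have h : (\sum_(1 <= d < n) (d %| n) * d ^ 2 <= \sum_(2 <= e < n.+1) (n %/ e) ^ 2)%N.
  apply: (@leq_trans (\sum_(1 <= d < n) \sum_(2 <= e < n.+1) (d * e == n) * d ^ 2)).
    rewrite !big_nat; apply: leq_sum => d /andP[d0 dn].
    have [dvd|] := boolP (d %| n)%N; last by rewrite mul0n.
    rewrite mul1n (bigD1_seq (n %/ d)%N) ?iota_uniq //=.
      by rewrite [(d * _)%N]mulnC divnK // eqxx mul1n leq_addr.
    rewrite mem_index_iota ltnS leq_div andbT leq_divRL // mulnC.
    by case/dvdnP: dvd => q E; move: dn; rewrite E; case: q E => [|[|q]] E; nia.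
  rewrite exchange_big_nat /= !big_nat; apply: leq_sum => e /andP[e2 en].
  apply: (@leq_trans (\sum_(1 <= d < n) (d == n %/ e) * (n %/ e) ^ 2)).
    rewrite !big_nat; apply: leq_sum => d /andP[d0 dn].
    case: eqP => [E|_]; last by rewrite mul0n.
    by rewrite -E mulnK ?eqxx //; lia.
  rewrite -big_distrl /= -{2}[((n %/ e) ^ 2)%N]mul1n leq_mul2r; apply/orP; right.
  have [h|h] := boolP ((n %/ e)%N \in index_iota 1 n).
    rewrite (bigD1_seq (n %/ e)%N) ?iota_uniq //= eqxx big1 ?addn0 // => d hd.
    by rewrite (negbTE hd).
  rewrite big1_seq // => d /= hd; case: eqP => // E; by rewrite -E hd in h.
have := sum_quotient_sq n n0; rewrite -big_distrl /= => h2.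
have : ((\sum_(2 <= e < n.+1) (n %/ e) ^ 2) * n < n ^ 2 * n)%N.
  by apply: leq_ltn_trans h2 _; rewrite ltn_mul2l expn_gt0 n0 ltn_predL n0.
by rewrite ltn_mul2r n0 /= => h3; exact: leq_ltn_trans h h3.
Qed.

Lemma absz_sum (I : Type) (r : seq I) (P : pred I) (F : I -> int) :
  (absz (\sum_(i <- r | P i) F i)%R <= \sum_(i <- r | P i) absz (F i))%N.
Proof.
elim/big_rec2: _ => // i y x _ h.
apply: (@leq_trans (absz (F i) + absz y)); last by rewrite leq_add2l.
by lia.
Qed.

(** Bit lengths ask only for a polynomial bound. This one follows from the defining recursion by
    strong induction, without multiplicativity, because the squares of the proper divisors of n add
    up to less than n^2. *)
Lemma mu_bound n : (absz (mu n) <= n ^ 2)%N.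
Proof.
elim/ltn_ind: n => n IH; have [->|n0] := posnP n; first by [].
rewrite muE //; have [->|n1] := eqVneq n 1%N; first by rewrite big_geq.
rewrite sub0r abszN; apply: leq_trans (absz_sum _ _ _) _.
apply: leq_trans (ltnW (sum_divisors_sq n0)); rewrite !big_nat.
apply: leq_sum => d /andP[d0 dn]; rewrite abszM leq_mul ?IH //.
Qed.

Lemma mertens_bound n : (absz (mertens n) <= n ^ 3)%N.
Proof.
apply: leq_trans (absz_sum _ _ _) _.
apply: (@leq_trans (\sum_(1 <= d < n.+1) n ^ 2)).
  rewrite !big_nat; apply: leq_sum => d /andP[d0 dn].
  by apply: leq_trans (mu_bound d) _; rewrite leq_exp2r.
by rewrite sum_nat_const_nat subn1 /= -expnS.
Qed.

(** Dyadic blocks: the 2^e values of j from 2^e on contribute at most X together. *)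
Lemma harmonic_bound e n X : (n < 2 ^ e)%N -> (\sum_(1 <= j < n.+1) X %/ j <= X * e)%N.
Proof.
elim: e n => [|e IH] n hn; first by rewrite expn0 ltnS leqn0 in hn; rewrite (eqP hn) big_geq.
have [h|h] := ltnP n (2 ^ e); first by apply: leq_trans (IH n h) _; rewrite leq_mul2l leqnSn orbT.
have p0 : (0 < 2 ^ e)%N by rewrite expn_gt0.
rewrite (big_cat_nat (n := (2 ^ e)%N)) //=; last by exact: leqW.
rewrite mulnS addnC leq_add //; last first.
  have -> : (2 ^ e = (2 ^ e).-1.+1)%N by rewrite prednK.
  by apply: IH; rewrite prednK.
apply: (@leq_trans (\sum_(2 ^ e <= j < n.+1) X %/ 2 ^ e)).
  by rewrite !big_nat; apply: leq_sum => j /andP[h1 _]; exact: leq_div2l.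
rewrite sum_nat_const_nat; apply: (@leq_trans (2 ^ e * (X %/ 2 ^ e))); last first.
  by rewrite mulnC leq_divM.
by rewrite leq_mul2r; apply/orP; right; move: hn; rewrite expnS; lia.
Qed.

(** * Floor sums *)

Lemma sum_ind_lt n m : (m <= n)%N -> (\sum_(0 <= j < n) (j < m) = m)%N.
Proof.
move=> mn; rewrite (big_cat_nat (n := m)) //=.
rewrite (eq_big_nat _ _ (F2 := fun=> 1%N)); last by move=> d /andP[_ ->].
rewrite [X in (_ + X)%N]big1_seq ?addn0.
  by rewrite big_const_nat subn0 iter_addn_0 mul1n.
by move=> d; rewrite mem_index_iota => /andP[_ /andP[h _]]; rewrite ltnNge h.
Qed.

(** The lattice points under a line are counted by rows instead of columns. Reversing both indices
    makes the counting start from the opposite corner, so that the rows again form a floor sum, now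
    of slope m / a. *)
Lemma floor_sum_swap_nat n m a b : (0 < a < m)%N -> (b < m)%N ->
  (\sum_(0 <= i < n) (a * i + b) %/ m =
   \sum_(0 <= t < (a * n + b) %/ m) (m * t + (a * n + b) %% m) %/ a)%N.
Proof.
move=> /andP[a0 am] bm; have m0 : (0 < m)%N by lia.
set q := ((a * n + b) %/ m)%N; set r := ((a * n + b) %% m)%N.
have E : (a * n + b = q * m + r)%N by exact: divn_eq.
rewrite (eq_big_nat _ _ (F2 := fun i => \sum_(0 <= j < q) (j < (a * i + b) %/ m))%N); last first.
  by move=> i /andP[_ hi]; rewrite sum_ind_lt // leq_div2r // leq_add2r leq_mul2l ltnW ?orbT.
rewrite exchange_big_nat /= big_nat_rev /= add0n.
apply: eq_big_nat => t /andP[_ tq].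
rewrite big_nat_rev /= add0n -[RHS](@sum_ind_lt n); last first.
  by rewrite -ltnS ltn_divLR //; nia.
apply: eq_big_nat => i /andP[_ ni]; congr nat_of_bool.
by rewrite !leq_divRL //; apply/idP/idP; nia.
Qed.

Definition floor_sum (n : nat) (m a b : int) : int :=
  \sum_(0 <= i < n) ((a * Posz i + b) %/ m)%Z.

Lemma floor_sum_swap n (m a b : int) : 0 <= a < m -> 0 <= b < m ->
  floor_sum n m a b =
  floor_sum `|((a * Posz n + b) %/ m)%Z| a m ((a * Posz n + b) %% m)%Z.
Proof.
case: m a b => // m [] // a [] // b; rewrite !ltz_nat !lez_nat /= => am bm.
have m0 : (0 < m)%N by lia.
rewrite /floor_sum -PoszM -PoszD divz_nat modz_nat absz_nat.
case: (posnP a) => [->|a0].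
  rewrite mul0n add0n divn_small // [RHS]big_geq //.
  by apply: big1 => i _; rewrite mul0r add0r divz_nat divn_small.
have := @floor_sum_swap_nat n m a b; rewrite a0 am bm => /(_ isT isT) E.
transitivity (Posz (\sum_(0 <= i < n) (a * i + b) %/ m)%N).
  rewrite (big_morph Posz PoszD (erefl (Posz 0))).
  by apply: eq_big_nat => i _; rewrite -PoszM -PoszD divz_nat.
rewrite E (big_morph Posz PoszD (erefl (Posz 0))).
by apply: eq_big_nat => i _; rewrite -PoszM -PoszD divz_nat.
Qed.

Lemma sum_id n : \sum_(0 <= i < n) Posz i = (Posz n * (Posz n - 1) %/ 2)%Z.
Proof.
elim: n => [|n IH]; first by rewrite big_geq // mul0r.
rewrite big_nat_recr //= IH; have -> : Posz n.+1 * (Posz n.+1 - 1) = Posz n * 2 + Posz n * (Posz n - 1).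
  by rewrite intS; ring.
by rewrite divzMDl // addrC.
Qed.

(** Together with the swap, which exchanges m and a, this is one round of Euclid's algorithm on the
    pair (m, a). *)
Lemma floor_sum_reduce n (m a b : int) : 0 < m ->
  floor_sum n m a b = (Posz n * (Posz n - 1) %/ 2)%Z * (a %/ m)%Z + Posz n * (b %/ m)%Z +
    floor_sum n m (a %% m)%Z (b %% m)%Z.
Proof.
move=> m0; have m1 : m != 0 by rewrite gt_eqF.
rewrite -sum_id /floor_sum mulr_suml.
have -> : Posz n * (b %/ m)%Z = \sum_(0 <= i < n) (b %/ m)%Z.
  by rewrite big_const_nat subn0 iter_addr_0 -mulr_natl natz.
rewrite -!big_split /=; apply: eq_big_nat => i _.
rewrite {1}(divz_eq a m) {1}(divz_eq b m).
have -> : ((a %/ m)%Z * m + (a %% m)%Z) * Posz i + ((b %/ m)%Z * m + (b %% m)%Z) =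
  (Posz i * (a %/ m)%Z + (b %/ m)%Z) * m + ((a %% m)%Z * Posz i + (b %% m)%Z) by ring.
by rewrite divzMDl.
Qed.

(** * A while language and its compilation to the machine *)

Inductive expr := EC of int | EV of nat | EB of binop & expr & expr.

Inductive cmd :=
| CSkip
| CAsn of nat & expr
| CLd of nat & nat & expr
| CSt of nat & expr & expr
| CSeq of cmd & cmd
| CIf of expr & cmd & cmd
| CWhile of expr & cmd.

Record state := State { va : nat -> int; ar : nat -> nat -> int }.

Definition setv (s : state) x z := State (fun y => if y == x then z else va s y) (ar s).

Definition seta (s : state) a i z :=
  State (va s) (fun b j => if (b == a) && (j == i) then z else ar s b j).

Fixpoint eval (s : state) (e : expr) : int :=
  match e with
  | EC z => z
  | EV x => va s x
  | EB o e1 e2 => eval_binop o (eval s e1) (eval s e2)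
  end.

Definition bits (n : nat) (z : int) : bool := (`|z|%N < 2 ^ n)%N.

(* [L] bounds the bit length of the stored values and of the addresses, the last
   argument counts steps. *)
Inductive hexec (L : nat) : cmd -> state -> state -> nat -> Prop :=
| HSkip s : hexec L CSkip s s 1
| HAsn s x e : bits L (eval s e) -> hexec L (CAsn x e) s (setv s x (eval s e)) 1
| HLd s x a e i : eval s e = Posz i -> bits L (Posz i) ->
    hexec L (CLd x a e) s (setv s x (ar s a i)) 1
| HSt s a e1 e2 i : eval s e1 = Posz i -> bits L (Posz i) -> bits L (eval s e2) ->
    hexec L (CSt a e1 e2) s (seta s a i (eval s e2)) 1
| HSeq c1 c2 s1 s2 s3 n1 n2 : hexec L c1 s1 s2 n1 -> hexec L c2 s2 s3 n2 ->
    hexec L (CSeq c1 c2) s1 s3 (n1 + n2)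
| HIfT e c1 c2 s s' n : 0 < eval s e -> hexec L c1 s s' n -> hexec L (CIf e c1 c2) s s' n.+1
| HIfF e c1 c2 s s' n : eval s e <= 0 -> hexec L c2 s s' n -> hexec L (CIf e c1 c2) s s' n.+1
| HWhileF e c s : eval s e <= 0 -> hexec L (CWhile e c) s s 1
| HWhileT e c s1 s2 s3 n1 n2 : 0 < eval s1 e -> hexec L c s1 s2 n1 ->
    hexec L (CWhile e c) s2 s3 n2 -> hexec L (CWhile e c) s1 s3 (n1 + n2).+1.

(* Registers below 64 hold the variables, register 64 the base address of the
   arrays, registers 65 to 127 are scratch; entry [i] of array [a < 4] lives in
   register [base + 4 * i + a]. *)
Fixpoint comp_expr (e : expr) (t : nat) : program :=
  match e with
  | EC z => Const t z
  | EV x => Seq (Const t 0) (Op OpAdd t x t)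
  | EB o e1 e2 => Seq (comp_expr e1 t) (Seq (comp_expr e2 t.+1) (Op o t t t.+1))
  end.

Definition comp_addr (e : expr) (a : nat) : program :=
  Seq (comp_expr e 65) (Seq (Const 66 4) (Seq (Op OpMul 65 65 66)
    (Seq (Op OpAdd 65 65 64) (Seq (Const 66 (Posz a)) (Op OpAdd 65 65 66))))).

Fixpoint compile (c : cmd) : program :=
  match c with
  | CSkip => Skip
  | CAsn x e => Seq (comp_expr e 65) (Seq (Const 66 0) (Op OpAdd x 65 66))
  | CLd x a e => Seq (comp_addr e a) (Read x 65)
  | CSt a e1 e2 => Seq (comp_addr e1 a) (Seq (comp_expr e2 66) (Write 65 66))
  | CSeq c1 c2 => Seq (compile c1) (compile c2)
  | CIf e c1 c2 => Seq (comp_expr e 65) (If 65 (compile c1) (compile c2))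
  | CWhile e c => Seq (comp_expr e 65) (While 65 (Seq (compile c) (comp_expr e 65)))
  end.

Fixpoint wf_expr (e : expr) (t : nat) : bool :=
  match e with
  | EC _ => (t < 128)%N
  | EV x => (x < 64)%N && (t < 128)%N
  | EB _ e1 e2 => [&& wf_expr e1 t, wf_expr e2 t.+1 & (t.+1 < 128)%N]
  end.

Fixpoint wf_cmd (c : cmd) : bool :=
  match c with
  | CSkip => true
  | CAsn x e => (x < 64)%N && wf_expr e 65
  | CLd x a e => [&& (x < 64)%N, (a < 4)%N & wf_expr e 65]
  | CSt a e1 e2 => [&& (a < 4)%N, wf_expr e1 65 & wf_expr e2 66]
  | CSeq c1 c2 => wf_cmd c1 && wf_cmd c2
  | CIf e c1 c2 => [&& wf_expr e 65, wf_cmd c1 & wf_cmd c2]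
  | CWhile e c => wf_expr e 65 && wf_cmd c
  end.

Definition refines (base : nat) (m : memory) (s : state) : Prop :=
  [/\ forall x, (x < 64)%N -> m x = va s x,
      m 64%N = Posz base &
      forall a i, (a < 4)%N -> m (base + 4 * i + a)%N = ar s a i].

Definition bounded_state (L : nat) (s : state) : Prop :=
  (forall x, (x < 64)%N -> bits L (va s x)) /\
  (forall a i, (a < 4)%N -> bits L (ar s a i)).

Lemma bitlen_le n z : (0 < n)%N -> bits n z -> (bitlen z <= n)%N.
Proof.
move=> n0 h; rewrite /bitlen; have [->|z0] := posnP `|z|%N; first by rewrite trunc_log0.
by rewrite -(ltn_exp2l _ _ (isT : (1 < 2)%N)); apply: leq_ltn_trans h; exact: trunc_logP.
Qed.

Lemma bits_le n n' z : (n <= n')%N -> bits n z -> bits n' z.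
Proof. by move=> nn h; apply: (leq_trans h); rewrite leq_exp2l. Qed.

Lemma bits_bitlen z : bits (bitlen z) z.
Proof. by rewrite /bits /bitlen trunc_log_ltn. Qed.

Lemma bits_add n n' x y : bits n x -> bits n' y -> bits (n + n').+1 (x + y).
Proof.
rewrite /bits => hx hy.
have h : (absz (x + y)%R <= absz x + absz y)%N by lia.
have h1 : (2 ^ n <= 2 ^ (n + n'))%N by rewrite leq_exp2l ?leq_addr.
have h2 : (2 ^ n' <= 2 ^ (n + n'))%N by rewrite leq_exp2l ?leq_addl.
by rewrite expnS; lia.
Qed.

Lemma bits_opp n x : bits n (- x) = bits n x.
Proof. by rewrite /bits abszN. Qed.

Lemma bits_mul n n' x y : bits n x -> bits n' y -> bits (n + n').+1 (x * y).
Proof.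
rewrite /bits abszM => hx hy; rewrite expnS expnD.
have : (absz x * absz y <= 2 ^ n * 2 ^ n')%N by rewrite leq_mul // ltnW.
have : (0 < 2 ^ n * 2 ^ n')%N by rewrite muln_gt0 !expn_gt0.
by lia.
Qed.

Lemma bits_div n x y : bits n x -> bits n.+1 (x %/ y)%Z.
Proof.
rewrite /bits => hx.
have h : (absz (x %/ y)%Z <= absz x)%N.
  have [->|y0] := eqVneq y 0; first by rewrite divz0.
  have E := divz_eq x y; have := modz_ge0 x y0; have := ltz_mod x y0.
  by nia.
by rewrite expnS; lia.
Qed.

Lemma bits_binop o n n' x y : bits n x -> bits n' y -> bits (n + n').+1 (eval_binop o x y).
Proof.
case: o => /= hx hy.
- exact: bits_add.
- by apply: bits_add; rewrite ?bits_opp.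
- exact: bits_mul.
- by apply: bits_le (bits_div y hx); rewrite ltnS leq_addr.
Qed.

Lemma update_eq m i z : update m i z i = z.
Proof. by rewrite /update /= eqxx. Qed.

Lemma update_neq m i z j : j != i -> update m i z j = m j.
Proof. by rewrite /update /= => /negbTE ->. Qed.

Lemma bitlen_small (n : nat) : (n < 128)%N -> (bitlen n <= 7)%N.
Proof. by move=> h; apply: bitlen_le. Qed.

(* [weight e * L] bounds the bit length of the value of [e] when its variables
   have at most [L] bits. *)
Fixpoint weight (e : expr) : nat :=
  match e with
  | EC z => bitlen z
  | EV _ => 1
  | EB _ e1 e2 => (weight e1 + weight e2).+1
  end.

Lemma weight_gt0 e : (0 < weight e)%N.
Proof. by case: e. Qed.

Lemma bits_eval L s e t : (0 < L)%N -> bounded_state L s -> wf_expr e t ->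
  bits (weight e * L) (eval s e).
Proof.
move=> L0 [hv _]; elim: e t => [z|x|o e1 IH1 e2 IH2] t /=.
- by move=> _; apply: bits_le (bits_bitlen z); rewrite leq_pmulr.
- by case/andP=> hx _; rewrite mul1n; exact: hv.
- case/and3P=> h1 h2 _; apply: bits_le (bits_binop o (IH1 _ h1) (IH2 _ h2)).
  by rewrite mulSn mulnDl; lia.
Qed.

(** The factor K depends on the expression alone: all intermediate values have at most
    [weight e * L] bits and the number of instructions is fixed. The scratch registers from t on
    serve as a stack, so everything below t survives. *)
Lemma comp_expr_correct e : exists K, forall L s m t,
  (0 < L)%N -> (64 < t)%N -> wf_expr e t -> bounded_state L s ->
  (forall x, (x < 64)%N -> m x = va s x) ->
  exists m' T, [/\ exec (comp_expr e t) m m' T, m' t = eval s e,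
    forall r, (r < t)%N || (128 <= r)%N -> m' r = m r & (T <= K * L)%N].
Proof.
elim: e => [z|x|o e1 [K1 IH1] e2 [K2 IH2]].
- exists (8 + bitlen z)%N => L s m t L0 t64 /= t128 bs ms.
  exists (update m t z), (1 + bitlen t + bitlen z)%N; split.
  + exact: exec_Const.
  + exact: update_eq.
  + by move=> r hr; rewrite update_neq //; lia.
  + by have := bitlen_small t128; nia.
- exists 33%N => L s m t L0 t64 /= /andP[x64 t128] bs ms.
  eexists; eexists; split.
  + by apply: exec_Seq; [exact: exec_Const|exact: exec_Op].
  + rewrite update_eq /= update_eq addr0 update_neq ?ms //; lia.
  + by move=> r hr; rewrite !update_neq //; lia.
  + have x128 : (x < 128)%N by lia.
    have bt := bitlen_small t128; have bx := bitlen_small x128.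
    rewrite update_eq update_neq; last by lia.
    have b0 : (bitlen (0 : int) <= 1)%N by [].
    have bm : (bitlen (m x) <= L)%N by rewrite ms //; apply: bitlen_le => //; case: bs => + _; apply.
    by move: (bitlen x) (bitlen t) bt bx b0 bm => X Y; nia.
- exists (K1 + K2 + 22 + weight e1 + weight e2)%N => L s m t L0 t64 /= /and3P[h1 h2 t128] bs ms.
  have [m1 [T1 [x1 v1 f1 c1]]] := IH1 L s m t L0 t64 h1 bs ms.
  have [|m2 [T2 [x2 v2 f2 c2]]] := IH2 L s m1 t.+1 L0 (ltnW t64) h2 bs.
    by move=> x hx; rewrite f1 ?ms //; lia.
  eexists; eexists; split.
  + by apply: exec_Seq; [exact: x1|apply: exec_Seq; [exact: x2|exact: exec_Op]].
  + by rewrite update_eq v2 f2 ?ltnSn // v1.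
  + by move=> r hr; rewrite update_neq ?f2 ?f1 //; lia.
  + rewrite v2 f2 ?ltnSn // v1.
    have bt := bitlen_small (ltnW t128); have bt1 := bitlen_small t128.
    have w1 : (bitlen (eval s e1) <= weight e1 * L)%N.
      by apply: bitlen_le (bits_eval L0 bs h1); rewrite muln_gt0 weight_gt0.
    have w2 : (bitlen (eval s e2) <= weight e2 * L)%N.
      by apply: bitlen_le (bits_eval L0 bs h2); rewrite muln_gt0 weight_gt0.
    move: (bitlen (eval s e1)) (bitlen (eval s e2)) (bitlen t) (bitlen t.+1) w1 w2 bt bt1 => A B C D.
    rewrite !mulnDl; move: (weight e1 * L)%N (weight e2 * L)%N (K1 * L)%N (K2 * L)%N c1 c2 => E F G H.
    by lia.
Qed.

Lemma comp_addr_correct e a : (a < 4)%N -> exists K, forall L s m base i,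
  (0 < L)%N -> wf_expr e 65 -> bounded_state L s -> refines base m s ->
  bits L (Posz base) -> eval s e = Posz i -> bits L (Posz i) ->
  exists m' T, [/\ exec (comp_addr e a) m m' T, m' 65%N = Posz (base + 4 * i + a),
    forall r, (r < 65)%N || (128 <= r)%N -> m' r = m r & (T <= K * L)%N].
Proof.
move=> a4; have [K hK] := comp_expr_correct e.
exists (K + 200)%N => L s m base i L0 we bs [mv mb ma] bb ei bi.
have [m1 [T1 [x1 v1 f1 c1]]] := hK L s m 65%N L0 isT we bs mv.
eexists; eexists; split.
- apply: exec_Seq; first exact: x1.
  apply: exec_Seq; first exact: exec_Const.
  apply: exec_Seq; first exact: exec_Op.
  apply: exec_Seq; first exact: exec_Op.
  apply: exec_Seq; first exact: exec_Const.
  exact: exec_Op.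
- rewrite /update /= v1 ei f1 // mb.
  by rewrite -!PoszM -!PoszD; congr Posz; lia.
- by move=> r hr; rewrite !update_neq ?f1 //; lia.
- rewrite /update /= v1 ei f1 // mb -!PoszM -!PoszD.
  have b4 : (bitlen 4%N <= 7)%N by [].
  have ba : (bitlen a <= 7)%N by apply: bitlen_small; lia.
  have b65 : (bitlen 65%N <= 7)%N by [].
  have b66 : (bitlen 66%N <= 7)%N by [].
  have b64 : (bitlen 64%N <= 7)%N by [].
  have Bi := bitlen_le L0 bi; have Bb := bitlen_le L0 bb.
  have L1 : (0 < L.+2)%N by [].
  have Bi4 : (bitlen (Posz (i * 4)) <= L.+2)%N.
    by apply: bitlen_le => //; move: bi; rewrite /bits /= !expnS; lia.
  have Bs : (bitlen (Posz (i * 4 + base)) <= L.+3)%N.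
    by apply: bitlen_le => //; move: bi bb; rewrite /bits /= !expnS; lia.
  rewrite mulnDl; move: (K * L)%N c1 => KL c1.
  move: (bitlen _) (bitlen _) (bitlen _) (bitlen _) (bitlen _) (bitlen _) (bitlen _) (bitlen _) (bitlen _) b4 ba b65 b66 b64 Bi Bb Bi4 Bs => *.
  by lia.
Qed.

Lemma refines_setv base m m' s x z : (127 < base)%N -> (x < 64)%N -> refines base m s ->
  m' x = z -> (forall r, r != x -> (r < 65)%N || (128 <= r)%N -> m' r = m r) ->
  refines base m' (setv s x z).
Proof.
move=> hb hx [mv mb ma] mx f; split.
- move=> y hy /=; case: eqP => [->|/eqP yx] //.
  by rewrite f ?mv //; lia.
- by rewrite f //; lia.
- by move=> a i a4 /=; rewrite f ?ma //; lia.
Qed.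

Lemma bounded_setv L s x z : bounded_state L s -> bits L z -> bounded_state L (setv s x z).
Proof. by move=> [h1 h2] hz; split => //= y hy; case: eqP => // _; exact: h1. Qed.

Lemma bounded_seta L s a i z : bounded_state L s -> bits L z -> bounded_state L (seta s a i z).
Proof. by move=> [h1 h2] hz; split => //= b j hb; case: ifP => // _; exact: h2. Qed.

Lemma refines_seta base m m' s a i z : (127 < base)%N -> (a < 4)%N -> refines base m s ->
  m' (base + 4 * i + a)%N = z ->
  (forall r, r != (base + 4 * i + a)%N -> (r < 65)%N || (128 <= r)%N -> m' r = m r) ->
  refines base m' (seta s a i z).
Proof.
move=> hb ha [mv mb ma] mx f; split.
- by move=> y hy /=; rewrite f ?mv //; lia.
- by rewrite f //; lia.
- move=> b j b4 /=; have [/andP[/eqP -> /eqP ->] //|h] := ifP.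
  by rewrite f ?ma //; lia.
Qed.

Lemma refines_frame base m m' s : (127 < base)%N -> refines base m s ->
  (forall r, (r < 65)%N || (128 <= r)%N -> m' r = m r) -> refines base m' s.
Proof.
move=> hb [mv mb ma] f; split.
- by move=> y hy; rewrite f ?mv //; lia.
- by rewrite f //; lia.
- by move=> a i a4; rewrite f ?ma //; lia.
Qed.

(** The order of quantifiers matters: K comes before L and the state, so that one program has one
    factor for all inputs although L grows with b. *)
Definition implements (p : program) (c : cmd) (K : nat) : Prop :=
  forall L s s' n, hexec L c s s' n -> forall base m, (0 < L)%N -> (127 < base)%N ->
    bits L (Posz base) -> refines base m s -> bounded_state L s ->
    exists m' T, [/\ exec p m m' T, refines base m' s', bounded_state L s' &
      (T <= K * L * n)%N].

Lemma hexec_gt0 L c s s' n : hexec L c s s' n -> (0 < n)%N.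
Proof. by elim=> //= *; lia. Qed.

Lemma compile_while e c K : wf_expr e 65 -> implements (compile c) c K ->
  exists K', implements (compile (CWhile e c)) (CWhile e c) K'.
Proof.
move=> we IH; have [Ke hKe] := comp_expr_correct e.
pose W := (weight e + 8)%N.
exists (K + Ke + W)%N => L s s' n h base m L0 hb bb rm bs.
have w0 : (0 < weight e * L)%N by rewrite muln_gt0 weight_gt0.
(* On entry of the compiled loop the guard is already in register 65. The summand [Ke * L] reserves
   time for the evaluation that precedes the loop. *)
have main m0 : refines base m0 s -> m0 65%N = eval s e ->
    exists m' T, [/\ exec (While 65 (Seq (compile c) (comp_expr e 65))) m0 m' T,
      refines base m' s', bounded_state L s' & (T + Ke * L <= (K + Ke + W) * L * n)%N].
  clear rm; move Ew : (CWhile e c) h => w h.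
  elim: h Ew m0 bs => // {s s' n w}.
  - move=> e' c' s hs [? ?] m0 bs r0 v0; subst e' c'.
    eexists; eexists; split; [by apply: exec_WhileF; rewrite v0| exact: r0| exact: bs|].
    have := bitlen_le w0 (bits_eval L0 bs we); rewrite v0.
    have : (bitlen 65%N <= 7)%N by [].
    move: (bitlen _) (bitlen _) => A B hA hB; rewrite muln1 /W !mulnDl.
    move: (weight e * L)%N (K * L)%N (Ke * L)%N hB => *.
    by lia.
  - move=> e' c' s1 s2 s3 n1 n2 hs h1 _ h2 IH2 [? ?] m0 bs r0 v0; subst e' c'.
    have [m1 [T1 [x1 r1 b1 c1]]] := IH _ _ _ _ h1 base m0 L0 hb bb r0 bs.
    have [mv _ _] := r1.
    have [m2 [T2 [x2 v2 f2 c2]]] := hKe L s2 m1 65%N L0 isT we b1 mv.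
    have r2 := refines_frame hb r1 f2.
    have [m3 [T3 [x3 r3 b3 c3]]] := IH2 erefl m2 b1 r2 v2.
    eexists; eexists; split; [|exact: r3|exact: b3|].
    + apply: exec_WhileT; [by rewrite v0|apply: exec_Seq; [exact: x1|exact: x2]|exact: x3].
    have := bitlen_le w0 (bits_eval L0 bs we); rewrite v0.
    have : (bitlen 65%N <= 7)%N by [].
    have n10 := hexec_gt0 h1.
    move: (bitlen _) (bitlen _) => A B hA hB.
    rewrite -[((n1 + n2).+1)]addn1 !mulnDr muln1; move: c3; set X := (_ * n2)%N => c3.
    have h4 : (K * L * n1 <= (K + Ke + W) * L * n1)%N by rewrite !leq_mul // -addnA leq_addr.
    have h5 : (Ke * L + weight e * L + 8 <= (K + Ke + W) * L)%N by rewrite /W !mulnDl; nia.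
    move: c1 c2 h4 h5 hB c3; move: (K * L * n1)%N ((K + Ke + W) * L * n1)%N ((K + Ke + W) * L)%N (weight e * L)%N (Ke * L)%N.
    by move=> *; lia.
have [mv _ _] := rm.
have [m1 [T1 [x1 v1 f1 c1]]] := hKe L s m 65%N L0 isT we bs mv.
have [m2 [T2 [x2 r2 b2 c2]]] := main m1 (refines_frame hb rm f1) v1.
exists m2, (T1 + T2)%N; split => //; first exact: exec_Seq x1 x2.
by lia.
Qed.

Lemma hexec_LdE L x a e s s' n : hexec L (CLd x a e) s s' n ->
  exists i, [/\ eval s e = Posz i, bits L (Posz i), s' = setv s x (ar s a i) & n = 1%N].
Proof. by move=> h; inversion h; subst; eexists; split; eauto. Qed.

Lemma hexec_StE L a e1 e2 s s' n : hexec L (CSt a e1 e2) s s' n ->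
  exists i, [/\ eval s e1 = Posz i, bits L (Posz i), bits L (eval s e2) &
    s' = seta s a i (eval s e2) /\ n = 1%N].
Proof. by move=> h; inversion h; subst; eexists; split; eauto. Qed.

Lemma hexec_SeqE L c1 c2 s s' n : hexec L (CSeq c1 c2) s s' n ->
  exists s1 n1 n2, [/\ hexec L c1 s s1 n1, hexec L c2 s1 s' n2 & n = (n1 + n2)%N].
Proof. by move=> h; inversion h; subst; do 3 eexists; split; eauto. Qed.

Lemma hexec_IfE L e c1 c2 s s' n : hexec L (CIf e c1 c2) s s' n ->
  exists2 n', n = n'.+1 & (0 < eval s e /\ hexec L c1 s s' n') \/
    (eval s e <= 0 /\ hexec L c2 s s' n').
Proof. by move=> h; inversion h; subst; eexists; eauto. Qed.

Lemma compile_correct c : wf_cmd c -> exists K, implements (compile c) c K.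
Proof.
elim: c => [|x e|x a e|a e1 e2|c1 IH1 c2 IH2|e c1 IH1 c2 IH2|e c IH] /=.
- move=> _; exists 1%N => L s s' n h base m L0 hb bb rm bs.
  inversion h; subst; exists m, 1%N; split => //; first exact: exec_Skip.
  by lia.
- case/andP=> hx we; have [K hK] := comp_expr_correct e.
  exists (K + weight e + 50)%N => L s s' n h base m L0 hb bb rm bs.
  inversion h; subst; have [mv _ _] := rm.
  have [m1 [T1 [x1 v1 f1 c1]]] := hK L s m 65%N L0 isT we bs mv.
  have w0 : (0 < weight e * L)%N by rewrite muln_gt0 weight_gt0.
  eexists; eexists; split.
  + apply: exec_Seq; first exact: x1.
    apply: exec_Seq; [exact: exec_Const|exact: exec_Op].
  + apply: (refines_setv (m := m)) => //.
      by rewrite update_eq /= update_eq addr0 update_neq.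
    by move=> r rx hr; rewrite !update_neq ?f1 //; lia.
  + exact: bounded_setv.
  + rewrite update_eq update_neq // v1.
    have := bitlen_le w0 (bits_eval L0 bs we).
    have := bitlen_small (ltn_trans hx (isT : (64 < 128)%N)).
    have : (bitlen 65%N <= 7)%N by []. have : (bitlen 66%N <= 7)%N by []. have : (bitlen (0:int) <= 1)%N by [].
    rewrite muln1 !mulnDl; move: (K * L)%N (weight e * L)%N c1 => A B c1.
    move: (bitlen _) (bitlen _) (bitlen _) (bitlen _) (bitlen _) => *; lia.
- case/and3P=> hx ha we; have [K hK] := comp_addr_correct e ha.
  exists (K + 50)%N => L s s' n h base m L0 hb bb rm bs.
  have [i [H3 H5 -> ->]] := hexec_LdE h; have [_ _ ma] := rm.
  have [m1 [T1 [x1 v1 f1 c1]]] := hK L s m base i L0 we bs rm bb H3 H5.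
  have E : m1 (base + 4 * i + a)%N = ar s a i by rewrite f1 ?ma //; lia.
  eexists; eexists; split.
  + by apply: exec_Seq; [exact: x1|exact: exec_Read v1].
  + apply: (refines_setv (m := m)) => //; first by rewrite update_eq.
    by move=> r rx hr; rewrite !update_neq ?f1.
  + by apply: bounded_setv => //; case: bs => _; apply.
  + rewrite E; have b1 : (bitlen (ar s a i) <= L)%N by apply: bitlen_le => //; case: bs => _; apply.
    have b2 : (bitlen (base + 4 * i + a)%N <= L.+4)%N.
      by apply: bitlen_le => //; move: bb H5; rewrite /bits /= !expnS; lia.
    have b3 := bitlen_small (ltn_trans hx (isT : (64 < 128)%N)).
    have b4 : (bitlen 65%N <= 7)%N by [].
    move: b1 b2 b3 b4 c1; move: (bitlen _) (bitlen _) (bitlen _) (bitlen _) => A B C D b1 b2 b3 b4 c1.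
    by rewrite muln1 !mulnDl; move: (K * L)%N c1 => *; lia.
- case/and3P=> ha w1 w2; have [K1 hK1] := comp_addr_correct e1 ha.
  have [K2 hK2] := comp_expr_correct e2.
  exists (K1 + K2 + weight e2 + 50)%N => L s s' n h base m L0 hb bb rm bs.
  have [i [H3 H5 H6 [-> ->]]] := hexec_StE h.
  have [m1 [T1 [x1 v1 f1 c1]]] := hK1 L s m base i L0 w1 bs rm bb H3 H5.
  have [mv _ _] := refines_frame hb rm f1.
  have [m2 [T2 [x2 v2 f2 c2]]] := hK2 L s m1 66%N L0 isT w2 bs mv.
  have e65 : m2 65%N = Posz (base + 4 * i + a) by rewrite f2.
  eexists; eexists; split.
  + by apply: exec_Seq; [exact: x1|apply: exec_Seq; [exact: x2|exact: exec_Write e65]].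
  + apply: (refines_seta (m := m)) => //; first by rewrite update_eq.
    by move=> r rx hr; rewrite !update_neq ?f2 ?f1 //; lia.
  + exact: bounded_seta.
  + rewrite v2.
    have b1 : (bitlen (eval s e2) <= L)%N by exact: bitlen_le.
    have b2 : (bitlen (base + 4 * i + a)%N <= L.+4)%N.
      by apply: bitlen_le => //; move: bb H5; rewrite /bits /= !expnS; lia.
    have b3 : (bitlen 66%N <= 7)%N by []. have b4 : (bitlen 65%N <= 7)%N by [].
    move: b1 b2 b3 b4 c1; move: (bitlen _) (bitlen _) (bitlen _) (bitlen _) => A B C D b1 b2 b3 b4 c1.
    by rewrite muln1 !mulnDl; move: (K1 * L)%N (K2 * L)%N (weight e2 * L)%N c1 c2 => *; lia.
- case/andP=> /IH1[K1 h1] /IH2[K2 h2].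
  exists (K1 + K2)%N => L s s' n h base m L0 hb bb rm bs.
  have [s1 [n1 [n2 [H1 H4 ->]]]] := hexec_SeqE h.
  have [m1 [T1 [x1 r1 b1 c1_]]] := h1 _ _ _ _ H1 base m L0 hb bb rm bs.
  have [m2 [T2 [x2 r2 b2 c2_]]] := h2 _ _ _ _ H4 base m1 L0 hb bb r1 b1.
  exists m2, (T1 + T2)%N; split => //; first exact: exec_Seq x1 x2.
  rewrite mulnDr leq_add //.
    by apply: (leq_trans c1_); rewrite !leq_mul // leq_addr.
  by apply: (leq_trans c2_); rewrite !leq_mul // leq_addl.
- case/and3P=> we /IH1[K1 h1] /IH2[K2 h2]; have [K hK] := comp_expr_correct e.
  exists (K1 + K2 + (K + weight e + 8))%N => L s s' n h base m L0 hb bb rm bs.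
  have [mv _ _] := rm.
  have [m1 [T1 [x1 v1 f1 c1_]]] := hK L s m 65%N L0 isT we bs mv.
  have r1 := refines_frame hb rm f1.
  have w0 : (0 < weight e * L)%N by rewrite muln_gt0 weight_gt0.
  have be := bitlen_le w0 (bits_eval L0 bs we).
  have b65 : (bitlen 65%N <= 7)%N by [].
  have bound (T n0 K0 : nat) : (T <= K0 * L * n0)%N -> (K0 <= K1 + K2)%N ->
    (T1 + (1 + bitlen 65%N + bitlen (eval s e) + T) <= (K1 + K2 + (K + weight e + 8)) * L * n0.+1)%N.
    move=> hT hK0; have h' : (K0 * L * n0 <= (K1 + K2 + (K + weight e + 8)) * L * n0)%N.
      by rewrite !leq_mul //; lia.
    have h'' : (K * L + weight e * L + 8 * L <= (K1 + K2 + (K + weight e + 8)) * L)%N.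
      by rewrite -!mulnDl leq_mul //; lia.
    rewrite mulnS; move: be b65 c1_; move: (bitlen _) (bitlen _) => A B be b65 c1_.
    move: (K * L)%N (weight e * L)%N (K0 * L * n0)%N ((K1 + K2 + (K + weight e + 8)) * L)%N ((K1 + K2 + (K + weight e + 8)) * L * n0)%N h' h'' hT c1_ be => *.
    by lia.
  have [n' -> [[pe H5]|[pe H5]]] := hexec_IfE h.
  + have [m2 [T2 [x2 r2 b2 c2_]]] := h1 _ _ _ _ H5 base m1 L0 hb bb r1 bs.
    eexists; eexists; split; [|exact: r2|exact: b2|].
      by apply: exec_Seq; [exact: x1|apply: exec_IfT; [rewrite v1|exact: x2]].
    by rewrite v1; apply: bound c2_ _; rewrite leq_addr.
  + have [m2 [T2 [x2 r2 b2 c2_]]] := h2 _ _ _ _ H5 base m1 L0 hb bb r1 bs.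
    eexists; eexists; split; [|exact: r2|exact: b2|].
      by apply: exec_Seq; [exact: x1|apply: exec_IfF; [rewrite v1|exact: x2]].
    by rewrite v1; apply: bound c2_ _; rewrite leq_addl.
- by case/andP=> we /IH[K hK]; exact: compile_while we hK.
Qed.

(** * Relocation of the input *)

Fixpoint doublings (n : nat) : program :=
  if n is n'.+1 then Seq (Op OpAdd 0 0 0) (doublings n') else Skip.

(** Straight-line code: as long as registers 2 to 127 hold input, only registers 0 and 1 are free,
    which leaves no room for the counter of a loop. *)
Fixpoint save_registers (n : nat) : program :=
  if n is n'.+1 then
    Seq (save_registers n') (Seq (Op OpAdd 0 0 1) (Write 0 n.+1))
  else Skip.

(* Before anything else can be computed, all registers may be occupied by the
   input. Doubling register 0, which contains [k], yields the address [256 * k]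
   beyond the input without destroying any information. *)
Definition prelude : program :=
  Seq (doublings 8)
  (Seq (Write 0 1)
  (Seq (Const 1 4)
  (Seq (save_registers 126)
  (Seq (Const 64 504)
  (Seq (Op OpSub 64 0 64)
  (Seq (Const 3 256)
  (Seq (Op OpDiv 2 64 3)
  (Seq (Const 4 4)
  (Seq (Op OpMul 5 2 4)
  (Seq (Const 6 127)
  (Seq (Op OpSub 5 5 6)
  (Seq (Const 7 128)
  (Seq (Const 8 1)
  (While 5 (Seq (Op OpAdd 0 0 1) (Seq (Read 9 7) (Seq (Write 0 9)
     (Seq (Op OpAdd 7 7 8) (Op OpSub 5 5 8))))))))))))))))))).

Section Prelude.
Variables (L k : nat) (m0 : memory).
Hypothesis k0 : (0 < k)%N.
Hypothesis kL : (1024 * k < 2 ^ L)%N.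
Hypothesis m00 : m0 0%N = Posz k.
Hypothesis m0b : forall r, bits L (m0 r).
Hypothesis m0z : forall r, (4 * k < r)%N -> m0 r = 0.

Let base := (256 * k)%N.

Lemma L_gt0 : (9 < L)%N.
Proof. by rewrite -(ltn_exp2l _ _ (isT : (1 < 2)%N)); apply: leq_ltn_trans kL; rewrite /= ; lia. Qed.

Lemma bitlenL z : bits L z -> (bitlen z <= L)%N.
Proof. by apply: bitlen_le; have := L_gt0; lia. Qed.

Lemma bitlen_nat n : (n <= 1024 * k)%N -> (bitlen (Posz n) <= L)%N.
Proof. by move=> h; apply: bitlenL; rewrite /bits /=; exact: leq_ltn_trans kL. Qed.

Lemma doublings_exec n m v : m 0%N = Posz v -> (v * 2 ^ n <= 1024 * k)%N ->
  exists m' T, [/\ exec (doublings n) m m' T, m' 0%N = Posz (v * 2 ^ n),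
    forall r, r != 0%N -> m' r = m r & (T <= 6 * n * L + 1)%N].
Proof.
elim: n m v => [|n IH] m v hm hv /=.
  exists m, 1%N; split => //; first exact: exec_Skip.
  by rewrite hm expn0 muln1.
have [|m' [T [x e f c]]] := IH (update m 0 (Posz (v + v))) (v + v)%N (update_eq _ _ _).
  by move: hv; rewrite expnS; lia.
exists m', ((1 + bitlen 0%N + bitlen 0%N + bitlen 0%N + bitlen (m 0%N) + bitlen (m 0%N)) + T)%N; split.
- apply: exec_Seq; last exact: x.
  have -> : Posz (v + v) = eval_binop OpAdd (m 0%N) (m 0%N) by rewrite hm /= PoszD.
  exact: exec_Op.
- by rewrite e expnS; congr Posz; lia.
- by move=> r r0; rewrite f // update_neq.
- have : (bitlen (m 0%N) <= L)%N.
    by rewrite hm; apply: bitlen_nat; move: hv; have := expn_gt0 2 n.+1; nia.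
  have -> : bitlen 0%N = 1%N by [].
  by have := L_gt0; nia.
Qed.

(** Entries 0 to n of array 0 have been copied with stride 4, and register 0 holds the address
    written last. The final clause leaves the three arrays interleaved with array 0 filled with
    zeros, which the sieve relies on. *)
Definition stored (n : nat) (m : memory) : Prop :=
  [/\ m 0%N = Posz (base + 4 * n), m 1%N = 4,
    forall r, (127 < r < base)%N -> m r = m0 r,
    forall j, (j <= n)%N -> m (base + 4 * j)%N = m0 j.+1 &
    forall r, (base <= r)%N -> (forall j, (j <= n)%N -> r <> (base + 4 * j)%N) -> m r = 0].

Lemma save_exec n m : (n <= 126)%N -> stored 0 m ->
  (forall r, (1 < r < base)%N -> m r = m0 r) ->
  exists m' T, [/\ exec (save_registers n) m m' T, stored n m',
    forall r, (1 < r < base)%N -> m' r = m0 r & (T <= 12 * n * L + 1)%N].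
Proof.
have L9 := L_gt0.
elim: n => [|n IH] hn sm fm /=.
  by exists m, 1%N; split => //; exact: exec_Skip.
have [|m1 [T1 [x1 [a0 a1 a2 a3 a4] f1 c1]]] := IH _ sm fm; first by lia.
pose m2 := update m1 0 (Posz (base + 4 * n.+1)).
pose m3 := update m2 (base + 4 * n.+1)%N (m2 n.+2).
have v2 : m2 n.+2 = m0 n.+2.
  rewrite /m2 update_neq //; apply: f1; rewrite /base; lia.
have E : Posz (base + 4 * n.+1) = eval_binop OpAdd (m1 0%N) (m1 1%N).
  by rewrite a0 a1 /= -PoszD; congr Posz; lia.
eexists m3, _; split.
- apply: exec_Seq; first exact: x1.
  apply: exec_Seq; last by apply: exec_Write; exact: update_eq.
  by have := exec_Op m1 OpAdd 0 0 1; rewrite -E; apply.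
- split.
  + by rewrite /m3 /m2 update_neq ?update_eq // /base; lia.
  + by rewrite /m3 /m2 !update_neq // /base; lia.
  + by move=> r hr; rewrite /m3 /m2 !update_neq ?a2 //; lia.
  + move=> j; rewrite leq_eqVlt ltnS => /orP[/eqP ->|hj]; first by rewrite /m3 update_eq v2.
    by rewrite /m3 /m2 !update_neq ?a3 // /base; lia.
  + move=> r hr hj; rewrite /m3 update_neq; last by apply/eqP; apply: hj.
    rewrite /m2 update_neq; last by rewrite /base in hr; lia.
    by apply: a4 => // j jn; apply: hj; lia.
- by move=> r hr; rewrite /m3 /m2 !update_neq ?f1 //; lia.
- rewrite v2 a0 a1.
  have b0 : (bitlen (Posz (base + 4 * n)) <= L)%N by apply: bitlen_nat; rewrite /base; lia.
  have b1 : (bitlen (Posz (base + 4 * n.+1)) <= L)%N by apply: bitlen_nat; rewrite /base; lia.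
  have b2 := bitlenL (m0b n.+2).
  have b3 : (bitlen (Posz n.+2) <= L)%N by apply: bitlen_nat; lia.
  have -> : bitlen 0%N = 1%N by []. have -> : bitlen 1%N = 1%N by []. have -> : bitlen 4 = 3%N by [].
  move: b0 b1 b2 b3 c1; move: (bitlen _) (bitlen _) (bitlen _) (bitlen _) => A B C D *.
  by nia.
Qed.

Definition small (m : memory) := forall r, (r < 128)%N -> bits L (m r).

Lemma small_update m i z : small m -> bits L z -> small (update m i z).
Proof.
move=> sm bz r hr; have [->|ri] := eqVneq r i; first by rewrite update_eq.
by rewrite update_neq //; exact: sm.
Qed.

Lemma bits_nat n : (n <= 1024 * k)%N -> bits L (Posz n).
Proof. by move=> h; rewrite /bits /=; exact: leq_ltn_trans kL. Qed.

Definition copy_loop : program :=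
  While 5 (Seq (Op OpAdd 0 0 1) (Seq (Read 9 7) (Seq (Write 0 9)
     (Seq (Op OpAdd 7 7 8) (Op OpSub 5 5 8))))).

Lemma exec_Op_eq m o i j l x y z : m j = x -> m l = y -> eval_binop o x y = z ->
  exec (Op o i j l) m (update m i z)
    (1 + bitlen i + bitlen j + bitlen l + bitlen x + bitlen y)%N.
Proof. by move=> <- <- <-; exact: exec_Op. Qed.

Lemma loop_exec d n m : (126 <= n)%N -> (n.+1 + d = 4 * k)%N -> stored n m -> small m ->
  m 5%N = Posz d -> m 7%N = Posz n.+2 -> m 8%N = 1 ->
  exists m' T, [/\ exec copy_loop m m' T, stored (n + d) m', small m',
    m' 2%N = m 2%N /\ m' 64%N = m 64%N & (T <= 80 * L * d.+1)%N].
Proof.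
have L9 := L_gt0.
elim: d n m => [|d IH] n m n126 nd sm bm m5 m7 m8.
  exists m, (1 + bitlen 5%N + bitlen (m 5%N))%N; split => //.
  - by apply: exec_WhileF; rewrite m5.
  - by rewrite addn0.
  - by rewrite m5; have -> : bitlen 5%N = 3%N by []; have -> : bitlen 0 = 1%N by []; lia.
have [a0 a1 a2 a3 a4] := sm.
pose z := m0 n.+2.
have mz : m n.+2 = z by apply: a2; rewrite /base; lia.
pose m1 := update m 0 (Posz (base + 4 * n.+1)).
pose m2 := update m1 9 z.
pose m3 := update m2 (base + 4 * n.+1)%N z.
pose m4 := update m3 7 (Posz n.+3).
pose m5' := update m4 5 (Posz d).
have u5 : stored n.+1 m5'.
  split.
  + rewrite /m5' update_neq // /m4 update_neq // /m3 update_neq; last by rewrite /base; lia.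
    by rewrite /m2 update_neq // /m1 update_eq.
  + by rewrite /m5' /m4 /m3 /m2 /m1 !update_neq // /base; lia.
  + by move=> r hr; rewrite /m5' /m4 /m3 /m2 /m1 !update_neq ?a2 //; lia.
  + move=> j; rewrite leq_eqVlt ltnS => /orP[/eqP ->|hj].
      rewrite /m5' update_neq; last by rewrite /base; lia.
      rewrite /m4 update_neq; last by rewrite /base; lia.
      by rewrite /m3 update_eq.
    by rewrite /m5' /m4 /m3 /m2 /m1 !update_neq ?a3 // /base; lia.
  + move=> r hr hj; rewrite /m5' update_neq; last by rewrite /base in hr; lia.
    rewrite /m4 update_neq; last by rewrite /base in hr; lia.
    rewrite /m3 update_neq; last by apply/eqP; apply: hj.
    rewrite /m2 /m1 !update_neq; try by rewrite /base in hr; lia.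
    by apply: a4 => // j jn; apply: hj; lia.
have bb : bits L (Posz (base + 4 * n.+1)) by apply: bits_nat; rewrite /base; lia.
have b3 : bits L (Posz n.+3) by apply: bits_nat; lia.
have b2 : bits L (Posz n.+2) by apply: bits_nat; lia.
have bd : bits L (Posz d) by apply: bits_nat; lia.
have bd1 : bits L (Posz d.+1) by apply: bits_nat; lia.
have bz : bits L z := m0b _.
have bn : bits L (Posz (base + 4 * n)) by apply: bits_nat; rewrite /base; lia.
have s5 : small m5' by do ! apply: small_update => //.
have v : m5' 5%N = Posz d by rewrite /m5' update_eq.
have v7 : m5' 7%N = Posz n.+3 by rewrite /m5' update_neq // /m4 update_eq.
have v8 : m5' 8%N = 1 by rewrite /m5' /m4 /m3 /m2 /m1 !update_neq // /base; lia.
have v2 : m5' 2%N = m 2%N by rewrite /m5' /m4 /m3 /m2 /m1 !update_neq // /base; lia.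
have v64 : m5' 64%N = m 64%N by rewrite /m5' /m4 /m3 /m2 /m1 !update_neq // /base; lia.
have h1 : (126 <= n.+1)%N by exact: leqW.
have h2 : (n.+2 + d = 4 * k)%N by rewrite -nd addSnnS.
have [m' [T [x' st sm' [w2 w64] cT]]] := IH n.+1 m5' h1 h2 u5 s5 v v7 v8.
have hbase : (128 < base + 4 * n.+1)%N by rewrite /base; lia.
eexists m', _; split.
- apply: exec_WhileT; [by rewrite m5| |exact: x'].
  apply: exec_Seq.
    by apply: (@exec_Op_eq _ _ _ _ _ _ _ (Posz (base + 4 * n.+1)) a0 a1); rewrite /= -PoszD; congr Posz; lia.
  apply: exec_Seq.
    have e7 : m1 7%N = Posz n.+2 by rewrite /m1 update_neq.
    have ez : m1 n.+2 = z by rewrite /m1 update_neq.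
    by have := exec_Read 9 e7; rewrite ez; apply.
  apply: exec_Seq.
    have e0 : m2 0%N = Posz (base + 4 * n.+1) by rewrite /m2 update_neq // /m1 update_eq.
    have e9 : m2 9%N = z by rewrite /m2 update_eq.
    by have := exec_Write 9 e0; rewrite e9; apply.
  apply: exec_Seq.
    have e7 : m3 7%N = Posz n.+2 by rewrite /m3 /m2 /m1 !update_neq //; lia.
    have e8 : m3 8%N = 1 by rewrite /m3 /m2 /m1 !update_neq //; lia.
    by apply: (@exec_Op_eq _ _ _ _ _ _ _ (Posz n.+3) e7 e8); rewrite /= -PoszD addn1.
  have e5 : m4 5%N = Posz d.+1 by rewrite /m4 /m3 /m2 /m1 !update_neq //; lia.
  have e8 : m4 8%N = 1 by rewrite /m4 /m3 /m2 /m1 !update_neq //; lia.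
  by apply: (@exec_Op_eq _ _ _ _ _ _ _ (Posz d) e5 e8); rewrite /= intS; ring.
- by rewrite -addSnnS.
- exact: sm'.
- by rewrite w2 w64.
- rewrite m5.
  have B1 := bitlenL bb; have B2 := bitlenL b2; have B3 := bitlenL bd1; have B4 := bitlenL bz; have B5 := bitlenL bn.
  have -> : bitlen 0%N = 1%N by []. have -> : bitlen 1%N = 1%N by []. have -> : bitlen 4 = 3%N by [].
  have -> : bitlen 5%N = 3%N by []. have -> : bitlen 7%N = 3%N by [].
  have -> : bitlen 8%N = 4%N by []. have -> : bitlen 9%N = 4%N by [].
  move: B1 B2 B3 B4 B5 cT; move: (bitlen _) (bitlen _) (bitlen _) (bitlen _) (bitlen _) => A B C D E B1 B2 B3 B4 B5 cT.
  by rewrite mulnS; move: (80 * L * d.+1)%N cT => *; lia.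
Qed.

Lemma prelude_exec : exists m T n, [/\ exec prelude m0 m T,
    (4 * k <= n.+1)%N /\ stored n m, small m,
    m 2%N = Posz k /\ m 64%N = Posz base & (T <= 4000 * L * k)%N].
Proof.
have L9 := L_gt0.
have k1 : (1 * 2 ^ 8 <= 1024 * k)%N by rewrite /=; lia.
have kk : (k * 2 ^ 8 <= 1024 * k)%N by rewrite /=; lia.
have [d1 [T1 [x1 v1 f1 c1]]] := doublings_exec m00 kk.
have {}v1 : d1 0%N = Posz base by rewrite v1 /base; congr Posz; lia.
pose d2 := update d1 base (d1 1%N).
pose d3 := update d2 1 4.
have s3 : stored 0 d3.
  split.
  - by rewrite /d3 update_neq // /d2 update_neq /base ?v1 ?muln0 ?addn0 //; lia.
  - by rewrite /d3 update_eq.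
  - by move=> r hr; rewrite /d3 /d2 !update_neq ?f1 //; lia.
  - move=> j; rewrite leqn0 => /eqP ->; rewrite muln0 addn0 /d3 update_neq; last by rewrite /base; lia.
    by rewrite /d2 update_eq f1.
  - move=> r hr hj; have := hj 0%N isT; rewrite muln0 addn0 => hr0.
    rewrite /d3 update_neq; last by rewrite /base in hr; lia.
    rewrite /d2 update_neq; last by apply/eqP.
    by rewrite f1 ?m0z //; rewrite /base in hr; lia.
have f3 r : (1 < r < base)%N -> d3 r = m0 r.
  by move=> hr; rewrite /d3 /d2 !update_neq ?f1 //; lia.
have [d4 [T4 [x4 s4 f4 c4]]] := save_exec (leqnn 126) s3 f3.
have [a0 a1 a2 a3 a4] := s4.
have bL n : (n <= 1024)%N -> bits L (Posz n) by move=> h; apply: bits_nat; lia.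
have b0 : bits L (Posz (base + 4 * 126)) by apply: bits_nat; rewrite /base; lia.
have sm4 : small d4.
  move=> r hr; have [->|r0] := eqVneq r 0%N; first by rewrite a0.
  have [->|r1] := eqVneq r 1%N; first by rewrite a1; exact: bL.
  by rewrite f4 //; rewrite /base; lia.
(* The last saved entry has offset 504 = 4 * 126 from the base; dividing the base by 256 then
   recovers k. *)
pose e1 := update d4 64 504.
pose e2 := update e1 64 (Posz base).
pose e3 := update e2 3 256.
pose e4 := update e3 2 (Posz k).
pose e5 := update e4 4 4.
pose e6 := update e5 5 (Posz (4 * k)).
pose e7 := update e6 6 127.
pose e8 := update e7 5 (Posz (4 * k) - 127).
pose e9 := update e8 7 128.
pose e10 := update e9 8 1.
have bb : bits L (Posz base) by apply: bits_nat; rewrite /base; lia.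
have bk : bits L (Posz k) by apply: bits_nat; lia.
have b4k : bits L (Posz (4 * k)) by apply: bits_nat; lia.
have b4k' : bits L (Posz (4 * k) - 127).
  move: kL; rewrite /bits => kL'; apply: leq_ltn_trans kL'; lia.
have sm10 : small e10 by do ! (apply: small_update => //); try exact: bL; try exact: (bL 504%N); exact: bits_nat.
have fe r : (127 < r)%N || (r < 2)%N -> e10 r = d4 r.
  move=> hr; have ne x : (1 < x < 128)%N -> r != x by clear -hr; lia.
  by rewrite /e10 /e9 /e8 /e7 /e6 /e5 /e4 /e3 /e2 /e1 !update_neq ?ne.
have hb r : (base <= r)%N -> (127 < r)%N by rewrite /base; clear -k0; lia.
have s10 : stored 126 e10.
  split.
  - by rewrite fe.
  - by rewrite fe.
  - by move=> r hr; rewrite fe ?a2 //; case/andP: hr => ->.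
  - by move=> j hj; rewrite fe ?a3 // hb // leq_addr.
  - by move=> r hr hj; rewrite fe ?a4 // hb.
have fin : exists m T n, [/\ exec copy_loop e10 m T, (4 * k <= n.+1)%N /\ stored n m,
    small m, m 2%N = e10 2%N /\ m 64%N = e10 64%N & (T <= 320 * L * k)%N].
  have v5 : e10 5%N = Posz (4 * k) - 127 by rewrite /e10 /e9 !update_neq // /e8 update_eq.
  (* If there are at most 127 entries, the straight-line part has copied them all (and some zeros
     after them), and the counter 4 k - 127 of the loop is not positive. *)
  have [h|h] := leqP (4 * k) 127.
    exists e10, (1 + bitlen 5%N + bitlen (e10 5%N))%N, 126%N; split => //.
    - by apply: exec_WhileF; rewrite v5; lia.
    - by have := bitlenL (sm10 5%N isT); have -> : bitlen 5%N = 3%N by []; move: (bitlen _) => *; nia.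
  have v5' : e10 5%N = Posz (4 * k - 127) by rewrite v5; lia.
  have h126 : (127 + (4 * k - 127) = 4 * k)%N by lia.
  have v7 : e10 7%N = Posz 128 by rewrite /e10 update_neq // /e9 update_eq.
  have v8 : e10 8%N = 1 by rewrite /e10 update_eq.
  have [m' [T [h1 h2 h3 h4 h5]]] := loop_exec (leqnn 126) h126 s10 sm10 v5' v7 v8.
  exists m', T, (126 + (4 * k - 127))%N; split => //; first by split => //; lia.
  by apply: (leq_trans h5); nia.
have [m [T [n [y1 y2 y3 [y4 y5] y6]]]] := fin.
have b80 : bitlen 0%N = 1%N by []. have b81 : bitlen 1%N = 1%N by []. have b84 : bitlen 4 = 3%N by [].
eexists m, (T1 + (_ + (_ + (T4 + (_ + (_ + (_ + (_ + (_ + (_ + (_ + (_ + (_ + (_ + T))))))))))))))%N, n.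
split => //.
- apply: exec_Seq; first exact: x1.
  apply: exec_Seq; first by apply: exec_Write; exact: v1.
  apply: exec_Seq; first exact: exec_Const.
  apply: exec_Seq; first exact: x4.
  apply: exec_Seq; first exact: exec_Const.
  apply: exec_Seq.
    apply: (@exec_Op_eq e1 OpSub 64 0 64 (Posz (base + 4 * 126)) 504 (Posz base)).
    - by rewrite /e1 update_neq.
    - exact: update_eq.
    - by rewrite /= PoszD addrK.
  apply: exec_Seq; first exact: exec_Const.
  apply: exec_Seq.
    apply: (@exec_Op_eq e3 OpDiv 2 64 3 (Posz base) 256 (Posz k)).
    - by rewrite /e3 update_neq // /e2 update_eq.
    - exact: update_eq.
    - by rewrite /= /base PoszM mulKz.
  apply: exec_Seq; first exact: exec_Const.
  apply: exec_Seq.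
    apply: (@exec_Op_eq e5 OpMul 5 2 4 (Posz k) 4 (Posz (4 * k))).
    - by rewrite /e5 update_neq // /e4 update_eq.
    - exact: update_eq.
    - by rewrite /= PoszM mulrC.
  apply: exec_Seq; first exact: exec_Const.
  apply: exec_Seq.
    apply: (@exec_Op_eq e7 OpSub 5 5 6 (Posz (4 * k)) 127).
    - by rewrite /e7 update_neq // /e6 update_eq.
    - exact: update_eq.
    - exact: erefl.
  apply: exec_Seq; first exact: exec_Const.
  apply: exec_Seq; first exact: exec_Const.
  exact: y1.
- have B1 : (bitlen (d1 1%N) <= L)%N by rewrite f1 //; exact: bitlenL.
  have B2 := bitlenL bb; have B3 := bitlenL b0; have B4 := bitlenL bk; have B5 := bitlenL b4k.
  have c x : (x <= 1024)%N -> (bitlen (Posz x) <= L)%N by move=> h; apply: bitlenL; exact: bL.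
  have [h2 h3 h4 h5] := And4 (c 2%N isT) (c 3%N isT) (c 4%N isT) (c 5%N isT).
  have [h6 h7 h8 h64] := And4 (c 6%N isT) (c 7%N isT) (c 8%N isT) (c 64%N isT).
  have g1 : (bitlen 504 <= L)%N := c 504%N isT. have g2 : (bitlen 256 <= L)%N := c 256%N isT.
  have g3 : (bitlen 127 <= L)%N := c 127%N isT. have g4 : (bitlen 128 <= L)%N := c 128%N isT.
  have g5 : (bitlen 1 <= L)%N := c 1%N isT. have g6 : (bitlen 4 <= L)%N := c 4%N isT.
  have Lk : (L <= L * k)%N by rewrite leq_pmulr.
  rewrite b80 b81; move: c1 c4 y6; rewrite -!mulnA; move: (L * k)%N Lk => X Lk c1 c4 y6.
  clear - L9 B1 B2 B3 B4 B5 h2 h3 h4 h5 h6 h7 h8 h64 g1 g2 g3 g4 g5 g6 Lk c1 c4 y6.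
  by lia.
Qed.

End Prelude.

(** * Weakest preconditions and sizes of numbers *)

Fixpoint mods (c : cmd) : seq nat :=
  match c with
  | CSkip => [::]
  | CAsn x _ | CLd x _ _ => [:: x]
  | CSt _ _ _ => [::]
  | CSeq c1 c2 | CIf _ c1 c2 => mods c1 ++ mods c2
  | CWhile _ c => mods c
  end.

Fixpoint amods (c : cmd) : seq nat :=
  match c with
  | CSkip | CAsn _ _ | CLd _ _ _ => [::]
  | CSt a _ _ => [:: a]
  | CSeq c1 c2 | CIf _ c1 c2 => amods c1 ++ amods c2
  | CWhile _ c => amods c
  end.

Definition frame (ms am : seq nat) (s s' : state) : Prop :=
  (forall y, y \notin ms -> va s' y = va s y) /\ (forall a, a \notin am -> ar s' a = ar s a).

Lemma frame_va ms am s s' i v : frame ms am s s' -> va s i = v -> i \notin ms -> va s' i = v.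
Proof. by move=> [f _] <- h; exact: f. Qed.

Lemma frame_ar ms am s s' a v : frame ms am s s' -> ar s a = v -> a \notin am -> ar s' a = v.
Proof. by move=> [_ f] <- h; exact: f. Qed.

Lemma frame_trans ms am ms' am' s s1 s2 : frame ms am s s1 -> frame ms' am' s1 s2 ->
  frame (ms ++ ms') (am ++ am') s s2.
Proof.
move=> [f1 f2] [g1 g2]; split=> y; rewrite mem_cat negb_or => /andP[h1 h2].
- by rewrite g1 ?f1.
- by rewrite g2 ?f2.
Qed.

Lemma frame_sub ms am ms' am' s s' : frame ms am s s' -> {subset ms <= ms'} ->
  {subset am <= am'} -> frame ms' am' s s'.
Proof.
by move=> [f1 f2] h1 h2; split=> y hy; [apply: f1|apply: f2]; apply: contra hy => ?;
  [exact: h1|exact: h2].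
Qed.

Lemma hexec_frame L c s s' n : hexec L c s s' n -> frame (mods c) (amods c) s s'.
Proof.
elim=> {c s s' n} //=.
- by move=> s x e _; split=> // y; rewrite inE /= => /negbTE ->.
- by move=> s x a e i _ _; split=> // y; rewrite inE /= => /negbTE ->.
- by move=> s a e1 e2 i _ _ _; split=> // y; rewrite inE /= => /negbTE ->.
- by move=> c1 c2 s1 s2 s3 n1 n2 _ h1 _ h2; exact: frame_trans h1 h2.
- move=> e c1 c2 s s' n _ _ h; apply: (frame_sub h) => y hy; by rewrite mem_cat hy.
- move=> e c1 c2 s s' n _ _ h; apply: (frame_sub h) => y hy; by rewrite mem_cat hy orbT.
- move=> e c s1 s2 s3 n1 n2 _ _ h1 _ h2; apply: (frame_sub (frame_trans h1 h2)) => y;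
  by rewrite mem_cat orbb.
Qed.

(** The existence of a run: termination, the time bound and the size discipline [L] built into
    [hexec] are all part of the assertion. *)
Definition wp (L : nat) (c : cmd) (s : state) (T : nat) (Q : state -> Prop) : Prop :=
  exists s' n, [/\ hexec L c s s' n, (n <= T)%N & Q s'].

Section Rules.
Variable L : nat.
Implicit Types (c : cmd) (s : state) (Q : state -> Prop).

Lemma wp_time T T' c s Q : wp L c s T Q -> (T <= T')%N -> wp L c s T' Q.
Proof. by move=> [s' [n [h1 h2 h3]]] h; exists s', n; split => //; exact: leq_trans h. Qed.

Lemma wp_weaken T c s Q Q' : wp L c s T Q -> 
  (forall s', frame (mods c) (amods c) s s' -> Q s' -> Q' s') -> wp L c s T Q'.
Proof.
by move=> [s' [n [h1 h2 h3]]] h; exists s', n; split => //; apply: h => //; exact: hexec_frame h1.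
Qed.

Lemma wp_skip s Q : Q s -> wp L CSkip s 1 Q.
Proof. by move=> q; exists s, 1%N; split => //; exact: HSkip. Qed.

Lemma wp_call c1 c2 s T1 T2 Q1 Q : wp L c1 s T1 Q1 ->
  (forall s', frame (mods c1) (amods c1) s s' -> Q1 s' -> wp L c2 s' T2 Q) ->
  wp L (CSeq c1 c2) s (T1 + T2) Q.
Proof.
move=> [s1 [n1 [h1 h2 h3]]] h; have [s2 [n2 [g1 g2 g3]]] := h s1 (hexec_frame h1) h3.
by exists s2, (n1 + n2)%N; split; [exact: HSeq h1 g1|exact: leq_add|].
Qed.

Lemma wp_asn c x e s v T Q : eval s e = v -> bits L v ->
  (forall s', frame [:: x] [::] s s' -> va s' x = v -> wp L c s' T Q) ->
  wp L (CSeq (CAsn x e) c) s T.+1 Q.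
Proof.
move=> <- b h; rewrite -add1n; apply: (wp_call (Q1 := fun s' => va s' x = eval s e)).
  by exists (setv s x (eval s e)), 1%N; split => //; [exact: HAsn|rewrite /= eqxx].
by move=> s' f e'; exact: h.
Qed.

Lemma wp_ld c x a e s i v T Q : eval s e = Posz i -> bits L (Posz i) -> ar s a i = v ->
  (forall s', frame [:: x] [::] s s' -> va s' x = v -> wp L c s' T Q) ->
  wp L (CSeq (CLd x a e) c) s T.+1 Q.
Proof.
move=> ei b ev h; rewrite -add1n; apply: (wp_call (Q1 := fun s' => va s' x = v)).
  by exists (setv s x (ar s a i)), 1%N; split => //; [exact: HLd|rewrite /= eqxx].
by move=> s' f e'; exact: h.
Qed.

Definition store (A : nat -> int) i z : nat -> int := fun j => if j == i then z else A j.

Lemma wp_st c a e1 e2 s i v A T Q : eval s e1 = Posz i -> bits L (Posz i) ->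
  eval s e2 = v -> bits L v -> ar s a = A ->
  (forall s', frame [::] [:: a] s s' -> ar s' a = store A i v -> wp L c s' T Q) ->
  wp L (CSeq (CSt a e1 e2) c) s T.+1 Q.
Proof.
move=> ei b <- bv <- h; rewrite -add1n.
apply: (wp_call (Q1 := fun s' => ar s' a = store (ar s a) i (eval s e2))).
  exists (seta s a i (eval s e2)), 1%N; split => //; first exact: HSt.
  by rewrite /= /store eqxx.
by move=> s' f e'; exact: h.
Qed.

Lemma wp_if c1 c2 e s T Q : (0 < eval s e -> wp L c1 s T Q) ->
  (eval s e <= 0 -> wp L c2 s T Q) -> wp L (CIf e c1 c2) s T.+1 Q.
Proof.
move=> h1 h2; have [h|h] := lerP (eval s e) 0.
  by have [s' [n [x1 x2 x3]]] := h2 h; exists s', n.+1; split => //; exact: HIfF.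
by have [s' [n [x1 x2 x3]]] := h1 h; exists s', n.+1; split => //; exact: HIfT.
Qed.

(** The cost of a round may depend on its index. The sieve and the Mertens recursion are cheap only
    on average, through a harmonic sum. *)
Lemma wp_for_sum c e s n (t : nat -> nat) (I : nat -> state -> Prop) Q : I 0%N s ->
  (forall j s', (j < n)%N -> I j s' -> 0 < eval s' e /\ wp L c s' (t j) (I j.+1)) ->
  (forall s', I n s' -> eval s' e <= 0 /\ Q s') ->
  wp L (CWhile e c) s (\sum_(0 <= j < n) (t j).+1 + 1) Q.
Proof.
move=> I0 step final.
suff H d j s0 : (j + d = n)%N -> I j s0 ->
    wp L (CWhile e c) s0 (\sum_(j <= i < n) (t i).+1 + 1) Q.
  by apply: (H n 0%N) => //; rewrite add0n.
elim: d j s0 => [|d IH] j s0 jn Ij.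
  rewrite addn0 in jn; subst j; have [h q] := final _ Ij.
  by exists s0, 1%N; split => //; [exact: HWhileF|rewrite leq_addl].
have jn' : (j < n)%N by lia.
have [pe [s1 [n1 [x1 x2 x3]]]] := step _ _ jn' Ij.
have [|s2 [n2 [y1 y2 y3]]] := IH j.+1 s1 _ x3; first by rewrite addSnnS.
exists s2, (n1 + n2).+1; split => //; first exact: HWhileT x1 y1.
by rewrite big_ltn // -addnA; lia.
Qed.

Lemma wp_loop_sum c e s n (t : nat -> nat) (I : nat -> state -> Prop) Q : I 0%N s ->
  (forall j s', (j < n)%N -> frame (mods c) (amods c) s s' -> I j s' ->
     0 < eval s' e /\ wp L c s' (t j) (I j.+1)) ->
  (forall s', frame (mods c) (amods c) s s' -> I n s' -> eval s' e <= 0 /\ Q s') ->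
  wp L (CWhile e c) s (\sum_(0 <= j < n) (t j).+1 + 1) Q.
Proof.
move=> I0 step final.
apply: (@wp_for_sum _ _ _ _ _ (fun j s' => frame (mods c) (amods c) s s' /\ I j s')).
- by split.
- move=> j s' jn [f i]; have [h1 h2] := step j s' jn f i; split => //.
  apply: (wp_weaken h2) => s'' f' i'; split => //.
  by apply: (frame_sub (frame_trans f f')) => y; rewrite mem_cat orbb.
- by move=> s' [f i]; exact: final.
Qed.

Lemma wp_loop c e s n t (I : nat -> state -> Prop) Q : I 0%N s ->
  (forall j s', (j < n)%N -> frame (mods c) (amods c) s s' -> I j s' ->
     0 < eval s' e /\ wp L c s' t (I j.+1)) ->
  (forall s', frame (mods c) (amods c) s s' -> I n s' -> eval s' e <= 0 /\ Q s') ->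
  wp L (CWhile e c) s (n * t.+1 + 1) Q.
Proof.
move=> I0 step final; have := @wp_loop_sum c e s n (fun=> t) I Q I0 step final.
by rewrite sum_nat_const_nat subn0.
Qed.

End Rules.

(** Sizes in units of b bits. A product adds the units and a sum costs at most one more, so that
    every size condition becomes an inequality between numerals, which [sz_auto] settles by
    computation. *)
Definition sz (b e : nat) (z : int) : bool := bits (e * b) z.

Section Sizes.
Variable b : nat.
Hypothesis b0 : (0 < b)%N.

Lemma sz_le e e' z : sz b e z -> (e <= e')%N -> sz b e' z.
Proof. by move=> h ee; apply: bits_le h; rewrite leq_mul2r ee orbT. Qed.

Lemma sz_add e f x y : sz b e x -> sz b f y -> sz b (maxn e f).+1 (x + y).
Proof.
move=> hx hy; have := sz_le hx (leq_maxl e f); have := sz_le hy (leq_maxr e f).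
rewrite /sz /bits mulSn expnD; move: (2 ^ _)%N => X h1 h2.
have : (2 <= 2 ^ b)%N by rewrite -{1}(expn1 2) leq_exp2l.
have h : (absz (x + y)%R <= absz x + absz y)%N by lia.
by nia.
Qed.

Lemma sz_opp e x : sz b e x -> sz b e (- x).
Proof. by rewrite /sz bits_opp. Qed.

Lemma sz_mul e f x y : sz b e x -> sz b f y -> sz b (e + f) (x * y).
Proof.
rewrite /sz /bits abszM mulnDl expnD => hx hy.
exact: ltn_mul.
Qed.

Lemma sz_div e x y : sz b e x -> sz b e (x %/ y)%Z.
Proof.
rewrite /sz /bits => hx; apply: leq_ltn_trans hx.
have [->|y0] := eqVneq y 0; first by rewrite divz0.
have E := divz_eq x y; have := modz_ge0 x y0; have := ltz_mod x y0.
by nia.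
Qed.

Lemma sz_const e z : (absz z < 2 ^ e)%N -> sz b e z.
Proof. by rewrite /sz /bits => h; apply: (leq_trans h); rewrite leq_exp2l // leq_pmulr. Qed.

Lemma sz_abs e x y : sz b e x -> (`|y| <= `|x|)%R -> sz b e y.
Proof. by rewrite /sz /bits => h h'; apply: leq_ltn_trans h; lia. Qed.

Lemma sz_sum e f m n (F : nat -> int) : (n - m < 2 ^ (f * b))%N ->
  (forall i, (m <= i < n)%N -> sz b e (F i)) -> sz b (e + f) (\sum_(m <= i < n) F i).
Proof.
move=> hn hF; rewrite /sz /bits mulnDl expnD.
have h : (absz (\sum_(m <= i < n) F i)%R <= (n - m) * 2 ^ (e * b))%N.
  apply: leq_trans (absz_sum _ _ _) _; rewrite -sum_nat_const_nat !big_nat.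
  by apply: leq_sum => i hi; apply: ltnW; exact: hF.
by apply: leq_ltn_trans h _; rewrite mulnC ltn_pmul2l // expn_gt0.
Qed.

End Sizes.

Ltac sz_rec :=
  lazymatch goal with
  | |- is_true (sz _ _ (_ + _)) => eapply sz_add; [eassumption|sz_rec|sz_rec]
  | |- is_true (sz _ _ (- _)) => eapply sz_opp; sz_rec
  | |- is_true (sz _ _ (_ * _)) => eapply sz_mul; sz_rec
  | |- is_true (sz _ _ (divz _ _)) => eapply sz_div; sz_rec
  | |- is_true (sz _ _ 0) => apply: (@sz_const _ _ 1); [eassumption|done]
  | |- is_true (sz _ _ 1) => apply: (@sz_const _ _ 1); [eassumption|done]
  | |- is_true (sz _ _ 2) => apply: (@sz_const _ _ 2); [eassumption|done]
  | |- _ => eassumption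
  end.

Ltac sz_auto := eapply sz_le; [sz_rec | vm_compute; reflexivity].

(** Transports all known values of variables and arrays from the old state to the new one along the
    frame [F], and drops those that may have been overwritten. Only equations with the value on the
    right are recognized. *)
Ltac carry F :=
  match type of F with frame ?ms ?am ?s ?s' =>
    repeat match goal with
    | H : va s ?i = ?v |- _ =>
        first [ let H' := fresh "Htmp" in
                pose proof (frame_va F H (erefl true)) as H'; clear H; rename H' into H
              | clear H ]
    | H : ar s ?i = ?v |- _ =>
        first [ let H' := fresh "Htmp" in
                pose proof (frame_ar F H (erefl true)) as H'; clear H; rename H' into H
              | clear H ]
    end; clear F; try clear s
  end.

Ltac rwva := repeat match goal with
  | H : va ?s ?i = _ |- context [va ?s ?i] => rewrite H
  end.

(* Symbolic execution of the assignment at the head of a sequence; [v] is the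
   value assigned. *)
Tactic Notation "asn" constr(v) "as" ident(H) :=
  apply: (wp_asn (v := v)); [rewrite /=; rwva; try done | | let s' := fresh "s" in
    let F := fresh "F" in move=> s' F H; carry F].

Tactic Notation "asn" constr(v) := let H := fresh "V" in asn v as H.

Declare Scope cmd_scope.
Delimit Scope cmd_scope with cmd.
Notation "x [+] y" := (EB OpAdd x y) (at level 50, left associativity) : cmd_scope.
Notation "x [-] y" := (EB OpSub x y) (at level 50, left associativity) : cmd_scope.
Notation "x [*] y" := (EB OpMul x y) (at level 40, left associativity) : cmd_scope.
Notation "x [/] y" := (EB OpDiv x y) (at level 40, left associativity) : cmd_scope.
Notation "x ::= e" := (CAsn x e) (at level 60) : cmd_scope.
Notation "c ;; d" := (CSeq c d) (at level 65, right associativity) : cmd_scope.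

(** * The algorithm *)

(* Variables: 0 output, 1 bound D on the coordinates, 2 number of vertices,
   3 u ^ 6, 4 u ^ 3, 5 u, 7 loop index, 8 sum over the pieces and 9 weight of the
   origin for the current orientation, 10 common denominator, 11-17 current piece,
   18-28 lattice point count_cmd, 29-35 sum over multiples, 36-45 Mertens function,
   46-57 current vertex and its neighbours, 58-59 their indices, 60-63 scratch.
   Arrays: 0 input, 1 Moebius function and 2 Mertens function up to u ^ 6,
   3 Mertens function at the quotients of variable 36. *)
Definition fs_body : cmd := (
  26 ::= EV 22 [/] EV 21 ;; 22 ::= EV 22 [-] EV 26 [*] EV 21 ;;
  24 ::= EV 24 [+] EV 20 [*] (EV 20 [-] EC 1) [/] EC 2 [*] EV 26 ;;
  26 ::= EV 23 [/] EV 21 ;; 23 ::= EV 23 [-] EV 26 [*] EV 21 ;;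
  24 ::= EV 24 [+] EV 20 [*] EV 26 ;;
  25 ::= EV 22 [*] EV 20 [+] EV 23 ;; 20 ::= EV 25 [/] EV 21 ;;
  23 ::= EV 25 [-] EV 20 [*] EV 21 ;;
  26 ::= EV 21 ;; 21 ::= EV 22 ;; 22 ::= EV 26 ;; CSkip)%cmd.

Definition floor_sum_cmd : cmd := (24 ::= EC 0 ;; CWhile (EV 20) fs_body ;; CSkip)%cmd.

Section FloorSum.
Variable b : nat.
Hypothesis b0 : (0 < b)%N.
(** One bound for every value and address of the whole program; all sizes derived below stay under
    200 units. *)
Let L := (200 * b)%N.

Lemma fs_body_spec s n m a c r :
  va s 20 = n -> va s 21 = m -> va s 22 = a -> va s 23 = c -> va s 24 = r ->
  sz b 12 n -> sz b 30 m -> sz b 30 a -> sz b 40 c -> sz b 70 r ->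
  let y := (a %% m)%Z * n + (c %% m)%Z in
  wp L fs_body s 13 (fun s' => [/\ va s' 20 = (y %/ m)%Z, va s' 21 = (a %% m)%Z,
    va s' 22 = m, va s' 23 = (y %% m)%Z &
    va s' 24 = r + (n * (n - 1) %/ 2)%Z * (a %/ m)%Z + n * (c %/ m)%Z]).
Proof.
move=> h20 h21 h22 h23 h24 sn sm sa sc sr y.
eapply wp_time.
- rewrite /fs_body.
  asn (a %/ m)%Z; first by sz_auto.
  asn (a %% m)%Z; first by rewrite /modz; sz_auto.
  asn (r + (n * (n - 1) %/ 2)%Z * (a %/ m)%Z); first by sz_auto.
  asn (c %/ m)%Z; first by sz_auto.
  asn (c %% m)%Z; first by rewrite /modz; sz_auto.
  asn (r + (n * (n - 1) %/ 2)%Z * (a %/ m)%Z + n * (c %/ m)%Z); first by sz_auto.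
  asn y; first by rewrite /y /modz; sz_auto.
  asn (y %/ m)%Z; first by rewrite /y /modz; sz_auto.
  asn (y %% m)%Z; first by rewrite /y /modz; sz_auto.
  asn m; first by sz_auto.
  asn (a %% m)%Z; first by rewrite /modz; sz_auto.
  asn m; first by sz_auto.
  exact: wp_skip.
- done.
Qed.

Lemma floor_sum0 m a c : floor_sum 0 m a c = 0.
Proof. by rewrite /floor_sum big_geq. Qed.

(* The product [m * (a %% m)] halves at each step. *)
Lemma fs_loop_spec e s (n : nat) m a c r :
  va s 20 = Posz n -> va s 21 = m -> va s 22 = a -> va s 23 = c -> va s 24 = r ->
  sz b 12 n -> sz b 30 m -> sz b 30 a -> sz b 40 c -> 0 < m ->
  m * (a %% m)%Z < Posz (2 ^ e) ->
  (absz r + e.+1 * 2 ^ (58 * b) <= 2 ^ (70 * b))%N ->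
  wp L (CWhile (EV 20) fs_body) s (e.+1 * 14 + 1) (fun s' => va s' 24 = r + floor_sum n m a c /\ sz b 70 (va s' 24)).
Proof.
elim/ltn_ind: e s n m a c r => e IH s n m a c r h20 h21 h22 h23 h24 sn sm sa sc m0 hP hr.
have sr : sz b 70 r.
  rewrite /sz /bits; apply: leq_trans hr; rewrite -addn1 leq_add2l.
  by rewrite muln_gt0 expn_gt0.
case: n h20 sn => [|n] h20 sn.
  by exists s, 1%N; split; [apply: HWhileF; rewrite /= h20|lia|rewrite floor_sum0 addr0 h24; split].
have m1 : m != 0 by rewrite gt_eqF.
have [s1 [n1 [x1 t1 [g20 g21 g22 g23 g24]]]] := fs_body_spec h20 h21 h22 h23 h24 sn sm sa sc sr.
set y := _ + _ in g20 g23.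
have /andP[a0 am] : 0 <= (a %% m)%Z < m by rewrite modz_ge0 //= ltz_pmod.
have /andP[c0 cm] : 0 <= (c %% m)%Z < m by rewrite modz_ge0 //= ltz_pmod.
have y0 : 0 <= y by rewrite addr_ge0 // mulr_ge0.
have q0 : 0 <= (y %/ m)%Z by rewrite divz_ge0.
pose inc := (Posz n.+1 * (Posz n.+1 - 1) %/ 2)%Z * (a %/ m)%Z + Posz n.+1 * (c %/ m)%Z.
have fE : floor_sum n.+1 m a c = inc + floor_sum `|(y %/ m)%Z| (a %% m)%Z m (y %% m)%Z.
  by rewrite floor_sum_reduce // floor_sum_swap // ?a0 ?c0.
(* One round adds less than 2^(58 b) to the accumulator; the hypothesis on [r] leaves room below
   2^(70 b) for all e + 1 rounds. *)
have inc36 : sz b 58 inc by rewrite /inc; sz_auto.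
have [n' n'E] : exists n' : nat, (y %/ m)%Z = Posz n' by exists `|(y %/ m)%Z|%N; rewrite gez0_abs.
rewrite n'E absz_nat in fE; rewrite n'E in g20.
have hn' : (n' <= n.+1)%N.
  have : (y %/ m)%Z < Posz n.+2.
    rewrite ltz_divLR // /y; have : (a %% m)%Z * Posz n.+1 <= m * Posz n.+1 by rewrite ler_wpM2r // ltW.
    have -> : Posz n.+2 * m = m * Posz n.+1 + m by rewrite [Posz n.+2]intS; ring.
    by move=> h; apply: ler_ltD.
  by rewrite n'E ltz_nat.
rewrite fE addrA.
suff : wp L (CWhile (EV 20) fs_body) s1 (e * 14 + 1)
    (fun s' => va s' 24 = r + inc + floor_sum n' (a %% m)%Z m (y %% m)%Z /\ sz b 70 (va s' 24)).
  move=> [s2 [n2 [x2 t2 q2]]]; exists s2, (n1 + n2).+1; split => //.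
  - by apply: HWhileT x1 x2; rewrite /= h20.
  - by clear -t1 t2; lia.
have r24 : va s1 24 = r + inc by rewrite g24 /inc addrA.
case: n' n'E fE g20 hn' => [|n'] n'E fE g20 hn'.
  exists s1, 1%N; split; [by apply: HWhileF; rewrite /= g20|by rewrite addn1|].
  rewrite floor_sum0 addr0 r24; split => //.
  rewrite /sz /bits; apply: leq_trans hr; rewrite mulSn.
  have i1 : (absz inc < 2 ^ (58 * b))%N := inc36.
  by clear -i1; lia.
have ap : 0 < (a %% m)%Z.
  rewrite lt_neqAle a0 andbT; apply/eqP => a00; move: n'E.
  rewrite /y -a00 mul0r add0r divz_small //; apply/andP; split=> //.
  by clear -m0 cm; lia.
have P0 : 0 < m * (a %% m)%Z by rewrite mulr_gt0.
case: e IH hP hr => [|e] IH hP hr; first by move: hP; rewrite expn0; clear -P0; lia.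
apply: (IH e) => //.
- by apply: (sz_abs b0 sn); clear -hn'; lia.
- by apply: (sz_abs b0 sm); clear -ap am; lia.
- have /andP[y1 y2] : 0 <= (y %% m)%Z < m by rewrite modz_ge0 //= ltz_pmod.
  apply: (sz_le (e := 30)) => //; apply: (sz_abs b0 sm); clear -y1 y2; lia.
- have r0 := modz_ge0 m (lt0r_neq0 ap); have r1 := ltz_pmod m ap.
  have E := divz_eq m (a %% m)%Z.
  move: hP; rewrite expnS PoszM => hP.
  move: ap am E r0 r1 hP; move: (m %/ (a %% m)%Z)%Z (m %% (a %% m)%Z)%Z => k r'.
  move: (a %% m)%Z => a' ap am E r0 r1 hP.
  clear - ap am E r0 r1 hP.
  have k1 : 1 <= k by nia.
  have h2 : 2 * r' < m by nia.
  have h3 : a' * (2 * r') < a' * m by rewrite ltr_pM2l.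
  by move: (Posz (2 ^ e)) hP h3 => X; rewrite mulrCA [m * a']mulrC; move: (a' * r') (a' * m); lia.
- apply: leq_trans hr; rewrite [X in (_ <= _ + X)%N]mulSn addnA leq_add2r.
  move: inc36; rewrite /sz /bits; clear; lia.
Qed.

Lemma fs_spec s (n : nat) m a c :
  va s 20 = Posz n -> va s 21 = m -> va s 22 = a -> va s 23 = c ->
  sz b 12 n -> sz b 30 m -> sz b 30 a -> sz b 40 c -> 0 < m ->
  wp L floor_sum_cmd s (860 * b) (fun s' => va s' 24 = floor_sum n m a c /\ sz b 70 (va s' 24)).
Proof.
move=> h20 h21 h22 h23 sn sm sa sc m0.
eapply wp_time.
- rewrite /floor_sum_cmd; asn (0 : int); first by sz_auto.
  apply: wp_call; last by move=> s' _ q; apply: wp_skip; exact: q.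
  apply: (wp_weaken (Q := fun s' => va s' 24 = 0 + floor_sum n m a c /\ sz b 70 (va s' 24)));
    last by move=> s' _; rewrite add0r.
  (* Both m and its residue stay below 2^(30 b), hence 60 b halvings of their product suffice. *)
  apply: (@fs_loop_spec (60 * b)) => //.
  + have h1 := ltz_pmod a m0; have h2 := modz_ge0 a (lt0r_neq0 m0).
    have : (absz m < 2 ^ (30 * b))%N by [].
    have -> : (60 * b = 30 * b + 30 * b)%N by lia.
    rewrite expnD PoszM; move: (2 ^ (30 * b))%N => X hX; nia.
  + rewrite add0n.
    have h : (forall n, n < 2 ^ n)%N by move=> n0; exact: ltn_expl.
    have hb := h b; apply: (@leq_trans (2 ^ (7 * b) * 2 ^ b * 2 ^ (58 * b))); last first.
      by rewrite -!expnD leq_exp2l //; lia.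
    rewrite leq_mul2r; apply/orP; right.
    have : (2 ^ 7 <= 2 ^ (7 * b))%N by rewrite leq_exp2l //; lia.
    by rewrite [(2 ^ 7)%N]/=; move: (2 ^ b)%N (2 ^ (7 * b))%N hb => A B; nia.
- by nia.
Qed.

Definition count_cmd : cmd := (
  27 ::= EC 0 [-] (EC 0 [-] EV 12) [/] EV 18 ;; 28 ::= EV 13 [/] EV 18 ;;
  20 ::= EV 28 [-] EV 27 [+] EC 1 ;;
  CIf (EV 20)
    (28 ::= EV 20 ;; 21 ::= EV 18 [*] EV 15 ;; 22 ::= EV 16 [*] EV 18 ;;
     23 ::= EV 17 [+] EV 16 [*] EV 18 [*] EV 27 ;; floor_sum_cmd ;;
     19 ::= EV 24 [+] EV 28 [*] (EC 1 [+] (EC 0 [-] EV 14) [/] EV 18) ;; CSkip)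
    (19 ::= EC 0 ;; CSkip) ;;
  CSkip)%cmd.

(** Counts the points of the lattice g Z^2 with X0 <= x <= X1, Y0 <= y and w y - h x <= c, column by
    column: in column g x the multiples of g end at the floor of (c + h g x) / (g w) and start at
    the ceiling of Y0 / g. Ceilings are written as 0 - ((0 - X) / g). A column whose top lies too
    low would count negatively. *)
Definition count_points (g X0 X1 Y0 w h c : int) : int :=
  let x0 := 0 - ((0 - X0) %/ g)%Z in
  let n := (X1 %/ g)%Z - x0 + 1 in
  if 0 < n then
    floor_sum `|n| (g * w) (h * g) (c + h * g * x0) + n * (1 + ((0 - Y0) %/ g)%Z)
  else 0.

Lemma count_spec s g X0 X1 Y0 w h c :
  va s 12 = X0 -> va s 13 = X1 -> va s 14 = Y0 -> va s 15 = w -> va s 16 = h ->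
  va s 17 = c -> va s 18 = g ->
  sz b 8 X0 -> sz b 8 X1 -> sz b 9 Y0 -> sz b 8 w -> sz b 8 h -> sz b 17 c ->
  sz b 18 g -> 0 < g -> 0 < w ->
  wp L count_cmd s (880 * b) (fun s' => va s' 19 = count_points g X0 X1 Y0 w h c /\
    sz b 72 (va s' 19)).
Proof.
move=> h12 h13 h14 h15 h16 h17 h18 s12 s13 s14 s15 s16 s17 s18 g0 w0.
eapply wp_time.
- rewrite /count_cmd.
  pose x0 := 0 - ((0 - X0) %/ g)%Z; pose n := (X1 %/ g)%Z - x0 + 1.
  have sx0 : sz b 10 x0 by rewrite /x0; sz_auto.
  have sn : sz b 12 n by rewrite /n; sz_auto.
  asn x0; first by sz_auto.
  asn (X1 %/ g)%Z; first by sz_auto.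
  asn n; first by sz_auto.
  eapply wp_call; last by move=> s' _ q; apply: wp_skip; exact: q.
  apply: (wp_if (T := (860 * b + 6)%N)); rewrite /=; rwva => hn.
  + eapply wp_time.
      asn n; first by sz_auto.
      asn (g * w); first by sz_auto.
      asn (h * g); first by sz_auto.
      asn (c + h * g * x0); first by sz_auto.
      eapply wp_call.
        apply: (@fs_spec _ `|n|%N); try eassumption; try by sz_auto.
        * by rewrite gtz0_abs.
        
        * by rewrite mulr_gt0.
      move=> s' F [r1 r2]; carry F.
      rewrite r1 in r2.
      asn (floor_sum `|n| (g * w) (h * g) (c + h * g * x0) + n * (1 + ((0 - Y0) %/ g)%Z)) as R;
        first by sz_auto.
      apply: wp_skip; rewrite R /count_points -/x0 -/n hn; split => //.
      by sz_auto.
    by clear -b0; lia.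
  + eapply wp_time.
      asn (0 : int) as R; first by sz_auto.
      apply: wp_skip; rewrite R /count_points -/x0 -/n ltNge hn; split => //.
      by sz_auto.
    by clear -b0; lia.
- by clear -b0; lia.
Qed.

End FloorSum.

(* The quotients [n = x / j] are treated in the order of decreasing [j]. In the
   recursion for [M(n)], the terms [M(n / d)] with [n / d <= u ^ 3] are grouped by
   the value [q] of [n / d]; any other [n / d] is either within the range of the
   table or the quotient of [x] by [j * d], treated before. *)
Definition mert_q : cmd := (
  CLd 45 2 (EV 40) ;;
  44 ::= EV 44 [-] EV 45 [*] (EV 39 [/] EV 40 [-] EV 39 [/] (EV 40 [+] EC 1)) ;;
  40 ::= EV 40 [+] EC 1 ;; CSkip)%cmd.

Definition mert_d : cmd := (
  43 ::= EV 39 [/] EV 42 ;;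
  CIf (EV 43 [-] EV 3) (CLd 45 3 (EV 38 [*] EV 42) ;; CSkip) (CLd 45 2 (EV 43) ;; CSkip) ;;
  44 ::= EV 44 [-] EV 45 ;; 42 ::= EV 42 [+] EC 1 ;; CSkip)%cmd.

Definition mert_j : cmd := (
  39 ::= EV 36 [/] EV 38 ;; 44 ::= EC 1 ;; 40 ::= EC 1 ;;
  CWhile (EV 4 [+] EC 1 [-] EV 40) mert_q ;;
  41 ::= EV 39 [/] (EV 4 [+] EC 1) ;; 42 ::= EC 2 ;;
  CWhile (EV 41 [+] EC 1 [-] EV 42) mert_d ;;
  CSt 3 (EV 38) (EV 44) ;; 38 ::= EV 38 [-] EC 1 ;; CSkip)%cmd.

Definition mertens_cmd : cmd := (
  38 ::= EV 36 [/] (EV 3 [+] EC 1) ;;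
  CIf (EV 38) (CWhile (EV 38) mert_j ;; 37 ::= EV 44 ;; CSkip) (CLd 37 2 (EV 36) ;; CSkip) ;;
  CSkip)%cmd.

Lemma addz1 (n : nat) : Posz n + 1 = Posz n.+1.
Proof. by rewrite -[_ + 1]/(Posz (n + 1)) addn1. Qed.

Section Mertens.
Variable b : nat.
Hypothesis b0 : (0 < b)%N.
Let L := (200 * b)%N.

Lemma sz_natE e (n : nat) : sz b e (Posz n) = (n < 2 ^ (e * b))%N.
Proof. by []. Qed.

Lemma sz_nat_le e (m n : nat) : sz b e (Posz n) -> (m <= n)%N -> sz b e (Posz m).
Proof. by rewrite !sz_natE => h1 h2; exact: leq_ltn_trans h1. Qed.

Lemma sz_mertens e n : sz b e (Posz n) -> sz b (e * 3) (mertens n).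
Proof.
rewrite sz_natE /sz /bits => h; apply: leq_ltn_trans (mertens_bound n) _.
by rewrite mulnAC expnM ltn_exp2r.
Qed.

Lemma sz_mu e n : sz b e (Posz n) -> sz b (e * 2) (mu n).
Proof.
rewrite sz_natE /sz /bits => h; apply: leq_ltn_trans (mu_bound n) _.
by rewrite mulnAC expnM ltn_exp2r.
Qed.

(** These are u^6 and u^3 in the end. D gets 2 units, hence u as well, and Y gets 12. *)
Variables (Y K : nat).
Hypothesis K0 : (0 < K)%N.
Hypothesis KY : (K <= Y)%N.
Hypothesis sY : sz b 12 (Posz Y).

Definition partial_q (n j : nat) : int :=
  1 - \sum_(1 <= q < j.+1) mertens q * (Posz (n %/ q) - Posz (n %/ q.+1)).

Lemma sz_partial_q n j : sz b 2 (Posz n) -> sz b 12 (Posz j) -> sz b 55 (partial_q n j).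
Proof.
move=> hn hj; have h : sz b 52 (\sum_(1 <= q < j.+1) mertens q * (Posz (n %/ q) - Posz (n %/ q.+1))).
  apply: (@sz_sum b 40 12); first by rewrite subn1.
  move=> q /andP[q1 q2]; have sq := sz_mertens (sz_nat_le hj q2).
  have s1 : sz b 2 (Posz (n %/ q)) by apply: sz_nat_le hn _; exact: leq_div.
  have s2 : sz b 2 (Posz (n %/ q.+1)) by apply: sz_nat_le hn _; exact: leq_div.
  by sz_auto.
by rewrite /partial_q; sz_auto.
Qed.

Lemma mert_q_loop s n : va s 39 = Posz n -> va s 44 = 1 -> va s 40 = 1 -> va s 4 = Posz K ->
  sz b 2 (Posz n) -> (forall i, (i <= Y)%N -> ar s 2 i = mertens i) ->
  wp L (CWhile (EV 4 [+] EC 1 [-] EV 40)%cmd mert_q) s (K * 5 + 1)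
    (fun s' => va s' 44 = partial_q n K).
Proof.
move=> h39 h44 h40 h4 sn hM.
have sK : sz b 12 (Posz K) := sz_nat_le sY KY.
apply: (wp_loop (t := 4) (I := fun j s' => va s' 44 = partial_q n j /\ va s' 40 = Posz j.+1)).
- by rewrite h44 h40 /partial_q big_geq // subr0.
- move=> j s' jK F [g44 g40]; rewrite /=.
  have A2 : ar s' 2 = ar s 2 by exact: (frame_ar F erefl).
  carry F; rewrite -/(ar s 2) in A2; rwva; split; first by lia.
  have sj : sz b 12 (Posz j) by apply: sz_nat_le sY _; lia.
  have sj1 : sz b 12 (Posz j.+1) by apply: sz_nat_le sY _; lia.
  have sj2 : sz b 13 (Posz j.+2).
    have -> : Posz j.+2 = Posz j + 2 by lia.
    by sz_auto.
  have sM := sz_mertens sj1; have sp := sz_partial_q sn sj; have sp1 := sz_partial_q sn sj1.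
  eapply wp_time.
    rewrite /mert_q; apply: (wp_ld (i := j.+1) (v := mertens j.+1)).
    + by rewrite /= g40.
    + by apply: (bits_le _ sj1); rewrite leq_mul2r orbT.
    + by rewrite A2 hM // (leq_trans jK).
    clear A2; move=> s1 F g45; carry F.
    asn (partial_q n j.+1) as R.
      rewrite [in RHS]/partial_q big_nat_recr //= /partial_q -[Posz j.+1 + 1]/(Posz (j.+1 + 1)) addn1 !divz_nat.
      by ring.
      by sz_auto.
    asn (Posz j.+2) as R2; [exact: addz1|by sz_auto|].
    by apply: wp_skip; rewrite R R2.
  by [].
- move=> s' F [g44 g40]; carry F; rewrite /=; rwva; split => //.
  by lia.
Qed.

Definition partial_d (n j : nat) : int :=
  partial_q n K - \sum_(2 <= d < j.+2) mertens (n %/ d).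

Lemma sz_partial_d n j : sz b 2 (Posz n) -> sz b 12 (Posz j) -> sz b 57 (partial_d n j).
Proof.
move=> hn hj; have h : sz b 18 (\sum_(2 <= d < j.+2) mertens (n %/ d)).
  apply: (@sz_sum b 6 12); first by rewrite -[j.+2]addn2 addnK.
  move=> d _; apply: (@sz_mertens 2); apply: sz_nat_le hn _; exact: leq_div.
have sK : sz b 12 (Posz K) := sz_nat_le sY KY.
have hq := sz_partial_q hn sK.
by rewrite /partial_d; sz_auto.
Qed.

Lemma mert_d_loop s x j n : va s 39 = Posz n -> va s 44 = partial_q n K -> va s 42 = 2 ->
  va s 41 = Posz (n %/ K.+1) -> va s 38 = Posz j -> va s 3 = Posz Y ->
  sz b 2 (Posz x) -> (0 < j)%N -> n = (x %/ j)%N -> (Y < n)%N ->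
  (forall i, (i <= Y)%N -> ar s 2 i = mertens i) ->
  (forall i, (j < i <= x %/ Y.+1)%N -> ar s 3 i = mertens (x %/ i)) ->
  wp L (CWhile (EV 41 [+] EC 1 [-] EV 42)%cmd mert_d) s ((n %/ K.+1).-1 * 9 + 1)
    (fun s' => va s' 44 = mertens n).
Proof.
move=> h39 h44 h42 h41 h38 h3 sx j0 nE Yn hM hB.
have sn : sz b 2 (Posz n) by apply: sz_nat_le sx _; rewrite nE leq_div.
have E0 : (0 < n %/ K.+1)%N by rewrite divn_gt0 //; lia.
have nK : (n %/ K.+1 <= n)%N by exact: leq_div.
apply: (wp_loop (t := 8) (I := fun i s' => va s' 44 = partial_d n i /\ va s' 42 = Posz i.+2)).
- by rewrite h44 h42 /partial_d big_geq // subr0.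
- move=> i s' iE F [g44 g42]; rewrite /=.
  have A2 : ar s' 2 = ar s 2 by exact: (frame_ar F erefl).
  have A3 : ar s' 3 = ar s 3 by exact: (frame_ar F erefl).
  carry F; rwva; split; first by lia.
  have si : sz b 2 (Posz i) by apply: sz_nat_le sn _; lia.
  have si1 : sz b 2 (Posz i.+1) by apply: sz_nat_le sn _; lia.
  have si2 : sz b 2 (Posz i.+2) by apply: sz_nat_le sn _; lia.
  have si3 : sz b 3 (Posz i.+3) by (have -> : Posz i.+3 = Posz i.+2 + 1 by lia); sz_auto.
  have st : sz b 2 (Posz (n %/ i.+2)) by apply: sz_nat_le sn _; exact: leq_div.
  have sp1 : sz b 57 (partial_d n i.+1) by apply: sz_partial_d => //; exact: (sz_le si1).
  pose t := (n %/ i.+2)%N.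
  have tE : t = (x %/ (j * i.+2))%N by rewrite /t nE divnMA.
  eapply wp_time.
    rewrite /mert_d; asn (Posz t) as V43; [by rewrite /= divz_nat|by apply: (bits_le _ st); rewrite leq_mul2r orbT|].
    eapply (wp_call (Q1 := fun s' => va s' 45 = mertens t)).
      apply: (wp_if (T := 2)); rewrite /=; rwva => ht.
      + have tY : (Y < t)%N by rewrite subr_gt0 ltz_nat in ht.
        (* With d = i + 2, the quotient of x by j d exceeds Y exactly when j d <= x / (Y + 1). As d
           >= 2, the index j d is larger than j, so this entry of array 3 is already filled. *)
        have jJ : (j * i.+2 <= x %/ Y.+1)%N.
          by rewrite leq_divRL // mulnC -leq_divRL ?muln_gt0 ?j0 // -tE.
        apply: (wp_ld (i := (j * i.+2)%N) (v := mertens t)).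
        * by rewrite /=; rwva.
        * have jx : (j * i.+2 <= x)%N := leq_trans jJ (leq_div _ _).
          by apply: (bits_le _ (sz_nat_le sx jx)); rewrite leq_mul2r orbT.
        * by rewrite A3 hB -?tE // jJ andbT -{1}[j]muln1 ltn_mul2l j0.
        by move=> s1 F h45; apply: wp_skip.
      + have tY : (t <= Y)%N by rewrite subr_le0 lez_nat in ht.
        apply: (wp_ld (i := t) (v := mertens t)).
        * by rewrite /=; rwva.
        * by apply: (bits_le _ st); rewrite leq_mul2r orbT.
        * by rewrite A2 hM.
        by move=> s1 F h45; apply: wp_skip.
    move=> s1 F /= h45; carry F.
    asn (partial_d n i.+1) as R.
      rewrite [in RHS]/partial_d big_nat_recr //= /partial_d -/t.
      by ring.
      by sz_auto.
    asn (Posz i.+3) as R2; [exact: addz1|by sz_auto|].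
    by apply: wp_skip; rewrite R R2.
  by [].
- move=> s' F [g44 g42]; carry F; rewrite /=; rwva; split; first by lia.
  rewrite /partial_d /partial_q prednK // -mertens_rec //; lia.
Qed.

Definition mert_time (x : nat) : nat :=
  let J := (x %/ Y.+1)%N in
  (\sum_(0 <= i < J) (K * 5 + (x %/ (J - i) %/ K.+1) * 9 + 20).+1 + 10)%N.

Lemma mert_j_spec s x j : va s 36 = Posz x -> va s 38 = Posz j -> va s 3 = Posz Y ->
  va s 4 = Posz K -> sz b 2 (Posz x) -> (0 < j)%N -> (j <= x %/ Y.+1)%N ->
  (forall i, (i <= Y)%N -> ar s 2 i = mertens i) ->
  (forall i, (j < i <= x %/ Y.+1)%N -> ar s 3 i = mertens (x %/ i)) ->
  wp L mert_j s (K * 5 + (x %/ j %/ K.+1) * 9 + 20)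
    (fun s' => [/\ va s' 38 = Posz j.-1, va s' 44 = mertens (x %/ j) &
      ar s' 3 = store (ar s 3) j (mertens (x %/ j))]).
Proof.
move=> h36 h38 h3 h4 sx j0 jJ hM hB.
(* The contents of the arrays get names of their own, so that [carry] transports an equation
   [ar s 2 = M] while the facts about [M] do not mention the state. *)
have A2 : ar s 2 = ar s 2 by []. have A3 : ar s 3 = ar s 3 by [].
move: {-1}(ar s 2) A2 hM => M A2 hM. move: {-1}(ar s 3) A3 hB => B A3 hB.
pose n := (x %/ j)%N.
have sn : sz b 2 (Posz n) by apply: sz_nat_le sx _; exact: leq_div.
have sj : sz b 2 (Posz j) by apply: sz_nat_le sx _; apply: leq_trans jJ (leq_div _ _).
have sK : sz b 12 (Posz K) := sz_nat_le sY KY.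
have Yn : (Y < n)%N by rewrite /n leq_divRL // mulnC -leq_divRL.
have se : sz b 2 (Posz (n %/ K.+1)) by apply: sz_nat_le sn _; exact: leq_div.
have sMn : sz b 6 (mertens n) := sz_mertens sn.
eapply wp_time.
  rewrite /mert_j.
  asn (Posz n); [by rewrite /n divz_nat|by sz_auto|].
  asn (1 : int); first by sz_auto.
  asn (1 : int); first by sz_auto.
  eapply wp_call.
    apply: (@mert_q_loop _ n); try eassumption; try done.
    by move=> i hi; rewrite A2 hM.
  move=> s1 F /= V44; carry F.
  asn (Posz (n %/ K.+1)); [by rewrite addz1 divz_nat|by sz_auto|].
  asn (2 : int); first by sz_auto.
  eapply wp_call.
    apply: (@mert_d_loop _ x j n); try eassumption; try done.
    - by move=> i hi; rewrite A2 hM.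
    - by move=> i hi; rewrite A3 hB.
  move=> s2 F /= V44'; carry F.
  apply: (wp_st (i := j) (v := mertens n) (A := B)).
  - by rewrite /=; rwva.
  - by sz_auto.
  - by rewrite /=; rwva.
  - by sz_auto.
  - exact: A3.
  clear A3; move=> s3 F A3; carry F.
  asn (Posz j.-1); [by rewrite -{1}(prednK j0) -addz1 addrK|by apply: (bits_le _ (sz_nat_le sj (leq_pred j))); rewrite leq_mul2r orbT|].
  by apply: wp_skip; split.
have e1 := leq_pred (n %/ K.+1); rewrite -/n; move: (n %/ K.+1)%N (n %/ K.+1).-1 e1 => E E1 e1.
by clear -e1; lia.
Qed.

Lemma mert_spec s x : va s 36 = Posz x -> va s 3 = Posz Y -> va s 4 = Posz K ->
  sz b 2 (Posz x) -> (forall i, (i <= Y)%N -> ar s 2 i = mertens i) ->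
  wp L mertens_cmd s (mert_time x) (fun s' => va s' 37 = mertens x).
Proof.
move=> h36 h3 h4 sx hM; pose J := (x %/ Y.+1)%N.
have A2 : ar s 2 = ar s 2 by []. move: {-1}(ar s 2) A2 hM => M A2 hM.
have sJ : sz b 2 (Posz J) by apply: sz_nat_le sx _; exact: leq_div.
have sMx : sz b 6 (mertens x) := sz_mertens sx.
eapply wp_time.
  rewrite /mertens_cmd; asn (Posz J); [by rewrite addz1 divz_nat|by sz_auto|].
  eapply wp_call; last by move=> s' _ q; apply: wp_skip; exact: q.
  apply: (wp_if (T := (\sum_(0 <= i < J) (K * 5 + (x %/ (J - i) %/ K.+1) * 9 + 20).+1 + 1 + 3)%N)); rewrite /=; rwva => hJ.
  - have J0 : (0 < J)%N by [].
    eapply wp_time.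
      eapply (wp_call (Q1 := fun s' => va s' 44 = mertens x)).
        apply: (wp_loop_sum (n := J) (t := fun i => (K * 5 + (x %/ (J - i) %/ K.+1) * 9 + 20)%N)
          (I := fun i s' => [/\ va s' 38 = Posz (J - i),
            (0 < i)%N -> va s' 44 = mertens (x %/ (J - i).+1) &
            forall i', (J - i < i' <= J)%N -> ar s' 3 i' = mertens (x %/ i')])).
        + by rewrite V subn0; split => // i'; rewrite ltnNge => /andP[/negP].
        + move=> i s' iJ F [g38 g44 g3]; carry F; rewrite /=; rwva; split; first by rewrite ltz_nat subn_gt0.
          apply: wp_weaken.
            apply: (@mert_j_spec _ x (J - i)); try eassumption.
            * by rewrite subn_gt0.
            * exact: leq_subr.
            * by move=> i' hi; rewrite A2 hM.
          move=> s1 _ [k38 k44 k3]; have e : (J - i.+1 = (J - i).-1)%N by rewrite subnS.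
          have Ji : (0 < J - i)%N by rewrite subn_gt0.
          split; rewrite ?e ?prednK // => i' /andP[h1 h2].
          rewrite k3 /store; case: eqP => [-> //|ne].
          by apply: g3; rewrite h2 andbT; move: h1 ne; clear; lia.
        (* The last round treats j = 1, where the quotient is x itself. *)
        + move=> s' F [g38 g44 _]; rewrite /= g38 subnn; split=> //.
          by rewrite g44 // subnn divn1.
      move=> s1 F /= V44; carry F.
      asn (mertens x); first by sz_auto.
      by apply: wp_skip.
    by rewrite -!addnA leq_add2l.
  - have xY : (x <= Y)%N.
      by move: hJ; rewrite lez_nat leqn0 /J -leqn0 leqNgt divn_gt0 // -leqNgt.
    eapply wp_time.
      apply: (wp_ld (i := x) (v := mertens x)).
      + by rewrite /=; rwva.
      + by sz_auto.
      + by rewrite A2 hM.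
      by move=> s1 F V37; apply: wp_skip.
    by clear; lia.
by rewrite /mert_time -/J; clear; lia.
Qed.

End Mertens.

(** * Tables of the Moebius and Mertens functions *)

Definition sieve_j : cmd := (
  CLd 62 1 (EV 61) ;; CSt 1 (EV 61) (EV 62 [-] EV 60) ;; 61 ::= EV 61 [+] EV 7 ;; CSkip)%cmd.

Definition sieve_i : cmd := (
  CLd 60 1 (EV 7) ;; 61 ::= EV 7 [+] EV 7 ;; CWhile (EV 3 [+] EC 1 [-] EV 61) sieve_j ;;
  7 ::= EV 7 [+] EC 1 ;; CSkip)%cmd.

(** Starts from zeros with a 1 at index 1. When index i is reached, its entry is final, since all
    smaller divisors have been processed; it is then subtracted from all proper multiples of i. *)
Definition sieve_cmd : cmd := (
  CSt 1 (EC 1) (EC 1) ;; 7 ::= EC 1 ;; CWhile (EV 3 [+] EC 1 [-] EV 7) sieve_i ;; CSkip)%cmd.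

Definition prefix_i : cmd := (
  CLd 61 1 (EV 7) ;; 60 ::= EV 60 [+] EV 61 ;; CSt 2 (EV 7) (EV 60) ;;
  7 ::= EV 7 [+] EC 1 ;; CSkip)%cmd.

Definition prefix_cmd : cmd := (
  7 ::= EC 1 ;; 60 ::= EC 0 ;; CWhile (EV 3 [+] EC 1 [-] EV 7) prefix_i ;; CSkip)%cmd.

Section Sieve.
Variables b Y : nat.
Hypothesis b0 : (0 < b)%N.
Let L := (200 * b)%N.
Hypothesis Y0 : (0 < Y)%N.
Hypothesis sY : sz b 12 (Posz Y).

(* The table after the multiples of [1 .. i] have been updated. *)
Definition partial_mu (i j : nat) : int :=
  ind (j == 1)%N - \sum_(1 <= d < i.+1) ind ((d %| j) && (d < j))%N * mu d.

Lemma partial_muS i j : partial_mu i.+1 j =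
  partial_mu i j - ind ((i.+1 %| j) && (i.+1 < j))%N * mu i.+1.
Proof. by rewrite /partial_mu big_nat_recr //=; ring. Qed.

Lemma partial_mu_mu i j : (0 < j <= i.+1)%N -> partial_mu i j = mu j.
Proof.
move=> /andP[j0 ji]; rewrite muE // /partial_mu (big_cat_nat (n := j)) //=.
rewrite [\sum_(j <= _ < _) _]big1_seq ?addr0.
  by congr (_ - _); apply: eq_big_nat => d /andP[_ h]; rewrite h andbT.
by move=> d; rewrite mem_index_iota => /andP[_ /andP[h _]]; rewrite ltnNge h andbF mul0r.
Qed.

Lemma sz_ind e (c : bool) z : sz b e z -> sz b e (ind c * z).
Proof. by case: c; rewrite ?mul1r // mul0r => _; rewrite /sz /bits expn_gt0. Qed.

Lemma sz_partial_mu i j : (i <= Y)%N -> sz b 38 (partial_mu i j).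
Proof.
move=> iY; have h : sz b 36 (\sum_(1 <= d < i.+1) ind ((d %| j) && (d < j))%N * mu d).
  apply: (@sz_sum b 24 12); first by rewrite subn1; apply: leq_ltn_trans sY.
  move=> d /andP[_ di]; apply: sz_ind; apply: (@sz_mu b 12); apply: sz_nat_le sY _.
  by apply: leq_trans iY.
have h1 : sz b 1 (ind (j == 1)%N) by apply: (sz_const b0); case: eqP.
by rewrite /partial_mu; sz_auto.
Qed.

Lemma sieve_j_loop s i : (i < Y)%N -> va s 3 = Posz Y -> va s 7 = Posz i.+1 -> va s 60 = mu i.+1 ->
  va s 61 = Posz (2 * i.+1) -> (forall j, (0 < j <= Y)%N -> ar s 1 j = partial_mu i j) ->
  wp L (CWhile (EV 3 [+] EC 1 [-] EV 61)%cmd sieve_j) s ((Y %/ i.+1).-1 * 5 + 1)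
    (fun s' => forall j, (0 < j <= Y)%N -> ar s' 1 j = partial_mu i.+1 j).
Proof.
move=> iY h3 h7 h60 h61 h1.
pose F1 (t j : nat) := partial_mu i j - ind [&& i.+1 %| j, i.+1 < j & j <= t.+1 * i.+1]%N * mu i.+1.
have Yi : (0 < Y %/ i.+1)%N by rewrite divn_gt0.
have si : sz b 12 (Posz i.+1) := sz_nat_le sY iY.
have sm : sz b 24 (mu i.+1) := @sz_mu b 12 _ si.
apply: (wp_loop (t := 4) (I := fun t s' => va s' 61 = Posz (t.+2 * i.+1) /\
  forall j, (0 < j <= Y)%N -> ar s' 1 j = F1 t j)).
- rewrite h61; split=> // j hj; rewrite h1 // /F1.
  have -> : [&& i.+1 %| j, i.+1 < j & j <= 1 * i.+1]%N = false.
    by rewrite mul1n; case: ltnP => h; rewrite ?andbF // leqNgt h !andbF.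
  by rewrite mul0r subr0.
- move=> t s' ht F [g61 g1]; carry F; rewrite /=; rwva.
  have tY : (t.+2 * i.+1 <= Y)%N by rewrite -leq_divRL //; move: ht Yi; clear; lia.
  split; first by rewrite subr_gt0 addz1 ltz_nat ltnS.
  have A1 : ar s' 1 = ar s' 1 by []. move: {-1}(ar s' 1) A1 g1 => A A1 g1.
  have sj : sz b 12 (Posz (t.+2 * i.+1)) := sz_nat_le sY tY.
  have p0 := sz_partial_mu (t.+2 * i.+1) (ltnW iY).
  pose v := partial_mu i (t.+2 * i.+1).
  have sv : sz b 38 v by exact: p0.
  eapply wp_time.
    rewrite /sieve_j; apply: (wp_ld (i := (t.+2 * i.+1)%N) (v := v)).
    - by rewrite /=; rwva.
    - by sz_auto.
    - rewrite A1 g1; last by rewrite tY andbT.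
      rewrite /F1 [(_ <= t.+1 * _)%N]leqNgt ltn_pmul2r // ltnSn !andbF mul0r subr0 //.
    move=> s1 F V62; carry F.
    apply: (wp_st (i := (t.+2 * i.+1)%N) (v := v - mu i.+1) (A := A)).
    - by rewrite /=; rwva.
    - by sz_auto.
    - by rewrite /=; rwva.
    - by sz_auto.
    - exact: A1.
    clear A1; move=> s2 F A1; carry F.
    asn (Posz (t.+3 * i.+1)) as R; [by rewrite -PoszD -mulSnr| |].
      have -> : Posz (t.+3 * i.+1) = Posz (t.+2 * i.+1) + Posz i.+1 by rewrite -PoszD -mulSnr.
      by sz_auto.
    apply: wp_skip; split=> // j hj; rewrite A1 /store /F1.
    case: eqP => [->|ne].
      have -> : [&& i.+1 %| t.+2 * i.+1, i.+1 < t.+2 * i.+1 & t.+2 * i.+1 <= t.+2 * i.+1]%N = true.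
        by rewrite dvdn_mull //= leqnn andbT; clear; nia.
      by rewrite /v mul1r.
    rewrite g1 // /F1; congr (_ - ind _ * _).
    have [/dvdnP[q E]|] := boolP (i.+1 %| j)%N => //=; congr (_ && _).
    have nq : q <> t.+2 by move=> e; apply: ne; rewrite E e.
    by rewrite E !leq_pmul2r //; move: nq; clear; lia.
  by [].
- move=> s' F [g61 g1]; carry F; rewrite /=; rwva; split.
    rewrite subr_le0 addz1 lez_nat.
    have -> : ((Y %/ i.+1).-1.+2 = (Y %/ i.+1).+1)%N by rewrite prednK.
    by rewrite ltn_ceil.
  move=> j /andP[j0 jY]; rewrite g1 ?j0 // /F1 partial_muS; congr (_ - ind _ * _).
  rewrite prednK //; have [/dvdnP[q E]|] := boolP (i.+1 %| j)%N => //=.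
  have -> : (j <= Y %/ i.+1 * i.+1)%N by rewrite E leq_pmul2r // leq_divRL // -E.
  by rewrite andbT.
Qed.

Definition sieve_time : nat := (\sum_(0 <= i < Y) ((Y %/ i.+1).-1 * 5 + 6).+1 + 5)%N.

Lemma sieve_spec s : va s 3 = Posz Y -> (forall j, ar s 1 j = 0) ->
  wp L sieve_cmd s sieve_time (fun s' => forall j, (0 < j <= Y)%N -> ar s' 1 j = mu j).
Proof.
move=> h3 h1; have A1 : ar s 1 = ar s 1 by []. move: {-1}(ar s 1) A1 h1 => A A1 h1.
have s1 : sz b 1 (Posz 1) by apply: (sz_const b0).
eapply wp_time.
  rewrite /sieve_cmd; apply: (wp_st (i := 1%N) (v := 1) (A := A)) => //; try by sz_auto.
  clear A1; move=> s1' F A1; carry F.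
  asn (1 : int) as V7; first by sz_auto.
  eapply wp_call; last by move=> s' _ q; apply: wp_skip; exact: q.
  apply: (wp_loop_sum (n := Y) (t := fun i => ((Y %/ i.+1).-1 * 5 + 6)%N)
    (I := fun i s' => va s' 7 = Posz i.+1 /\ forall j, (0 < j <= Y)%N -> ar s' 1 j = partial_mu i j)).
  - rewrite V7; split=> // j /andP[j0 jY]; rewrite A1 /store /partial_mu big_geq // subr0.
    by case: eqP => // _; rewrite h1.
  - move=> i s' iY F [g7 g1]; carry F; rewrite /=; rwva; split.
      by rewrite subr_gt0 addz1 ltz_nat ltnS.
    have B1 : ar s' 1 = ar s' 1 by []. move: {-1}(ar s' 1) B1 g1 => B B1 g1.
    have si : sz b 12 (Posz i.+1) := sz_nat_le sY iY.
    have sm : sz b 24 (mu i.+1) := @sz_mu b 12 _ si.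
    eapply wp_time.
      rewrite /sieve_i; apply: (wp_ld (i := i.+1) (v := mu i.+1)).
      + by rewrite /=; rwva.
      + by sz_auto.
      + by rewrite B1 g1 ?iY // partial_mu_mu // leqnn.
      move=> s2 F V60; carry F.
      asn (Posz (2 * i.+1)) as V61; [by rewrite -PoszD addnn mul2n| |].
        by have -> : Posz (2 * i.+1) = Posz i.+1 + Posz i.+1; [rewrite -PoszD addnn mul2n|sz_auto].
      eapply wp_call.
        apply: (@sieve_j_loop _ i); try eassumption.
        by move=> j hj; rewrite B1 g1.
      move=> s3 F /= g1'; clear B1; carry F.
      have B1 : ar s3 1 = ar s3 1 by []. move: {-1}(ar s3 1) B1 g1' => B' B1 g1'.
      asn (Posz i.+2) as R; [exact: addz1| |].
        by have -> : Posz i.+2 = Posz i.+1 + 1; [rewrite addz1|sz_auto].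
      apply: wp_skip; split=> // j hj; by rewrite B1 g1'.
    by rewrite -!addnA; clear; lia.
  - move=> s' F [g7 g1]; rewrite /=; carry F; rwva; split; first by rewrite addz1 subrr.
    by move=> j hj; rewrite g1 // partial_mu_mu //; case/andP: hj => -> /leqW ->.
by rewrite /sieve_time; clear; lia.
Qed.

Lemma prefix_spec s : va s 3 = Posz Y -> (forall j, (0 < j <= Y)%N -> ar s 1 j = mu j) ->
  (forall j, ar s 2 j = 0) ->
  wp L prefix_cmd s (Y * 6 + 4) (fun s' => forall j, (j <= Y)%N -> ar s' 2 j = mertens j).
Proof.
move=> h3 h1 h2.
have A1 : ar s 1 = ar s 1 by []. move: {-1}(ar s 1) A1 h1 => A A1 h1.
have A2 : ar s 2 = ar s 2 by []. move: {-1}(ar s 2) A2 h2 => C A2 h2.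
eapply wp_time.
  rewrite /prefix_cmd; asn (1 : int) as V7; first by sz_auto.
  asn (0 : int) as V60; first by sz_auto.
  eapply wp_call; last by move=> s' _ q; apply: wp_skip; exact: q.
  apply: (wp_loop (n := Y) (t := 5%N)
    (I := fun i s' => [/\ va s' 7 = Posz i.+1, va s' 60 = mertens i &
      forall j, (j <= i)%N -> ar s' 2 j = mertens j])).
  - rewrite V7 V60 /mertens big_geq //; split=> // j; rewrite leqn0 => /eqP ->.
    by rewrite A2 h2 big_geq.
  - move=> i s' iY F [g7 g60 g2]; carry F; rewrite /=; rwva; split.
      by rewrite subr_gt0 addz1 ltz_nat ltnS.
    have B1 : ar s' 2 = ar s' 2 by []. move: {-1}(ar s' 2) B1 g2 => B B1 g2.
    have si : sz b 12 (Posz i.+1) := sz_nat_le sY iY.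
    have sm : sz b 24 (mu i.+1) := @sz_mu b 12 _ si.
    have sM : sz b 36 (mertens i.+1) := @sz_mertens b 12 _ si.
    eapply wp_time.
      rewrite /prefix_i; apply: (wp_ld (i := i.+1) (v := mu i.+1)).
      + by rewrite /=; rwva.
      + by sz_auto.
      + by rewrite A1 h1.
      move=> s2 F V61; carry F.
      asn (mertens i.+1) as V60'; [by rewrite [RHS]/mertens big_nat_recr|by sz_auto|].
      apply: (wp_st (i := i.+1) (v := mertens i.+1) (A := B)).
      + by rewrite /=; rwva.
      + by sz_auto.
      + by rewrite /=; rwva.
      + by sz_auto.
      + exact: B1.
      clear B1; move=> s3 F B1; carry F.
      asn (Posz i.+2) as R; [exact: addz1| |].
        by have -> : Posz i.+2 = Posz i.+1 + 1; [rewrite addz1|sz_auto].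
      apply: wp_skip; split=> // j hj; rewrite B1 /store.
      by case: eqP => [->//|ne]; apply: g2; move: ne hj; clear; lia.
    by [].
  - move=> s' F [g7 g60 g2]; rewrite /=; carry F; rwva; split=> //.
    by rewrite addz1 subrr.
by clear; lia.
Qed.

End Sieve.

(** * A bound on the coordinates and its seventh root *)

Definition set_max (e : expr) : cmd := CIf (EV 1 [-] e)%cmd CSkip (1 ::= e ;; CSkip)%cmd.

Definition bound_body : cmd := (
  CLd 60 0 (EV 7 [+] EV 7) ;; CLd 61 0 (EV 7 [+] EV 7 [+] EC 1) ;;
  set_max (EV 60 [/] EV 61 [+] EC 1) ;; set_max ((EC 0 [-] EV 60) [/] EV 61 [+] EC 1) ;;
  7 ::= EV 7 [+] EC 1 ;; CSkip)%cmd.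

Definition bound_cmd : cmd := (
  1 ::= EC 1 ;; 7 ::= EC 0 ;; CWhile (EV 2 [+] EV 2 [-] EV 7) bound_body ;; CSkip)%cmd.

Definition root_cmd : cmd := (
  5 ::= EC 1 ;;
  CWhile (EV 1 [-] EV 5 [*] EV 5 [*] EV 5 [*] EV 5 [*] EV 5 [*] EV 5 [*] EV 5)
    (5 ::= EV 5 [+] EC 1 ;; CSkip) ;;
  4 ::= EV 5 [*] EV 5 [*] EV 5 ;; 3 ::= EV 4 [*] EV 4 ;; CSkip)%cmd.

Section Bound.
Variables b k : nat.
Hypothesis b0 : (0 < b)%N.
Let L := (200 * b)%N.

Lemma set_max_spec s e D v : va s 1 = D -> eval s e = v -> sz b 10 v ->
  wp L (set_max e) s 4 (fun s' => va s' 1 = Num.max D v).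
Proof.
move=> h1 he sv; eapply wp_time.
  apply: (wp_if (T := 2)); rewrite /=; rwva => h.
  - eapply wp_time; first by apply: wp_skip; rewrite h1 max_l //; move: h; rewrite he subr_gt0 => /ltW.
    by [].
  - apply: (wp_asn he); first by sz_auto.
    move=> s' F V; apply: wp_skip; rewrite V max_r //.
    by move: h; rewrite he subr_le0.
by [].
Qed.

Variable X : nat -> int.
Hypothesis X1 : forall j, (j < 2 * k)%N -> 0 < X (2 * j).+1.
Hypothesis sX : forall j, sz b 1 (X j).
Hypothesis sk : sz b 8 (Posz k).

(** Coordinate number i of the polygon is the fraction with numerator X (2 i) and denominator X (2 i
    + 1); a polygon with k vertices has 2 k of them. *)
Definition covered (j : nat) (D : int) := forall i, (i < j)%N -> `|X (2 * i)| <= D * X (2 * i).+1.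

(** The converse estimate, through which D is later compared with the diameter. *)
Definition attained (D : int) := D = 1 \/
  exists2 i, (i < 2 * k)%N & (D - 1) * X (2 * i).+1 <= `|X (2 * i)|.

(** The absolute value of a fraction is bounded without a case distinction on its sign, by rounding
    both x / y and - x / y down and adding 1. The last clause keeps D below 2^b. *)
Lemma max_step (D x y : int) : 0 < y -> 
  let D1 := Num.max (Num.max D ((x %/ y)%Z + 1)) (((0 - x) %/ y)%Z + 1) in
  [/\ D <= D1, `|x| <= D1 * y, D1 = D \/ (D1 - 1) * y <= `|x| &
    forall B : int, D <= B -> `|x| + 1 <= B -> D1 <= B].
Proof.
move=> y0 D1.
have E1 := divz_eq x y; have E2 := divz_eq (0 - x) y.
have r1 := modz_ge0 x (lt0r_neq0 y0); have r2 := modz_ge0 (0 - x) (lt0r_neq0 y0).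
have r1' := ltz_pmod x y0; have r2' := ltz_pmod (0 - x) y0.
rewrite /D1; move: (x %/ y)%Z ((0 - x) %/ y)%Z (x %% y)%Z ((0 - x) %% y)%Z E1 E2 r1 r2 r1' r2'.
clear D1 => q1 q2 r r' E1 E2 r1 r2 r1' r2'.
have [h1|h1] := leP D (q1 + 1).
  have [h2|h2] := leP (q1 + 1) (q2 + 1).
    by split; [lia|nia|right; nia|move=> B; nia].
  by split; [lia|nia|right; nia|move=> B; nia].
have [h2|h2] := leP D (q2 + 1).
  by split; [lia|nia|right; nia|move=> B; nia].
by split; [lia|nia|left|].
Qed.

Lemma bound_spec s : va s 2 = Posz k -> ar s 0 = X ->
  wp L bound_cmd s (30 * k + 10) (fun s' => exists D : nat, [/\ va s' 1 = Posz D,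
    (0 < D <= 2 ^ b)%N, covered (2 * k) D & attained D]).
Proof.
move=> h2 A0.
eapply wp_time.
  rewrite /bound_cmd; asn (1 : int) as V1; first by sz_auto.
  asn (0 : int) as V7; first by sz_auto.
  eapply wp_call; last by move=> s' _ q; apply: wp_skip; exact: q.
  apply: (wp_loop (n := (2 * k)%N) (t := 13%N) (I := fun j s' => va s' 7 = Posz j /\ exists D : nat,
    [/\ va s' 1 = Posz D, (0 < D <= 2 ^ b)%N, covered j D & attained D])).
  - split; first by rewrite V7.
    exists 1%N; split; [by rewrite V1|by rewrite expn_gt0|by []|by left].
  - move=> j s' jk F [g7 [D [g1 /andP[D0 Db] cD aD]]]; carry F; rewrite /=; rwva; split.
      by rewrite subr_gt0 -PoszD addnn -mul2n ltz_nat.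
    have sj : sz b 9 (Posz (2 * k)).
      by have -> : Posz (2 * k) = Posz k + Posz k; [rewrite -PoszD addnn mul2n|sz_auto].
    have sj1 : sz b 9 (Posz j) := sz_nat_le sj (ltnW jk).
    have sj2 : sz b 10 (Posz (2 * j)).
      by have -> : Posz (2 * j) = Posz j + Posz j; [rewrite -PoszD addnn mul2n|sz_auto].
    have sj3 : sz b 11 (Posz (2 * j).+1) by rewrite -addz1; sz_auto.
    have sx := sX (2 * j); have sy := sX (2 * j).+1.
    have y0 := X1 jk.
    have [m1 m2 m3 m4] := max_step D (X (2 * j)) y0.
    set x := X (2 * j) in sx m1 m2 m3 m4; set y := X (2 * j).+1 in sy y0 m1 m2 m3 m4.
    eapply wp_time.
      rewrite /bound_body; apply: (wp_ld (i := (2 * j)%N) (v := x)).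
      + by rewrite /=; rwva; rewrite -PoszD addnn mul2n.
      + by sz_auto.
      + by rewrite A0.
      move=> s1 F V60; carry F.
      apply: (wp_ld (i := (2 * j).+1) (v := y)).
      + by rewrite /=; rwva; rewrite -PoszD addnn -mul2n addz1.
      + by sz_auto.
      + by rewrite A0.
      move=> s2 F V61; carry F.
      eapply wp_call.
        apply: (set_max_spec (v := (x %/ y)%Z + 1)); [eassumption|by rewrite /=; rwva|by sz_auto].
      move=> s3 F /= W1; carry F.
      eapply wp_call.
        apply: (set_max_spec (v := ((0 - x) %/ y)%Z + 1)); [eassumption|by rewrite /=; rwva|by sz_auto].
      move=> s4 F /= W2; carry F.
      asn (Posz j.+1) as R; [exact: addz1|by rewrite -addz1; sz_auto|].
      apply: wp_skip; split=> //.
      move: W2 m1 m2 m3 m4; set D1 := Num.max _ _ => W2 m1 m2 m3 m4.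
      have [D' D'E] : exists D' : nat, D1 = Posz D' by exists `|D1|%N; rewrite gez0_abs // (le_trans _ m1).
      rewrite D'E in W2 m1 m2 m3 m4; exists D'; split => //.
      + rewrite -!ltz_nat -!lez_nat; apply/andP; split; first by apply: lt_le_trans m1; rewrite ltz_nat.
        apply: m4; first by rewrite lez_nat.
        by move: sx; rewrite /sz /bits mul1n; clear; lia.
      + move=> i; rewrite ltnS leq_eqVlt => /orP[/eqP -> //|ij].
        apply: (le_trans (cD i ij)); rewrite ler_wpM2r // ltW // X1 //.
        exact: ltn_trans jk.
      + case: m3 => [->//|h]; right; by exists j.
    by [].
  - move=> s' F [g7 q]; rewrite /=; carry F; rwva; split=> //.
    by rewrite -PoszD addnn -mul2n subrr.
by clear; lia.
Qed.

(** A linear search for the least u >= 1 with u^7 >= D takes O(u) steps, far below u^6. Minimality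
    gives (u - 1)^7 < D, from which u^6 is bounded by a multiple of D^(6/7). *)
Lemma root_spec s (D : nat) : va s 1 = Posz D -> (0 < D)%N -> sz b 2 (Posz D) ->
  exists u : nat, [/\ (0 < u <= D)%N, (D <= u ^ 7)%N, (u = 1%N \/ (u.-1 ^ 7 < D)%N) &
  wp L root_cmd s (3 * u + 10) (fun s' => [/\ va s' 5 = Posz u, va s' 4 = Posz (u ^ 3) & va s' 3 = Posz (u ^ 6)])].
Proof.
move=> h1 D0 sD.
have DD : (D <= D ^ 7)%N by case: D D0 {h1 sD} => // D _; rewrite expnS leq_pmulr // expn_gt0.
have ex : exists u, (0 < u)%N && (D <= u ^ 7)%N by exists D; rewrite D0.
have [u /andP[u0 uD] umin] := ex_minnP ex.
have uD' : (u <= D)%N by apply: umin; rewrite D0.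
have ulast j : (j.+1 < u)%N -> (j.+1 ^ 7 < D)%N.
  by move=> ju; rewrite ltnNge; apply/negP => h; have := umin j.+1 h; rewrite leqNgt ju.
exists u; split => //; first by rewrite u0.
  by case: u u0 ulast {uD uD' umin} => // -[|u] _ ul; [left|right; exact: ul].
have su : sz b 2 (Posz u) := sz_nat_le sD uD'.
eapply wp_time.
  rewrite /root_cmd; asn (1 : int) as V5; first by sz_auto.
  eapply (wp_call (Q1 := fun s' => va s' 5 = Posz u)).
    apply: (wp_loop (n := u.-1) (t := 2%N) (I := fun j s' => va s' 5 = Posz j.+1)).
    - by rewrite V5.
    - move=> j s' ju F g5; carry F; rewrite /=; rwva; split.
        rewrite subr_gt0 -!PoszM ltz_nat; have := ulast j; rewrite !expnS expn0 muln1 !mulnA; apply.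
        by rewrite -ltn_predRL.
      eapply wp_time.
        asn (Posz j.+2) as R; [exact: addz1|apply: (sz_le (e := 2)) => //; apply: (sz_nat_le su); by rewrite -ltn_predRL|].
        exact: wp_skip.
      by [].
    - move=> s' F g5; carry F; rewrite /=; rwva; rewrite prednK //; split=> //.
      by rewrite subr_le0 -!PoszM lez_nat; move: uD; rewrite !expnS expn0 muln1 !mulnA.
  move=> s1 F /= g5; carry F.
  asn (Posz (u ^ 3)) as R4; [by rewrite -!PoszM !expnS expn0 muln1 mulnA| |].
    by have -> : Posz (u ^ 3) = Posz u * Posz u * Posz u; [rewrite -!PoszM !expnS expn0 muln1 mulnA|sz_auto].
  asn (Posz (u ^ 6)) as R3; [by rewrite -PoszM -expnD| |].
    have -> : Posz (u ^ 6) = Posz u * Posz u * Posz u * (Posz u * Posz u * Posz u).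
      by rewrite -!PoszM !expnS expn0 muln1 !mulnA.
    by sz_auto.
  exact: wp_skip.
by clear -u0; lia.
Qed.

End Bound.

(** * Multiples of a fixed point beyond the table *)

Definition clip_cmd : cmd := (
  CIf (EV 34)
    (60 ::= EV 35 [/] EV 34 ;; CIf (EV 33 [-] EV 60) (33 ::= EV 60 ;; CSkip) CSkip ;; CSkip)
    (CIf (EC 0 [-] EV 34)
      (60 ::= EC 0 [-] EV 35 [/] (EC 0 [-] EV 34) ;;
       CIf (EV 60 [-] EV 32) (32 ::= EV 60 ;; CSkip) CSkip ;; CSkip)
      (CIf (EC 0 [-] EV 35) (33 ::= EC 0 ;; CSkip) CSkip)))%cmd.

Definition tail_z : cmd := (
  CIf (EV 30 [*] EV 30 [+] EV 31 [*] EV 31) (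
    32 ::= EV 3 [+] EC 1 ;; 33 ::= EV 1 ;;
    34 ::= EC 0 [-] EV 10 [*] EV 30 ;; 35 ::= EC 0 [-] EV 12 ;; clip_cmd ;;
    34 ::= EV 10 [*] EV 30 ;; 35 ::= EV 13 ;; clip_cmd ;;
    34 ::= EC 0 [-] EV 10 [*] EV 31 ;; 35 ::= EC 0 [-] EV 14 ;; clip_cmd ;;
    34 ::= EV 10 [*] (EV 15 [*] EV 31 [-] EV 16 [*] EV 30) ;; 35 ::= EV 17 ;; clip_cmd ;;
    CIf (EV 33 [+] EC 1 [-] EV 32) (
      36 ::= EV 33 ;; mertens_cmd ;; 8 ::= EV 8 [+] EV 11 [*] EV 37 ;;
      36 ::= EV 32 [-] EC 1 ;; mertens_cmd ;; 8 ::= EV 8 [-] EV 11 [*] EV 37 ;; CSkip)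
      CSkip ;; CSkip)
    CSkip)%cmd.

(** One shape for all contributions: a strip below an edge, cut off from below at height Y0; a
    vertical edge or a single vertex is the case w = 1, h = 0. All conditions are linear, so the
    multiples of a point that lie in a piece form an interval. *)
Definition in_piece (X0 X1 Y0 w h c : int) (z : int * int) : bool :=
  [&& X0 <= z.1, z.1 <= X1, Y0 <= z.2 & w * z.2 - h * z.1 <= c].

Definition zscale (m : int) (z : int * int) : int * int := (m * z.1, m * z.2).

Definition mu_range (Y D : nat) (P : int -> bool) : int :=
  \sum_(Y.+1 <= d < D.+1) mu d * ind (P (Posz d)).

Lemma mu_range_itv (Y D : nat) (P : int -> bool) (lo hi : int) :
  (forall d : int, 0 < d -> [&& Posz Y < d, d <= Posz D & P d] = (lo <= d <= hi)) ->
  Posz Y < lo -> hi <= Posz D ->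
  mu_range Y D P = if lo <= hi then mertens `|hi|%N - mertens `|lo - 1|%N else 0.
Proof.
move=> H Ylo hiD.
have E : mu_range Y D P = \sum_(Y.+1 <= d < D.+1) if lo <= Posz d <= hi then mu d else 0.
  apply: eq_big_nat => d /andP[d1 d2].
  rewrite -H ?ltz_nat ?lez_nat; last exact: leq_ltn_trans d1.
  by rewrite d1 -ltnS d2 /=; case: (P d); rewrite ?mulr1 ?mulr0.
rewrite E; case: ifP => lohi; last first.
  by apply: big1 => d _; case: ifP => // /andP[h1 h2]; move: (le_trans h1 h2); rewrite lohi.
have [n nE] : exists n, lo = Posz n.+1 by exists (absz lo).-1; move: Ylo; clear; lia.
have [m mE] : exists m, hi = Posz m by exists (absz hi); move: Ylo lohi; clear; lia.
have nE' : Posz n.+1 - 1 = Posz n by rewrite -addz1 addrK.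
subst lo hi; rewrite nE' !absz_nat.
have nm : (n <= m)%N by move: lohi; clear; lia.
have mD : (m <= D)%N by move: hiD; clear; lia.
have Yn : (Y <= n)%N by move: Ylo; clear; lia.
rewrite /mertens [in RHS](@big_cat_nat _ _ _ n.+1) //= addrAC subrr add0r.
rewrite (@big_cat_nat _ _ _ n.+1) //=; last by rewrite ltnS (leq_trans nm).
rewrite [X in X + _]big_nat big1 ?add0r; last first.
  by move=> d /andP[_ d2]; rewrite lez_nat leqNgt d2.
rewrite (@big_cat_nat _ _ _ m.+1) //= [X in _ + X]big_nat [X in _ + X]big1 ?addr0; last first.
  by move=> d /andP[d1 _]; rewrite !lez_nat [(d <= m)%N]leqNgt d1 andbF.
by apply: eq_big_nat => d /andP[d1 d2]; rewrite !lez_nat d1 -ltnS d2.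
Qed.

Section Tail.
Variable b : nat.
Hypothesis b0 : (0 < b)%N.
Let L := (200 * b)%N.

(** Division by alpha turns the inequality into an upper or a lower bound for d, depending on the
    sign. For alpha = 0 it holds always or never; in the latter case hi = 0 empties the interval,
    because lo is positive. *)
Lemma clip_spec s lo hi alpha beta :
  va s 32 = lo -> va s 33 = hi -> va s 34 = alpha -> va s 35 = beta ->
  sz b 20 lo -> sz b 20 hi -> sz b 19 alpha -> sz b 19 beta -> 0 < lo ->
  wp L clip_cmd s 9 (fun s' => exists lo' hi',
    [/\ va s' 32 = lo', va s' 33 = hi', sz b 20 lo' && sz b 20 hi', (lo <= lo') && (hi' <= Num.max 0 hi) &
     forall d, (lo <= d <= hi) && (alpha * d <= beta) = (lo' <= d <= hi')]).
Proof.
move=> h32 h33 h34 h35 slo shi sa sb lo0.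
eapply wp_time.
  apply: (wp_if (T := 8)); rewrite /=; rwva => ha.
  - eapply wp_time.
      asn (beta %/ alpha)%Z as V60; first by sz_auto.
      eapply wp_call; last by move=> s' _ q; apply: wp_skip; exact: q.
      have H d : (alpha * d <= beta) = (d <= (beta %/ alpha)%Z).
        by rewrite lez_divRL // mulrC.
      have sq : sz b 20 (beta %/ alpha)%Z by sz_auto.
      move: (beta %/ alpha)%Z V60 H sq => q V60 H sq.
      apply: (wp_if (T := 2)); rewrite /=; rwva => h1.
      + eapply wp_time.
          asn q as R; first by sz_auto.
          apply: wp_skip; exists lo, q; split => //.
          - by rewrite slo sq.
          - by rewrite lexx /= le_max; apply/orP; right; move: h1; clear; lia.
          - by move=> d; rewrite H; move: h1; clear; lia.
        by [].
      + eapply wp_time.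
          apply: wp_skip; exists lo, hi; split => //; first by rewrite slo.
          - by rewrite lexx /= le_max lexx orbT.
          - by move=> d; rewrite H; move: h1; clear; lia.
        by [].
    by [].
  - apply: (wp_if (T := 7)); rewrite /=; rwva => hb.
    + eapply wp_time.
        asn (0 - (beta %/ (0 - alpha))%Z) as V60; first by sz_auto.
        eapply wp_call; last by move=> s' _ q; apply: wp_skip; exact: q.
        have H d : (alpha * d <= beta) = (0 - (beta %/ (0 - alpha))%Z <= d).
          by rewrite [RHS]lerBlDr addrC -lerBlDr sub0r lez_divRL // [0 - alpha]sub0r mulrNN mulrC.
        have sq : sz b 20 (0 - (beta %/ (0 - alpha))%Z) by sz_auto.
        move: (0 - (beta %/ (0 - alpha))%Z) V60 H sq => q V60 H sq.
        apply: (wp_if (T := 2)); rewrite /=; rwva => h1.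
        * eapply wp_time.
            asn q as R; first by sz_auto.
            apply: wp_skip; exists q, hi; split => //; first by rewrite sq.
            - by rewrite le_max lexx orbT andbT; move: h1; clear; lia.
            - by move=> d; rewrite H; move: h1; clear; lia.
          by [].
        * eapply wp_time.
            apply: wp_skip; exists lo, hi; split => //; first by rewrite slo.
            - by rewrite lexx /= le_max lexx orbT.
            - by move=> d; rewrite H; move: h1; clear; lia.
          by [].
      by [].
    + have a0 : alpha = 0 by move: ha hb; clear; lia.
      apply: (wp_if (T := 6)); rewrite /=; rwva => h1.
      * eapply wp_time.
          asn (0 : int) as R; first by sz_auto.
          apply: wp_skip; exists lo, 0; split => //.
          - by rewrite slo; sz_auto.
          - by rewrite lexx le_max lexx.
          - by move=> d; rewrite a0 mul0r; move: h1 lo0; clear; lia.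
        by [].
      * eapply wp_time.
          apply: wp_skip; exists lo, hi; split => //; first by rewrite slo.
          - by rewrite lexx /= le_max lexx orbT.
          - by move=> d; rewrite a0 mul0r; move: h1 lo0; clear; lia.
        by [].
by [].
Qed.

Variables (D Y K TB : nat).
Hypothesis K0 : (0 < K)%N.
Hypothesis KY : (K <= Y)%N.
Hypothesis sY : sz b 12 (Posz Y).
Hypothesis sD : sz b 2 (Posz D).
Hypothesis hTB : forall x, (x <= D)%N -> (mert_time Y K x <= TB)%N.
Variables (Q coef X0 X1 Y0 w h c : int).
Hypotheses (sQ : sz b 6 Q) (scoef : sz b 1 coef) (sX0 : sz b 8 X0) (sX1 : sz b 8 X1)
  (sY0 : sz b 9 Y0) (sw : sz b 8 w) (sh : sz b 8 h) (sc : sz b 17 c).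

Let piece := in_piece X0 X1 Y0 w h c.

Definition tail_term (z : int * int) : int :=
  if 0 < z.1 * z.1 + z.2 * z.2 then coef * mu_range Y D (fun d => piece (zscale (Q * d) z)) else 0.

Lemma tail_z_spec s T (zx zy : int) :
  va s 1 = Posz D -> va s 3 = Posz Y -> va s 4 = Posz K -> va s 8 = T -> va s 10 = Q ->
  va s 11 = coef -> va s 12 = X0 -> va s 13 = X1 -> va s 14 = Y0 -> va s 15 = w ->
  va s 16 = h -> va s 17 = c -> va s 30 = zx -> va s 31 = zy ->
  (forall i, (i <= Y)%N -> ar s 2 i = mertens i) ->
  sz b 3 zx -> sz b 3 zy -> sz b 130 T ->
  wp L tail_z s (2 * TB + 60) (fun s' => va s' 8 = T + tail_term (zx, zy)).
Proof.
move=> h1 h3 h4 h8 h10 h11 h12 h13 h14 h15 h16 h17 h30 h31 hM szx szy sT.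
have A2 : ar s 2 = ar s 2 by []. move: {-1}(ar s 2) A2 hM => M A2 hM.
eapply wp_time.
  apply: (wp_if (T := (2 * TB + 59)%N)); rewrite /=; rwva; last first.
    move=> hz; eapply wp_time; first by apply: wp_skip; rewrite /tail_term ltNge hz addr0.
    by rewrite addn_gt0 orbT.
  move=> hz; eapply wp_time.
    asn (Posz Y.+1) as V32; [exact: addz1|by rewrite -addz1; sz_auto|].
    asn (Posz D) as V33; first by sz_auto.
    asn (0 - Q * zx); first by sz_auto.
    asn (0 - X0); first by sz_auto.
    have sY1 : sz b 20 (Posz Y.+1) by rewrite -addz1; sz_auto.
    have sD1 : sz b 20 (Posz D) by sz_auto.
    eapply wp_call.
      apply: (clip_spec (lo := Posz Y.+1) (hi := Posz D) (alpha := 0 - Q * zx) (beta := 0 - X0));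
        try eassumption; by [sz_auto|].
    move=> s1 F /= [lo1 [hi1 [l32 l33 /andP[sl1 sh1] /andP[lo1Y hi1D] E1]]]; carry F.
    rewrite max_r // in hi1D.
    asn (Q * zx); first by sz_auto.
    asn X1; first by sz_auto.
    eapply wp_call.
      apply: (clip_spec (lo := lo1) (hi := hi1) (alpha := Q * zx) (beta := X1));
        try eassumption; try by sz_auto.
      by apply: lt_le_trans lo1Y.
    move=> s2 F /= [lo2 [hi2 [m32 m33 /andP[sl2 sh2] /andP[lo2Y hi2D] E2]]]; carry F.
    asn (0 - Q * zy); first by sz_auto.
    asn (0 - Y0); first by sz_auto.
    eapply wp_call.
      apply: (clip_spec (lo := lo2) (hi := hi2) (alpha := 0 - Q * zy) (beta := 0 - Y0));
        try eassumption; try by sz_auto.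
      by apply: lt_le_trans lo2Y; apply: lt_le_trans lo1Y.
    move=> s3 F /= [lo3 [hi3 [n32 n33 /andP[sl3 sh3] /andP[lo3Y hi3D] E3]]]; carry F.
    asn (Q * (w * zy - h * zx)); first by sz_auto.
    asn c; first by sz_auto.
    eapply wp_call.
      apply: (clip_spec (lo := lo3) (hi := hi3) (alpha := Q * (w * zy - h * zx)) (beta := c));
        try eassumption; try by sz_auto.
      by apply: lt_le_trans lo3Y; apply: lt_le_trans lo2Y; apply: lt_le_trans lo1Y.
    move=> s4 F /= [lo [hi [p32 p33 /andP[sl sh'] /andP[loY hiD] E4]]]; carry F.
    have Ylo : Posz Y < lo by move: lo1Y lo2Y lo3Y loY; clear; lia.
    have hD : hi <= Posz D by move: hi1D hi2D hi3D hiD; clear; lia.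
    (* Each of the four linear conditions of the piece, evaluated at Q d z, is one clipping of the
       initial interval from Y + 1 to D. *)
    have H (d : int) : 0 < d ->
        [&& Posz Y < d, d <= Posz D & piece (zscale (Q * d) (zx, zy))] = (lo <= d <= hi).
      move=> d0; rewrite -E4 -E3 -E2 -E1 /piece /in_piece /zscale /=.
      have -> : (Posz Y.+1 <= d) = (Posz Y < d) by [].
      rewrite -!andbA; congr [&& _, _ & _]; congr [&& _, _, _ & _].
      - by apply/idP/idP; move: (X0) (Q * zx) (Q * d * zx) (mulrAC Q zx d); clear => A B C <-; lia.
      - by rewrite mulrAC.
      - by apply/idP/idP; move: (Y0) (Q * zy) (Q * d * zy) (mulrAC Q zy d); clear => A B C <-; lia.
      - by congr (_ <= _); ring.
    have R0 := mu_range_itv H Ylo hD.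
    eapply wp_call; last by move=> s' _ q; apply: wp_skip; exact: q.
    apply: (wp_if (T := (2 * TB + 8)%N)); rewrite /=; rwva => hlh; last first.
      eapply wp_time; first by apply: wp_skip; rewrite /tail_term hz R0; case: leP; [move: hlh; clear; lia|rewrite mulr0 addr0].
      by clear; lia.
    have lohi : lo <= hi by move: hlh; clear; lia.
    rewrite lohi in R0.
    have [n nE] : exists n, lo = Posz n.+1 by exists (absz lo).-1; move: Ylo; clear; lia.
    have [m mE] : exists m, hi = Posz m by exists (absz hi); move: Ylo lohi; clear; lia.
    have nE' : Posz n.+1 - 1 = Posz n by rewrite -addz1 addrK.
    rewrite nE nE' mE !absz_nat in R0; rewrite nE in p32 lohi; rewrite mE in p33 lohi hD.
    have mD : (m <= D)%N by move: hD; clear; lia.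
    have nD : (n <= D)%N by move: lohi hD; clear; lia.
    have sm : sz b 2 (Posz m) := sz_nat_le sD mD.
    have sn : sz b 2 (Posz n) := sz_nat_le sD nD.
    have sMm : sz b 6 (mertens m) := sz_mertens sm.
    have sMn : sz b 6 (mertens n) := sz_mertens sn.
    eapply wp_time.
      asn (Posz m); first by sz_auto.
      eapply wp_call.
        apply: wp_time; last exact: (hTB mD).
        apply: (mert_spec b0 K0 KY sY); try eassumption.
        by move=> i Hi; rewrite A2 hM.
      move=> s5 F /= V37; carry F.
      asn (T + coef * mertens m); first by sz_auto.
      asn (Posz n); first by sz_auto.
      eapply wp_call.
        apply: wp_time; last exact: (hTB nD).
        apply: (mert_spec b0 K0 KY sY); try eassumption.
        by move=> i Hi; rewrite A2 hM.
      move=> s6 F /= V37'; carry F.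
      asn (T + coef * mertens m - coef * mertens n) as R; first by sz_auto.
      by apply: wp_skip; rewrite R /tail_term hz R0; ring.
    by clear; lia.
  by clear; lia.
by clear; lia.
Qed.

End Tail.

(** * The sums over one piece *)

Definition direct_d : cmd := (
  CLd 60 1 (EV 29) ;; 18 ::= EV 10 [*] EV 29 ;; count_cmd ;;
  8 ::= EV 8 [+] EV 60 [*] EV 11 [*] EV 19 ;; 29 ::= EV 29 [+] EC 1 ;; CSkip)%cmd.

Definition tail_row : cmd := (
  31 ::= EC 0 [-] EV 5 ;;
  CWhile (EV 5 [+] EC 1 [-] EV 31) (tail_z ;; 31 ::= EV 31 [+] EC 1 ;; CSkip) ;;
  30 ::= EV 30 [+] EC 1 ;; CSkip)%cmd.

(** The first count uses the step Q (D + 2), for which the origin is the only lattice point in the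
    box of half-width Q D containing the piece; it yields the contribution of the piece to the
    weight of the origin. Then come the direct counts for d up to [EV 3], and the tail over the
    square of half-width u. *)
Definition run_piece : cmd := (
  18 ::= EV 10 [*] (EV 1 [+] EC 2) ;; count_cmd ;; 9 ::= EV 9 [+] EV 11 [*] EV 19 ;;
  29 ::= EC 1 ;; CWhile (EV 3 [+] EC 1 [-] EV 29) direct_d ;;
  30 ::= EC 0 [-] EV 5 ;; CWhile (EV 5 [+] EC 1 [-] EV 30) tail_row ;; CSkip)%cmd.

Record piece := Piece { pcoef : int; pX0 : int; pX1 : int; pY0 : int; pw : int; ph : int; pc : int }.

Section Piece.
Variable b : nat.
Hypothesis b0 : (0 < b)%N.
Let L := (200 * b)%N.
Variables (D u Y K TB : nat).
Hypothesis K0 : (0 < K)%N.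
Hypothesis KY : (K <= Y)%N.
Hypothesis sY : sz b 12 (Posz Y).
Hypothesis sD : sz b 2 (Posz D).
Hypothesis su : sz b 2 (Posz u).
Hypothesis hTB : forall x, (x <= D)%N -> (mert_time Y K x <= TB)%N.

Definition globals (s : state) : Prop :=
  [/\ va s 1 = Posz D, va s 3 = Posz Y, va s 4 = Posz K & va s 5 = Posz u] /\
  (forall i, (0 < i <= Y)%N -> ar s 1 i = mu i) /\ (forall i, (i <= Y)%N -> ar s 2 i = mertens i).

Variables (Q coef X0 X1 Y0 w h c : int).
Hypotheses (sQ : sz b 6 Q) (scoef : sz b 1 coef) (sX0 : sz b 8 X0) (sX1 : sz b 8 X1)
  (sY0 : sz b 9 Y0) (sw : sz b 8 w) (sh : sz b 8 h) (sc : sz b 17 c).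
Hypotheses (Q0 : 0 < Q) (w0 : 0 < w).

Let term := tail_term D Y Q coef X0 X1 Y0 w h c.

Lemma sz_tail_term z : sz b 7 (term z).
Proof.
rewrite /term /tail_term; case: ifP => _; last by sz_auto.
have h1 : sz b 6 (mu_range Y D (fun d => in_piece X0 X1 Y0 w h c (zscale (Q * d) z))).
  apply: (@sz_sum b 4 2).
    by apply: leq_ltn_trans sD; rewrite subSS leq_subr.
  move=> d /andP[_ dD]; have sd : sz b 2 (Posz d) by apply: sz_nat_le sD _.
  have := sz_mu sd; case: (in_piece _ _ _ _ _ _ _); rewrite /ind ?mulr1 ?mulr0 // => _.
  by sz_auto.
by sz_auto.
Qed.

Lemma lt_range_u : (2 * u + 1 < 2 ^ (3 * b))%N.
Proof.
have : (u < 2 ^ (2 * b))%N := su.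
have : (2 ^ (2 * b).+1 <= 2 ^ (3 * b))%N by rewrite leq_exp2l //; clear -b0; lia.
by rewrite expnS; clear; lia.
Qed.

Definition coord (i : nat) : int := Posz i - Posz u.

Lemma coordS i : coord i + 1 = coord i.+1.
Proof. by rewrite /coord -addz1 addrAC. Qed.

Lemma sz_coord i : (i <= 2 * u + 1)%N -> sz b 3 (coord i).
Proof.
move=> hi; have h1 := lt_range_u; rewrite /coord /sz /bits.
by move: hi h1; move: (2 ^ _)%N; clear; lia.
Qed.

Definition row_sum (x : int) (n : nat) : int := \sum_(0 <= j < n) term (x, coord j).
Definition box_sum (n : nat) : int := \sum_(0 <= i < n) row_sum (coord i) (2 * u + 1).
Definition direct_sum (n : nat) : int :=
  \sum_(1 <= d < n.+1) mu d * coef * count_points (Q * Posz d) X0 X1 Y0 w h c.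

Lemma sz_row_sum x n : (n <= 2 * u + 1)%N -> sz b 10 (row_sum x n).
Proof.
move=> hn; apply: (@sz_sum b 7 3) => [|j _]; last exact: sz_tail_term.
by rewrite subn0; exact: leq_ltn_trans hn lt_range_u.
Qed.

Lemma sz_box_sum n : (n <= 2 * u + 1)%N -> sz b 13 (box_sum n).
Proof.
move=> hn; apply: (@sz_sum b 10 3) => [|j _]; last exact: sz_row_sum.
by rewrite subn0; exact: leq_ltn_trans hn lt_range_u.
Qed.

Definition vars_ok (s : state) : Prop :=
  [/\ va s 10 = Q, va s 11 = coef & va s 12 = X0] /\
  [/\ va s 13 = X1, va s 14 = Y0, va s 15 = w, va s 16 = h & va s 17 = c].

Lemma tail_row_spec s T x : globals s -> vars_ok s -> va s 8 = T -> va s 30 = x ->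
  sz b 3 x -> sz b 3 (x + 1) -> sz b 123 T ->
  wp L tail_row s ((2 * u + 1) * (2 * TB + 64) + 5)
    (fun s' => va s' 8 = T + row_sum x (2 * u + 1) /\ va s' 30 = x + 1).
Proof.
move=> [[h1 h3 h4 h5] [_ hM]] [[h10 h11 h12] [h13 h14 h15 h16 h17]] h8 h30 sx sx1 sT.
have A2 : ar s 2 = ar s 2 by []. move: {-1}(ar s 2) A2 hM => M A2 hM.
eapply wp_time.
  rewrite /tail_row; asn (coord 0) as V31; first by have h0 := sz_coord (leq0n (2 * u + 1)); sz_auto.
  eapply (wp_call (Q1 := fun s' => va s' 8 = T + row_sum x (2 * u + 1))).
    apply: (wp_loop (n := (2 * u + 1)%N) (t := (2 * TB + 63)%N) (I := fun j s' => 
      va s' 8 = T + row_sum x j /\ va s' 31 = coord j)).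
    - by rewrite h8 V31 /row_sum big_geq // addr0.
    - move=> j s' ju F [g8 g31]; carry F; rewrite /=; rwva; split.
        by rewrite /coord; move: ju; clear; lia.
      have sj := sz_coord (ltnW ju); have sj1 := sz_coord ju.
      have sr := sz_row_sum x (ltnW ju).
      eapply wp_time.
        eapply wp_call.
          apply: (tail_z_spec b0 K0 KY sY sD hTB sQ scoef sX0 sX1 sY0 sw sh sc (T := T + row_sum x j));
            try eassumption.
          + by move=> i Hi; rewrite A2 hM.
          + by sz_auto.
        move=> s1 F /= V8; carry F.
        asn (coord j.+1) as R; [exact: coordS|by sz_auto|].
        by apply: wp_skip; rewrite R V8 -addrA /row_sum big_nat_recr.
      by clear; lia.
    - move=> s' F [g8 g31]; carry F; rewrite /=; rwva; split=> //.
      by rewrite /coord; clear; lia.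
  move=> s1 F /= V8; carry F.
  asn (x + 1) as R; first by sz_auto.
  exact: wp_skip.
by clear; lia.
Qed.

Definition piece_time : nat :=
  (Y * (880 * b + 10) + 880 * b + (2 * u + 1) * ((2 * u + 1) * (2 * TB + 64) + 10) + 20)%N.

Definition piece_T : int := direct_sum Y + box_sum (2 * u + 1).
Definition piece_Z : int := coef * count_points (Q * (Posz D + 2)) X0 X1 Y0 w h c.

(** The size is read off from the specification of [count_cmd], applied to an ad hoc state with the
    parameters in variables 12 to 18. *)
Lemma sz_count_points g : sz b 18 g -> 0 < g -> sz b 72 (count_points g X0 X1 Y0 w h c).
Proof.
move=> sg g0.
pose s := State (fun i => nth 0 (nseq 12 0 ++ [:: X0; X1; Y0; w; h; c; g]) i) (fun _ _ => 0).
have [s' [n [_ _ [<- //]]]] := count_spec b0 (s := s) (erefl _) (erefl _) (erefl _) (erefl _)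
  (erefl _) (erefl _) (erefl _) sX0 sX1 sY0 sw sh sc sg g0 w0.
Qed.

Lemma scale_d d : (0 < d <= Y)%N -> sz b 18 (Q * Posz d) /\ 0 < Q * Posz d.
Proof.
move=> /andP[d0 dY]; have sd := sz_nat_le sY dY.
by split; [sz_auto|rewrite mulr_gt0].
Qed.

Lemma sz_direct_sum n : (n <= Y)%N -> sz b 109 (direct_sum n).
Proof.
move=> nY; apply: (@sz_sum b 97 12) => [|d /andP[d0 dn]].
  by rewrite subn1; exact: leq_ltn_trans nY sY.
have dY : (d <= Y)%N by apply: leq_trans nY.
have [s1 s2] := scale_d (introT andP (conj d0 dY)).
have s3 := sz_count_points s1 s2; have s4 := sz_mu (sz_nat_le sY dY).
by sz_auto.
Qed.

Lemma sz_piece_T : sz b 110 piece_T.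
Proof.
have h1 := sz_direct_sum (leqnn Y); have h2 := sz_box_sum (leqnn (2 * u + 1)).
by rewrite /piece_T; sz_auto.
Qed.

Lemma scale_Z : sz b 9 (Q * (Posz D + 2)) /\ 0 < Q * (Posz D + 2).
Proof. by split; [sz_auto|rewrite mulr_gt0 //; clear; lia]. Qed.

Lemma sz_piece_Z : sz b 73 piece_Z.
Proof.
have [s1 s2] := scale_Z; have s1' : sz b 18 (Q * (Posz D + 2)) by sz_auto.
by have s3 := sz_count_points s1' s2; rewrite /piece_Z; sz_auto.
Qed.

Lemma run_piece_spec s T Z : globals s -> vars_ok s -> va s 8 = T -> va s 9 = Z ->
  sz b 120 T -> sz b 120 Z ->
  wp L run_piece s piece_time (fun s' => va s' 8 = T + piece_T /\ va s' 9 = Z + piece_Z).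
Proof.
move=> [[h1 h3 h4 h5] [hm hM]] [[h10 h11 h12] [h13 h14 h15 h16 h17]] h8 h9 sT sZ.
have A1 : ar s 1 = ar s 1 by []. move: {-1}(ar s 1) A1 hm => mt A1 hm.
have A2 : ar s 2 = ar s 2 by []. move: {-1}(ar s 2) A2 hM => M A2 hM.
have [sg0 g0] := scale_Z.
have sg0' : sz b 18 (Q * (Posz D + 2)) by sz_auto.
have sds := sz_direct_sum (leqnn Y).
eapply wp_time.
  rewrite /run_piece; asn (Q * (Posz D + 2)); first by sz_auto.
  eapply wp_call.
    apply: (count_spec b0 (X0 := X0) (X1 := X1) (Y0 := Y0) (w := w) (h := h) (c := c)
      (g := Q * (Posz D + 2))); eassumption.
  move=> s1 F /= [V19 s19]; carry F; rewrite V19 in s19.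
  asn (Z + piece_Z); first by have h0 := sz_piece_Z; sz_auto.
  asn (1 : int) as V29; first by sz_auto.
  eapply (wp_call (Q1 := fun s' => va s' 8 = T + direct_sum Y)).
    apply: (wp_loop (n := Y) (t := (880 * b + 8)%N) (I := fun j s' => 
      va s' 8 = T + direct_sum j /\ va s' 29 = Posz j.+1)).
    - by rewrite h8 V29 /direct_sum big_geq // addr0.
    - move=> j s' jY F [g8 g29]; carry F; rewrite /=; rwva; split.
        by rewrite subr_gt0 addz1 ltz_nat ltnS.
      have [sg gg] := scale_d (introT andP (conj (ltn0Sn j) jY)).
      have sj : sz b 12 (Posz j.+1) := sz_nat_le sY jY.
      have smu := sz_mu sj; have sp := sz_direct_sum (ltnW jY).
      eapply wp_time.
        rewrite /direct_d; apply: (wp_ld (i := j.+1) (v := mu j.+1)).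
        + by rewrite /=; rwva.
        + by sz_auto.
        + by rewrite A1 hm.
        move=> s2 F V60; carry F.
        asn (Q * Posz j.+1); first by sz_auto.
        eapply wp_call.
          apply: (count_spec b0 (X0 := X0) (X1 := X1) (Y0 := Y0) (w := w) (h := h) (c := c)
            (g := Q * Posz j.+1)); eassumption.
        move=> s3 F /= [W19 t19]; carry F; rewrite W19 in t19.
        asn (T + direct_sum j + mu j.+1 * coef * count_points (Q * Posz j.+1) X0 X1 Y0 w h c) as V8';
          first by sz_auto.
        asn (Posz j.+2) as R; [exact: addz1|by rewrite -addz1; sz_auto|].
        by apply: wp_skip; split; rewrite ?R // V8' -addrA /direct_sum [in RHS]big_nat_recr.
      by clear; lia.
    - move=> s' F [g8 g29]; carry F; rewrite /=; rwva; split=> //.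
      by rewrite addz1 subrr.
  move=> s2 F /= V8; carry F.
  have sT1 : sz b 121 (T + direct_sum Y) by sz_auto.
  asn (coord 0) as V30; first by have h0 := sz_coord (leq0n (2 * u + 1)); sz_auto.
  eapply (wp_call (Q1 := fun s' => va s' 8 = T + piece_T)).
    apply: (wp_loop (n := (2 * u + 1)%N) (t := ((2 * u + 1) * (2 * TB + 64) + 5)%N)
      (I := fun j s' => va s' 8 = T + direct_sum Y + box_sum j /\ va s' 30 = coord j)).
    - by rewrite V8 V30 /box_sum big_geq // addr0.
    - move=> j s' ju F [g8 g30]; carry F; rewrite /=; rwva; split.
        by rewrite /coord; move: ju; clear; lia.
      have sj := sz_coord (ltnW ju); have sj1 := sz_coord ju.
      have sr := sz_box_sum (ltnW ju).
      apply: wp_weaken.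
        apply: (@tail_row_spec _ (T + direct_sum Y + box_sum j) (coord j)); try eassumption; rewrite ?coordS //.
        + by split; [split|split=> i hi; rewrite ?A1 ?A2 ?hm ?hM].
        + by sz_auto.
      move=> s3 _ [-> ->]; split; last by rewrite coordS.
      by rewrite -addrA [in RHS]/box_sum big_nat_recr.
    - move=> s' F [g8 g30]; carry F; rewrite /=; rwva; split.
        by rewrite /coord; clear; lia.
      by rewrite -addrA.
  move=> s3 F /= W8; carry F.
  by apply: wp_skip.
rewrite /piece_time; move: ((2 * u + 1) * (2 * TB + 64))%N (2 * u + 1)%N (880 * b)%N => Z1 N c1.
by rewrite -addnS; move: (leq_mul2l N (Z1 + 6) (Z1 + 10)) (leq_mul2l Y (c1 + 9) (c1 + 10));
  rewrite !leq_add2l !orbT; clear; lia.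
Qed.

End Piece.

(** * From corners to pieces *)

Definition load_vertex (i x y dx dy : nat) : cmd := (
  CLd x 0 (EC 4 [*] EV i) ;; CLd dx 0 (EC 4 [*] EV i [+] EC 1) ;;
  CLd y 0 (EC 4 [*] EV i [+] EC 2) ;; CLd dy 0 (EC 4 [*] EV i [+] EC 3) ;; CSkip)%cmd.

Definition load_corner (p n : nat) : cmd := (
  load_vertex p 46 47 52 53 ;; load_vertex 7 48 49 54 55 ;; load_vertex n 50 51 56 57 ;;
  10 ::= EV 52 [*] EV 53 [*] EV 54 [*] EV 55 [*] EV 56 [*] EV 57 ;;
  46 ::= EV 46 [*] (EV 10 [/] EV 52) ;; 47 ::= EV 47 [*] (EV 10 [/] EV 53) ;;
  48 ::= EV 48 [*] (EV 10 [/] EV 54) ;; 49 ::= EV 49 [*] (EV 10 [/] EV 55) ;;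
  50 ::= EV 50 [*] (EV 10 [/] EV 56) ;; 51 ::= EV 51 [*] (EV 10 [/] EV 57) ;; CSkip)%cmd.

Definition set_edge : cmd := (
  CIf (EV 50 [-] EV 48)
    (11 ::= EC (-1) ;; 12 ::= EV 48 ;; 13 ::= EV 50 [-] EC 1 ;; 14 ::= EC 0 [-] EV 10 [*] EV 1 ;;
     15 ::= EV 50 [-] EV 48 ;; 16 ::= EV 51 [-] EV 49 ;;
     17 ::= (EV 50 [-] EV 48) [*] EV 49 [-] (EV 51 [-] EV 49) [*] EV 48 [-] EC 1 ;; CSkip)
    (CIf (EV 48 [-] EV 50)
      (11 ::= EC 1 ;; 12 ::= EV 50 ;; 13 ::= EV 48 [-] EC 1 ;; 14 ::= EC 0 [-] EV 10 [*] EV 1 ;;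
       15 ::= EV 48 [-] EV 50 ;; 16 ::= EV 49 [-] EV 51 ;;
       17 ::= (EV 48 [-] EV 50) [*] EV 49 [-] (EV 49 [-] EV 51) [*] EV 48 ;; CSkip)
      (CIf (EV 51 [-] EV 49) (11 ::= EC 1 ;; CSkip) (11 ::= EC 0 ;; CSkip) ;;
       12 ::= EV 48 ;; 13 ::= EV 48 ;; 14 ::= EV 49 [+] EC 1 ;; 15 ::= EC 1 ;; 16 ::= EC 0 ;;
       17 ::= EV 51 ;; CSkip)))%cmd.

(** [edge_weight] in integral coordinates: a strict inequality becomes a weak one after subtracting
    1, both for the open end of the column range and for points strictly below the edge. The cut at
    height -m lies below all points of the box. A vertical edge that does not run upwards gets
    coefficient 0. *)
Definition edge_piece (m : int) (a b : int * int) : piece :=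
  if 0 < b.1 - a.1 then
    Piece (-1) a.1 (b.1 - 1) (0 - m) (b.1 - a.1) (b.2 - a.2)
      ((b.1 - a.1) * a.2 - (b.2 - a.2) * a.1 - 1)
  else if 0 < a.1 - b.1 then
    Piece 1 b.1 (a.1 - 1) (0 - m) (a.1 - b.1) (a.2 - b.2)
      ((a.1 - b.1) * a.2 - (a.2 - b.2) * a.1)
  else Piece (if 0 < b.2 - a.2 then 1 else 0) a.1 a.1 (a.2 + 1) 1 0 b.2.

Definition set_lexleft (x : nat) (e1 e2 : expr) : cmd :=
  (CIf (EC 0 [-] e1) (x ::= EC 1 ;; CSkip)
    (CIf e1 (x ::= EC 0 ;; CSkip) (CIf e2 (x ::= EC 1 ;; CSkip) (x ::= EC 0 ;; CSkip))))%cmd.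

(** The connectives of [lex_sector] are arithmetized: with bits s and t for [lexleft], the
    conjunction is (1 - s) t and the disjunction is 1 - s (1 - t). *)
Definition set_vertex : cmd := (
  set_lexleft 60 (EV 46 [-] EV 48) (EV 47 [-] EV 49) ;;
  set_lexleft 61 (EV 50 [-] EV 48) (EV 51 [-] EV 49) ;;
  CIf ((EV 46 [-] EV 48) [*] (EV 51 [-] EV 49) [-] (EV 47 [-] EV 49) [*] (EV 50 [-] EV 48))
    (11 ::= (EC 1 [-] EV 60) [*] EV 61 [-] (EC 1 [-] EV 60) ;; CSkip)
    (11 ::= (EC 1 [-] EV 60 [*] (EC 1 [-] EV 61)) [-] (EC 1 [-] EV 60) ;; CSkip) ;;
  12 ::= EV 48 ;; 13 ::= EV 48 ;; 14 ::= EV 49 ;; 15 ::= EC 1 ;; 16 ::= EC 0 ;;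
  17 ::= EV 49 ;; CSkip)%cmd.

Definition vertex_piece (o a b : int * int) : piece :=
  Piece (vertex_weight o a b) a.1 a.1 a.2 1 0 a.2.

(** The parameters are the variables that hold the indices of the preceding and the following
    vertex; exchanging them reverses the orientation. *)
Definition corner_cmd (p n : nat) : cmd :=
  (load_corner p n ;; set_edge ;; run_piece ;; set_vertex ;; run_piece ;; CSkip)%cmd.

Definition has_piece (s : state) (P : piece) : Prop :=
  [/\ va s 11 = pcoef P & va s 12 = pX0 P] /\
  [/\ va s 13 = pX1 P, va s 14 = pY0 P, va s 15 = pw P, va s 16 = ph P & va s 17 = pc P].

Definition sz_piece (b : nat) (P : piece) : Prop :=
  [/\ sz b 1 (pcoef P), sz b 8 (pX0 P) & sz b 8 (pX1 P)] /\
  [/\ sz b 9 (pY0 P), sz b 8 (pw P), sz b 8 (ph P), sz b 17 (pc P) & 0 < pw P].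

Section Corner.
Variable b : nat.
Hypothesis b0 : (0 < b)%N.
Let L := (200 * b)%N.

Lemma sz_edge_piece m (x y : int * int) : sz b 8 m -> sz b 7 x.1 -> sz b 7 x.2 ->
  sz b 7 y.1 -> sz b 7 y.2 -> sz_piece b (edge_piece m x y).
Proof.
move=> sm x1 x2 y1 y2; rewrite /edge_piece; case: ifP => h1; [|case: ifP => h2].
- split; split=> /=; try by sz_auto.
  by [].
- split; split=> /=; try by sz_auto.
  by [].
- split; split=> /=; try by sz_auto.
  + by case: ifP => _; sz_auto.
  + by [].
Qed.

Lemma sz_vertex_piece (o x y : int * int) : sz b 7 x.1 -> sz b 7 x.2 ->
  sz_piece b (vertex_piece o x y).
Proof.
move=> x1 x2; split; split=> /=; try by sz_auto.
- by rewrite /vertex_weight; case: lex_sector; case: lexleft; apply: (@sz_const _ b0 1).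
- by [].
Qed.

Lemma set_edge_spec s m D Q (x y : int * int) : va s 10 = Q -> va s 1 = D -> Q * D = m ->
  va s 48 = x.1 -> va s 49 = x.2 -> va s 50 = y.1 -> va s 51 = y.2 ->
  sz b 8 m -> sz b 7 x.1 -> sz b 7 x.2 -> sz b 7 y.1 -> sz b 7 y.2 ->
  wp L set_edge s 14 (fun s' => has_piece s' (edge_piece m x y)).
Proof.
move=> h10 h1 Em h48 h49 h50 h51 sm x1 x2 y1 y2.
eapply wp_time.
  apply: (wp_if (T := 13)); rewrite /=; rwva => c1.
    eapply wp_time.
      asn (-1 : int); first by apply: (@bits_le 1) => //; clear -b0; lia.
      asn x.1; first by sz_auto.
      asn (y.1 - 1); first by sz_auto.
      asn (0 - m); [by rewrite Em|by sz_auto|].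
      asn (y.1 - x.1); first by sz_auto.
      asn (y.2 - x.2); first by sz_auto.
      asn ((y.1 - x.1) * x.2 - (y.2 - x.2) * x.1 - 1); first by sz_auto.
      by apply: wp_skip; rewrite /has_piece /edge_piece c1; split; split.
    by [].
  apply: (wp_if (T := 12)); rewrite /=; rwva => c2.
    eapply wp_time.
      asn (1 : int); first by sz_auto.
      asn y.1; first by sz_auto.
      asn (x.1 - 1); first by sz_auto.
      asn (0 - m); [by rewrite Em|by sz_auto|].
      asn (x.1 - y.1); first by sz_auto.
      asn (x.2 - y.2); first by sz_auto.
      asn ((x.1 - y.1) * x.2 - (x.2 - y.2) * x.1); first by sz_auto.
      by apply: wp_skip; rewrite /has_piece /edge_piece ltNge c1 c2; split; split.
    by [].
  eapply wp_time.
    eapply (wp_call (Q1 := fun s' => va s' 11 = if 0 < y.2 - x.2 then 1 else 0)).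
      apply: (wp_if (T := 2)); rewrite /=; rwva => c3.
        eapply wp_time.
          asn (1 : int) as R; first by sz_auto.
          by apply: wp_skip; rewrite R c3.
        by [].
      eapply wp_time.
        asn (0 : int) as R; first by sz_auto.
        by apply: wp_skip; rewrite R ltNge c3.
      by [].
    move=> s1 F /= V11; carry F.
    asn x.1; first by sz_auto.
    asn x.1; first by sz_auto.
    asn (x.2 + 1); first by sz_auto.
    asn (1 : int); first by sz_auto.
    asn (0 : int); first by sz_auto.
    asn y.2; first by sz_auto.
    by apply: wp_skip; rewrite /has_piece /edge_piece ltNge c1 ltNge c2; split; split.
  by [].
by [].
Qed.

Lemma set_lexleft_spec s i e1 e2 (u : int * int) : eval s e1 = u.1 -> eval s e2 = u.2 ->
  wp L (set_lexleft i e1 e2) s 5 (fun s' => va s' i = ind (lexleft u)).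
Proof.
move=> E1 E2; rewrite /lexleft.
have S0 : bits L 0 by sz_auto. have S1 : bits L 1 by sz_auto.
eapply wp_time.
  apply: (wp_if (T := 4)); rewrite /= E1 => h1.
    eapply wp_time; first by apply: (wp_asn (v := 1)) => // s' _ V; apply: wp_skip; rewrite V; have -> : u.1 < 0 by move: h1; clear; lia.
    by [].
  have -> : (u.1 < 0) = false by move: h1; clear; lia.
  apply: (wp_if (T := 3)); rewrite /= E1 => h2.
    eapply wp_time; first by apply: (wp_asn (v := 0)) => // s' _ V; apply: wp_skip; rewrite V; have -> : (u.1 == 0) = false by move: h2; clear; lia.
    by [].
  have -> : (u.1 == 0) = true by move: h1 h2; clear; lia.
  apply: (wp_if (T := 2)); rewrite /= E2 => h3.
    by eapply wp_time; first by apply: (wp_asn (v := 1)) => // s' _ V; apply: wp_skip; rewrite V h3.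
  by eapply wp_time; first by apply: (wp_asn (v := 0)) => // s' _ V; apply: wp_skip; rewrite V ltNge h3.
by [].
Qed.

Lemma set_vertex_spec s (o x y : int * int) :
  va s 46 = o.1 -> va s 47 = o.2 -> va s 48 = x.1 -> va s 49 = x.2 -> va s 50 = y.1 -> va s 51 = y.2 ->
  sz b 7 x.1 -> sz b 7 x.2 ->
  wp L set_vertex s 24 (fun s' => has_piece s' (vertex_piece o x y)).
Proof.
move=> h46 h47 h48 h49 h50 h51 x1 x2.
have S (z : int) : (absz z < 2)%N -> bits L z.
  by move=> hz; apply: (@bits_le 1) => //; clear -b0; rewrite /L; lia.
eapply wp_time.
  eapply wp_call.
    by apply: (@set_lexleft_spec _ _ _ _ (o - x)); rewrite /=; rwva.
  move=> s1 F /= V60; carry F.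
  eapply wp_call.
    by apply: (@set_lexleft_spec _ _ _ _ (y - x)); rewrite /=; rwva.
  move=> s2 F /= V61; carry F.
  eapply (wp_call (Q1 := fun s' => va s' 11 = vertex_weight o x y)).
    apply: (wp_if (T := 2)); rewrite /=; rwva => h.
      eapply wp_time.
        asn (vertex_weight o x y) as R.
        + rewrite /vertex_weight /lex_sector /cross /= h.
          by case: lexleft; case: lexleft.
        + by apply: S; rewrite /vertex_weight; case: lex_sector; case: lexleft.
        exact: wp_skip.
      by [].
    eapply wp_time.
      asn (vertex_weight o x y) as R.
      + rewrite /vertex_weight /lex_sector /cross /= ltNge h /=.
        by case: lexleft; case: lexleft.
      + by apply: S; rewrite /vertex_weight; case: lex_sector; case: lexleft.
      exact: wp_skip.
    by [].
  move=> s3 F /= V11; carry F.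
  asn x.1; first by sz_auto.
  asn x.1; first by sz_auto.
  asn x.2; first by sz_auto.
  asn (1 : int); first by sz_auto.
  asn (0 : int); first by sz_auto.
  asn x.2; first by sz_auto.
  by apply: wp_skip; rewrite /has_piece /vertex_piece; split; split.
by [].
Qed.

End Corner.

Section Corner.
Variable X : nat -> int.

Definition common_den (o a e : nat) : int :=
  X (4 * o).+1 * X (4 * o).+3 * X (4 * a).+1 * X (4 * a).+3 * X (4 * e).+1 * X (4 * e).+3.

Definition scaled (q : int) (i : nat) : int * int :=
  (X (4 * i)%N * (q %/ X (4 * i).+1)%Z, X (4 * i).+2 * (q %/ X (4 * i).+3)%Z).

Definition corner_edge (D : nat) (o a e : nat) : piece :=
  let q := common_den o a e in edge_piece (q * Posz D) (scaled q a) (scaled q e).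

Definition corner_vertex (o a e : nat) : piece :=
  let q := common_den o a e in vertex_piece (scaled q o) (scaled q a) (scaled q e).

Variables b k : nat.
Hypothesis b0 : (0 < b)%N.
Let L := (200 * b)%N.
Hypothesis sX : forall j, sz b 1 (X j).
Hypothesis sk : sz b 8 (Posz k).
Hypothesis X1 : forall j, (j < 2 * k)%N -> 0 < X (2 * j).+1.

Lemma load_vertex_spec s i j x y dx dy : va s i = Posz j -> ar s 0 = X -> sz b 10 (Posz j) ->
  uniq [:: i; x; y; dx; dy] ->
  wp L (load_vertex i x y dx dy) s 5 (fun s' => [/\ va s' x = X (4 * j)%N, va s' dx = X (4 * j).+1,
    va s' y = X (4 * j).+2 & va s' dy = X (4 * j).+3]).
Proof.
move=> hi A0 sj; rewrite /= !inE !negb_or => /and5P[/and4P[n1 n2 n3 n4] /and3P[n5 n6 n7] /andP[n8 n9] n10 _].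
have sj4 (e : nat) : (e <= 3)%N -> sz b 14 (Posz (4 * j + e)).
  move=> e3; rewrite PoszD PoszM; have h1 : sz b 3 (Posz 4) by apply: sz_const.
  have h2 : sz b 2 (Posz e) by apply: sz_const => //; apply: leq_ltn_trans e3 _.
  by sz_auto.
have ld v s1 e c T Q : (e <= 3)%N -> va s1 i = Posz j -> ar s1 0 = X ->
    (forall s', frame [:: v] [::] s1 s' -> va s' v = X (4 * j + e)%N -> wp L c s' T Q) ->
    wp L (CSeq (CLd v 0 (if e == 0 then EB OpMul (EC 4) (EV i) else EB OpAdd (EB OpMul (EC 4) (EV i)) (EC (Posz e)))) c) s1 T.+1 Q.
  move=> e3 hi1 A1 H; apply: (wp_ld (i := (4 * j + e)%N) (v := X (4 * j + e)%N)) => //.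
  - have -> : Posz (4 * j + e) = 4 * Posz j + Posz e by rewrite PoszD PoszM.
    by case: ifP => [/eqP ->|_]; rewrite /= hi1 ?addr0.
  - by apply: (bits_le _ (sj4 e e3)); rewrite leq_mul2r orbT.
  - by rewrite A1.
have fr v s1 s2 z w : frame [:: v] [::] s1 s2 -> va s1 z = w -> z != v -> va s2 z = w.
  by move=> [f _] <- h; apply: f; rewrite inE.
have fa v s1 s2 : frame [:: v] [::] s1 s2 -> ar s1 0 = X -> ar s2 0 = X.
  by move=> [_ f] <-; apply: f.
apply: (@ld x _ 0%N) => // s1 F1 V1; have i1 := fr _ _ _ _ _ F1 hi n1; have A1 := fa _ _ _ F1 A0.
apply: (@ld dx _ 1%N) => // s2 F2 V2; have i2 := fr _ _ _ _ _ F2 i1 n3; have A2 := fa _ _ _ F2 A1.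
apply: (@ld y _ 2%N) => // s3 F3 V3; have i3 := fr _ _ _ _ _ F3 i2 n2; have A3 := fa _ _ _ F3 A2.
apply: (@ld dy _ 3%N) => // s4 F4 V4; apply: wp_skip.
rewrite addn0 in V1; rewrite addn1 in V2; rewrite addn2 in V3; rewrite addn3 in V4.
have e1 := fr _ _ _ _ _ F4 (fr _ _ _ _ _ F3 (fr _ _ _ _ _ F2 V1 n6) n5) n7.
have n8' : dx != y by rewrite eq_sym.
have e2 := fr _ _ _ _ _ F4 (fr _ _ _ _ _ F3 V2 n8') n10.
have e3 := fr _ _ _ _ _ F4 V3 n9.
by split.
Qed.

Lemma den_pos i : (i < k)%N -> 0 < X (4 * i).+1 /\ 0 < X (4 * i).+3.
Proof.
move=> ik; split.
  have -> : (4 * i = 2 * (2 * i))%N by clear; lia.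
  by apply: X1; clear -ik; lia.
have -> : ((4 * i).+3 = (2 * (2 * i).+1).+1)%N by clear; lia.
by apply: X1; clear -ik; lia.
Qed.

Lemma common_den_pos o a e : (o < k)%N -> (a < k)%N -> (e < k)%N -> 0 < common_den o a e.
Proof.
by move=> /den_pos[p1 p2] /den_pos[p3 p4] /den_pos[p5 p6]; rewrite /common_den !mulr_gt0.
Qed.

Lemma sz_common_den o a e : sz b 6 (common_den o a e).
Proof.
have s1 := sX (4 * o).+1; have s2 := sX (4 * o).+3; have s3 := sX (4 * a).+1.
have s4 := sX (4 * a).+3; have s5 := sX (4 * e).+1; have s6 := sX (4 * e).+3.
by rewrite /common_den; sz_auto.
Qed.

Lemma sz_scaled q i : sz b 6 q -> sz b 7 (scaled q i).1 /\ sz b 7 (scaled q i).2.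
Proof.
move=> sq; have s1 := sX (4 * i)%N; have s2 := sX (4 * i).+2.
by split; rewrite /scaled /=; sz_auto.
Qed.

Lemma load_corner_spec s p n (o a e : nat) : (p, n) \in [:: (58, 59); (59, 58)]%N ->
  va s p = Posz o -> va s 7 = Posz a -> va s n = Posz e -> ar s 0 = X ->
  sz b 10 (Posz o) -> sz b 10 (Posz a) -> sz b 10 (Posz e) ->
  let q := common_den o a e in
  wp L (load_corner p n) s 23 (fun s' => [/\ va s' 10 = q,
    va s' 46 = (scaled q o).1 & va s' 47 = (scaled q o).2] /\
    [/\ va s' 48 = (scaled q a).1, va s' 49 = (scaled q a).2,
    va s' 50 = (scaled q e).1 & va s' 51 = (scaled q e).2]).
Proof.
move=> pn hp h7 hn A0 so sa se q.
have sq : sz b 6 q := sz_common_den o a e.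
have [t1 t2] := sz_scaled o sq; have [t3 t4] := sz_scaled a sq; have [t5 t6] := sz_scaled e sq.
have go p' n' : uniq [:: p'; 46; 47; 52; 53]%N -> uniq [:: n'; 50; 51; 56; 57]%N ->
    p' \notin [:: 48; 54; 49; 55]%N -> n' \notin [:: 46; 52; 47; 53; 48; 54; 49; 55]%N -> va s p' = Posz o -> va s n' = Posz e ->
    wp L (load_corner p' n') s 23 (fun s' => [/\ va s' 10 = q,
    va s' 46 = (scaled q o).1 & va s' 47 = (scaled q o).2] /\
    [/\ va s' 48 = (scaled q a).1, va s' 49 = (scaled q a).2,
    va s' 50 = (scaled q e).1 & va s' 51 = (scaled q e).2]); last first.
  by move: pn; rewrite !inE => /orP[] /eqP[e1 e2]; subst p n; apply: go.
move=> u1 u2 u3 u4 hp' hn'.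
eapply wp_time.
  eapply wp_call; first exact: (load_vertex_spec hp' A0 so u1).
  move=> s1 F /= [v1 v2 v3 v4].
  have hn1 : va s1 n' = Posz e.
    by apply: (frame_va F hn'); apply: contra u4; rewrite !inE => /or4P[] /eqP ->.
  clear hn' hp' hp hn; carry F.
  eapply wp_call; first by apply: (load_vertex_spec h7 A0 sa).
  move=> s2 F /= [v5 v6 v7 v8].
  have hn2 : va s2 n' = Posz e.
    by apply: (frame_va F hn1); apply: contra u4; rewrite !inE => /or4P[] /eqP ->.
  clear hn1; carry F.
  eapply wp_call; first exact: (load_vertex_spec hn2 A0 se u2).
  move=> s3 F /= [v9 v10 v11 v12]; clear hn2; carry F.
  asn q; first by sz_auto.
  asn (scaled q o).1; first by sz_auto.
  asn (scaled q o).2; first by sz_auto.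
  asn (scaled q a).1; first by sz_auto.
  asn (scaled q a).2; first by sz_auto.
  asn (scaled q e).1; first by sz_auto.
  asn (scaled q e).2; first by sz_auto.
  by apply: wp_skip.
by [].
Qed.

End Corner.

(** * The whole program and its number of steps *)

Definition orient_body (o : bool) : cmd := (
  58 ::= EV 7 [+] EV 2 [-] EC 1 ;; 58 ::= EV 58 [-] EV 58 [/] EV 2 [*] EV 2 ;;
  59 ::= EV 7 [+] EC 1 ;; 59 ::= EV 59 [-] EV 59 [/] EV 2 [*] EV 2 ;;
  corner_cmd (if o then 59 else 58) (if o then 58 else 59) ;;
  7 ::= EV 7 [+] EC 1 ;; CSkip)%cmd.

(** The direct counts include the origin with weight mu(d) for each d <= u^6, while the tail skips
    it. Hence M(u^6), the last entry of the table, is subtracted from the result. *)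
Definition orient_cmd (o : bool) : cmd := (
  7 ::= EC 0 ;; 8 ::= EC 0 ;; 9 ::= EC 0 ;; CWhile (EV 2 [-] EV 7) (orient_body o) ;;
  CLd 60 2 (EV 3) ;; CIf (EV 9) (0 ::= EV 8 [-] EV 60 ;; CSkip) CSkip ;; CSkip)%cmd.

Definition main_cmd : cmd := (
  bound_cmd ;; root_cmd ;; sieve_cmd ;; prefix_cmd ;; orient_cmd false ;; orient_cmd true ;; CSkip)%cmd.

Lemma modz_nat_sub (m n : nat) : Posz m - (Posz m %/ Posz n)%Z * Posz n = Posz (m %% n).
Proof. by rewrite -modz_nat. Qed.

(** There are at most u quotients. The grouped part costs about u^3 for each, and the rest costs x /
    (j u^3) for the j-th one, a harmonic sum of at most u^4 times 2 b. *)
Lemma mert_time_le b u D x : (0 < b)%N -> (0 < u)%N -> (D <= u ^ 7)%N -> sz b 2 (Posz D) -> (x <= D)%N ->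
  (mert_time (u ^ 6) (u ^ 3) x <= 60 * b * u ^ 4)%N.
Proof.
move=> b0 u0 Du sD xD; rewrite /mert_time; set J := (x %/ (u ^ 6).+1)%N.
have u1 : (1 <= u ^ 4)%N by rewrite expn_gt0 u0.
have xu : (x <= u ^ 7)%N := leq_trans xD Du.
have Ju : (J <= u)%N.
  rewrite /J -ltnS ltn_divLR //; apply: leq_ltn_trans xu _; rewrite expnS.
  by rewrite (@leq_ltn_trans (u * (u ^ 6).+1)) ?leq_mul2l ?leqnSn ?orbT // ltn_pmul2r.
have -> : (\sum_(0 <= i < J) (u ^ 3 * 5 + x %/ (J - i) %/ (u ^ 3).+1 * 9 + 20).+1 =
    J * (u ^ 3 * 5 + 21) + (\sum_(1 <= j < J.+1) (x %/ (u ^ 3).+1) %/ j) * 9)%N.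
  rewrite big_distrl /= -[X in (X * (_ + _))%N](subn0 J) -sum_nat_const_nat big_add1 /=.
  rewrite [X in _ = (_ + X)%N]big_nat_rev /= -big_split /= !big_nat; apply: eq_bigr => i iJ.
  by rewrite add0n -subnSK // divnAC; clear; lia.
have h1 : (\sum_(1 <= j < J.+1) (x %/ (u ^ 3).+1) %/ j <= (x %/ (u ^ 3).+1) * (2 * b))%N.
  apply: harmonic_bound; apply: leq_ltn_trans sD; apply: leq_trans xD; exact: leq_div.
have h2 : (x %/ (u ^ 3).+1 <= u ^ 4)%N.
  apply: (@leq_trans (x %/ u ^ 3)); first by apply: leq_div2l; rewrite ?expn_gt0 ?u0.
  have p0 : (0 < u ^ 3)%N by rewrite expn_gt0 u0.
  by rewrite -(leq_pmul2r p0) -expnD; apply: leq_trans (leq_divM _ _) xu.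
have h3 : (J * (u ^ 3 * 5 + 21) <= 26 * u ^ 4)%N.
  apply: (@leq_trans (u * (u ^ 3 * 26))); last by rewrite mulnA -expnS mulnC.
  by apply: leq_mul => //; rewrite (_ : 26 = 5 + 21)%N // mulnDr leq_add2l leq_pmull // expn_gt0 u0.
have h4 := leq_mul h2 (leqnn (2 * b)).
by move: (u ^ 4)%N (x %/ (u ^ 3).+1)%N h1 h2 h3 h4 u1 => U q; clear -b0; nia.
Qed.

Lemma sieve_time_le b Y : (0 < b)%N -> (0 < Y)%N -> sz b 12 (Posz Y) -> (sieve_time Y <= 72 * b * Y)%N.
Proof.
move=> b0 Y0 sY; rewrite /sieve_time.
have h : (\sum_(0 <= i < Y) ((Y %/ i.+1).-1 * 5 + 6).+1 <= (\sum_(1 <= j < Y.+1) Y %/ j) * 5 + Y * 7)%N.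
  rewrite big_distrl /= -[X in (X * 7)%N](subn0 Y) -sum_nat_const_nat big_add1 /=.
  rewrite -big_split /=; apply: leq_sum => i _.
  by have := leq_pred (Y %/ i.+1); move: (Y %/ i.+1).-1 (Y %/ i.+1)%N; clear; lia.
have := @harmonic_bound (12 * b) Y Y sY; move: h.
move: (\sum_(_ <= _ < _) _)%N (\sum_(_ <= _ < _) Y %/ _)%N => A B; clear -b0 Y0; nia.
Qed.

(** The tail computes two Mertens values, of about b u^4 steps each, at (2 u + 1)^2 points; the
    direct part makes u^6 counts of O(b) steps. The two are of the same order. *)
Lemma piece_time_le b u : (0 < b)%N -> (0 < u)%N ->
  (piece_time b u (u ^ 6) (60 * b * u ^ 4) <= 4000 * b * u ^ 6)%N.
Proof.
move=> b0 u0; rewrite /piece_time.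
have u1 : (u <= u ^ 4)%N by rewrite expnS leq_pmulr // expn_gt0 u0.
have uu : ((2 * u + 1) * (2 * u + 1) <= 9 * u ^ 2)%N by rewrite !expnS expn0 muln1; clear -u0; nia.
have E : (u ^ 6 = u ^ 2 * u ^ 4)%N by rewrite -expnD.
have u4 : (1 <= u ^ 4)%N by rewrite expn_gt0 u0.
have u2 : (u <= u ^ 2)%N by rewrite expnS leq_pmulr // expn_gt0 u0.
have h1 : (2 * (60 * b * u ^ 4) + 64 <= 184 * (b * u ^ 4))%N by move: (u ^ 4)%N u4; clear -b0; nia.
have h2 : ((2 * u + 1) * ((2 * u + 1) * (2 * (60 * b * u ^ 4) + 64)) <= 1656 * (b * u ^ 6))%N.
  rewrite mulnA; apply: leq_trans (leq_mul uu h1) _; rewrite E.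
  by move: (u ^ 2)%N (u ^ 4)%N; clear; lia.
have h3 : (2 * u + 1 <= 3 * u ^ 6)%N.
  have : (u <= u ^ 6)%N by rewrite expnS leq_pmulr // expn_gt0 u0.
  by move: (u ^ 6)%N; clear -u0; lia.
have u6 : (1 <= u ^ 6)%N by rewrite expn_gt0 u0.
rewrite [((2 * u + 1) * (_ + 10))%N]mulnDr.
move: ((2 * u + 1) * ((2 * u + 1) * _))%N h2 => A h2; move: (2 * u + 1)%N h3 => B h3.
have w1 : (u ^ 6 <= b * u ^ 6)%N by rewrite leq_pmull.
have w2 : (b <= b * u ^ 6)%N by rewrite leq_pmulr.
by move: (u ^ 6)%N u6 h2 h3 w1 w2 => U; clear -b0; lia.
Qed.

Section Main.
Variables (b k : nat) (X : nat -> int).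
Hypothesis b0 : (0 < b)%N.
Let L := (200 * b)%N.
Hypothesis sX : forall j, sz b 1 (X j).
Hypothesis k0 : (0 < k)%N.
Hypothesis sk : sz b 8 (Posz k).
Hypothesis X1 : forall j, (j < 2 * k)%N -> 0 < X (2 * j).+1.

Definition next_index i := (i.+1 %% k)%N.
Definition prev_index i := ((i + k).-1 %% k)%N.

Lemma next_lt i : (next_index i < k)%N. Proof. by rewrite ltn_mod. Qed.
Lemma prev_lt i : (prev_index i < k)%N. Proof. by rewrite ltn_mod. Qed.

Section Orient.
Variables (D u : nat).
Let Y := (u ^ 6)%N.
Let K := (u ^ 3)%N.
Let TB := (60 * b * u ^ 4)%N.
Hypothesis u0 : (0 < u)%N.
Hypothesis uD : (u <= D)%N.
Hypothesis Du : (D <= u ^ 7)%N.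
Hypothesis sD : sz b 2 (Posz D).

Definition run_T q (P : piece) := piece_T D u Y q (pcoef P) (pX0 P) (pX1 P) (pY0 P) (pw P) (ph P) (pc P).
Definition run_Z q (P : piece) := piece_Z D q (pcoef P) (pX0 P) (pX1 P) (pY0 P) (pw P) (ph P) (pc P).

Definition corner_T (o a e : nat) :=
  run_T (common_den X o a e) (corner_edge X D o a e) + run_T (common_den X o a e) (corner_vertex X o a e).
Definition corner_Z (o a e : nat) :=
  run_Z (common_den X o a e) (corner_edge X D o a e) + run_Z (common_den X o a e) (corner_vertex X o a e).

Let K0 : (0 < K)%N. Proof. by rewrite expn_gt0 u0. Qed.
Let KY : (K <= Y)%N. Proof. by rewrite leq_pexp2l. Qed.
Let su : sz b 2 (Posz u). Proof. exact: sz_nat_le sD uD. Qed.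
Let sY : sz b 12 (Posz Y).
Proof.
have -> : Posz Y = Posz u * Posz u * Posz u * Posz u * Posz u * Posz u.
  by rewrite /Y -!PoszM !expnS expn0 muln1 !mulnA.
by sz_auto.
Qed.
Let hTB x : (x <= D)%N -> (mert_time Y K x <= TB)%N.
Proof. exact: mert_time_le. Qed.

Definition input_ok (s : state) : Prop := va s 2 = Posz k /\ ar s 0 = X.

Lemma globals_frame ms am s s' : frame ms am s s' -> globals D u Y K s ->
  [&& 1 \notin ms, 3 \notin ms, 4 \notin ms & 5 \notin ms]%N -> (1 \notin am) && (2 \notin am) ->
  globals D u Y K s'.
Proof.
move=> [f1 f2] [[h1 h3 h4 h5] [hm hM]] /and4P[n1 n3 n4 n5] /andP[a1 a2].
by split; [split; rewrite f1|split=> i hi; rewrite f2 // ?hm ?hM].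
Qed.

Lemma corner_spec s p n (o a e : nat) T Z : (p, n) \in [:: (58, 59); (59, 58)]%N ->
  va s p = Posz o -> va s 7 = Posz a -> va s n = Posz e -> ar s 0 = X ->
  (o < k)%N -> (a < k)%N -> (e < k)%N -> globals D u Y K s ->
  va s 8 = T -> va s 9 = Z -> sz b 119 T -> sz b 119 Z ->
  wp L (corner_cmd p n) s (2 * piece_time b u Y TB + 62)
    (fun s' => va s' 8 = T + corner_T o a e /\ va s' 9 = Z + corner_Z o a e).
Proof.
move=> pn hp h7 hn A0 ok ak ek G h8 h9 sT sZ.
have so : sz b 10 (Posz o) by apply: (sz_le (e := 8)) => //; exact: (sz_nat_le sk (ltnW ok)).
have sa : sz b 10 (Posz a) by apply: (sz_le (e := 8)) => //; exact: (sz_nat_le sk (ltnW ak)).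
have se : sz b 10 (Posz e) by apply: (sz_le (e := 8)) => //; exact: (sz_nat_le sk (ltnW ek)).
have q0 := common_den_pos X1 ok ak ek; have sq := sz_common_den sX o a e.
rewrite /corner_T /corner_Z /corner_edge /corner_vertex; set q := common_den X o a e in q0 sq *.
have [t1 t2] := sz_scaled b0 sX o sq; have [t3 t4] := sz_scaled b0 sX a sq; have [t5 t6] := sz_scaled b0 sX e sq.
have sm : sz b 8 (q * Posz D) by sz_auto.
set eP := edge_piece _ _ _; set vP := vertex_piece _ _ _.
have [[e1 e2 e3] [e4 e5 e6 e7 e8]] : sz_piece b eP by exact: sz_edge_piece.
have [[v1 v2 v3] [v4 v5 v6 v7 v8]] : sz_piece b vP by exact: sz_vertex_piece.
have stT : sz b 110 (run_T q eP) by apply: (sz_piece_T b0 sY sD su).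
have stZ : sz b 73 (run_Z q eP) by apply: (sz_piece_Z b0 sD).
eapply wp_time.
  eapply wp_call; first exact: (load_corner_spec b0 sX pn hp h7 hn A0 so sa se).
  move=> s1 F [[g10 g46 g47] [g48 g49 g50 g51]].
  have G1 : globals D u Y K s1 by apply: (globals_frame F G).
  clear hp hn G; carry F.
  have h1 : va s1 1 = Posz D by case: G1 => [[]].
  eapply wp_call; first by apply: (set_edge_spec b0 (m := q * Posz D)); try eassumption.
  move=> s2 F hP; have G2 : globals D u Y K s2 by apply: (globals_frame F G1).
  clear G1 h1; carry F.
  eapply wp_call.
    apply: (run_piece_spec b0 K0 KY sY sD su hTB sq e1 e2 e3 e4 e5 e6 e7 q0 e8 G2 (T := T) (Z := Z)) => //.
    - by case: hP => [[? ?] [? ? ? ? ?]]; split; split.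
    - by sz_auto.
    - by sz_auto.
  move=> s3 F /= [W8 W9]; have G3 : globals D u Y K s3 by apply: (globals_frame F G2).
  clear G2 hP; carry F.
  eapply wp_call; first by apply: (set_vertex_spec b0); try eassumption.
  move=> s4 F hP; have G4 : globals D u Y K s4 by apply: (globals_frame F G3).
  clear G3; carry F.
  eapply wp_call; last by move=> s' _ q1; apply: wp_skip; exact: q1.
  apply: wp_weaken.
    apply: (run_piece_spec b0 K0 KY sY sD su hTB sq v1 v2 v3 v4 v5 v6 v7 q0 v8 G4 (T := T + run_T q eP) (Z := Z + run_Z q eP)) => //.
    - by case: hP => [[? ?] [? ? ? ? ?]]; split; split.
    - by sz_auto.
    - by sz_auto.
  by move=> s5 _ [-> ->]; rewrite !addrA.
by clear; lia.
Qed.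

Definition before (o : bool) i := if o then next_index i else prev_index i.
Definition after (o : bool) i := if o then prev_index i else next_index i.

Definition orient_T (o : bool) (n : nat) :=
  \sum_(0 <= i < n) corner_T (before o i) i (after o i).
Definition orient_Z (o : bool) (n : nat) :=
  \sum_(0 <= i < n) corner_Z (before o i) i (after o i).

Lemma sz_corner o a e : (o < k)%N -> (a < k)%N -> (e < k)%N ->
  sz b 111 (corner_T o a e) /\ sz b 111 (corner_Z o a e).
Proof.
move=> ok ak ek.
have q0 := common_den_pos X1 ok ak ek; have sq := sz_common_den sX o a e.
rewrite /corner_T /corner_Z /corner_edge /corner_vertex; set q := common_den X o a e in q0 sq *.
have [t1 t2] := sz_scaled b0 sX o sq; have [t3 t4] := sz_scaled b0 sX a sq; have [t5 t6] := sz_scaled b0 sX e sq.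
have sm : sz b 8 (q * Posz D) by sz_auto.
set eP := edge_piece _ _ _; set vP := vertex_piece _ _ _.
have [[e1 e2 e3] [e4 e5 e6 e7 e8]] : sz_piece b eP by exact: sz_edge_piece.
have [[v1 v2 v3] [v4 v5 v6 v7 v8]] : sz_piece b vP by exact: sz_vertex_piece.
have stT : sz b 110 (run_T q eP) by apply: (sz_piece_T b0 sY sD su).
have stZ : sz b 73 (run_Z q eP) by apply: (sz_piece_Z b0 sD).
have stT' : sz b 110 (run_T q vP) by apply: (sz_piece_T b0 sY sD su).
have stZ' : sz b 73 (run_Z q vP) by apply: (sz_piece_Z b0 sD).
by split; sz_auto.
Qed.

Lemma before_lt o i : (before o i < k)%N.
Proof. by rewrite /before; case: o; rewrite ?next_lt ?prev_lt. Qed.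

Lemma after_lt o i : (after o i < k)%N.
Proof. by rewrite /after; case: o; rewrite ?next_lt ?prev_lt. Qed.

Lemma sz_orient o n : (n <= k)%N -> sz b 119 (orient_T o n) /\ sz b 119 (orient_Z o n).
Proof.
move=> nk; split; (apply: (@sz_sum b 111 8) => [|i /andP[_ hi]];
  [by rewrite subn0; exact: leq_ltn_trans nk sk|]);
  by have [] := sz_corner (before_lt o i) (leq_trans hi nk) (after_lt o i).
Qed.

Definition orient_time : nat := (k * (2 * piece_time b u Y TB + 69) + 10)%N.

Lemma orient_spec o s v : input_ok s -> globals D u Y K s -> va s 0 = v ->
  wp L (orient_cmd o) s orient_time (fun s' =>
    va s' 0 = if 0 < orient_Z o k then orient_T o k - mertens Y else v).
Proof.
move=> [h2 A0] [[h1 h3 h4 h5] [hm hM]] h0; have [sT sZ] := sz_orient o (leqnn k).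
have A1 : ar s 1 = ar s 1 by []. move: {-1}(ar s 1) A1 hm => mt A1 hm.
have A2 : ar s 2 = ar s 2 by []. move: {-1}(ar s 2) A2 hM => M A2 hM.
have sMY : sz b 36 (mertens Y) := @sz_mertens b 12 _ sY.
eapply wp_time.
  rewrite /orient_cmd; asn (0 : int) as V7; first by sz_auto.
  asn (0 : int) as V8; first by sz_auto.
  asn (0 : int) as V9; first by sz_auto.
  eapply (wp_call (Q1 := fun s' => va s' 8 = orient_T o k /\ va s' 9 = orient_Z o k)).
    apply: (wp_loop (n := k) (t := (2 * piece_time b u Y TB + 68)%N)
      (I := fun j s' => [/\ va s' 7 = Posz j, va s' 8 = orient_T o j & va s' 9 = orient_Z o j])).
    - by rewrite V7 V8 V9 /orient_T /orient_Z !big_geq.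
    - move=> j s' jk F [g7 g8 g9]; carry F; rewrite /=; rwva; split.
        by rewrite subr_gt0 ltz_nat.
      have sj : sz b 8 (Posz j) := sz_nat_le sk (ltnW jk).
      have s58 : sz b 9 (Posz (j + k).-1).
        by apply: (@sz_nat_le _ 9 _ (j + k) _ (leq_pred _)); rewrite PoszD; sz_auto.
      have s59 : sz b 9 (Posz j.+1) by rewrite -addz1; sz_auto.
      have sp : sz b 8 (Posz (prev_index j)) := sz_nat_le sk (ltnW (prev_lt j)).
      have sn : sz b 8 (Posz (next_index j)) := sz_nat_le sk (ltnW (next_lt j)).
      have [sTj sZj] := sz_orient o (ltnW jk).
      eapply wp_time.
        asn (Posz (j + k).-1).
          by rewrite -PoszD -[in RHS](@addrK int 1 (Posz (j + k).-1)) addz1 prednK // addn_gt0 k0 orbT.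
          by sz_auto.
        asn (Posz (prev_index j)); [by rewrite modz_nat_sub|by sz_auto|].
        asn (Posz j.+1); [exact: addz1|by sz_auto|].
        asn (Posz (next_index j)); [by rewrite modz_nat_sub|by sz_auto|].
        eapply wp_call.
          apply: (@corner_spec _ (if o then 59 else 58) (if o then 58 else 59)
            (before o j) j (after o j) (orient_T o j) (orient_Z o j)) => //.
          + by case: (o).
          + by case: (o); rewrite /before; rwva.
          + by case: (o); rewrite /after; rwva.
          + exact: before_lt.
          + exact: after_lt.
          + by split; [split|split=> i hi; rewrite ?A1 ?A2 ?hm ?hM].
        move=> s1 F /= [W8 W9].
        have W7 : va s1 7 = Posz j by apply: (frame_va F); [eassumption|case: (o)].
        clear F.
        apply: (wp_asn (v := Posz j.+1)); [by rewrite /= W7 addz1|by sz_auto|].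
        move=> s2 F R; carry F; apply: wp_skip.
        by rewrite R W8 W9 /orient_T /orient_Z !big_nat_recr.
      by clear; lia.
    - move=> s' F [g7 g8 g9]; rewrite /= g7.
      have e2 : va s' 2 = Posz k by apply: (frame_va F); [eassumption|case: (o)].
      by rewrite e2 subrr.
  move=> s1 F /= [W8 W9].
  have e0 : va s1 0 = v by apply: (frame_va F); [eassumption|case: (o)].
  have e3 : va s1 3 = Posz Y by apply: (frame_va F); [eassumption|case: (o)].
  have e2 : ar s1 2 = M by apply: (frame_ar F); [eassumption|case: (o)].
  clear F V7 V8 V9 h2 h1 h3 h4 h5 h0 A0 A1 A2.
  apply: (wp_ld (i := Y) (v := mertens Y)); [by rewrite /= e3|by sz_auto|by rewrite e2 hM|].
  move=> s2 F V60; carry F.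
  eapply wp_call; last by move=> s' _ q1; apply: wp_skip; exact: q1.
  apply: (wp_if (T := 2)); rewrite /=; rwva => hz.
    eapply wp_time.
      asn (orient_T o k - mertens Y) as R; first by sz_auto.
      by apply: wp_skip; rewrite R hz.
    by [].
  eapply wp_time; first by apply: wp_skip; rewrite ltNge hz.
  by [].
by rewrite /orient_time; clear; lia.
Qed.

End Orient.

(** The orientation [true] is tried last and overwrites the output if it finds a positive weight at
    the origin; hence the form of the two implications. *)
Theorem main_spec s : input_ok s -> (forall j, ar s 1 j = 0) -> (forall j, ar s 2 j = 0) ->
  exists D u : nat, [/\ covered X (2 * k) (Posz D), attained k X (Posz D),
    [/\ (0 < D)%N, (0 < u)%N, (D <= u ^ 7)%N & u = 1%N \/ (u.-1 ^ 7 < D)%N] &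
    wp L main_cmd s (4500 * 4 * b * k * u ^ 6) (fun s' =>
      (0 < orient_Z D false k -> ~~ (0 < orient_Z D true k) ->
        va s' 0 = orient_T D u false k - mertens (u ^ 6)) /\
      (0 < orient_Z D true k -> va s' 0 = orient_T D u true k - mertens (u ^ 6)))].
Proof.
move=> [h2 A0] z1 z2.
have [s1 [n1 [x1 t1 [D [g1 /andP[D0 Db] cov att]]]]] := bound_spec b0 X1 sX sk h2 A0.
have F1 := hexec_frame x1.
have sD : sz b 2 (Posz D).
  by apply: leq_ltn_trans Db _; rewrite ltn_exp2l //; clear -b0; lia.
have [u [/andP[u0 uD] Du ul r2]] := root_spec b0 g1 D0 sD.
exists D, u; split=> //.
have su : sz b 2 (Posz u) := sz_nat_le sD uD.
have sY : sz b 12 (Posz (u ^ 6)).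
  have -> : Posz (u ^ 6) = Posz u * Posz u * Posz u * Posz u * Posz u * Posz u.
    by rewrite -!PoszM !expnS expn0 muln1 !mulnA.
  by sz_auto.
have Y0 : (0 < u ^ 6)%N by rewrite expn_gt0 u0.
have hS := sieve_time_le b0 Y0 sY.
have hP := piece_time_le b0 u0.
have F : frame (mods bound_cmd) (amods bound_cmd) s s1 := F1.
have B1 : forall j, ar s1 1 j = 0 by move=> j; rewrite (frame_ar F erefl).
have B2 : forall j, ar s1 2 j = 0 by move=> j; rewrite (frame_ar F erefl).
have A0' : ar s1 0 = X by apply: (frame_ar F A0).
have h2' : va s1 2 = Posz k by apply: (frame_va F h2).
clear F F1 z1 z2.
eapply wp_time.
  eapply wp_call; first by exists s1, n1; split; [exact: x1|exact: t1|exact: erefl].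
  move=> s1' _ e; subst s1'.
  eapply wp_call; first exact: r2.
  move=> s2 F /= [g5 g4 g3].
  have C1 : forall j, ar s2 1 j = 0 by move=> j; rewrite (frame_ar F erefl).
  have C2 : forall j, ar s2 2 j = 0 by move=> j; rewrite (frame_ar F erefl).
  carry F.
  eapply wp_call; first by apply: (sieve_spec b0 sY); eassumption.
  move=> s3 F /= m1.
  have E2 : forall j, ar s3 2 j = 0 by move=> j; rewrite (frame_ar F erefl).
  carry F.
  eapply wp_call; first by apply: (prefix_spec b0 sY); eassumption.
  move=> s4 F /= m2.
  have {}m1 : forall j, (0 < j <= u ^ 6)%N -> ar s4 1 j = mu j.
    by move=> j hj; rewrite (frame_ar F erefl) // m1.
  carry F.
  have G : globals D u (u ^ 6) (u ^ 3) s4 by [].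
  eapply wp_call; first by apply: (@orient_spec D u u0 uD Du sD false s4 _ _ G erefl).
  move=> s5 F /= W0.
  have G5 : globals D u (u ^ 6) (u ^ 3) s5 by apply: (globals_frame F G).
  clear G m1 m2; carry F.
  eapply wp_call; last by move=> s' _ q1; apply: wp_skip; exact: q1.
  apply: wp_weaken; first by apply: (@orient_spec D u u0 uD Du sD true s5 _ _ G5 erefl).
  move=> s6 _ R; rewrite R; split=> [hf /negbTE ht|->] //.
  by rewrite ht W0 hf.
rewrite /orient_time; move: (piece_time _ _ _ _) hP => P hP.
have uY : (u <= u ^ 6)%N by rewrite expnS leq_pmulr // expn_gt0 u0.
move: (u ^ 6)%N Y0 hS hP uY => U Y0 hS hP uY.
have w1 : (k * P <= k * (4000 * b * U))%N by rewrite leq_mul2l hP orbT.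
have w2 : (k <= k * (b * U))%N by rewrite leq_pmulr // muln_gt0 b0.
have w3 : (b * U <= k * (b * U))%N by rewrite leq_pmull.
have w4 : (U <= b * U)%N by rewrite leq_pmull.
have -> : (4500 * 4 * b * k * U = 4500 * 4 * (k * (b * U)))%N by clear; lia.
move: w1; have -> : (k * (4000 * b * U) = 4000 * (k * (b * U)))%N by clear; lia.
move: hS; have -> : (72 * b * U = 72 * (b * U))%N by clear; lia.
move: (sieve_time U) => S hS w1.
have -> : (k * (2 * P + 69) = 2 * (k * P) + 69 * k)%N by clear; lia.
move: (k * P)%N (k * (b * U))%N w1 w2 w3 => KP V w1 w2 w3.
move: (b * U)%N w3 w4 hS => W w3 w4 hS; clear -w1 w2 w3 w4 hS uY Y0 u0 k0.
by lia.
Qed.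

End Main.

(** * Counting lattice points with the Moebius function *)

Definition line_sum (N : nat) (G : int -> int) : int := \sum_(0 <= i < 2 * N + 1) G (coord N i).

Definition square_sum (N : nat) (F : int * int -> int) : int :=
  line_sum N (fun x => line_sum N (fun y => F (x, y))).

Lemma eq_line_sum N G H : (forall x : int, `|x| <= Posz N -> G x = H x) -> line_sum N G = line_sum N H.
Proof.
move=> GH; apply: eq_big_nat => i /andP[_ hi]; apply: GH; rewrite /coord.
by move: hi; clear; lia.
Qed.

Lemma eq_square_sum N F H : (forall z : int * int, `|z.1| <= Posz N -> `|z.2| <= Posz N -> F z = H z) ->
  square_sum N F = square_sum N H.
Proof. by move=> FH; apply: eq_line_sum => x hx; apply: eq_line_sum => y hy; exact: FH. Qed.

Lemma line_sumE N G : line_sum N G = G 0 + \sum_(1 <= n < N.+1) (G (Posz n) + G (- Posz n)).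
Proof.
elim: N => [|N IH]; first by rewrite /line_sum big_nat1 big_geq // addr0.
rewrite big_nat_recr //= addrA -IH /line_sum.
have -> : (2 * N.+1 + 1 = (2 * N + 1).+2)%N by clear; lia.
rewrite big_nat_recr //= big_nat_recl //=.
have -> : coord N.+1 0 = - Posz N.+1 by rewrite /coord sub0r.
have -> : coord N.+1 (2 * N + 1).+1 = Posz N.+1 by rewrite /coord; clear; lia.
rewrite (eq_bigr (fun i => G (coord N i))); first by ring.
by move=> i _; congr G; rewrite /coord; clear; lia.
Qed.

Lemma line_sum_mono N M G : (N <= M)%N -> (forall x : int, Posz N < `|x| -> G x = 0) ->
  line_sum M G = line_sum N G.
Proof.
move=> NM G0; rewrite !line_sumE (@big_cat_nat _ _ _ N.+1) //=.
rewrite [X in _ + (_ + X)]big_nat [X in _ + (_ + X)]big1 ?addr0 // => n /andP[nN _].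
by rewrite !G0 ?addr0 //; move: nN; clear; lia.
Qed.

(** Substitution n = d m; the values of m with d m > N contribute nothing because G vanishes
    there. *)
Lemma line_sum_dvd N d G : (0 < d)%N -> (forall x : int, Posz N < `|x| -> G x = 0) ->
  line_sum N (fun x => G (Posz d * x)) = line_sum N (fun x => ind (d %| absz x)%N * G x).
Proof.
move=> d0 G0; rewrite !line_sumE mulr0 dvdn0 mul1r; congr (_ + _).
pose H n := G (Posz n) + G (- Posz n).
transitivity (\sum_(1 <= m < N.+1) \sum_(1 <= n < N.+1) ind (n == d * m)%N * H n).
  apply: eq_big_nat => m /andP[m0 mN]; have dm : (0 < d * m)%N by rewrite muln_gt0 d0.
  have [h|h] := leqP (d * m) N.
    rewrite (bigD1_seq (d * m)%N) ?iota_uniq ?mem_index_iota ?dm //= eqxx mul1r.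
    rewrite big1 ?addr0 => [|n /negbTE ->]; last by rewrite mul0r.
    by rewrite /H PoszM mulrN.
  rewrite big1_seq => [|n /andP[_]].
    by rewrite !G0 ?addr0 //; move: h; rewrite -?PoszM; clear; lia.
  rewrite mem_index_iota => /andP[_ hn]; case: eqP => [e|]; last by rewrite mul0r.
  by move: hn; rewrite e ltnS leqNgt h.
rewrite exchange_big_nat /=; apply: eq_big_nat => n /andP[n0 nN].
rewrite -mulr_suml abszN absz_nat -mulrDr; congr (_ * _).
have [/dvdnP[q E]|nd] := boolP (d %| n)%N.
  have q0 : (0 < q)%N by case: q E => // E; rewrite E in n0.
  have qN : (q < N.+1)%N by apply: leq_ltn_trans nN; rewrite E leq_pmulr.
  rewrite (bigD1_seq q) ?iota_uniq ?mem_index_iota ?q0 //= E mulnC eqxx.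
  rewrite big1 ?addr0 // => m mq; case: eqP => // /eqP; rewrite eqn_pmul2l // => /eqP e.
  by rewrite e eqxx in mq.
rewrite big1 // => m _; case: eqP => // e; by rewrite e dvdn_mulr in nd.
Qed.

Definition outside (N : nat) (z : int * int) : Prop := (Posz N < `|z.1|) || (Posz N < `|z.2|).

Lemma line_sum0 N : line_sum N (fun=> 0) = 0.
Proof. by rewrite /line_sum big1. Qed.

Lemma square_sum_mono N M F : (N <= M)%N -> (forall z, outside N z -> F z = 0) ->
  square_sum M F = square_sum N F.
Proof.
move=> NM F0; rewrite /square_sum (line_sum_mono NM); last first.
  by move=> x hx; rewrite -[RHS](line_sum0 M); apply: eq_line_sum => y _; apply: F0; rewrite /outside /= hx.
by apply: eq_line_sum => x _; apply: line_sum_mono => // y hy; apply: F0; rewrite /outside /= hy orbT.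
Qed.

Lemma square_sum_dvd N d F : (0 < d)%N -> (forall z, outside N z -> F z = 0) ->
  square_sum N (fun z => F (zscale (Posz d) z)) =
  square_sum N (fun z => ind (d %| gcdn (absz z.1) (absz z.2))%N * F z).
Proof.
move=> d0 F0; rewrite /square_sum /zscale /=.
transitivity (line_sum N (fun x => ind (d %| absz x)%N * line_sum N (fun y => F (x, Posz d * y)))).
  rewrite -(line_sum_dvd (G := fun x => line_sum N (fun y => F (x, Posz d * y))) d0) // => x hx.
  by rewrite -[RHS](line_sum0 N); apply: eq_line_sum => y _; apply: F0; rewrite /outside /= hx.
apply: eq_line_sum => x _.
rewrite (line_sum_dvd (G := fun y => F (x, y)) d0); last first.
  by move=> y hy; apply: F0; rewrite /outside /= hy orbT.
rewrite /line_sum mulr_sumr; apply: eq_bigr => i _.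
by rewrite dvdn_gcd; case: (d %| _)%N; case: (d %| _)%N; rewrite ?mul0r ?mul1r.
Qed.

Lemma exchange_square_sum N m n (F : nat -> int * int -> int) :
  \sum_(m <= d < n) square_sum N (F d) = square_sum N (fun z => \sum_(m <= d < n) F d z).
Proof.
rewrite /square_sum /line_sum exchange_big_nat /=; apply: eq_bigr => i _.
by rewrite exchange_big_nat.
Qed.

Lemma mulr_square_sum N c F : c * square_sum N F = square_sum N (fun z => c * F z).
Proof. by rewrite /square_sum /line_sum mulr_sumr; apply: eq_bigr => i _; rewrite mulr_sumr. Qed.

Lemma square_sumD N F G : square_sum N F + square_sum N G = square_sum N (fun z => F z + G z).
Proof. by rewrite /square_sum /line_sum -big_split; apply: eq_bigr => i _; rewrite -big_split. Qed.

Definition nonzero (F : int * int -> int) (z : int * int) : int := if z == 0 then 0 else F z.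

Lemma line_sum_ind0 N c : line_sum N (fun x => ind (x == 0) * c) = c.
Proof.
rewrite line_sumE eqxx mul1r big_nat big1 ?addr0 // => n /andP[n0 _].
by rewrite oppr_eq0; case: n n0 => // n _; rewrite !mul0r.
Qed.

Lemma square_sum_nonzero N F : square_sum N F = F 0 + square_sum N (nonzero F).
Proof.
have -> : F 0 = square_sum N (fun z => ind (z == 0) * F 0).
  rewrite /square_sum -[LHS](line_sum_ind0 N (F 0)); apply: eq_line_sum => x _.
  rewrite -[in LHS](line_sum_ind0 N (F 0)) {1}/line_sum mulr_sumr; apply: eq_bigr => i _.
  have -> : ((x, coord N i) == 0) = (x == 0) && (coord N i == 0) by [].
  by case: (x == 0); case: (coord N i == 0); rewrite ?mul0r ?mul1r.
rewrite square_sumD; apply: eq_square_sum => z _ _; rewrite /nonzero.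
by case: eqP => [->|_]; rewrite ?mul1r ?addr0 ?mul0r ?add0r.
Qed.

Lemma outside_scale_big D d z : (D < d)%N -> z != 0 -> outside D (zscale (Posz d) z).
Proof.
case: z => x y dD; rewrite /outside /zscale /= => z0.
have /orP[h|h] : (x != 0) || (y != 0) by rewrite -negb_and.
  by apply/orP; left; rewrite normrM; nia.
by apply/orP; right; rewrite normrM; nia.
Qed.

Section Mobius.
Variables (D u Y : nat).
Hypothesis YE : Y = (u ^ 6)%N.
Hypothesis Du : (D <= u ^ 7)%N.
Hypothesis uD : (u <= D)%N.

Definition mobius_sum (f : int * int -> int) : int :=
  \sum_(1 <= d < Y.+1) mu d * square_sum D (fun z => f (zscale (Posz d) z)) +
  square_sum u (nonzero (fun z => \sum_(Y.+1 <= d < D.+1) mu d * f (zscale (Posz d) z))).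

Variable f : int * int -> int.
Hypothesis f0 : forall z, outside D z -> f z = 0.

Lemma nonzero_scale d z : (0 < d)%N -> nonzero (fun z => f (zscale (Posz d) z)) z = nonzero f (zscale (Posz d) z).
Proof.
move=> d0; rewrite /nonzero; have -> // : (zscale (Posz d) z == 0) = (z == 0).
case: z => x y; rewrite /zscale /=.
have -> : ((Posz d * x, Posz d * y) == 0) = (Posz d * x == 0) && (Posz d * y == 0) by [].
have -> : ((x, y) == 0) = (x == 0) && (y == 0) by [].
have d1 : (Posz d == 0) = false by case: d d0.
by rewrite !mulf_eq0 d1.
Qed.

(** With g(d) the sum of f(d z) over z <> 0, the direct part gives mu(d) g(d) plus mu(d) f(0), the
    tail gives mu(d) g(d). Collecting the terms by the point d z leaves the sum of mu over the
    divisors of its gcd. *)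
Theorem mobius_sumE : mobius_sum f - mertens Y * f 0 =
  square_sum D (fun z => ind (gcdn (absz z.1) (absz z.2) == 1)%N * f z).
Proof.
pose g d := square_sum D (nonzero (fun z => f (zscale (Posz d) z))).
have g0 d : (D < d)%N -> g d = 0.
  move=> dD; rewrite -[RHS](mul0r (square_sum D (fun=> 0))) mulr_square_sum.
  apply: eq_square_sum => z _ _; rewrite /nonzero mul0r; case: eqP => // /eqP z0.
  by rewrite f0 //; exact: outside_scale_big.
have E1 : \sum_(1 <= d < Y.+1) mu d * square_sum D (fun z => f (zscale (Posz d) z)) =
    mertens Y * f 0 + \sum_(1 <= d < Y.+1) mu d * g d.
  rewrite /mertens mulr_suml -big_split /=; apply: eq_bigr => d _.
  by rewrite square_sum_nonzero mulrDr; congr (_ * f _ + _); rewrite /zscale /= mulr0.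
have E2 : square_sum u (nonzero (fun z => \sum_(Y.+1 <= d < D.+1) mu d * f (zscale (Posz d) z))) =
    \sum_(Y.+1 <= d < D.+1) mu d * g d.
  transitivity (square_sum D (nonzero (fun z => \sum_(Y.+1 <= d < D.+1) mu d * f (zscale (Posz d) z)))).
    apply/esym/square_sum_mono => // z hz; rewrite /nonzero; case: eqP => // _.
    rewrite big_nat big1 // => d /andP[Yd _]; rewrite f0 ?mulr0 //.
    move: hz; rewrite /outside /zscale /= !normrM.
    (* A point z with a coordinate of absolute value at least u + 1 is carried outside by any d > Y,
       since Y u = u^7 >= D. *)
    have : (D < d * u.+1)%N.
      apply: leq_ltn_trans Du _; rewrite expnSr -YE.
      by apply: (@leq_ltn_trans (Y * u.+1)); [rewrite leq_mul2l leqnSn orbT|rewrite ltn_pmul2r].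
    move=> h /orP[h1|h1]; apply/orP; [left|right].
      by move: (z.1) h h1; clear => x; nia.
    by move: (z.2) h h1; clear => x; nia.
  under [RHS]eq_bigr do rewrite mulr_square_sum.
  rewrite exchange_square_sum; apply: eq_square_sum => z _ _; rewrite /nonzero.
  by case: eqP => // _; rewrite big1 // => d _; rewrite mulr0.
transitivity (\sum_(1 <= d < Y.+1) mu d * g d + \sum_(Y.+1 <= d < D.+1) mu d * g d).
  by rewrite /mobius_sum E1 E2; ring.
have E3 : \sum_(1 <= d < Y.+1) mu d * g d + \sum_(Y.+1 <= d < D.+1) mu d * g d =
    \sum_(1 <= d < D.+1) mu d * g d.
  have [YD|DY] := leqP Y D; first by rewrite -big_cat_nat.
  rewrite [X in _ + X]big_geq ?addr0; last by rewrite ltnS ltnW.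
  rewrite (@big_cat_nat _ _ _ D.+1) //= ?ltnS 1?ltnW // [X in _ + X]big_nat.
  by rewrite [X in _ + X]big1 ?addr0 // => d /andP[dD _]; rewrite g0 // mulr0.
rewrite E3.
have fz z : outside D z -> nonzero f z = 0 by move=> hz; rewrite /nonzero f0 //; case: eqP.
rewrite (eq_big_nat _ _ (F2 := fun d => square_sum D (fun z =>
  mu d * (ind (d %| gcdn (absz z.1) (absz z.2))%N * nonzero f z)))); last first.
  move=> d /andP[d0 _]; rewrite -mulr_square_sum -square_sum_dvd //; congr (_ * _).
  by apply: eq_square_sum => z _ _; exact: nonzero_scale.
rewrite exchange_square_sum; apply: eq_square_sum => z z1 z2.
rewrite /nonzero; case: eqP => [->|/eqP z0].
  by rewrite big1 ?gcd0n ?mul0r // => d _; rewrite !mulr0.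
have n0 : (0 < gcdn (absz z.1) (absz z.2))%N.
  case: z z0 {z1 z2} => x y; have -> : ((x, y) == 0) = (x == 0) && (y == 0) by [].
  by rewrite gcdn_gt0 !absz_gt0 negb_and.
have nD : (gcdn (absz z.1) (absz z.2) <= D)%N.
  case: (posnP (absz z.1)) => h.
    by rewrite h gcd0n; move: z2; clear; lia.
  by apply: leq_trans (dvdn_leq h (dvdn_gcdl _ _)) _; move: z1; clear; lia.
move: (gcdn _ _) n0 nD => n n0 nD.
rewrite -sum_mu // mulr_suml (@big_cat_nat _ _ _ n.+1) //= [X in _ + X]big_nat.
rewrite [X in _ + X]big1 ?addr0 => [|d /andP[nd _]]; last by rewrite gtnNdvd // mul0r mulr0.
by apply: eq_bigr => d _; rewrite mulrA [mu d * _]mulrC.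
Qed.

End Mobius.

(** * Pieces as weight functions on the lattice *)

Definition inside_piece (P : piece) (p : int * int) : bool :=
  in_piece (pX0 P) (pX1 P) (pY0 P) (pw P) (ph P) (pc P) p.

Definition piece_weight (P : piece) (p : int * int) : int := pcoef P * ind (inside_piece P p).

Definition in_box (m : int) (P : piece) : Prop :=
  [/\ - m <= pX0 P, pX1 P <= m & forall p, inside_piece P p -> - m <= p.2 <= m].

(* Every column of the piece reaches at least up to height [pY0 P - 1]. *)
Definition full_columns (P : piece) : Prop := pcoef P = 0 \/
  forall x, pX0 P <= x <= pX1 P -> (pY0 P - 1) * pw P <= pc P + ph P * x.

Lemma line_sum_itv D (F : int -> int) (lo hi : int) : (lo <= hi -> - Posz D <= lo /\ hi <= Posz D) ->
  line_sum D (fun x => if lo <= x <= hi then F x else 0) =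
  if 0 < hi - lo + 1 then \sum_(0 <= t < absz (hi - lo + 1)) F (lo + Posz t) else 0.
Proof.
move=> h; case: ifP => hl; last first.
  rewrite -[RHS](line_sum0 D); apply: eq_line_sum => x _; case: ifP => // /andP[h1 h2].
  by move: (le_trans h1 h2) hl; clear; lia.
have [h1 h2] : - Posz D <= lo /\ hi <= Posz D by apply: h; move: hl; clear; lia.
pose i0 := absz (lo + Posz D); pose n := absz (hi - lo + 1).
have e0 : Posz i0 = lo + Posz D by rewrite /i0; move: h1; clear; lia.
have en : Posz n = hi - lo + 1 by rewrite /n; move: hl; clear; lia.
rewrite -/n /line_sum (@big_cat_nat _ _ _ i0) //=; last by move: e0 en h2; clear; lia.
rewrite [X in X + _]big_nat [X in X + _]big1 ?add0r; last first.
  move=> i /andP[_ hi0]; case: ifP => // /andP[h3 _]; move: hi0 h3 e0; rewrite /coord; clear; lia.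
rewrite (@big_cat_nat _ _ _ (i0 + n)) //=; [|exact: leq_addr|by move: e0 en h2; clear; lia].
rewrite [X in _ + X]big_nat [X in _ + X]big1 ?addr0; last first.
  move=> i /andP[hi0 _]; case: ifP => // /andP[_ h3]; move: hi0 h3 e0 en; rewrite /coord; clear; lia.
have shift (G : nat -> int) : \sum_(i0 <= i < i0 + n) G i = \sum_(0 <= t < n) G (t + i0)%N.
  by rewrite -[in LHS](add0n i0) big_addn add0n addKn.
rewrite shift; apply: eq_big_nat => t /andP[_ tn].
have -> : coord D (t + i0) = lo + Posz t by rewrite /coord PoszD e0; clear; lia.
by case: ifP => //; move: tn en; clear; lia.
Qed.

Lemma line_sum_count D (lo hi : int) : (lo <= hi -> - Posz D <= lo /\ hi <= Posz D) -> lo <= hi + 1 ->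
  line_sum D (fun x => ind (lo <= x <= hi)) = hi - lo + 1.
Proof.
move=> h lh; transitivity (line_sum D (fun x => if lo <= x <= hi then 1 else 0)).
  by apply: eq_line_sum => x _; case: ifP.
rewrite line_sum_itv //; case: ifP => hl; last by move: hl lh; clear; lia.
by rewrite sumr_const_nat subn0 natz gtz0_abs.
Qed.

Lemma le_ceil (g X x : int) : 0 < g -> (X <= g * x) = (0 - ((0 - X) %/ g)%Z <= x).
Proof.
move=> g0; rewrite -(lerN2 x) -{1}(opprK X) lerNl sub0r sub0r -mulrN opprK.
by rewrite mulrC -lez_divRL //.
Qed.

(** [count_points] adds the number of points of each column by a formula that is right only if it is
    not negative. [full_columns] ensures this: the top of a column is at least one step below the
    first admissible multiple of g. *)
Lemma count_points_sum P m g D : in_box m P -> full_columns P -> 0 < pw P -> 0 < g ->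
  m <= g * Posz D ->
  pcoef P * count_points g (pX0 P) (pX1 P) (pY0 P) (pw P) (ph P) (pc P) =
  square_sum D (fun z => piece_weight P (zscale g z)).
Proof.
case: P => coef X0 X1 Y0 w h c; rewrite /in_box /full_columns /piece_weight /inside_piece /=.
move=> [b1 b2 b3] full w0 g0 mg; rewrite -mulr_square_sum.
case: full => [->|full]; first by rewrite !mul0r.
congr (_ * _); rewrite /count_points.
set x0 := 0 - ((0 - X0) %/ g)%Z; set y0 := 0 - ((0 - Y0) %/ g)%Z.
have gx x : (X0 <= g * x) = (x0 <= x) := le_ceil X0 x g0.
have gy y : (Y0 <= g * y) = (y0 <= y) := le_ceil Y0 y g0.
have gx1 x : (g * x <= X1) = (x <= (X1 %/ g)%Z) by rewrite lez_divRL // mulrC.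
pose top x := ((h * g * x + (c)) %/ (g * w))%Z.
have gw0 : 0 < g * w by rewrite mulr_gt0.
have gtop x y : (w * (g * y) - h * (g * x) <= c) = (y <= top x).
  by rewrite /top lez_divRL // lerBlDr; congr (_ <= _); ring.
have box1 (x : int) : - m <= g * x -> - Posz D <= x by nia.
have box2 (x : int) : g * x <= m -> x <= Posz D by nia.
have col x : x0 <= x <= (X1 %/ g)%Z ->
    line_sum D (fun y => ind (in_piece X0 X1 Y0 w h c (g * x, g * y))) = top x + (1 + ((0 - Y0) %/ g)%Z).
  rewrite -gx -gx1 => /andP[h1 h2].
  have bnd y : y0 <= y <= top x -> - Posz D <= y /\ y <= Posz D.
    rewrite -gy -gtop => /andP[h3 h4].
    have /andP[h5 h6] := b3 (g * x, g * y) (introT and4P (And4 h1 h2 h3 h4)).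
    by split; [exact: box1|exact: box2].
  rewrite (_ : top x + _ = top x - y0 + 1); last by rewrite /y0; ring.
  rewrite -(@line_sum_count D y0 (top x)).
  - apply: eq_line_sum => y _; rewrite /in_piece /= h1 h2 /= gy; congr ind.
    by rewrite -gtop.
  - move=> l; split.
      by have [] := bnd y0; rewrite ?lexx ?l.
    by have [] := bnd (top x); rewrite ?lexx ?l.
  - have H := full (g * x) (introT andP (conj h1 h2)).
    have ny : g * (y0 - 1) < Y0.
      by rewrite ltNge gy -ltNge; clear; lia.
    have : y0 - 1 <= top x; last by clear; lia.
    rewrite -gtop; have : w * (g * (y0 - 1)) <= w * (Y0 - 1).
      by rewrite ler_pM2l //; move: ny; clear; lia.
    by move: H; rewrite [(Y0 - 1) * w]mulrC; clear; lia.
rewrite /square_sum /zscale /=.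
transitivity (line_sum D (fun x => if x0 <= x <= (X1 %/ g)%Z then
    top x + (1 + ((0 - Y0) %/ g)%Z) else 0)); last first.
  apply: eq_line_sum => x _; case: ifP => hx; first by rewrite col.
  rewrite -[LHS](line_sum0 D); apply: eq_line_sum => y _.
  rewrite /in_piece /= gx gx1; have -> // : [&& x0 <= x, x <= (X1 %/ g)%Z, Y0 <= g * y & w * (g * y) - h * (g * x) <= c] = false.
  by rewrite andbA hx.
rewrite line_sum_itv; last first.
  move=> l; split; [apply: box1|apply: box2].
    have : X0 <= g * x0 by rewrite gx lexx.
    by move: b1; clear; lia.
  have : g * (X1 %/ g)%Z <= X1 by rewrite gx1 lexx.
  by move: b2; clear; lia.
case: ifP => // hn; rewrite big_split /= sumr_const_nat subn0; congr (_ + _).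
  rewrite /floor_sum; apply: eq_bigr => t _; rewrite /top; congr divz; ring.
rewrite -mulr_natr mulrC; congr (_ * _).
by rewrite natz gtz0_abs.
Qed.

Lemma edge_piece_weight m a e p : - m <= p.2 -> piece_weight (edge_piece m a e) p = edge_weight a e p.
Proof.
move=> hp; rewrite /piece_weight /edge_piece /edge_weight /inside_piece /in_piece subr_gt0.
have E w h : w * p.2 - h * p.1 - (w * a.2 - h * a.1) = w * (p.2 - a.2) - h * (p.1 - a.1) by ring.
have [h1|h1] := ltP a.1 e.1.
  rewrite /= mulN1r sub0r hp /=; congr (- ind [&& _, _ & _]).
    by clear; lia.
  by rewrite /cross /=; move: (E (e.1 - a.1) (e.2 - a.2)); clear; lia.
rewrite subr_gt0; have [h2|h2] := ltP e.1 a.1.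
  rewrite /= mul1r sub0r hp /=; congr (ind [&& _, _ & _]).
    by clear; lia.
  rewrite /cross.
  have -> : (e - a).1 * (p - a).2 - (e - a).2 * (p - a).1 =
    - ((a.1 - e.1) * (p.2 - a.2) - (a.2 - e.2) * (p.1 - a.1)) by rewrite /=; ring.
  by rewrite oppr_ge0 -E subr_le0.
rewrite /= subr_gt0 mul1r mul0r subr0; have [h3|h3] := ltP a.2 e.2.
  by rewrite mul1r; congr ind; clear -h1 h2; lia.
rewrite mul0r; have -> // : [&& p.1 == a.1, a.2 < p.2 & p.2 <= e.2] = false.
by clear -h3; lia.
Qed.

Lemma vertex_piece_weight o a e p : piece_weight (vertex_piece o a e) p = vertex_weight o a e * ind (p == a).
Proof.
rewrite /piece_weight /inside_piece /in_piece /= mul1r mul0r subr0; congr (_ * ind _).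
by case: p a => p1 p2 [a1 a2]; have -> : ((p1, p2) == (a1, a2)) = (p1 == a1) && (p2 == a2) by []; rewrite /=; clear; lia.
Qed.

Definition square (m : int) (p : int * int) : Prop := - m <= p.1 <= m /\ - m <= p.2 <= m.

(** Above x the edge has a height that is a convex combination of the heights of its end points,
    with weights proportional to the distances of x from the two ends. This bounds the piece from
    above and keeps all its columns full. *)
Lemma edge_piece_box m a e : square m a -> square m e ->
  in_box m (edge_piece m a e) /\ full_columns (edge_piece m a e).
Proof.
case: a e => a1 a2 [e1 e2] [/= /andP[p1 p2] /andP[p3 p4]] [/= /andP[q1 q2] /andP[q3 q4]].
rewrite /edge_piece /=; case: ifP => h1; [|case: ifP => h2].
- split.
    split=> /=; [lia|lia|] => -[x y]; rewrite /inside_piece /in_piece /= => /and4P[r1 r2 r3 r4].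
    have t0 : 0 <= x - a1 by lia.
    have s0 : 0 <= e1 - x by lia.
    have k1 : (x - a1) * e2 <= (x - a1) * m by rewrite ler_wpM2l.
    have k2 : (e1 - x) * a2 <= (e1 - x) * m by rewrite ler_wpM2l.
    have k3 : (e1 - a1) * y < (e1 - a1) * m by lia.
    by rewrite ltr_pM2l // in k3; lia.
  right=> /= x /andP[r1 r2].
  have t0 : 0 <= x - a1 by lia.
  have s0 : 0 <= e1 - x by lia.
  have k1 : (x - a1) * (- m) <= (x - a1) * e2 by rewrite ler_wpM2l.
  have k2 : (e1 - x) * (- m) <= (e1 - x) * a2 by rewrite ler_wpM2l.
  by lia.
- split.
    split=> /=; [lia|lia|] => -[x y]; rewrite /inside_piece /in_piece /= => /and4P[r1 r2 r3 r4].
    have t0 : 0 <= x - e1 by lia.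
    have s0 : 0 <= a1 - x by lia.
    have k1 : (x - e1) * a2 <= (x - e1) * m by rewrite ler_wpM2l.
    have k2 : (a1 - x) * e2 <= (a1 - x) * m by rewrite ler_wpM2l.
    have k3 : (a1 - e1) * y <= (a1 - e1) * m by lia.
    by rewrite ler_pM2l // in k3; lia.
  right=> /= x /andP[r1 r2].
  have t0 : 0 <= x - e1 by lia.
  have s0 : 0 <= a1 - x by lia.
  have k1 : (x - e1) * (- m) <= (x - e1) * a2 by rewrite ler_wpM2l.
  have k2 : (a1 - x) * (- m) <= (a1 - x) * e2 by rewrite ler_wpM2l.
  by lia.
- split.
    by split=> /=; [lia|lia|] => -[x y]; rewrite /inside_piece /in_piece /= => /and4P[r1 r2 r3 r4]; lia.
  rewrite /full_columns /=; case: ifP => h3; [right|by left].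
  by move=> x _; lia.
Qed.

Lemma vertex_piece_box m o a e : square m a ->
  in_box m (vertex_piece o a e) /\ full_columns (vertex_piece o a e).
Proof.
case: a => a1 a2 [/= /andP[p1 p2] /andP[p3 p4]]; split.
  by split=> //= -[x y]; rewrite /inside_piece /in_piece /= => /and4P[r1 r2 r3 r4]; lia.
by right=> /= x _; lia.
Qed.

Lemma square_sum_big N (I : Type) (r : seq I) (F : I -> int * int -> int) :
  \sum_(i <- r) square_sum N (F i) = square_sum N (fun z => \sum_(i <- r) F i z).
Proof.
rewrite /square_sum /line_sum exchange_big /=; apply: eq_bigr => i _.
by rewrite exchange_big.
Qed.

Lemma zscaleM q d z : zscale (q * d) z = zscale q (zscale d z).
Proof. by rewrite /zscale /= !mulrA. Qed.

Lemma zscale0 q : zscale q 0 = 0.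
Proof. by rewrite /zscale /= mulr0. Qed.

Lemma nonzero_sq (z : int * int) : (0 < z.1 * z.1 + z.2 * z.2) = (z != 0).
Proof.
case: z => x y /=; have -> : ((x, y) == 0) = (x == 0) && (y == 0) by [].
rewrite lt_neqAle eq_sym addr_ge0 ?andbT -?expr2 ?sqr_ge0 //.
by rewrite paddr_eq0 ?sqr_ge0 // !expf_eq0.
Qed.

Section Mobius.
Variables (D u : nat).
Let Y := (u ^ 6)%N.

Lemma eq_mobius_sum f g : f =1 g -> mobius_sum D u Y f = mobius_sum D u Y g.
Proof.
move=> fg; congr (_ + _).
  by apply: eq_bigr => d _; congr (_ * _); apply: eq_square_sum => z _ _; exact: fg.
apply: eq_square_sum => z _ _; rewrite /nonzero; case: eqP => // _.
by apply: eq_bigr => d _; rewrite fg.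
Qed.

Lemma mobius_sum_big (I : Type) (r : seq I) (f : I -> int * int -> int) :
  \sum_(i <- r) mobius_sum D u Y (f i) = mobius_sum D u Y (fun z => \sum_(i <- r) f i z).
Proof.
rewrite big_split /=; congr (_ + _).
  rewrite exchange_big /=; apply: eq_bigr => d _.
  by rewrite -mulr_sumr square_sum_big.
rewrite square_sum_big; apply: eq_square_sum => z _ _; rewrite /nonzero.
case: eqP => _; first by rewrite big1.
by rewrite exchange_big; apply: eq_bigr => d _; rewrite mulr_sumr.
Qed.

Lemma mobius_sumD f g : mobius_sum D u Y f + mobius_sum D u Y g = mobius_sum D u Y (fun z => f z + g z).
Proof.
have := mobius_sum_big [:: true; false] (fun b => if b then f else g).
rewrite !big_cons big_nil addr0 => ->; apply: eq_mobius_sum => z.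
by rewrite !big_cons big_nil addr0.
Qed.

Variables (q : int) (P : piece).
Hypotheses (q0 : 0 < q) (w0 : 0 < pw P).
Hypothesis box : in_box (q * Posz D) P.
Hypothesis full : full_columns P.

Lemma run_TE : run_T D u q P = mobius_sum D u Y (fun z => piece_weight P (zscale q z)).
Proof.
rewrite /run_T /piece_T; congr (_ + _).
  apply: eq_big_nat => d /andP[d0 _]; rewrite -mulrA (@count_points_sum P (q * Posz D) _ D) //.
  - by congr (_ * _); apply: eq_square_sum => z _ _; rewrite zscaleM.
  - by rewrite mulr_gt0.
  - by rewrite -mulrA ler_pM2l // -PoszM lez_nat leq_pmull.
transitivity (square_sum u (tail_term D Y q (pcoef P) (pX0 P) (pX1 P) (pY0 P) (pw P) (ph P) (pc P))) => //.
apply: eq_square_sum => z _ _; rewrite /tail_term nonzero_sq /nonzero; case: eqP => //= _.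
rewrite /mu_range mulr_sumr; apply: eq_bigr => d _.
by rewrite mulrCA zscaleM.
Qed.

Lemma piece_weight_outside z : outside D z -> piece_weight P (zscale q z) = 0.
Proof.
rewrite /piece_weight => oz; case h : (inside_piece P _); last by rewrite mulr0.
have [b1 b2 b3] := box; have /andP[b4 b5] := b3 _ h.
move: h; rewrite /inside_piece /in_piece => /and4P[h1 h2 _ _].
rewrite /= in h1 h2 b4 b5.
have k (x : int) : - (q * Posz D) <= q * x -> q * x <= q * Posz D -> `|x| <= Posz D.
  by rewrite -mulrN !ler_pM2l //; clear; lia.
move: oz; rewrite /outside !ltNge k ?k //; first exact: le_trans h1.
exact: le_trans h2 _.
Qed.

Lemma run_ZE : run_Z D q P = piece_weight P 0.
Proof.
rewrite /run_Z /piece_Z (@count_points_sum P (q * Posz D) _ D) //.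
- rewrite square_sum_nonzero zscale0 -[RHS]addr0; congr (_ + _).
  rewrite -[RHS](mul0r (square_sum D (fun=> 0))) mulr_square_sum.
  apply: eq_square_sum => z _ _; rewrite /nonzero mul0r; case: eqP => // /eqP z0.
  rewrite zscaleM piece_weight_outside //.
  have -> : Posz D + 2 = Posz D.+2 by clear; lia.
  exact: outside_scale_big (leqnSn _) z0.
- by rewrite mulr_gt0 //; clear; lia.
- by rewrite -mulrA ler_pM2l //; clear; nia.
Qed.

End Mobius.

Lemma edge_piece_pw m a e : 0 < pw (edge_piece m a e).
Proof. by rewrite /edge_piece; case: ifP => // h; case: ifP. Qed.

Section Weights.
Variables (X : nat -> int) (k D : nat).
Hypothesis X1 : forall j, (j < 2 * k)%N -> 0 < X (2 * j).+1.
Hypothesis cov : covered X (2 * k) (Posz D).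

Definition corner_weight (o a e : nat) (z : int * int) : int :=
  let q := common_den X o a e in
  piece_weight (corner_edge X D o a e) (zscale q z) + piece_weight (corner_vertex X o a e) (zscale q z).

Lemma square_scaled q i : (i < k)%N -> 0 < q -> (X (4 * i).+1 %| q)%Z -> (X (4 * i).+3 %| q)%Z ->
  square (q * Posz D) (scaled X q i).
Proof.
move=> ik q0 d1 d2; have [x1 x3] := den_pos X1 ik.
have H (x d : int) : 0 < d -> (d %| q)%Z -> `|x| <= Posz D * d ->
    - (q * Posz D) <= x * (q %/ d)%Z <= q * Posz D.
  move=> d0 /dvdzP[r E]; rewrite E mulzK ?gt_eqF // => hx.
  have r0 : 0 < r by rewrite -(pmulr_lgt0 _ d0) -E.
  by rewrite -ler_norml normrM (gtr0_norm r0) -mulrA mulrC ler_pM2l // mulrC.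
split; rewrite /scaled /=; apply: H => //.
  have e1 : (2 * (2 * i) = 4 * i)%N by clear; lia.
  by have := @cov (2 * i)%N; rewrite e1; apply; clear -ik; lia.
have e1 : (2 * (2 * i).+1 = (4 * i).+2)%N by clear; lia.
by have := @cov (2 * i).+1%N; rewrite e1; apply; clear -ik; lia.
Qed.

Lemma square_corner o a e : (o < k)%N -> (a < k)%N -> (e < k)%N ->
  let q := common_den X o a e in
  [/\ 0 < q, square (q * Posz D) (scaled X q o), square (q * Posz D) (scaled X q a) &
    square (q * Posz D) (scaled X q e)].
Proof.
move=> ok ak ek q; have q0 := common_den_pos X1 ok ak ek.
split=> //; apply: square_scaled => //; rewrite /q /common_den;
  repeat first [exact: dvdzz | apply: dvdz_mull; exact: dvdzz | apply: dvdz_mulr].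
Qed.

Lemma corner_TE u o a e : (o < k)%N -> (a < k)%N -> (e < k)%N ->
  corner_T X D u o a e = mobius_sum D u (u ^ 6) (corner_weight o a e).
Proof.
move=> ok ak ek; have [q0 so sa se] := square_corner ok ak ek.
have [b1 f1] := edge_piece_box sa se; have [b2 f2] := vertex_piece_box (scaled X (common_den X o a e) o) (scaled X (common_den X o a e) e) sa.
rewrite /corner_T /corner_edge /corner_vertex.
rewrite (run_TE u q0 (edge_piece_pw _ _ _) b1 f1) (@run_TE D u _ _ q0 _ b2 f2) //.
by rewrite mobius_sumD.
Qed.

Lemma corner_ZE o a e : (o < k)%N -> (a < k)%N -> (e < k)%N ->
  corner_Z X D o a e = corner_weight o a e 0.
Proof.
move=> ok ak ek; have [q0 so sa se] := square_corner ok ak ek.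
have [b1 f1] := edge_piece_box sa se; have [b2 f2] := vertex_piece_box (scaled X (common_den X o a e) o) (scaled X (common_den X o a e) e) sa.
rewrite /corner_Z /corner_edge /corner_vertex /corner_weight.
by rewrite (run_ZE q0 (edge_piece_pw _ _ _) b1 f1) (@run_ZE D _ _ q0 _ b2 f2) // !zscale0.
Qed.

Lemma corner_weight_outside o a e z : (o < k)%N -> (a < k)%N -> (e < k)%N -> outside D z ->
  corner_weight o a e z = 0.
Proof.
move=> ok ak ek oz; have [q0 so sa se] := square_corner ok ak ek.
have [b1 f1] := edge_piece_box sa se; have [b2 f2] := vertex_piece_box (scaled X (common_den X o a e) o) (scaled X (common_den X o a e) e) sa.
by rewrite /corner_weight (piece_weight_outside q0 b1) // (piece_weight_outside q0 b2).
Qed.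

(** The cut of the strip at height -q D is invisible for points with z.2 >= -D. *)
Lemma corner_weightE o a e z : (o < k)%N -> (a < k)%N -> (e < k)%N -> - Posz D <= z.2 ->
  let q := common_den X o a e in
  corner_weight o a e z = local_weight (scaled X q o) (scaled X q a) (scaled X q e) (zscale q z).
Proof.
move=> ok ak ek hz q; have q0 : 0 < q := common_den_pos X1 ok ak ek.
rewrite /corner_weight edge_piece_weight ?vertex_piece_weight //=.
by rewrite -mulrN ler_pM2l.
Qed.

Hypothesis k0 : (0 < k)%N.

Definition orient_weight (o : bool) (z : int * int) : int :=
  \sum_(0 <= i < k) corner_weight (before k o i) i (after k o i) z.

Lemma orient_TE u o : orient_T k X D u o k = mobius_sum D u (u ^ 6) (orient_weight o).
Proof.
rewrite /orient_T /orient_weight -mobius_sum_big; apply: eq_big_nat => i /andP[_ ik].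
by rewrite corner_TE // ?before_lt ?after_lt.
Qed.

Lemma orient_ZE o : orient_Z k X D o k = orient_weight o 0.
Proof.
rewrite /orient_Z /orient_weight; apply: eq_big_nat => i /andP[_ ik].
by rewrite corner_ZE // ?before_lt ?after_lt.
Qed.

Lemma orient_weight_outside o z : outside D z -> orient_weight o z = 0.
Proof.
move=> oz; rewrite /orient_weight big_nat big1 // => i /andP[_ ik].
by rewrite corner_weight_outside // ?before_lt ?after_lt.
Qed.

Theorem orient_count u o : (u <= D)%N -> (D <= u ^ 7)%N -> orient_weight o 0 = 1 ->
  orient_T k X D u o k - mertens (u ^ 6) =
  square_sum D (fun z => ind (gcdn (absz z.1) (absz z.2) == 1)%N * orient_weight o z).
Proof.
move=> uD Du f1; rewrite orient_TE -(mobius_sumE erefl Du uD (@orient_weight_outside o)).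
by rewrite f1 mulr1.
Qed.

End Weights.

Local Open Scope classical_set_scope.
Local Open Scope ring_scope.

(** * Winding numbers and the Jordan curve theorem for polygons *)

Section Crossing.
Variable R : realType.
Implicit Types (a b p q u v : R * R).

Lemma near_lt_cont (f g : R * R -> R) q :
  {for q, continuous f} -> {for q, continuous g} -> f q < g q ->
  \forall p \near q, f p < g p.
Proof.
move=> cf cg; rewrite -subr_gt0 => h.
have c : (fun p => g p - f p) @ q --> g q - f q by apply: cvgB.
near=> p; rewrite -subr_gt0; near: p.
exact: cvgr_gt _ c _ h.
Unshelve. all: end_near. Qed.

Lemma continuous_fst q : {for q, continuous (fun p : R * R => p.1)}.
Proof. exact: cvg_fst. Qed.

Lemma continuous_snd q : {for q, continuous (fun p : R * R => p.2)}.
Proof. exact: cvg_snd. Qed.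

Lemma continuous_cross u a q : {for q, continuous (fun p => cross u (p - a))}.
Proof.
have E : (fun p : R * R => cross u (p - a)) = (fun p => u.1 * (p.2 - a.2) - u.2 * (p.1 - a.1)).
  by apply/funext => p.
rewrite /= E; apply: cvgB; apply: cvgM; try exact: cvg_cst; apply: cvgB; try exact: cvg_cst.
- exact: continuous_snd.
- exact: continuous_fst.
Qed.

Definition below a b p : bool := (b.1 - a.1) * cross (b - a) (p - a) < 0.

(** The signed intersection of the edge with the vertical ray upwards from p: -1 for an edge passing
    over p from left to right, 1 for the other direction. A vertical edge contributes 0. *)
Definition crossing a b p : int :=
  (ind (b.1 <= p.1) - ind (a.1 <= p.1)) * ind (below a b p).

Definition on_segment a b p := exists2 t : R, 0 <= t <= 1 & p = (1 - t) *: a + t *: b.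

Definition vertex_jump q v p : int := ind (v.1 <= p.1) * ind (q.2 < v.2).

Lemma near_gt_fst (x : R) q : x < q.1 -> \forall p \near q, x < p.1.
Proof.
exact: (@near_lt_cont (fun _ => x) (fun p => p.1) q (cvg_cst x) (@continuous_fst q)).
Qed.

Lemma near_lt_fst (x : R) q : q.1 < x -> \forall p \near q, p.1 < x.
Proof.
exact: (@near_lt_cont (fun p => p.1) (fun _ => x) q (@continuous_fst q) (cvg_cst x)).
Qed.

Lemma near_le_fst (x : R) q : x != q.1 -> \forall p \near q, (x <= p.1) = (x <= q.1).
Proof.
rewrite neq_lt => /orP[h|h].
- have := near_gt_fst h; apply: filterS => p hp.
  by rewrite (ltW h) (ltW hp).
- have := near_lt_fst h; apply: filterS => p hp.
  by rewrite [LHS]leNgt [RHS]leNgt h hp.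
Qed.

Lemma near_below a b q : (b.1 - a.1) * cross (b - a) (q - a) != 0 ->
  \forall p \near q, below a b p = below a b q.
Proof.
have c : {for q, continuous (fun p => (b.1 - a.1) * cross (b - a) (p - a))}.
  by apply: cvgM; [exact: cvg_cst|exact: continuous_cross].
rewrite neq_lt => /orP[h|h].
- near=> p; rewrite /below h; near: p.
  by apply: (@near_lt_cont _ (fun _ => 0)) => //; exact: cvg_cst.
- near=> p; rewrite /below [RHS]ltNge (ltW h) /=; apply/negbTE; rewrite -leNgt ltW //; near: p.
  by apply: (@near_lt_cont (fun _ => 0)) => //; exact: cvg_cst.
Unshelve. all: end_near. Qed.

Lemma on_segment_left a b : on_segment a b a.
Proof. by exists 0; rewrite ?lexx ?ler01 // subr0 scale1r scale0r addr0. Qed.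

Lemma on_segment_right a b : on_segment a b b.
Proof. by exists 1; rewrite ?lexx ?ler01 // subrr scale1r scale0r add0r. Qed.

Lemma on_segment_cross a b q : a.1 != b.1 -> cross (b - a) (q - a) = 0 ->
  (a.1 <= q.1 <= b.1) || (b.1 <= q.1 <= a.1) -> on_segment a b q.
Proof.
case: a b q => [a1 a2] [b1 b2] [q1 q2]; rewrite /cross /= => ab c h.
have d0 : b1 - a1 != 0 by rewrite subr_eq0 eq_sym.
exists ((q1 - a1) / (b1 - a1)).
  case/orP: h => /andP[h1 h2].
  - have d : 0 < b1 - a1 by rewrite lt_neqAle eq_sym d0 /=; lra.
    by rewrite ler_pdivlMr // ler_pdivrMr //; lra.
  - have d : b1 - a1 < 0 by rewrite lt_neqAle d0 /=; lra.
    by rewrite ler_ndivlMr // ler_ndivrMr //; lra.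
congr pair => /=; rewrite /GRing.scale /=.
  by field.
apply: (mulIf d0); rewrite mulrDl -[_ * b2 * _]mulrA [b2 * _]mulrC mulrA divfK //.
rewrite mulrBl mul1r mulrBl [_ / _ * a2 * _]mulrAC divfK //.
by have := c; nra.
Qed.

Lemma on_segment_vertical a b q : a.1 = b.1 -> q.1 = a.1 ->
  (a.2 <= q.2 <= b.2) || (b.2 <= q.2 <= a.2) -> on_segment a b q.
Proof.
case: a b q => [a1 a2] [b1 b2] [q1 q2] /= <- -> h.
have [e|ab] := eqVneq a2 b2.
  exists 0; rewrite ?lexx ?ler01 // subr0 scale1r scale0r addr0.
  by congr pair; move: h; rewrite -e orbb => h; lra.
have d0 : b2 - a2 != 0 by rewrite subr_eq0 eq_sym.
exists ((q2 - a2) / (b2 - a2)).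
  case/orP: h => /andP[h1 h2].
  - have d : 0 < b2 - a2 by rewrite lt_neqAle eq_sym d0 /=; lra.
    by rewrite ler_pdivlMr // ler_pdivrMr //; lra.
  - have d : b2 - a2 < 0 by rewrite lt_neqAle d0 /=; lra.
    by rewrite ler_ndivlMr // ler_ndivrMr //; lra.
congr pair => /=; rewrite /GRing.scale /=; field => //.
Qed.

(* Subtracting the jumps at the two end points makes the contribution of an
   edge locally constant away from this edge, also on the vertical lines
   through its end points; the jumps telescope along a closed polygon. *)
Lemma crossing_locally_constant a b q : ~ on_segment a b q ->
  \forall p \near q,
    crossing a b p - (vertex_jump q b p - vertex_jump q a p) =
    crossing a b q - (vertex_jump q b q - vertex_jump q a q).
Proof.
move=> nq; rewrite /crossing /vertex_jump.
have na : a != q by apply/eqP => e; apply: nq; rewrite -e; exact: on_segment_left.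
have nb : b != q by apply/eqP => e; apply: nq; rewrite -e; exact: on_segment_right.
have [a1|a1] := eqVneq a.1 q.1; have [b1|b1] := eqVneq b.1 q.1.
- have e : ind (q.2 < b.2) = ind (q.2 < a.2).
    congr ind; apply/idP/idP => h; rewrite ltNge; apply/negP => h'; apply: nq.
    + by apply: on_segment_vertical; rewrite ?a1 ?b1 // h' ltW.
    + by apply: on_segment_vertical; rewrite ?a1 ?b1 //; apply/orP; right; rewrite h' ltW.
  by near=> p; rewrite a1 b1 e; ring.
- have h : a.2 != q.2.
    by apply: contra_neq na => h; rewrite [a]surjective_pairing [q]surjective_pairing a1 h.
  have c : (b.1 - a.1) * cross (b - a) (q - a) = (b.1 - a.1) ^+ 2 * (q.2 - a.2).
    by rewrite /cross /= a1; ring.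
  have d : 0 < (b.1 - a.1) ^+ 2 by rewrite exprn_even_gt0 //= subr_eq0 a1.
  have bq : below a b q = (q.2 < a.2) by rewrite /below c pmulr_rlt0 // subr_lt0.
  near=> p.
  have -> : (b.1 <= p.1) = (b.1 <= q.1) by near: p; exact: near_le_fst.
  have -> : below a b p = below a b q.
    near: p; apply: near_below; rewrite c mulf_neq0 ?subr_eq0 ?(eq_sym q.2) //.
    by rewrite lt0r_neq0.
  by rewrite bq; ring.
- have h : b.2 != q.2.
    by apply: contra_neq nb => h; rewrite [b]surjective_pairing [q]surjective_pairing b1 h.
  have c : (b.1 - a.1) * cross (b - a) (q - a) = (b.1 - a.1) ^+ 2 * (q.2 - b.2).
    by rewrite /cross /= b1; ring.
  have d : 0 < (b.1 - a.1) ^+ 2 by rewrite exprn_even_gt0 //= subr_eq0 b1 eq_sym.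
  have bq : below a b q = (q.2 < b.2) by rewrite /below c pmulr_rlt0 // subr_lt0.
  near=> p.
  have -> : (a.1 <= p.1) = (a.1 <= q.1) by near: p; exact: near_le_fst.
  have -> : below a b p = below a b q.
    near: p; apply: near_below; rewrite c mulf_neq0 ?subr_eq0 ?(eq_sym q.2) //.
    by rewrite lt0r_neq0.
  by rewrite bq; ring.
- have [e|ne] := eqVneq (b.1 <= q.1) (a.1 <= q.1).
  near=> p.
  have -> : (b.1 <= p.1) = (b.1 <= q.1) by near: p; exact: near_le_fst.
  have -> : (a.1 <= p.1) = (a.1 <= q.1) by near: p; exact: near_le_fst.
  by rewrite e; ring.
  near=> p.
  have -> : (b.1 <= p.1) = (b.1 <= q.1) by near: p; exact: near_le_fst.
  have -> : (a.1 <= p.1) = (a.1 <= q.1) by near: p; exact: near_le_fst.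
  have -> // : below a b p = below a b q.
  near: p; apply: near_below; apply/negP; rewrite mulf_eq0 => /orP[].
    by rewrite subr_eq0 => /eqP e; rewrite e eqxx in ne.
  move=> /eqP c; apply: nq; apply: on_segment_cross => //.
    by apply: contra_neq ne => ->.
  move: ne; case: (lerP b.1 q.1) => h1; case: (lerP a.1 q.1) => h2 // _.
  + by rewrite /= (ltW h2) ?orbT.
  + by rewrite /= (ltW h1).
Unshelve. all: end_near. Qed.

(** The corrected contribution is larger by one on the left of the edge than on its right. For a
    vertical edge [crossing] vanishes and the whole jump comes from the upper end point, through
    [vertex_jump]. *)
Lemma crossing_jump a b q (s : R) : a != b -> 0 < s < 1 ->
  q = (1 - s) *: a + s *: b ->
  exists C : int, \forall p \near q, cross (b - a) (p - a) != 0 ->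
    crossing a b p - (vertex_jump q b p - vertex_jump q a p) =
    C + ind (0 < cross (b - a) (p - a)).
Proof.
case: a b => [a1 a2] [b1 b2] ab /andP[s0 s1] qE.
have q1 : q.1 = (1 - s) * a1 + s * b1 by rewrite qE.
have q2 : q.2 = (1 - s) * a2 + s * b2 by rewrite qE.
have [lt|lt|eq1] := ltgtP a1 b1.
- exists (- 1 - (vertex_jump q (b1, b2) q - vertex_jump q (a1, a2) q)).
  have h1 : a1 < q.1 by rewrite q1; nra.
  have h2 : q.1 < b1 by rewrite q1; nra.
  have := near_gt_fst h1; have := near_lt_fst h2; apply: filterS2 => p p1 p2 c.
  rewrite /crossing /vertex_jump /= (leNgt b1 p.1) p1 (ltW p2) (leNgt b1 q.1) h2 (ltW h1).
  rewrite /below /= pmulr_rlt0; last by rewrite subr_gt0.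
  move: c; set X := cross _ _ => c; have [h|h|h] := ltgtP X 0;
    [by rewrite ?indE; ring | by rewrite ?indE; ring | by rewrite h eqxx in c].
- exists (- (vertex_jump q (b1, b2) q - vertex_jump q (a1, a2) q)).
  have h1 : b1 < q.1 by rewrite q1; nra.
  have h2 : q.1 < a1 by rewrite q1; nra.
  have := near_gt_fst h1; have := near_lt_fst h2; apply: filterS2 => p p1 p2 c.
  rewrite /crossing /vertex_jump /= (leNgt a1 p.1) p1 (ltW p2) (leNgt a1 q.1) h2 (ltW h1).
  rewrite /below /= nmulr_rlt0; last by rewrite subr_lt0.
  move: c; set X := cross _ _ => c; have [h|h|h] := ltgtP X 0;
    [by rewrite ?indE; ring | by rewrite ?indE; ring | by rewrite h eqxx in c].
- have ab2 : a2 != b2 by apply: contra_neq ab => ->; rewrite eq1.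
  have E p : cross ((b1, b2) - (a1, a2)) (p - (a1, a2)) = (b2 - a2) * (a1 - p.1).
    by rewrite /cross /= eq1; ring.
  have [lt|lt|eq2] := ltgtP a2 b2; last by rewrite eq2 eqxx in ab2.
  + exists (- 1); near=> p; rewrite E /crossing /vertex_jump /= eq1 subrr mul0r.
    have -> : q.2 < b2 by rewrite q2; nra.
    have -> : (q.2 < a2) = false by apply/negbTE; rewrite -leNgt q2; nra.
    rewrite mulf_eq0 !subr_eq0 eq_sym (negbTE ab2) /= => h.
    rewrite pmulr_rgt0 ?subr_gt0 //.
    have [h'|h'|h'] := ltgtP b1 p.1;
      [by rewrite ?indE; ring | by rewrite ?indE; ring | by rewrite h' eqxx in h].
  + exists 0; near=> p; rewrite E /crossing /vertex_jump /= eq1 subrr mul0r.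
    have -> : q.2 < a2 by rewrite q2; nra.
    have -> : (q.2 < b2) = false by apply/negbTE; rewrite -leNgt q2; nra.
    rewrite mulf_eq0 !subr_eq0 eq_sym (negbTE ab2) /= => h.
    rewrite nmulr_rgt0 ?subr_lt0 //.
    have [h'|h'|h'] := ltgtP b1 p.1;
      [by rewrite ?indE; ring | by rewrite ?indE; ring | by rewrite h' eqxx in h].
Unshelve. all: end_near. Qed.

End Crossing.

Section Polygon.
Variables (R : realType) (k : nat) (w : 'I_k -> R * R).
Implicit Types (p q : R * R) (i j : 'I_k).

Definition ep i (s : R) : R * R := (1 - s) *: w i + s *: w (ordS i).

Definition gamma : set (R * R) :=
  [set p | exists i (s : R), 0 <= s <= 1 /\ p = ep i s].

Definition wind p : int := \sum_i crossing (w i) (w (ordS i)) p.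

Definition joined p q := connected_component (~` gamma) p q.

Lemma gamma_segment p : gamma p <-> exists i, on_segment (w i) (w (ordS i)) p.
Proof. by split=> -[i [s]]; [case=> h e; exists i, s | move=> h e; exists i, s]. Qed.

Lemma ep0 i : ep i 0 = w i.
Proof. by rewrite /ep subr0 scale1r scale0r addr0. Qed.

Lemma ep1 i : ep i 1 = w (ordS i).
Proof. by rewrite /ep subrr scale1r scale0r add0r. Qed.

Lemma gammaP p : gamma p -> exists i s, 0 <= s < 1 /\ p = ep i s.
Proof.
move=> [i [s [/andP[s0 s1] ->]]].
have [->|s1'] := (s =P 1); first by rewrite ep1; exists (ordS i), 0; rewrite lexx ltr01 ep0.
by exists i, s; rewrite s0 lt_neqAle s1; split => //; rewrite andbT; apply/eqP.
Qed.

Lemma sum_vertex_jump q p :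
  \sum_i (vertex_jump q (w (ordS i)) p - vertex_jump q (w i) p) = 0.
Proof.
rewrite sumrB [X in _ - X](reindex_inj (can_inj (@ordSK k))) /=.
by rewrite subrr.
Qed.

Lemma windE q p : wind p = \sum_i (crossing (w i) (w (ordS i)) p -
  (vertex_jump q (w (ordS i)) p - vertex_jump q (w i) p)).
Proof. by rewrite sumrB sum_vertex_jump subr0. Qed.

(** All edges are corrected relative to the same point q, so the corrections cancel around the
    polygon while each corrected term is locally constant. *)
Lemma wind_locally_constant q : ~ gamma q -> \forall p \near q, wind p = wind q.
Proof.
move=> nq.
have H i := @crossing_locally_constant R (w i) (w (ordS i)) q
  (fun h => nq ((gamma_segment q).2 (ex_intro _ i h))).
near=> p; rewrite (windE q p) (windE q q); apply: eq_bigr => i _; move: i; near: p.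
exact: filter_forall.
Unshelve. all: end_near. Qed.

Lemma wind_connected (A : set (R * R)) p q : connected A -> A `<=` ~` gamma ->
  A p -> A q -> wind p = wind q.
Proof.
move=> cA Ag Ap Aq.
pose B := A `&` [set x | wind x = wind p].
(* The level set of [wind] in A is both relatively open and relatively closed; these sets describe
   its neighbourhoods in the plane. *)
have h (v : int) : open (fun x => \forall y \near x, ~ gamma y -> wind y = v).
  rewrite openE => x /=; rewrite /interior /= => hx.
  by have := nbhs_interior hx; apply: filterS.
have BE : B = A.
  apply: cA.
  - by exists p.
  - exists (fun x => \forall y \near x, ~ gamma y -> wind y = wind p) => //.
    rewrite /B eqEsubset; split => x [Ax /= hx]; split => //.
      have := wind_locally_constant (Ag _ Ax); apply: filterS => y ->.
      by rewrite hx.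
    by have := nbhs_singleton hx; apply; exact: Ag.
  - exists (~` (fun x => \forall y \near x, ~ gamma y -> wind y != wind p)).
      apply: open_closedC; rewrite openE => x /=; rewrite /interior /= => hx.
      by have := nbhs_interior hx; apply: filterS.
    rewrite /B eqEsubset; split => x [Ax /= hx]; split => //.
      by move=> hx'; have := nbhs_singleton hx' (Ag _ Ax); rewrite hx eqxx.
    apply: contrapT => hx'; apply: hx.
    have := wind_locally_constant (Ag _ Ax); apply: filterS => y -> _.
    exact/eqP.
by have : B q; [rewrite BE|case].
Qed.

Lemma wind_joined p q : joined p q -> wind p = wind q.
Proof.
move=> h; have [C [Cp Cg cC] Cq] := h.
exact: (wind_connected cC Cg).
Qed.

Hypothesis k2 : (2 < k)%N.
Hypothesis simple : forall i j s t, 0 <= s < 1 -> 0 <= t < 1 ->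
  ep i s = ep j t -> i = j /\ s = t.

Lemma ordS_neq i : ordS i != i.
Proof.
apply/negP => /eqP /(congr1 val) /=.
have [h|h] := ltnP i.+1 k; first by rewrite modn_small //; lia.
have -> : (i.+1 = k)%N by have := ltn_ord i; lia.
by rewrite modnn; lia.
Qed.

Lemma vertex_neq i : w i != w (ordS i).
Proof.
apply/negP => /eqP; rewrite -!ep0 => /simple; rewrite lexx ltr01 => /(_ isT isT) [e _].
by have := ordS_neq i; rewrite -e eqxx.
Qed.

Lemma on_segment_ep i j s : 0 <= s < 1 -> on_segment (w j) (w (ordS j)) (ep i s) ->
  j = i \/ s = 0 /\ ordS j = i.
Proof.
move=> hs [t /andP[t0 t1] e].
have [t1'|t1'] := (t =P 1).
  have : ep i s = ep (ordS j) 0 by rewrite e t1' ep0 subrr scale0r scale1r add0r.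
  by move/simple; rewrite lexx ltr01 => /(_ hs isT) [-> ->]; right.
have /simple : ep i s = ep j t by rewrite e.
have h : 0 <= t < 1 by rewrite t0 lt_neqAle t1 andbT; apply/eqP.
by move=> /(_ hs h) [-> _]; left.
Qed.

(** By simplicity, an interior point of edge i lies on no other edge, so all other corrected terms
    are constant nearby and join the constant C. *)
Lemma wind_jump i s : 0 < s < 1 ->
  exists C : int, \forall p \near ep i s, cross (w (ordS i) - w i) (p - w i) != 0 ->
    wind p = C + ind (0 < cross (w (ordS i) - w i) (p - w i)).
Proof.
move=> hs; set q := ep i s.
have [C hC] := crossing_jump (vertex_neq i) hs (erefl q).
pose D j := crossing (w j) (w (ordS j)) q - (vertex_jump q (w (ordS j)) q - vertex_jump q (w j) q).
have H j : \forall p \near q, j != i -> crossing (w j) (w (ordS j)) p -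
    (vertex_jump q (w (ordS j)) p - vertex_jump q (w j) p) = D j.
  have [->|ji] := eqVneq j i; first by near=> p.
  have nj : ~ on_segment (w j) (w (ordS j)) q.
    have h : 0 <= s < 1 by case/andP: hs => h1 h2; rewrite (ltW h1).
    move=> /(on_segment_ep h) [e|[e _]]; first by rewrite e eqxx in ji.
    by rewrite e ltxx in hs.
  by have := crossing_locally_constant nj; apply: filterS => p hp _.
exists (C + \sum_(j | j != i) D j).
near=> p => hc.
have hi := near hC p; rewrite (windE q) (bigD1 i) //= hi // (eq_bigr D); last first.
  by move=> j; move: j; near: p; exact: filter_forall.
by rewrite addrAC.
Unshelve. all: end_near. Qed.

End Polygon.

(** * Sectors and the local structure of the curve *)

Definition dot (R : realDomainType) (u v : R * R) : R := u.1 * v.1 + u.2 * v.2.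

(* The open sector swept counterclockwise from [u] to [v]. *)
Definition sector (R : realDomainType) (u v x : R * R) : bool :=
  if 0 < cross u v then (0 < cross u x) && (0 < cross x v)
  else (0 < cross u x) || (0 < cross x v).

Definition box (R : realDomainType) (q : R * R) (e : R) (p : R * R) : bool :=
  (`|p.1 - q.1| < e) && (`|p.2 - q.2| < e).

Section Sectors.
Variable R : realType.
Implicit Types (p q u v x y : R * R).

Lemma nearP_box q (P : R * R -> Prop) :
  (\forall p \near q, P p) <-> exists2 e : R, 0 < e & forall p, box q e p -> P p.
Proof.
split=> [/nbhs_ballP[e e0 h]|[e e0 h]].
  by exists e => // p /andP[h1 h2]; apply: h; split; rewrite /ball /= distrC.
apply/nbhs_ballP; exists e => // p [h1 h2]; apply: h; rewrite /box.
by move: h1 h2; rewrite /ball /= distrC => -> ; rewrite distrC => ->.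
Qed.

Lemma convex_lt (a b c t : R) : 0 <= t <= 1 -> a < c -> b < c -> (1 - t) * a + t * b < c.
Proof.
move=> /andP[t0 t1] ac bc; have [->|t0'] := eqVneq t 0; first by lra.
have : 0 < t * (c - b) by rewrite mulr_gt0 ?subr_gt0 // lt_neqAle eq_sym t0'.
have : 0 <= (1 - t) * (c - a) by rewrite mulr_ge0 ?subr_ge0 // ltW.
by lra.
Qed.

Lemma box_convex q e p p' (t : R) : 0 <= t <= 1 -> box q e p -> box q e p' ->
  box q e ((1 - t) *: p + t *: p').
Proof.
case: p p' q => [p1 p2] [p1' p2'] [q1 q2] ht.
rewrite /box /= !ltr_norml => /andP[/andP[a1 a2] /andP[b1 b2]] /andP[/andP[a1' a2'] /andP[b1' b2']].
have E (x x' z : R) : (1 - t) * x + t * x' - z = (1 - t) * (x - z) + t * (x' - z) by ring.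
rewrite /GRing.scale /= !E.
apply/andP; split; apply/andP; split; try exact: convex_lt.
- have := convex_lt ht (a := - (p1 - q1)) (b := - (p1' - q1)) (c := e); lra.
- have := convex_lt ht (a := - (p2 - q2)) (b := - (p2' - q2)) (c := e); lra.
Qed.

Lemma box_self q e : 0 < e -> box q e q.
Proof. by move=> e0; rewrite /box !subrr normr0 e0. Qed.

Lemma crossC u v : cross v u = - cross u v.
Proof. by rewrite /cross; ring. Qed.

Lemma cross_scale_r u v (t : R) : cross u (t *: v) = t * cross u v.
Proof. have -> : cross u (t *: v) = u.1 * (t * v.2) - u.2 * (t * v.1) by [].
by rewrite /cross; ring. Qed.

Lemma cross_scale_l u v (t : R) : cross (t *: u) v = t * cross u v.
Proof. have -> : cross (t *: u) v = t * u.1 * v.2 - t * u.2 * v.1 by [].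
by rewrite /cross; ring. Qed.

Lemma crossvv u : cross u u = 0.
Proof. by rewrite /cross mulrC subrr. Qed.

Lemma sector_ray u v (t : R) : 0 <= t -> ~~ sector u v (t *: u) /\ ~~ sector u v (t *: v).
Proof.
move=> t0; rewrite /sector !cross_scale_l !cross_scale_r !crossvv mulr0 ltxx /= andbF orbF.
have [h|h] := ltP 0 (cross u v) => //.
by rewrite -!leNgt mulr_ge0_le0.
Qed.

Lemma collinear_ray u x : 0 < dot u u -> cross u x = 0 ->
  x = (dot u x / dot u u) *: u.
Proof.
case: u x => [u1 u2] [x1 x2]; rewrite /dot /cross /= => d c.
have d0 : u1 * u1 + u2 * u2 != 0 by rewrite gt_eqF.
have c' : u1 * x2 = u2 * x1 by lra.
congr pair; rewrite /GRing.scale /= mulrAC; apply: (mulIf d0); rewrite divfK //.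
  by apply: subr0_eq; transitivity (u2 * (u2 * x1 - u1 * x2)); [ring|rewrite c' subrr mulr0].
by apply: subr0_eq; transitivity (u1 * (u1 * x2 - u2 * x1)); [ring|rewrite c' subrr mulr0].
Qed.

(** The rays from 0 through u and v are two different rays; they may be opposite. *)
Definition transverse u v := [/\ 0 < dot u u, 0 < dot v v & cross u v = 0 -> dot u v < 0].

Lemma transverse_sym u v : transverse u v -> transverse v u.
Proof.
move=> [h1 h2 h3]; split => // c.
have -> : dot v u = dot u v by rewrite /dot; ring.
by apply: h3; rewrite -[LHS]opprK -[RHS]oppr0 -c /cross; congr (- _); ring.
Qed.

Lemma sector_cover u v x : transverse u v ->
  [\/ sector u v x, sector v u x, exists2 t, 0 <= t & x = t *: u
    | exists2 t, 0 <= t & x = t *: v].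
Proof.
move=> [u0 v0 uv]; rewrite /sector (crossC u v) oppr_gt0 (crossC x v) (crossC u x) !oppr_gt0.
have [c|c] := eqVneq (cross u x) 0.
  have e := collinear_ray u0 c; set t := _ / _ in e.
  have [t0|t0] := leP 0 t; first by constructor 3; exists t.
  have cxv : cross x v = t * cross u v by rewrite e cross_scale_l.
  rewrite c ltxx /= orbF andbF cxv nmulr_rlt0 // nmulr_rgt0 //.
  have [h|h|h] := ltgtP 0 (cross u v); [by constructor 2|by constructor 1|].
  have e2 : x = (dot v x / dot v v) *: v.
    by apply: collinear_ray => //; rewrite crossC cxv -h mulr0 oppr0.
  constructor 4; exists (dot v x / dot v v) => //; apply: divr_ge0; last exact: ltW.
  have -> : dot v x = t * dot u v.
    by rewrite e; have -> : dot v (t *: u) = v.1 * (t * u.1) + v.2 * (t * u.2) by []; rewrite /dot; ring.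
  by rewrite mulr_le0 ?(ltW t0) // ltW // uv.
have [c'|c'] := eqVneq (cross x v) 0.
  have e : x = (dot v x / dot v v) *: v by apply: collinear_ray => //; rewrite crossC c' oppr0.
  set t := _ / _ in e.
  have [t0|t0] := leP 0 t; first by constructor 4; exists t.
  have cux : cross u x = t * cross u v by rewrite {1}e cross_scale_r.
  rewrite c' ltxx /= cux nmulr_rlt0 // nmulr_rgt0 //.
  have [h|h|h] := ltgtP 0 (cross u v); [by constructor 2|by constructor 1|].
  by rewrite cux -h mulr0 eqxx in c.
case: (ltgtP 0 (cross u x)) c => // h1 _; case: (ltgtP 0 (cross x v)) c' => // h2 _; case: (ltgtP 0 (cross u v)) => /= _;
  by [constructor 1|constructor 2].
Qed.

End Sectors.

Section Convex.
Variables (R : realType) (k : nat) (w : 'I_k -> R * R).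
Implicit Types (p q u v x y : R * R).

Definition convex_set (A : set (R * R)) :=
  forall x y (t : R), 0 <= t <= 1 -> A x -> A y -> A ((1 - t) *: x + t *: y).

Lemma continuous_line p u : continuous (fun t : R => p + t *: u).
Proof. by move=> t; apply: cvgD; [exact: cvg_cst|apply: cvgZl; exact: cvg_id]. Qed.

Lemma line_combination x y (t : R) : (1 - t) *: x + t *: y = x + t *: (y - x).
Proof. by rewrite scalerBl scale1r scalerBr addrAC addrA. Qed.

Lemma connected_convex (A : set (R * R)) : convex_set A -> connected A.
Proof.
move=> cA; have [[a Aa]|] := pselect (A !=set0); last first.
  by move=> /nonemptyPn ->; exact: connected0.
have -> : A = \bigcup_(y in A) ((fun t : R => a + t *: (y - a)) @` `[0, 1]).
  rewrite eqEsubset; split => [y Ay|x [y Ay [t]]].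
    by exists y => //; exists 1; rewrite /= ?in_itv /= ?lexx ?ler01 // scale1r addrC subrK.
  by rewrite /= in_itv /= => ht <-; rewrite -line_combination; exact: cA.
apply: bigcup_connected.
  by exists a => y Ay; exists 0; rewrite /= ?in_itv /= ?lexx ?ler01 // scale0r addr0.
move=> y Ay; apply: connected_continuous_connected; first exact: segment_connected.
exact/continuous_subspaceT/continuous_line.
Qed.

Lemma joined_convex (A : set (R * R)) x y : convex_set A -> A `<=` ~` gamma w ->
  A x -> A y -> joined w x y.
Proof.
by move=> cA Ag Ax Ay; apply: (connected_component_max Ax Ag (connected_convex cA)).
Qed.

Lemma half_plane_convex q u v (e : R) :
  convex_set [set p | box q e p && (0 < cross u (p - q))] /\
  convex_set [set p | box q e p && (0 < cross (p - q) v)].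
Proof.
split=> x y t ht /= /andP[bx cx] /andP[b_y cy]; rewrite box_convex //=.
- have -> : cross u ((1 - t) *: x + t *: y - q) =
      (1 - t) * cross u (x - q) + t * cross u (y - q).
    by rewrite /cross /= /GRing.scale /=; ring.
  have := @convex_lt _ (- cross u (x - q)) (- cross u (y - q)) 0 t ht.
  by rewrite !oppr_lt0 => /(_ cx cy); lra.
- have -> : cross ((1 - t) *: x + t *: y - q) v =
      (1 - t) * cross (x - q) v + t * cross (y - q) v.
    by rewrite /cross /= /GRing.scale /=; ring.
  have := @convex_lt _ (- cross (x - q) v) (- cross (y - q) v) 0 t ht.
  by rewrite !oppr_lt0 => /(_ cx cy); lra.
Qed.

Lemma small_line q (n : R * R) (P : R * R -> Prop) : (\forall p \near q, P p) ->
  exists2 d : R, 0 < d & forall t, `|t| < d -> P (q + t *: n).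
Proof.
move=> h; have := @continuous_line q n 0; rewrite /continuous_at scale0r addr0 => /(_ _ h).
move=> /nbhs_ballP[d d0 hd]; exists d => // t ht; apply: hd.
by rewrite /ball /= sub0r normrN.
Qed.

Definition perp u : R * R := (- u.2, u.1).

(** A sector of angle less than pi is convex inside the box. A larger one is the union of two
    half-boxes, which are convex and have a common point. *)
Lemma sector_joined q u v (e : R) x y : 0 < e -> transverse u v ->
  (forall p, box q e p -> gamma w p ->
     exists2 t, 0 <= t & p = q + t *: u \/ p = q + t *: v) ->
  box q e x -> box q e y -> sector u v (x - q) -> sector u v (y - q) ->
  joined w x y.
Proof.
move=> e0 [u0 v0 uv] hg bx b_y.
have ng p : box q e p -> sector u v (p - q) -> ~ gamma w p.
  move=> bp sp /(hg _ bp) [t t0 h]; have [h1 h2] := @sector_ray R u v t t0.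
  by case: h sp => ->; rewrite addrC addKr ?(negbTE h1) ?(negbTE h2).
have [c1 c2] := half_plane_convex q u v e.
rewrite {1 2}/sector; case: ifPn => cuv.
  move=> /andP[x1 x2] /andP[y1 y2].
  apply: (@joined_convex [set p | box q e p && ((0 < cross u (p - q)) && (0 < cross (p - q) v))]).
  - move=> a b t ht /= /andP[ba /andP[a1 a2]] /andP[bb /andP[b1 b2]].
    set z := (1 - t) *: a + t *: b.
    have /andP[-> ->] : box q e z && (0 < cross u (z - q)).
      by apply: c1; rewrite //= ?ba ?bb ?a1 ?b1.
    have /andP[_ ->] // : box q e z && (0 < cross (z - q) v).
    by apply: c2; rewrite //= ?ba ?bb ?a2 ?b2.
  - by move=> p /= /andP[bp sp]; apply: ng => //; rewrite /sector cuv.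
  - by rewrite /= bx x1 x2.
  - by rewrite /= b_y y1 y2.
have j1 a b : box q e a -> box q e b -> 0 < cross u (a - q) -> 0 < cross u (b - q) -> joined w a b.
  move=> ba bb ha hb; apply: (joined_convex c1); rewrite /= ?ba ?bb ?ha ?hb //.
  by move=> p /= /andP[bp sp]; apply: ng => //; rewrite /sector (negbTE cuv) sp.
have j2 a b : box q e a -> box q e b -> 0 < cross (a - q) v -> 0 < cross (b - q) v -> joined w a b.
  move=> ba bb ha hb; apply: (joined_convex c2); rewrite /= ?ba ?bb ?ha ?hb //.
  by move=> p /= /andP[bp sp]; apply: ng => //; rewrite /sector (negbTE cuv) sp orbT.
have [z [bz z1 z2]] : exists z, [/\ box q e z, 0 < cross u (z - q) & 0 < cross (z - q) v].
  (* A direction common to both half-planes: the normal of u if the rays are opposite, and - (u + v)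
     if the angle exceeds pi. *)
  have [n [n1 n2]] : exists n, 0 < cross u n /\ 0 < cross n v.
    have [h|h] := eqVneq (cross u v) 0.
      exists (perp u); split; first by move: u0; rewrite /dot /cross /perp /=; lra.
      by have := uv h; rewrite /dot /cross /perp /=; lra.
    exists (- (u + v)); have : cross u v < 0 by rewrite lt_neqAle h /= leNgt.
    by rewrite /cross /=; split; lra.
  have hn : \forall p \near q, box q e p by apply/nearP_box; exists e.
  have [d d0 hd] := small_line n hn.
  have dd : 0 < d / 2 by rewrite divr_gt0.
  exists (q + (d / 2) *: n); split.
  - by apply: hd; rewrite gtr0_norm //; lra.
  - by rewrite addrC addKr cross_scale_r mulr_gt0.
  - by rewrite addrC addKr cross_scale_l mulr_gt0.
move=> /orP[x1|x1] /orP[y1|y1].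
- exact: j1.
- by apply: (connected_component_trans (y := z)); [exact: j1|exact: j2].
- by apply: (connected_component_trans (y := z)); [exact: j2|exact: j1].
- exact: j2.
Qed.

End Convex.

Section Germ.
Variables (R : realType) (k : nat) (w : 'I_k -> R * R).
Implicit Types (p q u v x y : R * R) (i j : 'I_k).
Hypothesis k2 : (2 < k)%N.
Hypothesis simple : forall i j s t, 0 <= s < 1 -> 0 <= t < 1 ->
  ep w i s = ep w j t -> i = j /\ s = t.

Definition fwd i := w (ordS i) - w i.

(** Direction in which the curve is left backwards: at a vertex (s = 0) it follows the preceding
    edge. *)
Definition bwd i (s : R) := if s == 0 then w (ord_pred i) - w i else - fwd i.

Lemma epE i s : ep w i s = w i + s *: fwd i.
Proof. exact: line_combination. Qed.

Lemma dot_gt0 u : u != 0 -> 0 < dot u u.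
Proof.
case: u => [u1 u2] h; rewrite /dot /= lt_neqAle eq_sym.
rewrite addr_ge0 -?expr2 ?sqr_ge0 // andbT paddr_eq0 ?sqr_ge0 // !sqrf_eq0.
by apply: contra h => /andP[/eqP -> /eqP ->].
Qed.

Lemma fwd_gt0 i : 0 < dot (fwd i) (fwd i).
Proof. by apply: dot_gt0; rewrite subr_eq0 eq_sym vertex_neq. Qed.

Lemma fwd_pred i : w (ord_pred i) - w i = - fwd (ord_pred i).
Proof. by rewrite /fwd ord_predK opprB. Qed.

Lemma ep_pred i t : ep w (ord_pred i) t = w i + (1 - t) *: (w (ord_pred i) - w i).
Proof. by rewrite -line_combination subKr addrC /ep ord_predK. Qed.

Lemma dot_scale u (t : R) : dot u (t *: u) = t * dot u u.
Proof.
have -> : dot u (t *: u) = u.1 * (t * u.1) + u.2 * (t * u.2) by [].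
by rewrite /dot; ring.
Qed.

Lemma dotNN u : dot (- u) (- u) = dot u u.
Proof. by rewrite /dot /=; ring. Qed.

Lemma transverse_germ i s : transverse (fwd i) (bwd i s).
Proof.
have u0 := fwd_gt0 i; rewrite /bwd; case: eqP => _; last first.
  split=> //; first by rewrite dotNN.
  by move=> _; have -> : dot (fwd i) (- fwd i) = - dot (fwd i) (fwd i); [rewrite /dot /=; ring|lra].
have v0 : 0 < dot (w (ord_pred i) - w i) (w (ord_pred i) - w i).
  by rewrite fwd_pred dotNN fwd_gt0.
split=> // c; rewrite ltNge; apply/negP => d.
have := collinear_ray u0 c; set v := w (ord_pred i) - w i; set r := _ / _ => vE.
have r0 : 0 < r.
  rewrite lt_neqAle eq_sym divr_ge0 // ?(ltW u0) // andbT.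
  by apply/eqP => r0; move: v0; rewrite -/v vE r0 scale0r /dot /=; lra.
(* If both edges at the vertex had the same direction, the point with parameter 1 - a on the
   preceding edge would be the point with parameter r a on edge i. This value of a puts both
   parameters strictly between 0 and 1, as 1 - a = r a. *)
pose a := (r + 1)^-1.
have a0 : 0 < a by rewrite invr_gt0; lra.
have a1 : a < 1 by rewrite invf_lt1; lra.
have ra : 1 - a = r * a by rewrite /a; field; lra.
have : ep w (ord_pred i) (1 - a) = ep w i (r * a).
  by rewrite ep_pred subKr -/v vE scalerA epE mulrC.
move/simple; rewrite -ra => -[||e _]; try (apply/andP; split; lra).
have := ordS_neq k2 (ord_pred i); rewrite ord_predK.
by rewrite e eqxx.
Qed.

Lemma continuous_dot u a q : {for q, continuous (fun p => dot u (p - a))}.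
Proof.
have E : (fun p : R * R => dot u (p - a)) = (fun p => u.1 * (p.1 - a.1) + u.2 * (p.2 - a.2)).
  by apply/funext => p.
rewrite /= E; apply: cvgD; apply: cvgM; try exact: cvg_cst; apply: cvgB; try exact: cvg_cst.
- exact: continuous_fst.
- exact: continuous_snd.
Qed.

Lemma near_not_segment (a b q : R * R) : ~ on_segment a b q ->
  \forall p \near q, ~ on_segment a b p.
Proof.
move=> nq.
have E : [set p | on_segment a b p] = (fun t : R => a + t *: (b - a)) @` `[0, 1].
  rewrite eqEsubset; split => p /=.
    by move=> [t ht ->]; exists t; rewrite ?in_itv // line_combination.
  by move=> [t]; rewrite in_itv /= => ht <-; exists t => //; rewrite line_combination.
have cl : closed [set p | on_segment a b p].
  rewrite E; apply: compact_closed; first exact: norm_hausdorff.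
  apply: continuous_compact; last exact: segment_compact.
  exact/continuous_subspaceT/continuous_line.
have : open (~` [set p | on_segment a b p]) by rewrite openC.
by rewrite openE => /(_ q nq).
Qed.

(** Edges are closed sets, so near q only the edges through q occur. By simplicity these are edge i
    and, at a vertex, the preceding edge; in a small box they look like two full rays. *)
Lemma germ i s : 0 <= s < 1 -> exists2 e : R, 0 < e &
  forall p, box (ep w i s) e p -> (gamma w p <->
    exists2 t, 0 <= t & p = ep w i s + t *: fwd i \/ p = ep w i s + t *: bwd i s).
Proof.
move=> hs; have /andP[s0 s1] := hs; apply/nearP_box; set q := ep w i s.
have H j : \forall p \near q, on_segment (w j) (w (ordS j)) p ->
    on_segment (w j) (w (ordS j)) q.
  have [h|h] := pselect (on_segment (w j) (w (ordS j)) q); first by near=> p.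
  by have := near_not_segment h; apply: filterS => p.
(* The curve follows [bwd i s] for the parameter length r: a whole edge at a vertex, the part s of
   edge i otherwise. *)
pose r := if s == 0 then 1 else s.
have r0 : 0 < r by rewrite /r; case: ifPn => // h; rewrite lt_neqAle eq_sym h.
have [u0 v0 _] := transverse_germ i s.
have near_dot u (c : R) : 0 < c -> \forall p \near q, dot u (p - q) < c.
  move=> c0; apply: (@near_lt_cont _ (fun p => dot u (p - q)) (fun _ => c)).
  - exact: continuous_dot.
  - exact: cvg_cst.
  - by rewrite subrr /dot /= !mulr0 addr0.
have D1 := near_dot (fwd i) ((1 - s) * dot (fwd i) (fwd i)).
have D2 := near_dot (bwd i s) (r * dot (bwd i s) (bwd i s)).
have {}D1 : \forall p \near q, dot (fwd i) (p - q) < (1 - s) * dot (fwd i) (fwd i).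
  by apply: D1; rewrite mulr_gt0 // subr_gt0.
have {}D2 : \forall p \near q, dot (bwd i s) (p - q) < r * dot (bwd i s) (bwd i s).
  by apply: D2; rewrite mulr_gt0.
near=> p; split.
  move=> /gamma_segment[j hj].
  have hq : on_segment (w j) (w (ordS j)) q by move: j hj; near: p; exact: filter_forall.
  have [e|[se e]] := on_segment_ep simple hs hq.
    subst j; case: hj => t /andP[t0 t1]; rewrite -/(ep w i t) => ->.
    have [st|st] := leP s t.
      exists (t - s); first by rewrite subr_ge0.
      by left; rewrite /q !epE -addrA -scalerDl [s + _]addrC subrK.
    exists (s - t); first by rewrite subr_ge0 ltW.
    right; rewrite /bwd; have -> : (s == 0) = false by apply/negbTE; rewrite gt_eqF //; lra.
    by rewrite /q !epE -addrA scalerN -scalerBl subKr.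
  have je : j = ord_pred i by rewrite -e ordSK.
  subst j; case: hj => t /andP[t0 t1]; rewrite -/(ep w _ t) => ->.
  exists (1 - t); first by rewrite subr_ge0.
  right; rewrite /bwd se eqxx /q se ep0.
  exact: ep_pred.
move=> [t t0 [pE|pE]].
  have h : dot (fwd i) (p - q) < (1 - s) * dot (fwd i) (fwd i) by near: p.
  exists i, (s + t); split; last by rewrite pE /q !epE -addrA -scalerDl.
  have : t < 1 - s.
    rewrite -(ltr_pM2r u0); apply: le_lt_trans h; rewrite pE addrC addKr.
    by rewrite dot_scale.
  by move=> h'; apply/andP; split; lra.
have h : dot (bwd i s) (p - q) < r * dot (bwd i s) (bwd i s) by near: p.
have {h} tr : t < r.
  rewrite -(ltr_pM2r v0); apply: le_lt_trans h; rewrite pE addrC addKr.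
  by rewrite dot_scale.
move: tr pE; rewrite /r /bwd; case: eqP => [se|_] tr pE.
  exists (ord_pred i), (1 - t); split; first by apply/andP; split; lra.
  by rewrite ep_pred subKr pE /q se ep0.
exists i, (s - t); split; first by apply/andP; split; lra.
by rewrite pE /q !epE -addrA scalerN -scalerBl.
Unshelve. all: end_near. Qed.

End Germ.

Lemma succ_neq (l : int) : l + 1 <> l.
Proof. by lia. Qed.

Section Local.
Variables (R : realType) (k : nat) (w : 'I_k -> R * R).
Implicit Types (p q u v x y : R * R) (i j : 'I_k).
Hypothesis k2 : (2 < k)%N.
Hypothesis simple : forall i j s t, 0 <= s < 1 -> 0 <= t < 1 ->
  ep w i s = ep w j t -> i = j /\ s = t.

Lemma box_open q (e : R) q' : box q e q' ->
  exists2 d : R, 0 < d & forall p, box q' d p -> box q e p.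
Proof.
move=> /andP[h1 h2].
exists (Num.min (e - `|q'.1 - q.1|) (e - `|q'.2 - q.2|)); first by rewrite lt_min !subr_gt0 h1.
move=> p /andP[]; rewrite !lt_min => /andP[a1 _] /andP[_ a2]; apply/andP; split.
- by have := ler_normD (p.1 - q'.1) (q'.1 - q.1); rewrite addrA subrK; lra.
- by have := ler_normD (p.2 - q'.2) (q'.2 - q.2); rewrite addrA subrK; lra.
Qed.

Lemma crossNl u v : cross (- v) u = cross u v.
Proof. by rewrite /cross /=; ring. Qed.

Lemma sector_scale u v x (t : R) : 0 < t -> sector u v (t *: x) = sector u v x.
Proof. by move=> t0; rewrite /sector cross_scale_l cross_scale_r !pmulr_rgt0. Qed.

Lemma sector_nonempty u v : transverse u v -> exists x, sector u v x.
Proof.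
move=> [u0 v0 uv]; have [h|h] := boolP (0 < cross u v).
  exists (u + v); rewrite /sector h; have e1 : cross u (u + v) = cross u v by rewrite /cross /=; ring.
  have e2 : cross (u + v) v = cross u v by rewrite /cross /=; ring.
  by rewrite e1 e2 h.
exists (perp u); rewrite /sector (negbTE h); apply/orP; left.
by move: u0; rewrite /dot /cross /perp /=; lra.
Qed.

Lemma near_cross_l u q p0 : 0 < cross u (p0 - q) -> \forall p \near p0, 0 < cross u (p - q).
Proof.
exact: (@near_lt_cont R (fun _ => 0) (fun p => cross u (p - q)) p0 (cvg_cst 0) (@continuous_cross R u q p0)).
Qed.

Lemma sector_touches u v q d : transverse u v -> 0 < d ->
  exists2 x, box q d x & sector u v (x - q).
Proof.
move=> /sector_nonempty[n sn] d0.
have hn : \forall p \near q, box q d p by apply/nearP_box; exists d.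
have [c c0 hc] := small_line n hn.
exists (q + (c / 2) *: n); first by apply: hc; rewrite gtr0_norm; lra.
by rewrite addrC addKr sector_scale //; lra.
Qed.

(** The curve cuts a small box around one of its points into two connected sectors, with winding
    number l + 1 on the left and l on the right. Inside the box, equal winding numbers thus mean the
    same component of the complement. *)
Record local_structure i (s e : R) (l : int) : Prop := LocalStructure {
  ls_pos : 0 < e;
  ls_left : forall p, box (ep w i s) e p ->
    sector (fwd w i) (bwd w i s) (p - ep w i s) -> ~ gamma w p /\ wind w p = l + 1;
  ls_right : forall p, box (ep w i s) e p ->
    sector (bwd w i s) (fwd w i) (p - ep w i s) -> ~ gamma w p /\ wind w p = l;
  ls_cover : forall p, box (ep w i s) e p -> ~ gamma w p ->
    sector (fwd w i) (bwd w i s) (p - ep w i s) \/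
    sector (bwd w i s) (fwd w i) (p - ep w i s);
  ls_joined : forall p p', box (ep w i s) e p -> box (ep w i s) e p' ->
    ~ gamma w p -> ~ gamma w p' -> wind w p = wind w p' -> joined w p p' }.

(** The jump formula holds only in the interior of an edge, but the two sectors are connected. It is
    therefore enough to compare two points on both sides of edge i slightly ahead of q. *)
Lemma local_structure_exists i s : 0 <= s < 1 -> exists e l, local_structure i s e l.
Proof.
move=> hs; have [e e0 hg] := germ k2 simple i hs; set q := ep w i s in hg *.
set u := fwd w i in hg; set v := bwd w i s in hg.
have tr : transverse u v := transverse_germ k2 simple i s.
have tr' := transverse_sym tr.
have ng a b p : (a = u /\ b = v) \/ (a = v /\ b = u) -> box q e p -> sector a b (p - q) -> ~ gamma w p.
  move=> ab bp sp /(hg _ bp)[t t0 h]; have [h1 h2] := @sector_ray R a b t t0.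
  by case: ab h1 h2 h sp => -[-> ->] h1 h2 [] ->; rewrite addrC addKr ?(negbTE h1) ?(negbTE h2).
have jl x y : box q e x -> box q e y -> sector u v (x - q) -> sector u v (y - q) -> joined w x y.
  by apply: sector_joined => // p bp /(hg _ bp).
have jr x y : box q e x -> box q e y -> sector v u (x - q) -> sector v u (y - q) -> joined w x y.
  by apply: sector_joined => // p bp /(hg _ bp)[t t0 h]; exists t => //; case: h => h; [right|left].
have [x [y [bx b_y sx sy wxy]]] : exists x y, [/\ box q e x, box q e y,
    sector u v (x - q), sector v u (y - q) & wind w x = wind w y + 1].
  have hn : \forall p \near q, box q e p by apply/nearP_box; exists e.
  have [d d0 hd] := small_line u hn.
  have /andP[s0 s1] := hs.
  (* Small enough for q' to stay in the box and to be an interior point of edge i, also when q is a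
     vertex. *)
  pose t := Num.min (d / 2) ((1 - s) / 2).
  have t0 : 0 < t by rewrite lt_min; apply/andP; split; lra.
  have td : t < d by rewrite gt_min; apply/orP; left; lra.
  have ts : t <= (1 - s) / 2 by rewrite ge_min lexx orbT.
  set q' := q + t *: u.
  have q'E : q' = ep w i (s + t) by rewrite /q' /q !epE -addrA -scalerDl.
  have bq' : box q e q' by apply: hd; rewrite gtr0_norm.
  have hst : 0 < s + t < 1 by apply/andP; split; lra.
  have [C hC] := wind_jump k2 simple i hst; rewrite -q'E in hC.
  have hb : \forall p \near q', box q e p.
    by apply/nearP_box; exact: box_open.
  (* A convex sector has a second bounding ray; q' is strictly on the correct side of it, and so are
     the nearby points. [hv'] treats the opposite sector. *)
  have hv : \forall p \near q', 0 < cross u v -> 0 < cross (p - q) v.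
    have [h|h] := boolP (0 < cross u v); last by near=> p.
    have : 0 < cross (- v) (q' - q).
      by rewrite /q' addrC addKr cross_scale_r crossNl mulr_gt0.
    by move=> /near_cross_l; apply: filterS => p hp _; rewrite -crossNl.
  have hv' : \forall p \near q', 0 < cross v u -> 0 < cross v (p - q).
    have [h|h] := boolP (0 < cross v u); last by near=> p.
    have : 0 < cross v (q' - q) by rewrite /q' addrC addKr cross_scale_r mulr_gt0.
    by move=> /near_cross_l; apply: filterS.
  have H : \forall p \near q', [/\ box q e p,
     0 < cross u v -> 0 < cross (p - q) v, 0 < cross v u -> 0 < cross v (p - q) &
     cross u (p - w i) != 0 -> wind w p = C + ind (0 < cross u (p - w i))].
    by near=> p; split; near: p.
  have [c c0 hc] := small_line (perp u) H.
  have uu : 0 < dot u u by case: tr.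
  have cu : cross u (perp u) = dot u u by rewrite /cross /perp /dot /=; ring.
  have ci r : cross u (q' + r *: perp u - w i) = r * dot u u.
    have -> : q' + r *: perp u - w i = (s + t) *: u + r *: perp u.
      by rewrite q'E epE addrAC [w i + _]addrC addrK.
    have -> : cross u ((s + t) *: u + r *: perp u) = cross u ((s + t) *: u) + cross u (r *: perp u).
      by rewrite /cross /=; ring.
    by rewrite !cross_scale_r crossvv mulr0 add0r cu.
  have cq r : cross u (q' + r *: perp u - q) = r * dot u u.
    have -> : q' + r *: perp u - q = t *: u + r *: perp u.
      by rewrite /q' addrAC [q + _]addrC addrK.
    have -> : cross u (t *: u + r *: perp u) = cross u (t *: u) + cross u (r *: perp u).
      by rewrite /cross /=; ring.
    by rewrite !cross_scale_r crossvv mulr0 add0r cu.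
  have [] := hc (c / 2); first by rewrite gtr0_norm; lra.
  set x := q' + _ => bx cx1 _ wx.
  have [] := hc (- (c / 2)); first by rewrite normrN gtr0_norm; lra.
  set y := q' + _ => b_y _ cy1 wy.
  have c20 : 0 < c / 2 by lra.
  exists x, y; split=> //.
  - rewrite /sector; have -> : 0 < cross u (x - q) by rewrite cq mulr_gt0.
    by case: ifP => //= h; exact: cx1.
  - rewrite /sector; have -> : 0 < cross (y - q) u.
      by rewrite crossC cq mulNr opprK mulr_gt0.
    by case: ifP => /= [h|]; rewrite ?orbT // cy1.
  - rewrite wx ?wy ?ci ?mulf_neq0 ?oppr_eq0 ?gt_eqF //.
    rewrite mulr_gt0 // mulNr oppr_gt0 (ltNge (_ * _)) ltW ?mulr_gt0 //=.
    by rewrite /ind addr0.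
exists e, (wind w y); split => //.
- move=> p bp sp; split; first by apply: (ng u v) => //; left.
  by rewrite -wxy; apply: wind_joined; exact: jl.
- move=> p bp sp; split; first by apply: (ng v u) => //; right.
  by apply: wind_joined; exact: jr.
- move=> p bp np; have [h|h|[t t0 h]|[t t0 h]] := sector_cover (p - q) tr; [by left|by right| |].
    by case: np; apply/(hg _ bp); exists t => //; left; rewrite -h addrC subrK.
  by case: np; apply/(hg _ bp); exists t => //; right; rewrite -h addrC subrK.
- move=> p p' bp bp' np np' wpp'.
  have cov z : box q e z -> ~ gamma w z -> sector u v (z - q) /\ wind w z = wind w y + 1 \/
      sector v u (z - q) /\ wind w z = wind w y.
    move=> bz nz; have [h|h|[t t0 h]|[t t0 h]] := sector_cover (z - q) tr.
    + by left; split => //; rewrite -wxy; apply: wind_joined; exact: jl.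
    + by right; split => //; apply: wind_joined; exact: jr.
    + by case: nz; apply/(hg _ bz); exists t => //; left; rewrite -h addrC subrK.
    + by case: nz; apply/(hg _ bz); exists t => //; right; rewrite -h addrC subrK.
  have [[h1 e1]|[h1 e1]] := cov _ bp np; have [[h2 e2]|[h2 e2]] := cov _ bp' np'.
  + exact: jl.
  + by case: (@succ_neq (wind w y)); rewrite -e1 wpp' e2.
  + by case: (@succ_neq (wind w y)); rewrite -e2 -wpp' e1.
  + exact: jr.
Unshelve. all: end_near. Qed.

End Local.

(** * The components of the complement *)

Section Global.
Variables (R : realType) (k : nat) (w : 'I_k -> R * R).
Implicit Types (p q u v x y : R * R) (i j : 'I_k).
Hypothesis k2 : (2 < k)%N.
Hypothesis simple : forall i j s t, 0 <= s < 1 -> 0 <= t < 1 ->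
  ep w i s = ep w j t -> i = j /\ s = t.

Lemma near_not_gamma q : ~ gamma w q -> \forall p \near q, ~ gamma w p.
Proof.
move=> nq.
have H i : \forall p \near q, ~ on_segment (w i) (w (ordS i)) p.
  by apply: near_not_segment => h; apply: nq; apply/gamma_segment; exists i.
near=> p => /gamma_segment[i]; move: i; near: p; exact: filter_forall.
Unshelve. all: end_near. Qed.

Lemma box_sub q (e e' : R) p : e <= e' -> box q e p -> box q e' p.
Proof. by move=> h /andP[h1 h2]; rewrite /box !(lt_le_trans _ h). Qed.

Lemma box_convex_set q (e : R) : convex_set (box q e).
Proof. by move=> x y t; exact: box_convex. Qed.

(** The point q belongs to the closure of the component of p. *)
Definition touches p q := forall d : R, 0 < d -> exists2 x, box q d x & joined w p x.

(** Otherwise the component would be closed as well as open, hence the whole plane, although the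
    curve is not empty. *)
Lemma touches_some p : ~ gamma w p -> exists2 q, gamma w q & touches p q.
Proof.
move=> np; pose C := connected_component (~` gamma w) p.
apply: contrapT => h.
have cC : closure C `<=` ~` gamma w.
  move=> q cq gq; apply: h; exists q => // d d0.
  have [x [Cx bx]] : C `&` box q d !=set0 by apply: cq; apply/nearP_box; exists d.
  by exists x.
have clC : closed C.
  rewrite closure_id eqEsubset; split; first exact: subset_closure.
  apply: connected_component_max => //.
    by apply: subset_closure; exact: connected_component_refl.
  exact/connected_closure/component_connected.
have opC : open C.
  rewrite openE => x Cx; have nx : ~ gamma w x := connected_component_sub Cx.
  have /nearP_box[e e0 he] := near_not_gamma nx.
  apply/nearP_box; exists e => // y by_.
  apply: (connected_component_trans Cx).
  by apply: (joined_convex (box_convex_set (q := x) (e := e))) => //; exact: box_self.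
have CT : C = setT.
  apply: (@connected_convex R setT (fun _ _ _ _ _ _ => I)).
  - by exists p; exact: connected_component_refl.
  - by exists C => //; rewrite setTI.
  - by exists C => //; rewrite setTI.
have i0 : 'I_k by apply: (@Ordinal k 0%N); lia.
have : C (w i0) by rewrite CT.
move=> /connected_component_sub; apply.
by exists i0, 0; rewrite lexx ler01 ep0.
Qed.

Lemma both_sides q (d : R) : gamma w q -> 0 < d -> exists x y,
  [/\ box q d x, box q d y, ~ gamma w x, ~ gamma w y & wind w x = wind w y + 1].
Proof.
move=> /gammaP[i [s [hs ->]]] d0.
have [e [l h]] := local_structure_exists k2 simple i hs.
have tr := transverse_germ k2 simple i s.
have m0 : 0 < Num.min d e by rewrite lt_min d0 (ls_pos h).
have [x bx sx] := sector_touches (ep w i s) tr m0.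
have [y b_y sy] := sector_touches (ep w i s) (transverse_sym tr) m0.
have md : Num.min d e <= d by rewrite ge_min lexx.
have me : Num.min d e <= e by rewrite ge_min lexx orbT.
have [nx wx] := ls_left h (box_sub me bx) sx.
have [ny wy] := ls_right h (box_sub me b_y) sy.
by exists x, y; rewrite wx wy (box_sub md bx) (box_sub md b_y).
Qed.

(** The component of p has a point in the box, with winding number l or l + 1. Both values occur
    arbitrarily close to q, and the point near q with the same value is joined to it. *)
Lemma touches_near p i s e l q : ~ gamma w p -> local_structure w i s e l ->
  touches p (ep w i s) -> gamma w q -> box (ep w i s) e q -> touches p q.
Proof.
move=> np h tp gq bq d d0.
have [x bx jx] := tp e (ls_pos h).
have nx : ~ gamma w x := connected_component_sub jx.
have [c c0 hc] := box_open bq.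
have m0 : 0 < Num.min d c by rewrite lt_min d0.
have md : Num.min d c <= d by rewrite ge_min lexx.
have mc : Num.min d c <= c by rewrite ge_min lexx orbT.
have [y [z [b_y bz ny nz yz]]] := both_sides gq m0.
have val t : box (ep w i s) e t -> ~ gamma w t -> wind w t = l + 1 \/ wind w t = l.
  move=> bt nt; have [st|st] := ls_cover h bt nt.
    by left; have [] := ls_left h bt st.
  by right; have [] := ls_right h bt st.
have bey := hc _ (box_sub mc b_y); have bez := hc _ (box_sub mc bz).
have [wx|wx] := val _ bx nx.
- exists y; first exact: box_sub b_y.
  apply: (connected_component_trans jx); apply: (ls_joined h) => //.
  have [e1|e1] := val _ bey ny; have [e2|e2] := val _ bez nz; rewrite wx; clear -e1 e2 yz; lia.
- exists z; first exact: box_sub bz.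
  apply: (connected_component_trans jx); apply: (ls_joined h) => //.
  have [e1|e1] := val _ bey ny; have [e2|e2] := val _ bez nz; rewrite wx; clear -e1 e2 yz; lia.
Qed.

Lemma touches_closed p q : (forall d : R, 0 < d -> exists2 q', box q d q' & touches p q') ->
  touches p q.
Proof.
move=> h d d0; have [q' bq' tq'] := h d d0.
have [c c0 hc] := box_open bq'.
have [x bx jx] := tq' c c0.
by exists x => //; exact: hc.
Qed.

(** The parameters of the touched points form a subset of [0, 1] that is open by [touches_near],
    closed by [touches_closed] and not empty. *)
Lemma touches_edge p i s0 : ~ gamma w p -> 0 <= s0 <= 1 -> touches p (ep w i s0) ->
  forall s, 0 <= s <= 1 -> touches p (ep w i s).
Proof.
move=> np hs0 h0 s hs.
pose f t := w i + t *: fwd w i.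
have fE t : f t = ep w i t by rewrite epE.
pose B := [set t : R | t \in `[0, 1] /\ touches p (f t)].
have BE : B = `[0, 1]%classic.
  apply: (segment_connected (a := 0) (b := 1)).
  - by exists s0; split; rewrite ?in_itv //= fE.
  - exists [set t | \forall t' \near t, t' \in `[0, 1] -> touches p (f t')].
      rewrite openE => t; rewrite /interior /= => ht.
      exact: nbhs_interior ht.
    rewrite /B eqEsubset; split => t /= [t1 t2]; split => //; last first.
      by have := nbhs_singleton t2; apply.
    have gt : gamma w (f t) by exists i, t; rewrite fE; split => //; rewrite in_itv in t1.
    have [j [r [hr E]]] := gammaP gt.
    have [e [l hl]] := local_structure_exists k2 simple j hr.
    have hn : \forall q \near f t, box (ep w j r) e q.
      by apply/nearP_box; rewrite -E; exists e => //; exact: ls_pos hl.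
    have ht : \forall t' \near t, box (ep w j r) e (f t').
      exact: (@continuous_line R (w i) (fwd w i) t _ hn).
    apply: filterS ht => t' bt' ht'.
    apply: (touches_near np hl) => //; first by rewrite -E.
    by exists i, t'; rewrite fE; split => //; rewrite in_itv in ht'.
  - exists [set t | touches p (f t)]; last by rewrite eqEsubset; split => t [].
    rewrite closedE => t /= ht; apply: touches_closed => d d0.
    have hn : \forall q \near f t, box (f t) d q by apply/nearP_box; exists d.
    apply: contrapT => h; apply: ht.
    have hl : \forall t' \near t, box (f t) d (f t').
      exact: (@continuous_line R (w i) (fwd w i) t _ hn).
    apply: filterS hl => t' bt' ht'.
    by apply: h; exists (f t').
have : B s by rewrite BE /= in_itv.
by rewrite /B /= fE => -[].
Qed.

Lemma touches_all p q : ~ gamma w p -> gamma w q -> touches p q.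
Proof.
move=> np; have [q0 gq0 tq0] := touches_some np.
have [i [s [hs E]]] := gammaP gq0; rewrite {}E in tq0.
have hs' : 0 <= s <= 1 by case/andP: hs => -> /ltW ->.
have ti : touches p (w i).
  by rewrite -ep0; apply: (touches_edge np hs' tq0); rewrite lexx ler01.
have step j : touches p (w j) -> touches p (w (ordS j)).
  move=> tj; rewrite -ep1; apply: (@touches_edge p j 0); rewrite ?lexx ?ler01 //.
  by rewrite ep0.
have tall j : touches p (w j).
  have h n : touches p (w (iter n (@ordS k) i)) by elim: n => //= n IH; exact: step.
  have hv n : val (iter n (@ordS k) i) = ((i + n) %% k)%N.
    elim: n => [|n IH] /=; first by rewrite addn0 modn_small.
    by rewrite IH -addn1 modnDml addn1 addnS.
  (* Going around the cycle, j + (k - i) steps lead from i to j + k, which is j modulo k. *)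
  have -> // : j = iter (j + (k - i))%N (@ordS k) i.
  apply: val_inj; rewrite hv.
  have -> : (i + (j + (k - i)) = j + k)%N by have := ltn_ord i; lia.
  by rewrite modnDr modn_small.
move=> [j [r [hr ->]]]; apply: (@touches_edge p j 0); rewrite ?lexx ?ler01 //.
by rewrite ep0.
Qed.

Definition radius : R := \sum_i (`|(w i).1| + `|(w i).2|).

Lemma radius_ge i : `|(w i).1| <= radius /\ `|(w i).2| <= radius.
Proof.
rewrite /radius (bigD1 i) //=.
have h : 0 <= \sum_(j | j != i) (`|(w j).1| + `|(w j).2|).
  by apply: sumr_ge0 => j _; rewrite addr_ge0.
have h1 := normr_ge0 (w i).1; have h2 := normr_ge0 (w i).2.
by split; lra.
Qed.

Section Bounded.
Variable r : R.
Hypothesis wr : forall i, `|(w i).1| <= r /\ `|(w i).2| <= r.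

Lemma bound_le i : [/\ - r <= (w i).1, (w i).1 <= r,
  - r <= (w i).2 & (w i).2 <= r].
Proof. by have [] := wr i; rewrite !ler_norml => /andP[-> ->] /andP[-> ->]. Qed.

Lemma crossing_outside_fst i p : r < `|p.1| -> crossing (w i) (w (ordS i)) p = 0.
Proof.
have [a1 a2 _ _] := bound_le i; have [b1 b2 _ _] := bound_le (ordS i).
rewrite lter_normr => /orP[h|h]; rewrite /crossing.
  have -> : (w i).1 <= p.1 by lra.
  have -> : (w (ordS i)).1 <= p.1 by lra.
  by rewrite subrr mul0r.
have -> : ((w i).1 <= p.1) = false by apply/negbTE; rewrite -ltNge; lra.
have -> : ((w (ordS i)).1 <= p.1) = false by apply/negbTE; rewrite -ltNge; lra.
by rewrite subrr mul0r.
Qed.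

Lemma belowE (a b p : R * R) : (b.1 - a.1) * cross (b - a) (p - a) =
  (b.1 - a.1) * ((b.1 - p.1) * (p.2 - a.2) + (p.1 - a.1) * (p.2 - b.2)).
Proof. by rewrite /cross /=; ring. Qed.

(** To the left or right of all vertices no edge lies over p, and from above none is met. From below
    every edge over p counts, and the signed differences telescope around the polygon. *)
Lemma wind_outside p : (r < `|p.1|) || (r < `|p.2|) -> wind w p = 0.
Proof.
case/orP=> h; first by apply: big1 => i _; exact: crossing_outside_fst.
move: h; rewrite lter_normr => /orP[h|h].
  apply: big1 => i _; have [_ _ _ a2] := bound_le i; have [_ _ _ b2] := bound_le (ordS i).
  rewrite /crossing /below belowE.
  have [a1|a1] := lerP (w i).1 p.1; have [b1|b1] := lerP (w (ordS i)).1 p.1;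
    rewrite ?subrr ?mul0r //.
  - have -> : ((((w (ordS i)).1 - (w i).1) * (((w (ordS i)).1 - p.1) * (p.2 - (w i).2) +
      (p.1 - (w i).1) * (p.2 - (w (ordS i)).2))) < 0) = false.
      apply/negbTE; rewrite -leNgt; apply: mulr_ge0; first by lra.
      by apply: addr_ge0; apply: mulr_ge0; lra.
    by rewrite mulr0.
  - have -> : ((((w (ordS i)).1 - (w i).1) * (((w (ordS i)).1 - p.1) * (p.2 - (w i).2) +
      (p.1 - (w i).1) * (p.2 - (w (ordS i)).2))) < 0) = false.
      apply/negbTE; rewrite -leNgt; apply: mulr_le0; first by lra.
      by rewrite -oppr_ge0 opprD -!mulNr; apply: addr_ge0; apply: mulr_ge0; lra.
    by rewrite mulr0.
rewrite /wind (eq_bigr (fun i => ind ((w (ordS i)).1 <= p.1) - ind ((w i).1 <= p.1))).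
  rewrite sumrB [X in _ - X](reindex_inj (can_inj (@ordSK k))) /=.
  by rewrite subrr.
move=> i _; have [_ _ a2 _] := bound_le i; have [_ _ b2 _] := bound_le (ordS i).
rewrite /crossing /below belowE.
have [a1|a1] := lerP (w i).1 p.1; have [b1|b1] := lerP (w (ordS i)).1 p.1;
  rewrite ?subrr ?mul0r //.
- have -> : (((w (ordS i)).1 - (w i).1) * (((w (ordS i)).1 - p.1) * (p.2 - (w i).2) +
    (p.1 - (w i).1) * (p.2 - (w (ordS i)).2))) < 0.
    rewrite pmulr_rlt0; last by lra.
    have h1 : 0 < (w (ordS i)).1 - p.1 by lra.
    have h2 : 0 <= p.1 - (w i).1 by lra.
    have h3 : ((w (ordS i)).1 - p.1) * (p.2 - (w i).2) < 0 by rewrite pmulr_rlt0 //; lra.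
    have h4 : (p.1 - (w i).1) * (p.2 - (w (ordS i)).2) <= 0 by rewrite mulr_ge0_le0 //; lra.
    lra.
  by rewrite mulr1.
- have -> : (((w (ordS i)).1 - (w i).1) * (((w (ordS i)).1 - p.1) * (p.2 - (w i).2) +
    (p.1 - (w i).1) * (p.2 - (w (ordS i)).2))) < 0.
    rewrite nmulr_rlt0; last by lra.
    have h1 : (w (ordS i)).1 - p.1 <= 0 by lra.
    have h2 : p.1 - (w i).1 < 0 by lra.
    have h3 : 0 <= ((w (ordS i)).1 - p.1) * (p.2 - (w i).2) by rewrite mulr_le0 //; lra.
    have h4 : 0 < (p.1 - (w i).1) * (p.2 - (w (ordS i)).2) by rewrite nmulr_rgt0 //; lra.
    lra.
  by rewrite mulr1.
Qed.

Lemma gamma_bounded p : gamma w p -> `|p.1| <= r /\ `|p.2| <= r.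
Proof.
move=> [i [s [/andP[s0 s1] ->]]].
have [a1 a1' a2 a2'] := bound_le i; have [b1 b1' b2 b2'] := bound_le (ordS i).
have E1 : (ep w i s).1 = (1 - s) * (w i).1 + s * (w (ordS i)).1 by [].
have E2 : (ep w i s).2 = (1 - s) * (w i).2 + s * (w (ordS i)).2 by [].
by rewrite !ler_norml E1 E2; split; apply/andP; split; nra.
Qed.

End Bounded.

Definition far_point : R * R := (radius + 1, 0).

Lemma radius_ge0 : 0 <= radius.
Proof. by apply: sumr_ge0 => i _; rewrite addr_ge0. Qed.

Lemma far_points t : radius < t -> joined w far_point (t, 0).
Proof.
move=> ht; have r0 := radius_ge0.
apply: (@joined_convex R k w [set p | radius < p.1]) => //=; last by lra.
  move=> x y s hs /= hx hy; change (radius < (1 - s) * x.1 + s * y.1); have := @convex_lt _ (- x.1) (- y.1) (- radius) s hs.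
  have h1 : - x.1 < - radius by rewrite ltrN2.
  have h2 : - y.1 < - radius by rewrite ltrN2.
  by move=> /(_ h1 h2); lra.
move=> p /= hp /(gamma_bounded radius_ge)[h _]; move: h; apply/negP; rewrite -ltNge; exact: lt_le_trans hp (ler_norm _).
Qed.

Lemma wind_bounded p : ~ gamma w p -> wind w p <> 0 ->
  bounded_set (connected_component (~` gamma w) p).
Proof.
move=> np wp; exists radius; split; first exact: num_real.
move=> M hM x jx; rewrite /= prod_normE ge_max !leNgt -negb_or; apply/negP => h.
apply: wp; rewrite (wind_joined jx); apply: (wind_outside radius_ge).
by case/orP: h => h; apply/orP; [left|right]; lra.
Qed.

Lemma far_unbounded p : joined w p far_point ->
  ~ bounded_set (connected_component (~` gamma w) p).
Proof.
move=> jp [M [Mr hM]].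
pose t := Num.max (radius + 1) (M + 2).
have t1 : radius + 1 <= t by rewrite le_max lexx.
have t2 : M + 2 <= t by rewrite le_max lexx orbT.
have : joined w p (t, 0).
  by apply: (connected_component_trans jp); apply: far_points; lra.
have M1 : M < M + 1 by lra.
move=> /(hM _ M1); rewrite /= prod_normE ge_max /= => /andP[h _].
by have := ler_norm t; lra.
Qed.

(** Every component meets the box of one fixed local structure, so the winding number takes only the
    values l and l + 1 and determines the component. A far point has the value 0, which leaves l = 0
    (counterclockwise) or l = -1 (clockwise) and makes 0 the value of the unbounded component. Both
    values occur at every point of the curve, so l is the same everywhere. *)
Theorem jordan_polygon : exists2 l : int, l = 0 \/ l = -1 &
  (forall p, ~ gamma w p ->
     (bounded_set (connected_component (~` gamma w) p) <-> wind w p <> 0) /\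
     (wind w p = l \/ wind w p = l + 1)) /\
  (forall i s, 0 <= s < 1 -> exists e, local_structure w i s e l).
Proof.
have i0 : 'I_k by apply: (@Ordinal k 0%N); lia.
have h01 : 0 <= (0 : R) < 1 by rewrite lexx ltr01.
have [e [l hl]] := local_structure_exists k2 simple i0 h01.
have values i s e' l' p : 0 <= s < 1 -> local_structure w i s e' l' -> ~ gamma w p ->
    exists2 x, box (ep w i s) e' x & [/\ joined w p x, ~ gamma w x &
      wind w x = l' \/ wind w x = l' + 1].
  move=> hs h np.
  have gq : gamma w (ep w i s) by exists i, s; case/andP: hs => -> /ltW ->.
  have [x bx jx] := touches_all np gq (ls_pos h); exists x => //.
  have nx : ~ gamma w x := connected_component_sub jx.
  split=> //; have [sx|sx] := ls_cover h bx nx.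
    by right; have [] := ls_left h bx sx.
  by left; have [] := ls_right h bx sx.
have val i s e' l' p : 0 <= s < 1 -> local_structure w i s e' l' -> ~ gamma w p ->
    wind w p = l' \/ wind w p = l' + 1.
  by move=> hs h np; have [x _ [/wind_joined -> _]] := values i s e' l' p hs h np.
have nf : ~ gamma w far_point.
  move=> /(gamma_bounded radius_ge)[]; rewrite /far_point /= => h _.
  by have := ler_norm (radius + 1); lra.
have wf : wind w far_point = 0.
  apply: (wind_outside radius_ge); rewrite /far_point /=.
  by have := ler_norm (radius + 1); move=> h; apply/orP; left; lra.
exists l.
  by have := val _ _ _ _ _ h01 hl nf; rewrite wf; clear; lia.
split.
  move=> p np; split; last exact: val h01 hl np.
  split; last exact: wind_bounded.
  move=> bp wp.
  have [x bx [jx nx _]] := values _ _ _ _ _ h01 hl np.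
  have [y b_y [jy ny _]] := values _ _ _ _ _ h01 hl nf.
  apply: far_unbounded bp.
  apply: (connected_component_trans jx); apply: (connected_component_trans (y := y)).
    by apply: (ls_joined hl) => //; rewrite -(wind_joined jx) -(wind_joined jy) wp wf.
  exact: connected_component_sym.
move=> i s hs; have [e' [l' h']] := local_structure_exists k2 simple i hs.
exists e'; suff -> : l = l' by [].
have gq : gamma w (ep w i s) by exists i, s; case/andP: hs => -> /ltW ->.
have [x [y [bx b_y nx ny xy]]] := both_sides gq (ls_pos h').
have := val _ _ _ _ _ hs h' nx; have := val _ _ _ _ _ hs h' ny.
have := val _ _ _ _ _ h01 hl nx; have := val _ _ _ _ _ h01 hl ny.
by clear -xy; lia.
Qed.

End Global.

(** * The region as a sum of local weights *)

Section WeightSum.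
Variable R : realType.
Implicit Types (a b o p q u v : R * R).

(** The initial point is excluded, so that the half-open edges of a closed polygon partition it. *)
Definition on_half a b p := exists2 t : R, 0 < t <= 1 & p = (1 - t) *: a + t *: b.

Lemma crossing_rev a b p : crossing b a p = - crossing a b p.
Proof.
rewrite /crossing; have -> : below b a p = below a b p.
  by rewrite /below; congr (_ < 0); rewrite /cross /=; ring.
ring.
Qed.

Lemma on_half_cross a b p : on_half a b p -> cross (b - a) (p - a) = 0.
Proof.
move=> [t _ ->]; rewrite line_combination [a + _]addrC addrK cross_scale_r.
by rewrite crossvv mulr0.
Qed.

Lemma on_half_fst a b p : on_half a b p -> b.1 < a.1 -> b.1 <= p.1 /\ p.1 < a.1.
Proof.
move=> [t /andP[t0 t1] ->] ba; change (b.1 <= (1 - t) * a.1 + t * b.1 /\ (1 - t) * a.1 + t * b.1 < a.1).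
by split; nra.
Qed.

Lemma on_half_vertical a b p : a.1 = b.1 -> a.2 < b.2 ->
  on_half a b p <-> p.1 = a.1 /\ a.2 < p.2 <= b.2.
Proof.
move=> e ab; split.
  move=> [t /andP[t0 t1] ->]; change ((1 - t) * a.1 + t * b.1 = a.1 /\
    a.2 < (1 - t) * a.2 + t * b.2 <= b.2).
  by rewrite -e; split; [ring|apply/andP; split; nra].
move=> [p1 /andP[h1 h2]].
have hh : (a.2 <= p.2 <= b.2) || (b.2 <= p.2 <= a.2) by rewrite (ltW h1) h2.
have [t /andP[t0 t1] pE] := on_segment_vertical e p1 hh.
exists t => //; rewrite t1 lt_neqAle t0 !andbT; apply: contraTneq h1 => t00.
by rewrite pE -t00 subr0 scale1r scale0r addr0 ltxx.
Qed.

(** Off the edge the weight is the crossing number. On the edge, 1 is added when the edge is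
    [lexleft], that is when the direction (epsilon, 1) leads to its right-hand side. *)
Lemma edge_weightE a b p : a != b ->
  edge_weight a b p = crossing a b p + ind (lexleft (b - a) && `[< on_half a b p >]).
Proof.
move=> ab; rewrite /edge_weight /crossing /below /lexleft.
have -> : (b - a).1 = b.1 - a.1 by [].
have -> : (b - a).2 = b.2 - a.2 by [].
have [lt|lt|e] := ltgtP a.1 b.1.
- have -> : (b.1 - a.1 < 0) = false by apply/negbTE; rewrite -leNgt; lra.
  have -> : (b.1 - a.1 == 0) = false by rewrite subr_eq0 gt_eqF.
  rewrite /= addr0 pmulr_rlt0; last by rewrite subr_gt0.
  have [h1|h1] := lerP a.1 p.1; have [h2|h2] := lerP b.1 p.1 => //=; rewrite ?indE //; try by ring.
  by exfalso; lra.
- have -> : b.1 - a.1 < 0 by lra.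
  rewrite /= nmulr_rlt0; last by rewrite subr_lt0.
  have [h1|h1] := lerP b.1 p.1; last first.
    have -> : (a.1 <= p.1) = false by apply/negbTE; rewrite -ltNge; lra.
    rewrite (asboolF (P := on_half a b p)); last by move=> /on_half_fst /(_ lt)[]; lra.
    by rewrite /= indE; ring.
  have [h2|h2] := lerP a.1 p.1.
    rewrite (asboolF (P := on_half a b p)); last by move=> /on_half_fst /(_ lt)[]; lra.
    by rewrite /= !indE; ring.
  have [c|c|c] := ltgtP 0 (cross (b - a) (p - a)).
  + rewrite (asboolF (P := on_half a b p)); last by move=> /on_half_cross c'; rewrite c' ltxx in c.
    by rewrite /= !indE; ring.
  + rewrite (asboolF (P := on_half a b p)); last by move=> /on_half_cross c'; rewrite c' ltxx in c.
    by rewrite /= !indE; ring.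
  + rewrite (asboolT (P := on_half a b p)); first by rewrite /= !indE; ring.
    have [|||t /andP[t0 t1] pE] := @on_segment_cross R a b p; rewrite ?gt_eqF ?h1 ?(ltW h2) ?orbT //.
    exists t => //; rewrite t1 lt_neqAle t0 !andbT; apply: contraTneq h2 => t00.
    by rewrite pE -t00 subr0 scale1r scale0r addr0 ltxx.
- rewrite e (subrr b.1) subrr ltxx eqxx /= mul0r add0r subr_gt0.
  have [h|h] := ltP a.2 b.2; last first.
    congr ind; apply/negbTE/negP => /and3P[_ h1 h2]; lra.
  congr ind => /=; apply/idP/asboolP.
    by move=> /and3P[/eqP h1 h2 h3]; apply/on_half_vertical => //; rewrite h1 h2 h3.
  by move=> /(on_half_vertical _ e h)[-> ->]; rewrite e eqxx.
Qed.

Lemma lexleft_opp u : u != 0 -> lexleft (- u) = ~~ lexleft u.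
Proof.
case: u => u1 u2; rewrite /lexleft /= => h; rewrite !oppr_lt0 oppr_eq0 oppr_gt0.
have [h1|h1|h1] := ltgtP u1 0 => //=.
have [h2|h2|h2] := ltgtP u2 0 => //=.
by rewrite h1 h2 eqxx in h.
Qed.

Definition eta (e : R) : R * R := (e, 1).

Lemma near_eta u : u != 0 -> \forall e \near 0^'+,
  (0 < cross (eta e) u) = lexleft u /\ cross (eta e) u != 0.
Proof.
case: u => u1 u2 u0; rewrite /lexleft /cross /=.
have [e1|h] := eqVneq u1 0.
  have u2n : u2 != 0 by apply: contra_neq u0 => e2; rewrite e1 e2.
  rewrite e1.
  near=> e; have e0 : 0 < e by near: e; exact: nbhs_right_gt.
  have -> : e * u2 - 1 * 0 = e * u2 by ring.
  split; first by rewrite ltxx pmulr_rgt0.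
  by rewrite mulf_neq0 // gt_eqF.
have c0 : 0 < `|u2| + 1 by have := normr_ge0 u2; lra.
have d0 : 0 < `|u1| / (`|u2| + 1) by rewrite divr_gt0 ?normr_gt0.
near=> e; have e0 : 0 < e by near: e; exact: nbhs_right_gt.
have : e < `|u1| / (`|u2| + 1) by near: e; exact: nbhs_right_lt.
rewrite ltr_pdivlMr // mulrDr mulr1 => h1.
have h2 : `|e * u2| <= e * `|u2| by rewrite normrM gtr0_norm.
have {h2} : `|e * u2| < `|u1| by lra.
rewrite ltr_norml /= orbF mul1r => /andP[h2 h3].
have [lt|lt|eq] := ltgtP u1 0; last by rewrite eq eqxx in h.
- rewrite ltr0_norm // in h2 h3; have h4 : 0 < e * u2 - u1 by lra.
  by rewrite h4 gt_eqF.
- rewrite gtr0_norm // in h2 h3; have h4 : e * u2 - u1 < 0 by lra.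
  by rewrite lt_eqF // ltNge ltW.
Unshelve. all: end_near. Qed.

(** The conventions in [crossing], with <= for columns and < for heights, are those of a point
    pushed slightly to the right and, much more, upwards: its value at q is already the value after
    the push. *)
Lemma crossing_eta a b q e : a != b -> 0 < e -> (0 < cross (eta e) (b - a)) = lexleft (b - a) ->
  cross (eta e) (b - a) != 0 ->
  \forall t \near 0^'+, crossing a b (q + t *: eta e) = crossing a b q.
Proof.
move=> ab e0 ce cn.
have nx (x : R) : \forall t \near 0^'+, (x <= q.1 + t * e) = (x <= q.1).
  have [h|h] := lerP x q.1.
    near=> t; have t0 : 0 < t by near: t; exact: nbhs_right_gt.
    by apply: (le_trans h); rewrite lerDl mulr_ge0 ?ltW.
  have d0 : 0 < (x - q.1) / e by rewrite divr_gt0 // subr_gt0.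
  near=> t; have : t < (x - q.1) / e by near: t; exact: nbhs_right_lt.
  by rewrite ltr_pdivlMr // => h'; apply/negbTE; rewrite -ltNge; lra.
have [e1|n1] := eqVneq a.1 b.1.
  by near=> t; rewrite /crossing e1 !subrr !mul0r.
have nb : \forall t \near 0^'+, below a b (q + t *: eta e) = below a b q.
  have E t : (b.1 - a.1) * cross (b - a) (q + t *: eta e - a) =
      (b.1 - a.1) * cross (b - a) (q - a) - t * ((b.1 - a.1) * cross (eta e) (b - a)).
    have -> : cross (b - a) (q + t *: eta e - a) = (b.1 - a.1) * (q.2 + t * 1 - a.2) - (b.2 - a.2) * (q.1 + t * e - a.1) by [].
    by rewrite /cross /eta /=; ring.
  have s0 : (b.1 - a.1) * cross (eta e) (b - a) < 0.
    move: ce cn; rewrite /lexleft /=; have -> : (b.1 - a.1 == 0) = false by rewrite subr_eq0 eq_sym (negbTE n1).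
    rewrite /= orbF; have [lt|lt|eq] := ltgtP (b.1 - a.1) 0.
    - by move=> h _; rewrite nmulr_rlt0.
    - move=> h n; rewrite pmulr_rlt0 // lt_neqAle n leNgt h //.
    - by move: n1; rewrite eq_sym -subr_eq0 eq eqxx.
  rewrite /below; set X := _ * cross (b - a) (q - a) in E *; set Y := _ * cross (eta e) _ in E s0.
  have [h|h] := ltP X 0; last first.
    near=> t; have t0 : 0 < t by near: t; exact: nbhs_right_gt.
    by rewrite E; apply/negbTE; rewrite -leNgt; nra.
  have d0 : 0 < X / Y by rewrite -divrNN divr_gt0 // oppr_gt0.
  near=> t; have : t < X / Y by near: t; exact: nbhs_right_lt.
  by rewrite ltr_ndivlMr // E; lra.
near=> t; rewrite /crossing.
have -> : below a b (q + t *: eta e) = below a b q by near: t.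
have -> : (q + t *: eta e).1 = q.1 + t * e by [].
have -> : (a.1 <= q.1 + t * e) = (a.1 <= q.1) by near: t.
by have -> : (b.1 <= q.1 + t * e) = (b.1 <= q.1) by near: t.
Unshelve. all: end_near. Qed.

End WeightSum.

(** * The total weight on and off the curve *)

Section Total.
Variables (R : realType) (k : nat) (w : 'I_k -> R * R).
Implicit Types (p q u v x y : R * R) (i j : 'I_k).
Hypothesis k2 : (2 < k)%N.
Hypothesis simple : forall i j s t, 0 <= s < 1 -> 0 <= t < 1 ->
  ep w i s = ep w j t -> i = j /\ s = t.

Definition total p : int :=
  \sum_i local_weight (w (ord_pred i)) (w i) (w (ordS i)) p.

Definition total_rev p : int :=
  \sum_i local_weight (w (ordS i)) (w i) (w (ord_pred i)) p.

Lemma transverse_neq0 u v : transverse u v -> u != 0 /\ v != 0.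
Proof.
move=> [u0 v0 _]; split.
- by apply: contraTneq u0 => ->; rewrite /dot !mul0r addr0 ltxx.
- by apply: contraTneq v0 => ->; rewrite /dot !mul0r addr0 ltxx.
Qed.

Lemma lex_sector_eta u v e :
  (0 < cross (eta e) u) = lexleft u /\ cross (eta e) u != 0 ->
  (0 < cross (eta e) v) = lexleft v /\ cross (eta e) v != 0 ->
  sector v u (eta e) = lex_sector v u.
Proof.
rewrite /sector /lex_sector; move=> [<- _] [<- nv].
have -> // : (0 < cross v (eta e)) = ~~ (0 < cross (eta e) v).
by rewrite crossC oppr_gt0 -leNgt lt_neqAle nv.
Qed.

(** One epsilon serves finitely many directions at once and makes [eta e] parallel to none of
    them. *)
Lemma exists_eta (I : finType) (f : I -> R * R) : (forall z, f z != 0) ->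
  exists2 e : R, 0 < e & forall i : I,
    (0 < cross (eta e) (f i)) = lexleft (f i) /\ cross (eta e) (f i) != 0.
Proof.
move=> f0; near (0 : R)^'+ => e; exists e; first by near: e; exact: nbhs_right_gt.
by near: e; apply: filter_forall => z; exact: near_eta.
Unshelve. all: end_near. Qed.

Lemma sector_excl u v x : transverse u v -> sector u v x -> ~~ sector v u x.
Proof.
move=> [u0 _ uv]; rewrite /sector (crossC u v) (crossC u x) (crossC x v) !oppr_gt0.
have [c|c|c] := ltgtP 0 (cross u v).
- by move=> /andP[h1 h2]; rewrite negb_or -!leNgt !ltW.
- by move=> /orP[] h; rewrite negb_and -!leNgt (ltW h) ?orbT.
have E := collinear_ray u0 (esym c); set r := _ / _ in E.
have r0 : r < 0 by rewrite ltr_pdivrMr // mul0r uv.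
have -> : cross x v = - r * cross u x by rewrite E cross_scale_r crossC mulrN mulNr.
have r1 : 0 < - r by rewrite oppr_gt0.
by rewrite pmulr_rgt0 // pmulr_rlt0 // !orbb -leNgt => /ltW.
Qed.

(** An actual direction [eta e] off both rays lies in exactly one of the two sectors, and there
    [sector] agrees with [lex_sector]. *)
Lemma lex_sector_compl u v : transverse u v -> lex_sector u v = ~~ lex_sector v u.
Proof.
move=> tr; have [u0 v0] := transverse_neq0 tr.
have [e e0 he] := @exists_eta bool (fun b => if b then u else v)
  (fun b => if b as b return ((if b then u else v) != 0) then u0 else v0).
have hu := he true; have hv := he false; rewrite /= in hu hv.
rewrite -(lex_sector_eta hu hv) -(lex_sector_eta hv hu).
have [_ nu] := hu; have [_ nv] := hv.
have [h|h|[t t0 h]|[t t0 h]] := sector_cover (eta e) tr.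
- by rewrite h (sector_excl tr).
- by rewrite h (negbTE (sector_excl (transverse_sym tr) h)).
- by move: nu; rewrite h cross_scale_l crossvv mulr0 eqxx.
- by move: nv; rewrite h cross_scale_l crossvv mulr0 eqxx.
Qed.

(** By [crossing_eta] the value at a point of the curve is the value on the side to which the push
    leads: l if that is the right sector, from [bwd] to [fwd], and l + 1 otherwise. *)
Lemma wind_gamma i s e l : 0 <= s < 1 -> local_structure w i s e l ->
  wind w (ep w i s) = if lex_sector (bwd w i s) (fwd w i) then l else l + 1.
Proof.
move=> hs h; have tr := transverse_germ k2 simple i s.
have [u0 v0] := transverse_neq0 tr.
pose f (j : option 'I_k) := if j is Some j then fwd w j else bwd w i s.
have [|c c0 hc] := @exists_eta _ f.
  case=> [j|] //=; first by have [] := transverse_neq0 (transverse_germ k2 simple j 0).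
have hb : \forall p \near ep w i s, box (ep w i s) e p.
  by apply/nearP_box; exists e => //; exact: ls_pos h.
have [d d0 hd] := small_line (eta c) hb.
have [t [t0 td wt]] : exists t, [/\ 0 < t, t < d &
    wind w (ep w i s + t *: eta c) = wind w (ep w i s)].
  near (0 : R)^'+ => t; exists t; split.
  - by near: t; exact: nbhs_right_gt.
  - by near: t; exact: nbhs_right_lt.
  - apply: eq_bigr => j _; move: j; near: t; apply: filter_forall => j.
    have [h1 h2] := hc (Some j).
    by apply: crossing_eta => //; exact: vertex_neq.
have bt := hd t; rewrite gtr0_norm // in bt.
have sE a b : sector a b (ep w i s + t *: eta c - ep w i s) = sector a b (eta c).
  by rewrite [ep w i s + _]addrC addrK sector_scale.
have fi := hc (Some i); have fN := hc None; rewrite /= in fi fN.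
rewrite -wt; case: ifP => hl.
  by have [] := ls_right h (bt td); rewrite ?sE ?(lex_sector_eta fi fN).
have [] := ls_left h (bt td); rewrite ?sE ?(lex_sector_eta fN fi) //.
by rewrite (lex_sector_compl tr) hl.
Unshelve. all: end_near. Qed.

Lemma on_half_ep i j s : 0 <= s < 1 ->
  on_half (w j) (w (ordS j)) (ep w i s) <-> (if s == 0 then j = ord_pred i else j = i).
Proof.
move=> hs; have /andP[s0 s1] := hs; split.
  move=> [t /andP[t0 t1] e].
  have t01 : 0 <= t <= 1 by rewrite t1 ltW.
  have [ji|[-> <-]] := on_segment_ep simple hs (ex_intro2 _ _ t t01 e).
    subst j; case: eqP => // se; exfalso.
    have [t1'|t1'] := eqVneq t 1.
      move: e; rewrite se ep0 t1' subrr scale0r scale1r add0r => /eqP.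
      by apply/negP; exact: vertex_neq.
    have ht : 0 <= t < 1 by rewrite (ltW t0) lt_neqAle t1'.
    by have [_ st] := simple hs ht e; rewrite -st se ltxx in t0.
  by rewrite eqxx ordSK.
case: eqP => [-> ->|se ->].
  by exists 1; rewrite ?ltr01 ?lexx // ord_predK ep0 subrr scale0r scale1r add0r.
exists s => //; apply/andP; split; last exact: ltW.
by rewrite lt_neqAle s0 andbT eq_sym; apply/eqP.
Qed.

Lemma on_half_ep_rev i j s : 0 <= s < 1 ->
  on_half (w (ordS j)) (w j) (ep w i s) <-> j = i.
Proof.
move=> hs; have /andP[s0 s1] := hs; split.
  move=> [t /andP[t0 t1] e].
  have E : ep w i s = ep w j (1 - t) by rewrite e /ep subKr addrC.
  have ht : 0 <= 1 - t < 1 by apply/andP; split; lra.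
  by have [->] := simple hs ht E.
move=> ->; exists (1 - s); first by apply/andP; split; lra.
by rewrite subKr addrC.
Qed.

Lemma sum_ind_eq (F : 'I_k -> bool) (P : 'I_k -> Prop) i0 :
  (forall i, P i <-> i = i0) ->
  \sum_i ind (F i && `[< P i >]) = ind (F i0).
Proof.
move=> h; rewrite (bigD1 i0) //= asboolT; last exact/h.
rewrite andbT big1 ?addr0 // => i ni; rewrite asboolF ?andbF // => /h e.
by rewrite e eqxx in ni.
Qed.

Lemma sum_ind0 (F : 'I_k -> bool) (P : 'I_k -> Prop) :
  (forall i, ~ P i) -> \sum_i ind (F i && `[< P i >]) = 0.
Proof. by move=> h; rewrite big1 // => i _; rewrite asboolF ?andbF. Qed.

Lemma on_half_gamma i p : on_half (w i) (w (ordS i)) p -> gamma w p.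
Proof. by move=> [t /andP[/ltW t0 t1] ->]; exists i, t; rewrite t0 t1. Qed.

Lemma on_half_rev_gamma i p : on_half (w (ordS i)) (w i) p -> gamma w p.
Proof.
move=> [t /andP[t0 t1] ->]; exists i, (1 - t); split; first by apply/andP; split; lra.
by rewrite /ep subKr addrC.
Qed.

Lemma vertex_gamma i : gamma w (w i).
Proof. by exists i, 0; rewrite lexx ler01 ep0. Qed.

Lemma totalE p : total p = wind w p +
  \sum_i ind (lexleft (fwd w i) && `[< on_half (w i) (w (ordS i)) p >]) +
  \sum_i vertex_weight (w (ord_pred i)) (w i) (w (ordS i)) * ind (p == w i).
Proof.
rewrite /total /wind -!big_split /=; apply: eq_bigr => i _.
by rewrite /local_weight edge_weightE ?vertex_neq.
Qed.

Lemma total_revE p : total_rev p = - wind w p +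
  \sum_i ind (lexleft (- fwd w i) && `[< on_half (w (ordS i)) (w i) p >]) +
  \sum_i vertex_weight (w (ordS i)) (w i) (w (ord_pred i)) * ind (p == w i).
Proof.
rewrite /total_rev big_split /=; congr (_ + _).
rewrite (reindex_inj (can_inj (@ordSK k))) /= /wind -sumrN -big_split /=.
apply: eq_bigr => i _.
by rewrite ordSK edge_weightE ?(eq_sym (w (ordS i))) ?vertex_neq // crossing_rev opprB.
Qed.

Lemma sum_vertex (F : 'I_k -> int) p : ~ gamma w p -> \sum_i F i * ind (p == w i) = 0.
Proof.
move=> np; apply: big1 => i _; case: eqP => [e|_]; last by rewrite mulr0.
by case: np; rewrite e; exact: vertex_gamma.
Qed.

Lemma sum_vertex_ep (F : 'I_k -> int) i s : 0 <= s < 1 ->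
  \sum_j F j * ind (ep w i s == w j) = if s == 0 then F i else 0.
Proof.
move=> hs; case: eqP => [->|se].
  rewrite (bigD1 i) //= ep0 eqxx mulr1 big1 ?addr0 // => j ji.
  case: eqP => [e|_]; last by rewrite mulr0.
  have h0 : 0 <= (0 : R) < 1 by rewrite lexx ltr01.
  rewrite -!ep0 in e; have [ij _] := simple h0 h0 e.
  by rewrite ij eqxx in ji.
apply: big1 => j _; case: eqP => [e|_]; last by rewrite mulr0.
have h0 : 0 <= (0 : R) < 1 by rewrite lexx ltr01.
by rewrite -(ep0 w j) in e; have [_ /se] := simple hs h0 e.
Qed.

Lemma total_notin p : ~ gamma w p -> total p = wind w p.
Proof.
move=> np; rewrite totalE sum_vertex // sum_ind0 ?addr0 // => i.
by move=> /on_half_gamma.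
Qed.

Lemma total_rev_notin p : ~ gamma w p -> total_rev p = - wind w p.
Proof.
move=> np; rewrite total_revE sum_vertex // sum_ind0 ?addr0 // => i.
by move=> /on_half_rev_gamma.
Qed.

Lemma bwd0 i : bwd w i 0 = w (ord_pred i) - w i.
Proof. by rewrite /bwd eqxx. Qed.

Lemma lex_sector_opp u : u != 0 -> lex_sector (- u) u = lexleft u.
Proof.
move=> u0; rewrite /lex_sector (crossNl u u) crossvv ltxx lexleft_opp //.
by rewrite negbK orbb.
Qed.

(** If the push leads to the right, [wind] is l and the edge or vertex correction adds 1; if it
    leads to the left, [wind] is already l + 1 and the correction is 0. At a vertex the vertex
    weight cancels the correction of the preceding edge. *)
Lemma total_in i s e l : 0 <= s < 1 -> local_structure w i s e l -> total (ep w i s) = l + 1.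
Proof.
move=> hs h; have tr := transverse_germ k2 simple i s.
have [u0 v0] := transverse_neq0 tr.
rewrite totalE sum_vertex_ep // (wind_gamma hs h).
rewrite (@sum_ind_eq _ _ (if s == 0 then ord_pred i else i)); last first.
  by move=> j; rewrite (propext (on_half_ep i j hs)); case: (s == 0).
case: (s =P 0) => [s0|s0]; last first.
  rewrite /bwd; have -> : (s == 0) = false by apply/eqP.
  rewrite lex_sector_opp // addr0.
  by case: (lexleft _); rewrite indE ?addr0.
rewrite s0 bwd0 /vertex_weight -/(fwd w i).
have -> : ~~ lexleft (w (ord_pred i) - w i) = lexleft (fwd w (ord_pred i)).
  rewrite fwd_pred lexleft_opp ?negbK //.
  by have [] := transverse_neq0 (transverse_germ k2 simple (ord_pred i) 0).
case: (lex_sector _ _); rewrite ?indE; ring.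
Qed.

(** Reversal negates [wind] and exchanges the sides; the larger of the values -l and -l - 1 now
    belongs to the former right side. *)
Lemma total_rev_in i s e l : 0 <= s < 1 -> local_structure w i s e l ->
  total_rev (ep w i s) = - l.
Proof.
move=> hs h; have tr := transverse_germ k2 simple i s.
have [u0 v0] := transverse_neq0 tr.
rewrite total_revE sum_vertex_ep // (wind_gamma hs h).
rewrite (@sum_ind_eq _ _ (i)); last by move=> j; exact: (on_half_ep_rev i j hs).
case: (s =P 0) => [s0|s0]; last first.
  rewrite /bwd; have -> : (s == 0) = false by apply/eqP.
  rewrite lex_sector_opp // addr0 lexleft_opp //.
  by case: (lexleft _); rewrite /= indE; ring.
rewrite s0 bwd0 /vertex_weight -/(fwd w i) lexleft_opp //.
rewrite s0 bwd0 in tr; rewrite (lex_sector_compl tr).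
case: (lex_sector _ _); rewrite ?indE; ring.
Qed.

Lemma total_outside r p : (forall i, `|(w i).1| <= r /\ `|(w i).2| <= r) ->
  (r < `|p.1|) || (r < `|p.2|) -> total p = 0 /\ total_rev p = 0.
Proof.
move=> wr hp; have np : ~ gamma w p.
  by move=> /(gamma_bounded wr)[h1 h2]; move: hp; rewrite !ltNge h1 h2.
by rewrite total_notin // total_rev_notin // (wind_outside wr hp) oppr0.
Qed.

(** For l = 0 the winding number is 1 inside and [total] is 1 on the curve, while [total_rev] is -1
    inside and 0 on the curve. For l = -1 the roles are exchanged. *)
Theorem total_region : 
  let inside p := gamma w p \/ ~ gamma w p /\ bounded_set (connected_component (~` gamma w) p) in
  (forall p, total p = ind `[< inside p >] /\ total_rev p <= 0) \/
  (forall p, total_rev p = ind `[< inside p >] /\ total p <= 0).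
Proof.
move=> inside.
have [l l01 [out loc]] := jordan_polygon k2 simple.
have gin p : gamma w p -> total p = l + 1 /\ total_rev p = - l.
  move=> /gammaP[i [s [hs ->]]]; have [e he] := loc i s hs.
  by rewrite (total_in hs he) (total_rev_in hs he).
case: l01 => l0; subst l.
- left=> p; have [gp|np] := pselect (gamma w p).
    by have [-> ->] := gin p gp; rewrite asboolT; [|by left].
  have [bp wp] := out p np; rewrite total_notin // total_rev_notin //.
  have ip : inside p <-> wind w p <> 0.
    by split=> [[//|[_ /bp]]//|/bp h]; right.
  case: wp => wp; rewrite wp.
    by rewrite asboolF // => /ip; rewrite wp.
  by rewrite asboolT //; apply/ip; rewrite wp.
- right=> p; have [gp|np] := pselect (gamma w p).
    by have [-> ->] := gin p gp; rewrite asboolT; [|by left].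
  have [bp wp] := out p np; rewrite total_notin // total_rev_notin //.
  have ip : inside p <-> wind w p <> 0.
    by split=> [[//|[_ /bp]]//|/bp h]; right.
  case: wp => wp; rewrite wp.
    by rewrite asboolT //; apply/ip; rewrite wp.
  by rewrite asboolF // => /ip; rewrite wp.
Qed.

End Total.

(** * The number of primitive points *)

Section Rescale.
Variables (R : realType) (c : R).
Hypothesis c0 : 0 < c.

Definition rescale (z : int * int) : R * R := (c * z.1%:~R, c * z.2%:~R).

Lemma lt_rescale (x y : int) : (c * x%:~R < c * y%:~R) = (x < y).
Proof. by rewrite ltr_pM2l // ltr_int. Qed.

Lemma le_rescale (x y : int) : (c * x%:~R <= c * y%:~R) = (x <= y).
Proof. by rewrite ler_pM2l // ler_int. Qed.

Lemma eq_rescale (x y : int) : (c * x%:~R == c * y%:~R) = (x == y).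
Proof. by rewrite !eq_le !le_rescale. Qed.

Lemma cross_rescale (a e p q : int * int) :
  cross (rescale e - rescale a) (rescale q - rescale p) = c ^+ 2 * (cross (e - a) (q - p))%:~R.
Proof. by rewrite /cross /= !rmorphB !rmorphM /= !rmorphB /=; ring. Qed.

Lemma lexleft_rescale (a e : int * int) : lexleft (rescale e - rescale a) = lexleft (e - a).
Proof. by rewrite /lexleft /= !subr_lt0 !subr_eq0 !subr_gt0 lt_rescale lt_rescale eq_rescale. Qed.

Lemma edge_weight_rescale a e p : edge_weight (rescale a) (rescale e) (rescale p) = edge_weight a e p.
Proof.
rewrite /edge_weight !cross_rescale; have c2 : 0 < c ^+ 2 by rewrite exprn_gt0.
rewrite pmulr_rlt0 // pmulr_rge0 // ltrz0 ler0z /=.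
by rewrite !lt_rescale !le_rescale eq_rescale.
Qed.

Lemma vertex_weight_rescale o a e : vertex_weight (rescale o) (rescale a) (rescale e) = vertex_weight o a e.
Proof.
rewrite /vertex_weight /lex_sector !cross_rescale; have c2 : 0 < c ^+ 2 by rewrite exprn_gt0.
by rewrite pmulr_rgt0 // ltr0z !lexleft_rescale.
Qed.

Lemma local_weight_rescale o a e p :
  local_weight (rescale o) (rescale a) (rescale e) (rescale p) = local_weight o a e p.
Proof.
rewrite /local_weight edge_weight_rescale vertex_weight_rescale; congr (_ + _ * ind _).
case: p a => p1 p2 [a1 a2]; rewrite /rescale /=.
have -> : ((c * p1%:~R, c * p2%:~R) == (c * a1%:~R, c * a2%:~R)) =
  (c * p1%:~R == c * a1%:~R) && (c * p2%:~R == c * a2%:~R) by [].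
by rewrite !eq_rescale.
Qed.

End Rescale.

(** * The input as a polygon in the plane *)

Section Input.
Variables (k : nat) (v : vertices k).

Definition coordinates (j : nat) : int := nth 0 (polygon_input v) j.+1.

Lemma nth_quads (s : seq (rat * rat)) (i e : nat) x0 : (i < size s)%N -> (e < 4)%N ->
  nth 0 (flatten [seq [:: numq q.1; denq q.1; numq q.2; denq q.2] | q : rat * rat <- s]) (4 * i + e) =
  let q := nth x0 s i in nth 0 [:: numq q.1; denq q.1; numq q.2; denq q.2] e.
Proof.
elim: s i => [|q s IH] [|i] // hi he.
  by rewrite muln0 add0n; clear IH; case: e he => [|[|[|[|]]]].
have -> : (4 * i.+1 + e = (4 * i + e).+4)%N by rewrite mulnS -addnA.
exact: IH.
Qed.

Lemma size_quads (s : seq (rat * rat)) :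
  size (flatten [seq [:: numq q.1; denq q.1; numq q.2; denq q.2] | q : rat * rat <- s]) = (4 * size s)%N.
Proof. by elim: s => //= q s ->; rewrite mulnS. Qed.

Lemma coordinatesE (i : 'I_k) : let q := tnth v i in
  [/\ coordinates (4 * i)%N = numq q.1, coordinates (4 * i).+1 = denq q.1,
      coordinates (4 * i).+2 = numq q.2 & coordinates (4 * i).+3 = denq q.2].
Proof.
move=> q; have hi : (i < size v)%N by rewrite size_tuple.
have qE : q = nth (tnth_default v i) v i by exact: tnth_nth.
have H e : (e < 4)%N -> coordinates (4 * i + e)%N = nth 0 [:: numq q.1; denq q.1; numq q.2; denq q.2] e.
  by move=> he; rewrite /coordinates /polygon_input /= (nth_quads (tnth_default v i)) // -qE.
have := H 0%N isT; have := H 1%N isT; have := H 2%N isT; have := H 3%N isT.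
by rewrite addn0 addn1 addn2 addn3 => -> -> -> ->.
Qed.

Lemma coordinates_default j : (4 * k <= j)%N -> coordinates j = 0.
Proof. by move=> hj; rewrite /coordinates /= nth_default // size_quads size_tuple. Qed.

Lemma coordinates_den j : (j < 2 * k)%N -> 0 < coordinates (2 * j).+1.
Proof.
move=> jk; have ik : (j./2 < k)%N by rewrite -ltn_double -!mul2n; move: jk (odd_double_half j); clear; lia.
have [_ h1 _ h3] := coordinatesE (Ordinal ik); rewrite /= in h1 h3.
have jE := odd_double_half j; case: (odd j) jE => jE.
  have -> : ((2 * j).+1 = (4 * j./2).+3)%N by move: jE; clear; lia.
  by rewrite h3 denq_gt0.
have -> : (2 * j = 4 * j./2)%N by move: jE; clear; lia.
by rewrite h1 denq_gt0.
Qed.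

Lemma coordinates_bits b : is_bit_vertices b v -> forall j, sz b 1 (coordinates j).
Proof.
move=> /allP hb j; rewrite /sz mul1n /bits.
have [jk|jk] := leqP (4 * k) j; first by rewrite coordinates_default // expn_gt0.
have ik : (j %/ 4 < k)%N by rewrite ltn_divLR // mulnC.
have := hb _ (mem_tnth (Ordinal ik) v); rewrite /is_bit_rat -!andbA => /and4P[q1 q2 q3 q4].
have [h0 h1 h2 h3] := coordinatesE (Ordinal ik); rewrite /= in h0 h1 h2 h3.
have d1 := denq_gt0 (tnth v (Ordinal ik)).1; have d2 := denq_gt0 (tnth v (Ordinal ik)).2.
have P : 2 ^+ b = Posz (2 ^ b) by rewrite -natz natrX.
rewrite {}P in q1 q2 q3 q4.
have jE := divn_eq j 4; have := ltn_pmod j (isT : (0 < 4)%N).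
case: (j %% 4)%N jE => [|[|[|[|//]]]] jE _; rewrite jE mulnC ?addn0 ?addn1 ?addn2 ?addn3 ?h0 ?h1 ?h2 ?h3.
- by rewrite -ltz_nat abszE.
- by rewrite -ltz_nat gtz0_abs.
- by rewrite -ltz_nat abszE.
- by rewrite -ltz_nat gtz0_abs.
Qed.

Variable R : realType.
Let w (i : 'I_k) : R * R := rat_point R (tnth v i).

Lemma rescale_scaled (q : int) (i : 'I_k) : 0 < q -> (coordinates (4 * i).+1 %| q)%Z ->
  (coordinates (4 * i).+3 %| q)%Z -> w i = rescale (q%:~R)^-1 (scaled coordinates q i).
Proof.
move=> q0 d1 d2; have [h0 h1 h2 h3] := coordinatesE i.
rewrite h1 in d1; rewrite h3 in d2.
have qR : (q%:~R : R) != 0 by rewrite intr_eq0 gt_eqF.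
have E (x : rat) : (denq x %| q)%Z -> ratr x = (q%:~R : R)^-1 * (numq x * (q %/ denq x)%Z)%:~R.
  move=> /dvdzP[r qE]; have dx : denq x != 0 by rewrite denq_eq0.
  have rR : (r%:~R : R) != 0 by move: qR; rewrite qE rmorphM mulf_eq0 negb_or => /andP[].
  have dR : ((denq x)%:~R : R) != 0 by rewrite intr_eq0.
  rewrite qE mulzK // /ratr !rmorphM /= invfM; field.
  by rewrite rR dR.
by rewrite /w /rat_point /rescale /scaled /= h0 h1 h2 h3 (E _ d1) (E _ d2).
Qed.

Lemma int_point_rescale (q : int) z : 0 < q -> int_point R z = rescale (q%:~R)^-1 (zscale q z).
Proof.
move=> q0; have qR : (q%:~R : R) != 0 by rewrite intr_eq0 gt_eqF.
by rewrite /int_point /rescale /zscale /= !rmorphM /= !mulKf.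
Qed.

Hypothesis k2 : (2 < k)%N.
Hypothesis simple : simple_polygon R v.
Variable D : nat.
Hypothesis cov : covered coordinates (2 * k) (Posz D).

Lemma vertex_bound i : `|(w i).1| <= D%:R /\ `|(w i).2| <= D%:R.
Proof.
have [h0 h1 h2 h3] := coordinatesE i.
have c1 := @cov (2 * i)%N; have c2 := @cov (2 * i).+1.
have e1 : (2 * (2 * i) = 4 * i)%N by clear; lia.
have e2 : (2 * (2 * i).+1 = (4 * i).+2)%N by clear; lia.
rewrite e1 h0 h1 in c1; rewrite e2 h2 h3 in c2.
have ik := ltn_ord i.
have E (x : rat) : `|numq x| <= Posz D * denq x -> `|(ratr x : R)| <= D%:R.
  move=> hx; rewrite /ratr normrM normfV (gtr0_norm (_ : 0 < (denq x)%:~R)) ?ltr0z ?denq_gt0 //.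
  by rewrite ler_pdivrMr ?ltr0z ?denq_gt0 // -intr_norm -[D%:R]/((Posz D)%:~R) -intrM ler_int.
by split; apply: E; [apply: c1|apply: c2]; clear -ik; lia.
Qed.

(** The program truncates the strips from below, so single weights differ below the box. There both
    totals are 0, however: the truncated pieces stay in the box, and the winding number vanishes
    outside it. *)
Lemma orient_weight_total z :
  orient_weight coordinates k D false z = total w (int_point R z) /\
  orient_weight coordinates k D true z = total_rev w (int_point R z).
Proof.
have k0 : (0 < k)%N by apply: ltn_trans k2.
have den := coordinates_den.
have [hz|hz] := leP (- Posz D) z.2; last first.
  have oz : outside D z by rewrite /outside; apply/orP; right; move: hz; clear; lia.
  rewrite !(orient_weight_outside den cov k0) //.
  have wr i := vertex_bound i.
  have [|-> ->] := total_outside k2 simple (p := int_point R z) wr; last by [].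
  apply/orP; right; rewrite /int_point /= -intr_norm -[D%:R]/((Posz D)%:~R) ltr_int.
  by move: hz; clear; lia.
have C (o a e : 'I_k) : corner_weight coordinates D o a e z = local_weight (w o) (w a) (w e) (int_point R z).
  have q0 := common_den_pos den (ltn_ord o) (ltn_ord a) (ltn_ord e).
  rewrite (corner_weightE den) //.
  set q := common_den _ _ _ _ in q0 *.
  have qi : 0 < (q%:~R : R)^-1 by rewrite invr_gt0 ltr0z.
  rewrite (int_point_rescale z q0) !(rescale_scaled q0) ?local_weight_rescale //; rewrite /q /common_den;
  repeat first [exact: dvdzz | apply: dvdz_mull; exact: dvdzz | apply: dvdz_mulr].
split.
  by rewrite /orient_weight big_mkord; apply: eq_bigr => i _; rewrite -C.
by rewrite /orient_weight big_mkord; apply: eq_bigr => i _; rewrite -C.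
Qed.

End Input.

Lemma coord_inj N : injective (coord N).
Proof. by move=> i j; rewrite /coord; clear; lia. Qed.

Lemma sum_ind_count (T : Type) (s : seq T) (P : pred T) : \sum_(z <- s) ind (P z) = Posz (count P s).
Proof. by elim: s => [|z s IH]; rewrite ?big_nil // big_cons IH. Qed.

Lemma square_sum_card D (P : pred (int * int)) (A : set (int * int)) :
  (forall z, A z <-> P z) -> (forall z, P z -> ~ outside D z) ->
  exists2 n : nat, (A #= `I_n)%card & square_sum D (fun z => ind (P z)) = Posz n.
Proof.
move=> AP PD; pose r := index_iota 0 (2 * D + 1).
pose s := [seq (coord D i, coord D j) | i <- r, j <- r].
have us : uniq s.
  apply: allpairs_uniq; rewrite ?iota_uniq // => -[i j] [i' j'] _ _ [/coord_inj -> /coord_inj ->] //.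
have ms z : P z -> z \in s.
  move=> /PD oz; case: z oz => x y; rewrite /outside /= => oz.
  have hx : `|x| <= Posz D by rewrite leNgt; apply/negP => h; apply: oz; rewrite h.
  have hy : `|y| <= Posz D by rewrite leNgt; apply/negP => h; apply: oz; rewrite h orbT.
  have C (t : int) : `|t| <= Posz D -> exists2 i, i \in r & t = coord D i.
    move=> ht; exists (absz (t + Posz D)); last by rewrite /coord; move: ht; clear; lia.
    by rewrite mem_index_iota; move: ht; clear; lia.
  have [i ir ->] := C x hx; have [j jr ->] := C y hy.
  by apply/allpairsP; exists (i, j).
pose B := [fset z in [seq z <- s | P z]]%fset.
have AB : A = [set` B].
  apply/seteqP; split=> z /=.
    by move=> /AP hz; rewrite in_fset /= mem_filter hz ms.
  by rewrite in_fset /= mem_filter => /andP[/AP].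
exists (size [seq z <- s | P z]).
  by rewrite AB; apply/card_eq_fsetP; rewrite card_fseq undup_id // filter_uniq.
rewrite size_filter -sum_ind_count /s (@big_allpairs_dep _ _ _ _ _ _ _ r (fun=> r)) /square_sum /line_sum.
by apply: eq_bigr => i _.
Qed.

Section Output.
Variables (R : realType) (k : nat) (v : vertices k).
Hypothesis k2 : (2 < k)%N.
Hypothesis simple : simple_polygon R v.
Hypothesis origin : polygon_region R v (0, 0).
Variables D u : nat.
Hypothesis cov : covered (coordinates v) (2 * k) (Posz D).
Hypotheses (uD : (u <= D)%N) (Du : (D <= u ^ 7)%N).

(** The correct orientation has weight 1 at the origin, which lies in the region, and the other one
    has weight at most 0 there; so the sign of the weight selects the output. *)
Lemma output_correct (out : int) :
  (0 < orient_Z k (coordinates v) D false k -> ~~ (0 < orient_Z k (coordinates v) D true k) ->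
    out = orient_T k (coordinates v) D u false k - mertens (u ^ 6)) ->
  (0 < orient_Z k (coordinates v) D true k -> out = orient_T k (coordinates v) D u true k - mertens (u ^ 6)) ->
  exists2 n : nat, (primitive_points (polygon_region R v) #= `I_n)%card & out = Posz n.
Proof.
move=> hf ht; have k0 : (0 < k)%N by apply: ltn_trans k2.
have den := @coordinates_den k v.
pose w i : R * R := rat_point R (tnth v i).
pose inside p := polygon_region R v p.
have W z := orient_weight_total k2 simple cov z.
have o0 : int_point R 0 = (0, 0) by rewrite /int_point /= mulr0z.
have finish o : (forall z, orient_weight (coordinates v) k D o z = ind `[< inside (int_point R z) >]) ->
    out = orient_T k (coordinates v) D u o k - mertens (u ^ 6) ->
    exists2 n : nat, (primitive_points inside #= `I_n)%card & out = Posz n.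
  move=> hw; rewrite (orient_count den cov k0 uD Du); last by rewrite hw o0 asboolT.
  move=> hout.
  have [||n hn hs] := @square_sum_card D (fun z => (gcdn (absz z.1) (absz z.2) == 1%N) && `[< inside (int_point R z) >]) (primitive_points inside).
  - move=> z; rewrite /primitive_points /=; split.
      by move=> [g1 h]; apply/andP; split; [move: g1; rewrite /gcdz => -[->]|exact/asboolP].
    by move=> /andP[/eqP g1 /asboolP h]; split=> //; rewrite /gcdz g1.
  - move=> z /andP[_ hz] oz; have := hw z; rewrite (orient_weight_outside den cov k0 o oz) hz.
    by [].
  exists n => //; rewrite hout -hs; apply: eq_square_sum => z _ _; rewrite hw.
  by case: eqP => _; case: asboolP => _ /=; rewrite ?mul0r ?mul1r ?mulr0.
have [h|h] := @total_region R k w k2 simple.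
- apply: (finish false) => [z|]; first by rewrite (W z).1 (h _).1.
  apply: hf.
    by rewrite (orient_ZE den cov k0) (W 0).1 (h _).1 o0 asboolT.
  by rewrite (orient_ZE den cov k0) (W 0).2 -leNgt (h _).2.
- apply: (finish true) => [z|]; first by rewrite (W z).2 (h _).1.
  by apply: ht; rewrite (orient_ZE den cov k0) (W 0).2 (h _).1 o0 asboolT.
Qed.

End Output.

(** * The running time in terms of the diameter *)

Lemma vertices_inj (R : realType) (k : nat) (v : vertices k) : simple_polygon R v -> injective (tnth v).
Proof.
move=> simple i j vij; have h0 : 0 <= (0 : R) < 1 by rewrite lexx ltr01.
have [|//] := simple i j 0 0 h0 h0.
by rewrite /edge_point !subr0 !scale1r !scale0r !addr0 vij.
Qed.

(** The number k and the addresses must have O(b) bits. The vertices are distinct, and there are at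
    most 2^(4 b + 2) pairs of b-bit rationals; b = 0 is impossible because a denominator is at least
    1. *)
Lemma few_bit_vertices (b k : nat) (v : vertices k) : (0 < k)%N -> is_bit_vertices b v -> injective (tnth v) ->
  (0 < b)%N /\ (k < 2 ^ (8 * b))%N.
Proof.
move=> k0 /allP hb inj.
have P : 2 ^+ b = Posz (2 ^ b) by rewrite -natz natrX.
(* Numerators are shifted to be nonnegative, so that the vertices embed into a product of
   ordinals. *)
pose bias (x : rat) : int := numq x + Posz (2 ^ b).
have H i : let q := tnth v i in [/\ (absz (bias q.1) < 2 ^ b.+1)%N, (absz (denq q.1) < 2 ^ b)%N,
    (absz (bias q.2) < 2 ^ b.+1)%N & (absz (denq q.2) < 2 ^ b)%N] /\
    (0 <= bias q.1) && (0 <= bias q.2).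
  move=> q; have := hb _ (mem_tnth i v); rewrite -/q /is_bit_rat P -!andbA expnS.
  have := denq_gt0 q.1; have := denq_gt0 q.2.
  rewrite /bias; move: (numq q.1) (denq q.1) (numq q.2) (denq q.2) (2 ^ b)%N; clear.
  by move=> n1 d1 n2 d2 B ? ? /and4P[? ? ? ?]; split; [split|apply/andP; split]; lia.
have b0 : (0 < b)%N.
  rewrite lt0n; apply/eqP => bz; have [[_ h _ _] _] := H (Ordinal k0).
  by move: h; rewrite bz expn0 ltnS leqn0 absz_eq0 denq_eq0.
split=> //.
pose A := (2 ^ b.+1).-1; pose B := (2 ^ b).-1.
have AE : A.+1 = (2 ^ b.+1)%N by rewrite prednK // expn_gt0.
have BE : B.+1 = (2 ^ b)%N by rewrite prednK // expn_gt0.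
pose f (i : 'I_k) : 'I_A.+1 * 'I_B.+1 * ('I_A.+1 * 'I_B.+1) := let q := tnth v i in
  (inord (absz (bias q.1)), inord (absz (denq q.1)),
   (inord (absz (bias q.2)), inord (absz (denq q.2)))).
have finj : injective f.
  move=> i j [] /(congr1 val) e1 /(congr1 val) e2 /(congr1 val) e3 /(congr1 val) e4.
  have [[a1 a2 a3 a4] /andP[a5 a6]] := H i; have [[c1 c2 c3 c4] /andP[c5 c6]] := H j.
  move: e1 e2 e3 e4; rewrite /= !inordK ?AE ?BE // => e1 e2 e3 e4; apply: inj.
  have q1 := denq_gt0 (tnth v i).1; have q2 := denq_gt0 (tnth v i).2.
  have q3 := denq_gt0 (tnth v j).1; have q4 := denq_gt0 (tnth v j).2.
  have E (x y : rat) : numq x = numq y -> denq x = denq y -> x = y.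
    by move=> h1 h2; rewrite -[x]divq_num_den -[y]divq_num_den h1 h2.
  have [xi yi] : exists x, x = tnth v i by eexists.
  rewrite [LHS]surjective_pairing [RHS]surjective_pairing.
  by congr pair; apply: E; rewrite /bias in e1 a5 c5 e3 a6 c6; [move: e1 a5 c5|move: e2 q1 q3|move: e3 a6 c6|move: e4 q2 q4]; clear; lia.
have := leq_card f finj; rewrite !card_prod !card_ord AE BE -!expnD => /leq_ltn_trans; apply.
by rewrite ltn_exp2l //; clear -b0; lia.
Qed.

(** From (u - 1)^7 < D <= 2 M one gets (u - 1)^6 <= 2 M^(6/7). For u >= 2, passing from u - 1 to u
    costs a factor 2^6, and 128 = 64 * 2. *)
Lemma root_bound (R : realType) (D u : nat) (M : R) : 1 <= M -> D%:R <= 2 * M ->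
  u = 1%N \/ (u.-1 ^ 7 < D)%N -> (u ^ 6)%N%:R <= 128 * M `^ (6 / 7).
Proof.
move=> M1 DM hu; have M0 : 0 <= M by apply: le_trans M1.
have e1 : 1 `^ (6 / 7) = 1 :> R by rewrite powR1.
have P1 : 1 <= M `^ (6 / 7) by rewrite -[X in X <= _]e1; apply: ge0_ler_powR; rewrite ?nnegrE //.
case: hu => [->|hu]; first by rewrite exp1n; lra.
pose x : R := u.-1%:R.
have x0 : 0 <= x by [].
have x6 : x ^+ 6 <= 2 * M `^ (6 / 7).
  have -> : x ^+ 6 = (x ^+ 7) `^ (6 / 7).
    rewrite -!powR_mulrn // -powRrM; congr (_ `^ _).
    by rewrite mulrC -mulrA mulVf ?mulr1 // pnatr_eq0.
  apply: (@le_trans _ _ ((2 * M) `^ (6 / 7))).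
    apply: ge0_ler_powR; rewrite ?nnegrE ?exprn_ge0 ?mulr_ge0 //.
    by apply: le_trans DM; rewrite -natrX ler_nat ltnW.
  rewrite powRM // ler_pM2r; last exact: lt_le_trans P1.
  rewrite -[X in _ <= X](@powRr1 _ 2) //; apply: ler_powR; first by rewrite ler1n.
  by lra.
have [u1|u1] := leqP u 1.
  apply: (@le_trans _ _ 1); last by lra.
  by rewrite -[X in _ <= X]/(1%:R) ler_nat; case: u u1 {hu x x0 x6} => [|[|]].
have ux : u%:R <= 2 * x.
  by rewrite /x -natrM ler_nat; move: u1; clear; lia.
rewrite natrX; apply: (@le_trans _ _ ((2 * x) ^+ 6)); first by rewrite lerXn2r ?nnegrE ?mulr_ge0.
by rewrite exprMn; move: x6 => x6; lra.
Qed.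

(** Unless D = 1, some vertex has a coordinate of absolute value at least D - 1. Its distance to the
    origin, another point of the region, is at most d, whence D <= d + 1. *)
Lemma attained_bound (R : realType) (k : nat) (v : vertices k) (D : nat) (d : R) :
  attained k (coordinates v) (Posz D) -> polygon_region R v (0, 0) ->
  is_diameter (polygon_region R v) d -> D%:R <= 2 * Num.max 1 d.
Proof.
move=> att o0 [_ diam].
have m1 : 1 <= Num.max 1 d by rewrite le_max lexx.
have m2 : d <= Num.max 1 d by rewrite le_max lexx orbT.
case: att => [[->]|[i ik hi]]; first by lra.
suff : D%:R - 1 <= d by lra.
have jk : (i./2 < k)%N by rewrite -ltn_double -!mul2n; move: ik (odd_double_half i); clear; lia.
pose j := Ordinal jk; pose p := rat_point R (tnth v j).
have [h0 h1 h2 h3] := coordinatesE v j; rewrite /= in h0 h1 h2 h3.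
have hp : polygon_region R v p.
  left; exists j, 0; split; first by rewrite lexx ler01.
  by rewrite /edge_point subr0 scale1r scale0r addr0.
have hd := diam _ _ hp o0.
have [n1 n2] : `|p.1| <= Defs.edist p (0, 0) /\ `|p.2| <= Defs.edist p (0, 0).
  by rewrite /Defs.edist /= !subr0 -!sqrtr_sqr; split; apply: ler_wsqrtr; rewrite ?lerDl ?lerDr sqr_ge0.
have E (x : rat) : (Posz D - 1) * denq x <= `|numq x| -> D%:R - 1 <= `|(ratr x : R)|.
  move=> hx; rewrite /ratr normrM normfV (gtr0_norm (_ : 0 < (denq x)%:~R)) ?ltr0z ?denq_gt0 //.
  rewrite ler_pdivlMr ?ltr0z ?denq_gt0 // -intr_norm.
  by rewrite -[D%:R]/((Posz D)%:~R) -[1]/((1 : int)%:~R) -intrB -intrM ler_int.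
have iE := odd_double_half i; case: (odd i) iE => iE.
  have e : (2 * i = (4 * i./2).+2)%N by move: iE; clear; lia.
  by rewrite e h2 h3 in hi; apply: le_trans (E _ hi) (le_trans n2 hd).
have e : (2 * i = 4 * i./2)%N by move: iE; clear; lia.
by rewrite e h0 h1 in hi; apply: le_trans (E _ hi) (le_trans n1 hd).
Qed.

Lemma main_exec : exists (p : program) (K : nat), forall (b k : nat) (v : vertices k),
  (0 < b)%N -> (0 < k)%N -> (k < 2 ^ (8 * b))%N -> is_bit_vertices b v ->
  exists (D u : nat) (out : int) (t : nat),
    [/\ [/\ covered (coordinates v) (2 * k) (Posz D), attained k (coordinates v) (Posz D), (u <= D)%N,
          (D <= u ^ 7)%N & u = 1%N \/ (u.-1 ^ 7 < D)%N],
        computes_in_time p (polygon_input v) out t,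
        0 < orient_Z k (coordinates v) D false k -> ~~ (0 < orient_Z k (coordinates v) D true k) ->
          out = orient_T k (coordinates v) D u false k - mertens (u ^ 6),
        0 < orient_Z k (coordinates v) D true k ->
          out = orient_T k (coordinates v) D u true k - mertens (u ^ 6) &
        (t <= K * (u ^ 6 * (k * b ^ 2)))%N].
Proof.
have [K hK] : exists K, implements (compile main_cmd) main_cmd K by exact: compile_correct.
(* The prelude takes at most 4000 L k, and each of the at most 4500 * 4 * b k u^6 steps of the main
   program costs at most K L, with L = 200 b. *)
exists (Seq prelude (compile main_cmd)), (4000 * 200 + K * 200 * (4500 * 4))%N => b k v b0 k0 kb hv.
pose L := (200 * b)%N; pose m0 : memory := fun i => nth 0 (polygon_input v) i.
have sX := coordinates_bits hv; have den := @coordinates_den k v.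
have bX j : bits L (coordinates v j).
  by apply: bits_le (sX j); rewrite /L leq_mul2r orbT.
have bk : bits L (Posz k).
  by apply: (leq_trans kb); rewrite leq_exp2l // leq_mul2r orbT.
have kL : (1024 * k < 2 ^ L)%N.
  apply: (@leq_trans (2 ^ 10 * 2 ^ (8 * b))); first by rewrite ltn_pmul2l ?expn_gt0 //.
  by rewrite -expnD leq_exp2l // /L; clear -b0; lia.
have m0b r : bits L (m0 r) by case: r => [|r] //; exact: bX.
have m0z r : (4 * k < r)%N -> m0 r = 0 by case: r => // r hr; apply: coordinates_default.
have [m [T1 [n [x1 [kn st] sm [m2 m64] t1]]]] := prelude_exec k0 kL (erefl : m0 0%N = Posz k) m0b m0z.
have [_ _ _ st1 st2] := st.
pose base := (256 * k)%N.
(* The memory left by the prelude is read as an initial state: array 0 is the input, the other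
   arrays are zero, and variable 2 is k. *)
pose s := State m (fun a i => m (base + 4 * i + a)%N).
have s0 j : ar s 0 j = coordinates v j.
  rewrite /= addn0; have [jn|jn] := leqP j n; first exact: st1.
  rewrite st2 ?leq_addr //; first by rewrite coordinates_default // (leq_trans kn).
  by move=> i hi; move: jn hi; rewrite /base; clear; lia.
have sa a j : (0 < a < 4)%N -> ar s a j = 0.
  move=> ha; rewrite /= st2 //; first by rewrite -addnA leq_addr.
  by move=> i hi; move: ha; rewrite /base; clear; lia.
have ref : refines base m s by split.
have bnd : bounded_state L s.
  split=> [x hx|a j ha]; first by apply: sm; apply: ltn_trans hx _.
  case: a ha => [|a] ha; first by rewrite s0.
  by rewrite sa //; rewrite /bits expn_gt0.
have A0 : ar s 0 = coordinates v by apply/funext => j; exact: s0.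
have [D [u [cov att [D0 u0 Du ul]]]] := main_spec b0 sX k0 (kb : sz b 8 (Posz k)) den (conj (m2 : va s 2 = Posz k) A0)
  (fun j => @sa 1%N j isT) (fun j => @sa 2%N j isT).
move=> [s' [n' [hx hn [hf ht]]]].
have [m' [T2 [x2 [rv _ _] _ t2]]] := hK L s s' n' hx base m (ltac:(by rewrite /L muln_gt0)) (ltac:(rewrite /base; clear -k0; lia))
  (ltac:(apply: leq_ltn_trans kL; rewrite /base; clear; lia)) ref bnd.
have uD : (u <= D)%N.
  case: ul => [->//|ul]; rewrite -(prednK u0); apply: leq_ltn_trans ul.
  by case: (u.-1) => // j; rewrite expnS leq_pmulr // expn_gt0.
exists D, u, (va s' 0), (T1 + T2)%N; split=> //.
  by exists m'; [exact: exec_Seq x1 x2|exact: rv].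
apply: (@leq_trans (4000 * L * k + K * L * (4500 * 4 * b * k * u ^ 6))).
  by apply: leq_add => //; apply: leq_trans t2 _; rewrite leq_mul2l hn orbT.
have u6 : (0 < u ^ 6)%N by rewrite expn_gt0 u0.
rewrite /L mulnDl; apply: leq_add.
  have -> : (4000 * (200 * b) * k = 4000 * 200 * (b * k))%N by rewrite -!mulnA.
  rewrite leq_mul2l; apply/orP; right; rewrite mulnC -(mulnn b).
  by apply: (@leq_trans (k * (b * b))); [rewrite leq_mul2l leq_pmulr ?orbT|rewrite leq_pmull].
have -> // : (K * (200 * b) * (4500 * 4 * b * k * u ^ 6) = K * 200 * (4500 * 4) * (u ^ 6 * (k * b ^ 2)))%N.
by rewrite -(mulnn b); move: (4500 * 4)%N (u ^ 6)%N => c U; ring.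
Qed.

Theorem theorem1 :
  exists (p : program) (C c : nat),
    forall (R : realType) (k b : nat) (v : vertices k) (D : R),
      (2 < k)%N ->
      is_bit_vertices b v ->
      simple_polygon R v ->
      polygon_region R v (0, 0) ->
      is_diameter (polygon_region R v) D ->
      exists n t : nat,
        [/\ (primitive_points (polygon_region R v) #= `I_n)%card,
            computes_in_time p (polygon_input v) (Posz n) t
          & t%:R <= C%:R * (Num.max 1 D) `^ (6 / 7) * k%:R * (b ^ c)%N%:R].
Proof.
have [p [K hp]] := main_exec.
(* The factor 128 comes from [root_bound]. One factor b is the logarithmic factor in the number of
   steps, the other one the length of the registers. *)
exists p, (K * 128)%N, 2%N => R k b v d k2 hb simple origin diam.
have k0 : (0 < k)%N by apply: ltn_trans k2.
have [b0 kb] := few_bit_vertices k0 hb (vertices_inj simple).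
have [D [u [out [t [[cov att uD Du ul] hc hf ht htime]]]]] := hp b k v b0 k0 kb hb.
have [n hn outE] := output_correct k2 simple origin cov uD Du hf ht.
exists n, t; split=> //; first by rewrite -outE.
have M1 : 1 <= Num.max 1 d by rewrite le_max lexx.
have hu := root_bound M1 (attained_bound att origin diam) ul.
apply: (@le_trans _ _ (K * (u ^ 6 * (k * b ^ 2)))%N%:R); first by rewrite ler_nat.
rewrite (natrM _ K 128) mulnA (natrM _ (K * u ^ 6)) (natrM _ K) (natrM _ k).
move: hu; move: (u ^ 6)%N%:R (Num.max 1 d `^ (6 / 7)) => U V hu.
rewrite -[K%:R * 128%:R * V]mulrA -[leRHS]mulrA ler_wpM2r ?mulr_ge0 //.
by rewrite ler_wpM2l.
Qed.
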